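(* Let $\mathcal Z:\mathbb D_\epsilon^\star\to\mathbb R^3$ be a conformal parametrization of a complete planar minimal end (embedded or not) without umbilic points. If $\widetilde{\mathcal Z}:\mathbb D_\epsilon^\star\to\mathbb R^3$ is a minimal surface and $(\mathcal Z,\widetilde{\mathcal Z})$ is Ribaucour integrable, then either $\widetilde{\mathcal Z}$ is a complete planar minimal end or $\widetilde{\mathcal Z}$ extends regularly to the origin.
   Context: $\mathbb D_\epsilon\subset\mathbb C$ is the open disk of radius $\epsilon$ centered at $0$ and $\mathbb D_\epsilon^\star=\mathbb D_\epsilon\setminus\{0\}$. A complete planar minimal end is a conformal minimal immersion of $\mathbb D_\epsilon^\star$ such that curves tending to $0$ have infinite length, the total curvature is finite (so the Gauss map extends to $0$), and the coordinate function in the direction of the limiting normal has a finite limit at the origin; it need not be embedded. ''Extends regularly to the origin'' means that the Weierstrass data, hence the map, extend holomorphically, respectively smoothly, to the origin, so that there is no end there (the extended minimal surface may have a branch point at the origin). A pair of minimal immersions $(\mathcal Z,\widetilde{\mathcal Z})$ with Gauss maps $\mathcal N,\widetilde{\mathcal N}$ is Ribaucour integrable if $\mathcal N\neq\widetilde{\mathcal N}$ everywhere, there is a smooth $\tau$ with $\mathcal Z+\tau\mathcal N=\widetilde{\mathcal Z}+\tau\widetilde{\mathcal N}$, and $\Re\int_\gamma\frac{d\widetilde{\mathcal G}}{\widetilde{\mathcal G}-\mathcal G}=0$ for every loop $\gamma$, with $\mathcal G=\Pi\circ\mathcal N$, $\widetilde{\mathcal G}=\Pi\circ\widetilde{\mathcal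 N}$, $\Pi$ stereographic projection (equivalently the smooth 1-form $\frac{\langle d\widetilde{\mathcal N},\mathcal N\rangle}{1-\langle\mathcal N,\widetilde{\mathcal N}\rangle}$ is exact). For minimal surfaces it is understood, as in the classical theory, that the pair is given by smooth functions $\rho,\phi$ ($\tau=-\phi/\rho$) satisfying, for some real constant $c\ne0$, $d\rho=\langle\nabla^m\phi,d\mathcal N\rangle$, $\mathrm{Hess}(\phi)=c\rho\,I^m+(\rho-c\phi)II^m$, $|\nabla^m\phi|^2=-\rho^2+2c\rho\phi$, with $\widetilde{\mathcal Z}=\mathcal Z-\frac1{c\rho}(\nabla^m\phi+\rho\mathcal N)$ and $\widetilde{\mathcal N}=\mathcal N-\frac1{c\phi}(\nabla^m\phi+\rho\mathcal N)$, where $\nabla^m,\mathrm{Hess}$ refer to the first fundamental form $I^m$ of $\mathcal Z$ and $II^m=-\langle d\mathcal Z,d\mathcal N\rangle$. *)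

(* Defs.v *)
From Stdlib Require Import Reals.
From Coquelicot Require Import Coquelicot.

Open Scope R_scope.

(* Domains are regions of C = R * R; the parameter is p = u + i v = (u, v). *)

Definition disk (eps : R) (p : C) : Prop := Cmod p < eps.

Definition pdisk (eps : R) (p : C) : Prop := Cmod p < eps /\ p <> RtoC 0.

Definition R3 : Type := (R * R * R)%type.

Definition x1 (v : R3) : R := fst (fst v).
Definition x2 (v : R3) : R := snd (fst v).
Definition x3 (v : R3) : R := snd v.

Definition each_coord (P : (R3 -> R) -> Prop) : Prop := P x1 /\ P x2 /\ P x3.

Definition v0 : R3 := (0, 0, 0).
Definition vadd (v w : R3) : R3 := (x1 v + x1 w, x2 v + x2 w, x3 v + x3 w).
Definition vscal (a : R) (v : R3) : R3 := (a * x1 v, a * x2 v, a * x3 v).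
Definition vsub (v w : R3) : R3 := vadd v (vscal (-1) w).
Definition dot (v w : R3) : R := x1 v * x1 w + x2 v * x2 w + x3 v * x3 w.
Definition vnorm (v : R3) : R := sqrt (dot v v).
Definition cross (v w : R3) : R3 :=
  (x2 v * x3 w - x3 v * x2 w,
   x3 v * x1 w - x1 v * x3 w,
   x1 v * x2 w - x2 v * x1 w).

Inductive dir : Set := du | dv.

Definition pd (i : dir) (f : C -> R) (p : C) : R :=
  match i with
  | du => Derive (fun u => f (u, snd p)) (fst p)
  | dv => Derive (fun v => f (fst p, v)) (snd p)
  end.

Definition pd3 (i : dir) (Z : C -> R3) (p : C) : R3 :=
  (pd i (fun q => x1 (Z q)) p, pd i (fun q => x2 (Z q)) p, pd i (fun q => x3 (Z q)) p).

(* Meaningful for open U: all iterated partial derivatives exist and are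
   continuous at every point of U. *)
Definition smooth (U : C -> Prop) (f : C -> R) : Prop :=
  forall (n : nat) (p : C), U p -> ex_diff_n (fun u v => f (u, v)) n (fst p) (snd p).

Definition smooth3 (U : C -> Prop) (Z : C -> R3) : Prop :=
  each_coord (fun x => smooth U (fun p => x (Z p))).

Definition holomorphic_on (U : C -> Prop) (f : C -> C) : Prop :=
  forall p : C, U p -> ex_derive (K := C_AbsRing) (V := C_NormedModule) f p.

Definition gauss (Z : C -> R3) (p : C) : R3 :=
  let n := cross (pd3 du Z p) (pd3 dv Z p) in vscal (/ vnorm n) n.

Definition ff1 (Z : C -> R3) (i j : dir) (p : C) : R :=
  dot (pd3 i Z p) (pd3 j Z p).

Definition ff2 (Z : C -> R3) (i j : dir) (p : C) : R :=
  - dot (pd3 i Z p) (pd3 j (gauss Z) p).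

Definition det1 (Z : C -> R3) (p : C) : R :=
  ff1 Z du du p * ff1 Z dv dv p - (ff1 Z du dv p) ^ 2.

Definition det2 (Z : C -> R3) (p : C) : R :=
  ff2 Z du du p * ff2 Z dv dv p - (ff2 Z du dv p) ^ 2.

Definition mean_curvature (Z : C -> R3) (p : C) : R :=
  (ff2 Z du du p * ff1 Z dv dv p - 2 * ff2 Z du dv p * ff1 Z du dv p
   + ff2 Z dv dv p * ff1 Z du du p) / (2 * det1 Z p).

Definition gauss_curvature (Z : C -> R3) (p : C) : R := det2 Z p / det1 Z p.

Definition immersion (U : C -> Prop) (Z : C -> R3) : Prop :=
  smooth3 U Z /\ forall p, U p -> cross (pd3 du Z p) (pd3 dv Z p) <> v0.

Definition minimal_immersion (U : C -> Prop) (Z : C -> R3) : Prop :=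
  immersion U Z /\ forall p, U p -> mean_curvature Z p = 0.

Definition conformal (U : C -> Prop) (Z : C -> R3) : Prop :=
  forall p, U p -> ff1 Z du du p = ff1 Z dv dv p /\ ff1 Z du dv p = 0.

Definition umbilic (Z : C -> R3) (p : C) : Prop :=
  exists k : R, forall i j : dir, ff2 Z i j p = k * ff1 Z i j p.

(* The gradient with respect to the first fundamental form of Z, as a tangent
   vector of R^3: sum over i, j of I^{ij} (d_j phi) (d_i Z). *)
Definition grad (Z : C -> R3) (phi : C -> R) (p : C) : R3 :=
  vscal (/ det1 Z p)
    (vadd
       (vscal (ff1 Z dv dv p * pd du phi p - ff1 Z du dv p * pd dv phi p) (pd3 du Z p))
       (vscal (ff1 Z du du p * pd dv phi p - ff1 Z du dv p * pd du phi p) (pd3 dv Z p))).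

(* Hess(phi)(X, Y) = < nabla_X grad phi, Y >; the Levi-Civita connection of the
   first fundamental form is the tangential part of the flat derivative of R^3,
   and pairing with the tangent vector d_j Z discards the normal part. *)
Definition hess (Z : C -> R3) (phi : C -> R) (i j : dir) (p : C) : R :=
  dot (pd3 i (grad Z phi) p) (pd3 j Z p).

Definition velocity (c : R -> R3) (t : R) : R3 :=
  (Derive (fun s => x1 (c s)) t, Derive (fun s => x2 (c s)) t, Derive (fun s => x3 (c s)) t).

Definition Cvelocity (c : R -> C) (t : R) : C :=
  (Derive (fun s => fst (c s)) t, Derive (fun s => snd (c s)) t).

(* A C^1 curve on a closed interval I always extends to a neighbourhood of I,
   so two-sided derivatives at the end points lose no curve; the velocity may
   vanish, so piecewise C^1 curves are covered up to reparametrization. *)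
Definition C1_on (I : R -> Prop) (c : R -> C) : Prop :=
  forall t, I t ->
    ex_derive (fun s => fst (c s)) t /\ ex_derive (fun s => snd (c s)) t /\
    continuous (Derive (fun s => fst (c s))) t /\
    continuous (Derive (fun s => snd (c s))) t.

Definition curve_length (c : R -> R3) (a b : R) : R :=
  RInt (fun t => vnorm (velocity c t)) a b.

Definition complete_at_origin (eps : R) (Z : C -> R3) : Prop :=
  forall g : R -> C,
    C1_on (fun t => 0 <= t) g ->
    (forall t, 0 <= t -> pdisk eps (g t)) ->
    filterlim g (Rbar_locally p_infty) (locally (RtoC 0)) ->
    is_lim (fun T => curve_length (fun t => Z (g t)) 0 T) p_infty p_infty.

(* An end is a germ at the puncture, so the total curvature is that of some
   smaller punctured disk of radius r.  It is the improper integral, in polar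
   coordinates u + i v = s e^{i th}, of |K| dA with dA = sqrt(det I) du dv;
   the integrand is nonnegative, so convergence means boundedness. *)
Definition finite_total_curvature (eps : R) (Z : C -> R3) : Prop :=
  exists r M : R, 0 < r < eps /\
    forall d : R, 0 < d < r ->
      RInt (fun s =>
        RInt (fun th =>
          let p : C := (s * cos th, s * sin th) in
          Rabs (gauss_curvature Z p) * sqrt (det1 Z p) * s) 0 (2 * PI)) d r <= M.

Definition complete_planar_minimal_end (eps : R) (Z : C -> R3) : Prop :=
  minimal_immersion (pdisk eps) Z /\
  conformal (pdisk eps) Z /\
  complete_at_origin eps Z /\
  finite_total_curvature eps Z /\
  exists (n : R3) (l : R),
    filterlim (gauss Z) (locally' (RtoC 0)) (locally (n : R * R * R)) /\
    filterlim (fun p => dot (Z p) n) (locally' (RtoC 0)) (locally l).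

(* Stereographic projection from (0, 0, 1), meaningful where x3 n <> 1. *)
Definition stereo (n : R3) : C := (x1 n / (1 - x3 n), x2 n / (1 - x3 n)).

(* The chart 1 / stereo of the Riemann sphere, meaningful where x3 n <> -1. *)
Definition stereo_inv (n : R3) : C := (x1 n / (1 + x3 n), - x2 n / (1 + x3 n)).

(* Coefficient of the Weierstrass 1-form 2 d'(x o Z) = (x o Z_u - i x o Z_v) dz
   for a linear coordinate x.  In terms of the Weierstrass data (G, omega) the
   three 1-forms are (1 - G^2) omega, i (1 + G^2) omega, 2 G omega, up to a
   constant factor. *)
Definition weierstrass_form (x : R3 -> R) (Z : C -> R3) (p : C) : C :=
  (pd du (fun q => x (Z q)) p, - pd dv (fun q => x (Z q)) p).

(* stereo o gauss Z, as a map into the Riemann sphere, extends holomorphically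
   to the origin. *)
Definition gauss_extends (eps : R) (Z : C -> R3) : Prop :=
  exists (r : R) (g : C -> C), 0 < r <= eps /\ holomorphic_on (disk r) g /\
    ((forall p, pdisk r p -> x3 (gauss Z p) <> 1 /\ g p = stereo (gauss Z p)) \/
     (forall p, pdisk r p -> x3 (gauss Z p) <> -1 /\ g p = stereo_inv (gauss Z p))).

(* The three Weierstrass 1-forms are used rather than omega alone so that the
   condition makes sense also when G has a pole at the origin.  They may all
   vanish there (branch point). *)
Definition extends_regularly (eps : R) (Z : C -> R3) : Prop :=
  gauss_extends eps Z /\
  exists Zb : C -> R3,
    (forall p, pdisk eps p -> Zb p = Z p) /\
    smooth3 (disk eps) Zb /\
    conformal (disk eps) Zb /\
    each_coord (fun x => holomorphic_on (disk eps) (weierstrass_form x Zb)).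

(* The real part of the integral of dG~ / (G~ - G) vanishes along every closed
   C^1 loop of U on which G and G~ are finite. *)
Definition no_real_periods (U : C -> Prop) (Z Zt : C -> R3) : Prop :=
  forall g : R -> C,
    C1_on (fun t => 0 <= t <= 1) g ->
    g 0 = g 1 ->
    (forall t, 0 <= t <= 1 ->
       U (g t) /\ x3 (gauss Z (g t)) <> 1 /\ x3 (gauss Zt (g t)) <> 1) ->
    RInt (fun t =>
      Re (Cvelocity (fun s => stereo (gauss Zt (g s))) t
          / (stereo (gauss Zt (g t)) - stereo (gauss Z (g t))))%C) 0 1 = 0.

Definition ribaucour_system (U : C -> Prop) (Z Zt : C -> R3)
    (rho phi : C -> R) (c : R) : Prop :=
  forall p, U p ->
    let w := vadd (grad Z phi p) (vscal (rho p) (gauss Z p)) in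
    (forall i, pd i rho p = dot (grad Z phi p) (pd3 i (gauss Z) p)) /\
    (forall i j, hess Z phi i j p
       = c * rho p * ff1 Z i j p + (rho p - c * phi p) * ff2 Z i j p) /\
    dot (grad Z phi p) (grad Z phi p) = - rho p ^ 2 + 2 * c * rho p * phi p /\
    Zt p = vsub (Z p) (vscal (1 / (c * rho p)) w) /\
    gauss Zt p = vsub (gauss Z p) (vscal (1 / (c * phi p)) w).

(* rho and phi are required not to vanish, as they occur as denominators. *)
Definition ribaucour_integrable (U : C -> Prop) (Z Zt : C -> R3) : Prop :=
  (forall p, U p -> gauss Z p <> gauss Zt p) /\
  no_real_periods U Z Zt /\
  exists (tau rho phi : C -> R) (c : R),
    smooth U tau /\ smooth U rho /\ smooth U phi /\ c <> 0 /\
    (forall p, U p -> rho p <> 0 /\ phi p <> 0) /\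
    (forall p, U p -> tau p = - phi p / rho p) /\
    (forall p, U p ->
       vadd (Z p) (vscal (tau p) (gauss Z p)) = vadd (Zt p) (vscal (tau p) (gauss Zt p))) /\
    ribaucour_system U Z Zt rho phi c.

(* Main.v *)
Require Import Defs.
From Stdlib Require Import Reals Arith Lra Lia Psatz Classical.
From Coquelicot Require Import Coquelicot.

(* Choose an orthonormal frame with [e3] opposite to the limiting normal of [Z], so that
   in this frame the Gauss map [G] of [Z] vanishes at the puncture; let [om] be the
   Weierstrass form with components [(1 - G^2) om, i (1 + G^2) om, 2 G om] up to a factor.
   The Ribaucour system says that, with [Gt] the Gauss map of [Zt], the function
   [y = 1 / (Gt - G)] is holomorphic, satisfies the Riccati equation
   [y' = - (c / 2) om + G' y^2], and gives the Weierstrass data of [Zt]: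
   [omt = (2 / c) G' y^2].  Since the height of [Z] is bounded, [G om] extends to the
   origin, and hence [om] is meromorphic there; for [G ~ z^k] the Riccati equation for
   [Y = z^k y] forces [Y] to be bounded near the origin, so [y] is meromorphic too.  The
   equation leaves two exponents for [y].  In both cases the components of [Zt] behave as
   for a planar end with the same normal, and [omt] either stays bounded, whence [Zt]
   extends, or has a pole, whence [Zt] is complete. *)

Open Scope R_scope.

(** * Complex derivatives *)

(** The obstacle is that [y] lives on the punctured disk only and might have an essential
    singularity there. The quadratic term excludes it: with [G = z^k g] and [a = k g + z g'] one
    gets [z Y' = k Y + a Y^2 - O(z)], where [a 0 <> 0], and a holomorphic function whose derivative
    dominates its own square cannot become large. At the origin this leaves [Y = 0] or
    [Y = - 1 / g 0]. For the second root [G y + 1] vanishes at the origin, and this zero cancels the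
    poles of [Fe e3 Zt] and [omb Zt]. The assumptions on [Z] enter at separate places: without
    umbilics [G] is not constant, so [k] exists; the bounded height makes the inhomogeneous term
    [O(z)]; completeness makes [om] unbounded, which keeps the order of that term at most [k]. The
    limit normal of [Zt] is recovered from the estimate [Fe e3 Zt = O(z om Zt)], which involves no
    division and hence does not presuppose that the Gauss map of [Zt] avoids the centre of
    projection. *)

Definition isC (f : C -> C) (p l : C) : Prop :=
  is_derive (K := C_AbsRing) (V := C_NormedModule) f p l.

(** [C_NormedModule] and the ring seen as a module over itself carry the same operations in
    different records. The product rule, and the inner function of the chain rule, ask for the
    second. *)
Lemma isC_K f p l :
  isC f p l <-> is_derive (K := C_AbsRing) (V := AbsRing_NormedModule C_AbsRing) f p l.
Proof.
  split; intros [[H1 H2 H3] H4];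
    (split; [ split; [exact H1 | exact H2 | exact H3] | exact H4 ]).
Qed.

(** Differentiability along a filter demands the estimate at every limit point of [locally p]; such
    a point is [p] itself, so the usual condition remains. *)
Lemma isC_eps f p l :
  isC f p l <->
  (forall eps, 0 < eps -> exists d, 0 < d /\ forall q, Cmod (q - p) < d ->
     Cmod (f q - f p - (q - p) * l) <= eps * Cmod (q - p)).
Proof.
  split.
  - intros [_ H] eps He.
    destruct (H p (fun P HP => HP) (mkposreal eps He)) as [d Hd].
    exists d. split; [apply cond_pos |]. intros q Hq. apply (Hd q Hq).
  - intros H. split; [apply is_linear_scal_l |].
    intros x Hx.
    apply (is_filter_lim_locally_unique (V := AbsRing_NormedModule C_AbsRing)) in Hx.
    subst x. intros eps. destruct (H eps (cond_pos eps)) as [d [d0 Hd]].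
    exists (mkposreal d d0). intros q Hq. apply Hd. exact Hq.
Qed.

Lemma isC_comp f g p l m : isC f (g p) l -> isC g p m -> isC (fun z => f (g z)) p (m * l)%C.
Proof.
  intros Hf Hg. apply isC_K in Hg.
  apply (is_derive_comp (K := C_AbsRing) (V := C_NormedModule) f g p l m); auto.
Qed.

Lemma isC_mult f g p l m :
  isC f p l -> isC g p m -> isC (fun z => f z * g z)%C p (l * g p + f p * m)%C.
Proof.
  intros Hf Hg. apply isC_K in Hg. apply isC_K in Hf. apply isC_K.
  apply (is_derive_mult (K := C_AbsRing) f g p l m); auto. exact Cmult_comm.
Qed.

Lemma isC_plus f g p l m : isC f p l -> isC g p m -> isC (fun z => f z + g z)%C p (l + m)%C.
Proof.
  intros Hf Hg. apply (is_derive_plus (K := C_AbsRing) (V := C_NormedModule) f g p l m); auto.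
Qed.

Lemma isC_const (c p : C) : isC (fun _ => c) p 0%C.
Proof. apply (is_derive_const (K := C_AbsRing) (V := C_NormedModule)). Qed.

Lemma isC_id (p : C) : isC (fun z => z) p 1%C.
Proof. apply isC_K. apply (is_derive_id (K := C_AbsRing)). Qed.

Lemma isC_ext_loc f g p l :
  (exists d, 0 < d /\ forall q, Cmod (q - p) < d -> f q = g q) -> isC f p l -> isC g p l.
Proof.
  intros [d [d0 Hd]] Hf. apply isC_eps. intros eps He.
  destruct (proj1 (isC_eps f p l) Hf eps He) as [d1 [d10 H1]].
  exists (Rmin d d1). split; [apply Rmin_pos; auto |].
  intros q Hq.
  rewrite <- (Hd q), <- (Hd p).
  - apply H1. eapply Rlt_le_trans; [exact Hq | apply Rmin_r].
  - replace (p - p)%C with (0 : C) by ring. rewrite Cmod_0. exact d0.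
  - eapply Rlt_le_trans; [exact Hq | apply Rmin_l].
Qed.

(** Made for explicit remainders: the expansions of [/ z] and of the Cauchy kernel leave an error
    with an exact factor [(q - p)^2]. *)
Lemma isC_quadratic f p l K d :
  0 < d ->
  (forall q, Cmod (q - p) < d ->
     Cmod (f q - f p - (q - p) * l) <= K * (Cmod (q - p) * Cmod (q - p))) ->
  isC f p l.
Proof.
  intros d0 H. apply isC_eps. intros eps He.
  exists (Rmin d (eps / (Rabs K + 1))).
  assert (0 < Rabs K + 1) by (pose proof (Rabs_pos K); lra).
  split. { apply Rmin_pos; auto. apply Rdiv_lt_0_compat; lra. }
  intros q Hq.
  eapply Rle_trans. { apply H. eapply Rlt_le_trans; [exact Hq | apply Rmin_l]. }
  assert (Hq2 : Cmod (q - p) <= eps / (Rabs K + 1)).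
  { left. eapply Rlt_le_trans; [exact Hq | apply Rmin_r]. }
  rewrite <- Rmult_assoc. apply Rmult_le_compat_r; [apply Cmod_ge_0 |].
  apply Rle_trans with ((Rabs K + 1) * (eps / (Rabs K + 1))).
  - apply Rle_trans with (Rabs K * Cmod (q - p)).
    + apply Rmult_le_compat_r; [apply Cmod_ge_0 | apply Rle_abs].
    + apply Rmult_le_compat; try lra; [apply Rabs_pos | apply Cmod_ge_0].
  - right. field. lra.
Qed.

Lemma isC_unique f p l m : isC f p l -> isC f p m -> l = m.
Proof.
  intros Hl Hm. rewrite <- (is_C_derive_unique f p l Hl). apply is_C_derive_unique. exact Hm.
Qed.

Definition contC (f : C -> C) (p : C) : Prop :=
  continuous (T := C_UniformSpace) (U := C_UniformSpace) f p.

Lemma Cmod_le_abs (z : C) : Cmod z <= Rabs (fst z) + Rabs (snd z).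
Proof.
  replace z with (RtoC (fst z) + Ci * RtoC (snd z))%C at 1
    by (destruct z; unfold Cplus, Cmult; simpl; f_equal; ring).
  eapply Rle_trans; [apply Cmod_triangle |].
  rewrite Cmod_mult, Cmod_Ci, !Cmod_R. lra.
Qed.

Lemma abs_fst_le (z : C) : Rabs (fst z) <= Cmod z.
Proof. eapply Rle_trans; [apply Rmax_l | apply Rmax_Cmod]. Qed.

Lemma abs_snd_le (z : C) : Rabs (snd z) <= Cmod z.
Proof. eapply Rle_trans; [apply Rmax_r | apply Rmax_Cmod]. Qed.

(** The balls of [C_UniformSpace] are squares; the square of half side [d / 2] lies in the disk of
    radius [d]. *)
Lemma locally_Cmod (p : C) (P : C -> Prop) :
  locally (T := C_UniformSpace) p P <->
  exists d, 0 < d /\ forall q, Cmod (q - p) < d -> P q.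
Proof.
  split.
  - intros [d Hd]. exists d. split; [apply cond_pos |]. intros q Hq. apply Hd.
    split.
    + eapply Rle_lt_trans; [| exact Hq]. apply (abs_fst_le (q - p)%C).
    + eapply Rle_lt_trans; [| exact Hq]. apply (abs_snd_le (q - p)%C).
  - intros [d [d0 Hd]]. assert (H2 : 0 < d / 2) by lra.
    exists (mkposreal _ H2). intros q [H3 H4]. apply Hd.
    eapply Rle_lt_trans; [apply Cmod_le_abs |].
    assert (Rabs (fst (q - p)%C) < d / 2) by exact H3.
    assert (Rabs (snd (q - p)%C) < d / 2) by exact H4.
    lra.
Qed.

Lemma contC_eps f p :
  contC f p <->
  (forall eps, 0 < eps -> exists d, 0 < d /\ forall q, Cmod (q - p) < d ->
     Cmod (f q - f p) < eps).
Proof.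
  split.
  - intros H eps He.
    apply (locally_Cmod p). apply (H (fun z => Cmod (z - f p) < eps)).
    apply locally_Cmod. exists eps. split; auto.
  - intros H P HP. apply locally_Cmod in HP. destruct HP as [e [e0 He]].
    apply locally_Cmod. destruct (H e e0) as [d [d0 Hd]].
    exists d. split; auto.
Qed.

Lemma cont_pair {U : UniformSpace} (f : U -> C) (p : U) :
  continuous (U := C_UniformSpace) f p <->
  continuous (fun q => fst (f q)) p /\ continuous (fun q => snd (f q)) p.
Proof.
  split.
  - intros H. split.
    + apply (continuous_comp f fst); [exact H |]. destruct (f p). apply continuous_fst.
    + apply (continuous_comp f snd); [exact H |]. destruct (f p). apply continuous_snd.
  - intros [H1 H2] P [e He].
    assert (H3 := H1 _ (locally_ball (fst (f p)) e)).
    assert (H4 := H2 _ (locally_ball (snd (f p)) e)).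
    unfold filtermap in *. generalize (filter_and _ _ H3 H4).
    apply filter_imp. intros q [Ha Hb]. apply He. split; assumption.
Qed.

Lemma cont_Cmult {U : UniformSpace} (f g : U -> C) p :
  continuous (U := C_UniformSpace) f p -> continuous (U := C_UniformSpace) g p ->
  continuous (U := C_UniformSpace) (fun q => f q * g q)%C p.
Proof.
  intros Hf Hg. apply cont_pair in Hf. apply cont_pair in Hg. apply cont_pair.
  destruct Hf, Hg. simpl. split.
  - apply (continuous_minus (V := R_NormedModule)); apply (continuous_mult (K := R_AbsRing)); auto.
  - apply (continuous_plus (V := R_NormedModule)); apply (continuous_mult (K := R_AbsRing)); auto.
Qed.

Lemma cont_Cplus {U : UniformSpace} (f g : U -> C) p :
  continuous (U := C_UniformSpace) f p -> continuous (U := C_UniformSpace) g p ->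
  continuous (U := C_UniformSpace) (fun q => f q + g q)%C p.
Proof.
  intros Hf Hg. apply cont_pair in Hf. apply cont_pair in Hg. apply cont_pair.
  destruct Hf, Hg. simpl. split; apply (continuous_plus (V := R_NormedModule)); auto.
Qed.

Lemma cont_Cconst {U : UniformSpace} (c : C) (p : U) :
  continuous (U := C_UniformSpace) (fun _ => c) p.
Proof. apply continuous_const. Qed.

Lemma cont_Copp {U : UniformSpace} (f : U -> C) p :
  continuous (U := C_UniformSpace) f p ->
  continuous (U := C_UniformSpace) (fun q => - f q)%C p.
Proof.
  intros Hf. apply cont_pair in Hf. apply cont_pair. destruct Hf.
  split; apply (continuous_opp (V := R_NormedModule)); auto.
Qed.

Lemma cont_Cminus {U : UniformSpace} (f g : U -> C) p :
  continuous (U := C_UniformSpace) f p -> continuous (U := C_UniformSpace) g p ->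
  continuous (U := C_UniformSpace) (fun q => f q - g q)%C p.
Proof. intros Hf Hg. apply cont_Cplus; auto. apply cont_Copp; auto. Qed.

Lemma cont_Cinv {U : UniformSpace} (f : U -> C) p :
  continuous (U := C_UniformSpace) f p -> f p <> 0%C ->
  continuous (U := C_UniformSpace) (fun q => / f q)%C p.
Proof.
  intros Hf H0. apply cont_pair in Hf. apply cont_pair. destruct Hf as [Hf1 Hf2].
  assert (Hd : fst (f p) ^ 2 + snd (f p) ^ 2 <> 0).
  { intros H. apply H0. destruct (f p) as [a b]; simpl in *.
    assert (a = 0) by nra. assert (b = 0) by nra. subst. reflexivity. }
  assert (Hc : continuous (fun q => fst (f q) ^ 2 + snd (f q) ^ 2) p).
  { apply (continuous_plus (V := R_NormedModule)).
    - apply (continuous_comp (fun q => fst (f q)) (fun x => x ^ 2)); auto.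
      apply (ex_derive_continuous (V := R_NormedModule)). auto_derive; auto.
    - apply (continuous_comp (fun q => snd (f q)) (fun x => x ^ 2)); auto.
      apply (ex_derive_continuous (V := R_NormedModule)). auto_derive; auto. }
  assert (Hi : continuous (fun q => / (fst (f q) ^ 2 + snd (f q) ^ 2)) p).
  { apply (continuous_comp (fun q => fst (f q) ^ 2 + snd (f q) ^ 2) Rinv); auto.
    apply continuous_Rinv. exact Hd. }
  unfold Cinv, Rdiv; simpl fst; simpl snd. split; apply (continuous_mult (K := R_AbsRing)); auto.
  apply (continuous_opp (V := R_NormedModule)); auto.
Qed.

Lemma contC_id p : contC (fun z => z) p.
Proof. apply continuous_id. Qed.

Lemma contC_comp f g p : contC f (g p) -> contC g p -> contC (fun z => f (g z)) p.
Proof. intros Hf Hg. apply (continuous_comp g f); auto. Qed.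

Lemma isC_cont f p l : isC f p l -> contC f p.
Proof.
  intros H. apply contC_eps. intros eps He.
  destruct (proj1 (isC_eps _ _ _) H 1 Rlt_0_1) as [d [d0 Hd]].
  assert (Hl : 0 < Cmod l + 2) by (pose proof (Cmod_ge_0 l); lra).
  exists (Rmin d (eps / (Cmod l + 2))). split.
  { apply Rmin_pos; auto. apply Rdiv_lt_0_compat; auto. }
  intros q Hq.
  assert (H1 : Cmod (q - p) < d) by (eapply Rlt_le_trans; [exact Hq | apply Rmin_l]).
  assert (H2 : Cmod (q - p) < eps / (Cmod l + 2)) by (eapply Rlt_le_trans; [exact Hq | apply Rmin_r]).
  specialize (Hd q H1).
  replace (f q - f p)%C with ((f q - f p - (q - p) * l) + (q - p) * l)%C by ring.
  eapply Rle_lt_trans; [apply Cmod_triangle |]. rewrite Cmod_mult.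
  apply Rle_lt_trans with ((Cmod l + 1) * Cmod (q - p)); [lra |].
  apply Rle_lt_trans with ((Cmod l + 1) * (eps / (Cmod l + 2))).
  { apply Rmult_le_compat_l; [pose proof (Cmod_ge_0 l); lra | lra]. }
  replace eps with ((Cmod l + 2) * (eps / (Cmod l + 2))) at 2 by (field; lra).
  apply Rmult_lt_compat_r; [| lra]. apply Rdiv_lt_0_compat; lra.
Qed.

Lemma isC_inv_at (p : C) : p <> 0%C -> isC (fun z => / z)%C p (- / (p * p))%C.
Proof.
  intros Hp. assert (Hm : 0 < Cmod p) by exact (proj1 (Cmod_gt_0 p) Hp).
  apply (isC_quadratic _ _ _ (2 / (Cmod p * Cmod p * Cmod p)) (Cmod p / 2)); [lra |].
  intros q Hq.
  assert (Hq2 : Cmod p / 2 <= Cmod q).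
  { assert (Cmod p <= Cmod q + Cmod (q - p)).
    { replace p with (q + - (q - p))%C at 1 by ring.
      eapply Rle_trans; [apply Cmod_triangle |]. rewrite Cmod_opp. lra. }
    lra. }
  assert (Hq0 : q <> 0%C) by (apply (proj2 (Cmod_gt_0 q)); lra).
  replace (/ q - / p - (q - p) * - / (p * p))%C
    with ((q - p) * (q - p) * / (p * p * q))%C by (field; auto).
  assert (Hne : (p * p * q)%C <> 0%C) by (repeat apply Cmult_neq_0; auto).
  rewrite !Cmod_mult, Cmod_inv, !Cmod_mult; auto.
  rewrite Rmult_comm. apply Rmult_le_compat_r.
  { apply Rmult_le_pos; apply Cmod_ge_0. }
  unfold Rdiv. replace 2 with (/ / 2) by field. rewrite <- Rinv_mult.
  apply Rinv_le_contravar.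
  - apply Rmult_lt_0_compat; [lra |]. repeat apply Rmult_lt_0_compat; auto.
  - replace (/ 2 * (Cmod p * Cmod p * Cmod p)) with (Cmod p * Cmod p * (Cmod p / 2)) by field.
    apply Rmult_le_compat_l; auto. apply Rmult_le_pos; lra.
Qed.

Lemma isC_inv f p l : isC f p l -> f p <> 0%C -> isC (fun z => / f z)%C p (- l / (f p * f p))%C.
Proof.
  intros Hf H0.
  replace (- l / (f p * f p))%C with (l * - / (f p * f p))%C by (field; auto).
  apply (isC_comp (fun z => / z)%C f); auto. apply isC_inv_at; auto.
Qed.

Lemma isC_opp f p l : isC f p l -> isC (fun z => - f z)%C p (- l)%C.
Proof.
  intros Hf. apply (is_derive_opp (K := C_AbsRing) (V := C_NormedModule)); auto.
Qed.

Lemma isC_minus f g p l m : isC f p l -> isC g p m -> isC (fun z => f z - g z)%C p (l - m)%C.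
Proof. intros Hf Hg. apply isC_plus; auto. apply isC_opp; auto. Qed.

Lemma isC_eq f p l m : isC f p l -> l = m -> isC f p m.
Proof. intros H <-; exact H. Qed.

(** * Complex-valued functions of a real variable *)

Definition isRC (g : R -> C) (t : R) (d : C) : Prop :=
  is_derive (fun s => fst (g s)) t (fst d) /\ is_derive (fun s => snd (g s)) t (snd d).

Lemma isR_eps (f : R -> R) x l :
  is_derive f x l <->
  (forall eps, 0 < eps -> exists d, 0 < d /\ forall y, Rabs (y - x) < d ->
     Rabs (f y - f x - (y - x) * l) <= eps * Rabs (y - x)).
Proof.
  split.
  - intros [_ H] eps He.
    destruct (H x (fun P HP => HP) (mkposreal eps He)) as [d Hd].
    exists d. split; [apply cond_pos |]. intros y Hy. apply (Hd y Hy).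
  - intros H. split; [apply is_linear_scal_l |].
    intros y Hy.
    apply (is_filter_lim_locally_unique (V := R_NormedModule)) in Hy.
    subst y. intros eps. destruct (H eps (cond_pos eps)) as [d [d0 Hd]].
    exists (mkposreal d d0). intros q Hq. apply Hd. exact Hq.
Qed.

Lemma isRC_eps (g : R -> C) t d :
  isRC g t d <->
  (forall eps, 0 < eps -> exists e, 0 < e /\ forall s, Rabs (s - t) < e ->
     Cmod (g s - g t - RtoC (s - t) * d) <= eps * Rabs (s - t)).
Proof.
  unfold isRC. rewrite !isR_eps. split.
  - intros [H1 H2] eps He.
    destruct (H1 (eps / 2)) as [e1 [e10 He1]]; [lra |].
    destruct (H2 (eps / 2)) as [e2 [e20 He2]]; [lra |].
    exists (Rmin e1 e2). split; [apply Rmin_pos; auto |]. intros s Hs.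
    specialize (He1 s (Rlt_le_trans _ _ _ Hs (Rmin_l _ _))).
    specialize (He2 s (Rlt_le_trans _ _ _ Hs (Rmin_r _ _))).
    eapply Rle_trans; [apply Cmod_le_abs |]. simpl.
    match goal with |- Rabs ?a + Rabs ?b <= _ =>
      replace a with (fst (g s) - fst (g t) - (s - t) * fst d) by ring;
      replace b with (snd (g s) - snd (g t) - (s - t) * snd d) by ring end.
    lra.
  - intros H. split; intros eps He; destruct (H eps He) as [e [e0 Hs]];
      exists e; (split; [exact e0 |]); intros s Hse; specialize (Hs s Hse).
    + eapply Rle_trans; [| exact Hs]. eapply Rle_trans; [| apply abs_fst_le]. simpl.
      right. f_equal. ring.
    + eapply Rle_trans; [| exact Hs]. eapply Rle_trans; [| apply abs_snd_le]. simpl.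
      right. f_equal. ring.
Qed.

Lemma isC_curve f (g : R -> C) t l d :
  isC f (g t) l -> isRC g t d -> isRC (fun s => f (g s)) t (d * l)%C.
Proof.
  intros Hf Hg. apply isRC_eps. intros eps He.
  rewrite isC_eps in Hf. rewrite isRC_eps in Hg.
  pose proof (Cmod_ge_0 l) as Hl. pose proof (Cmod_ge_0 d) as Hd.
  assert (A1 : 0 < eps / (2 * (Cmod d + 1))) by (apply Rdiv_lt_0_compat; lra).
  assert (A2 : 0 < eps / (2 * (Cmod l + 1))) by (apply Rdiv_lt_0_compat; lra).
  destruct (Hf _ A1) as [e1 [e10 H1]].
  destruct (Hg _ A2) as [e2 [e20 H2]].
  (* The estimate with error [1] makes [g] Lipschitz at [t] with constant [Cmod d + 1]; this brings
     [g s] into the range where the estimate for [f] holds. *)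
  destruct (Hg 1 Rlt_0_1) as [e3 [e30 H3]].
  assert (A4 : 0 < e1 / (Cmod d + 1)) by (apply Rdiv_lt_0_compat; lra).
  exists (Rmin (Rmin e2 e3) (e1 / (Cmod d + 1))). split; [repeat apply Rmin_pos; auto |].
  intros s Hs.
  assert (Hs2 : Rabs (s - t) < e2).
  { eapply Rlt_le_trans; [exact Hs |]. eapply Rle_trans; [apply Rmin_l | apply Rmin_l]. }
  assert (Hs3 : Rabs (s - t) < e3).
  { eapply Rlt_le_trans; [exact Hs |]. eapply Rle_trans; [apply Rmin_l | apply Rmin_r]. }
  assert (Hs1 : Rabs (s - t) < e1 / (Cmod d + 1)).
  { eapply Rlt_le_trans; [exact Hs |]. apply Rmin_r. }
  specialize (H2 s Hs2). specialize (H3 s Hs3).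
  assert (H4 : Cmod (g s - g t) <= (Cmod d + 1) * Rabs (s - t)).
  { replace (g s - g t)%C with ((g s - g t - RtoC (s - t) * d) + RtoC (s - t) * d)%C by ring.
    eapply Rle_trans; [apply Cmod_triangle |]. rewrite Cmod_mult, Cmod_R. lra. }
  assert (H5 : Cmod (g s - g t) < e1).
  { eapply Rle_lt_trans; [exact H4 |].
    apply Rlt_le_trans with ((Cmod d + 1) * (e1 / (Cmod d + 1))).
    - apply Rmult_lt_compat_l; lra.
    - right; field; lra. }
  specialize (H1 _ H5).
  replace (f (g s) - f (g t) - RtoC (s - t) * (d * l))%C
    with ((f (g s) - f (g t) - (g s - g t) * l) + (g s - g t - RtoC (s - t) * d) * l)%C by ring.
  eapply Rle_trans; [apply Cmod_triangle |]. rewrite Cmod_mult.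
  apply Rle_trans with (eps / 2 * Rabs (s - t) + eps / 2 * Rabs (s - t)); [| lra].
  pose proof (Rabs_pos (s - t)) as Hp.
  apply Rplus_le_compat.
  - eapply Rle_trans; [exact H1 |].
    eapply Rle_trans; [apply Rmult_le_compat_l; [lra | exact H4] |].
    right; field; lra.
  - eapply Rle_trans; [apply Rmult_le_compat_r; [exact Hl | exact H2] |].
    apply Rle_trans with (eps / (2 * (Cmod l + 1)) * Rabs (s - t) * (Cmod l + 1)).
    + apply Rmult_le_compat_l; [| lra]. apply Rmult_le_pos; lra.
    + right; field; lra.
Qed.

Lemma isRC_mult (f g : R -> C) t l m :
  isRC f t l -> isRC g t m -> isRC (fun s => f s * g s)%C t (l * g t + f t * m)%C.
Proof.
  intros [Hf1 Hf2] [Hg1 Hg2]. split; simpl.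
  - evar_last.
    + apply (is_derive_minus (K := R_AbsRing) (V := R_NormedModule)).
      * apply (is_derive_mult (K := R_AbsRing) _ _ _ _ _ Hf1 Hg1). exact Rmult_comm.
      * apply (is_derive_mult (K := R_AbsRing) _ _ _ _ _ Hf2 Hg2). exact Rmult_comm.
    + unfold minus, plus, opp, mult; simpl. ring.
  - evar_last.
    + apply (is_derive_plus (K := R_AbsRing) (V := R_NormedModule)).
      * apply (is_derive_mult (K := R_AbsRing) _ _ _ _ _ Hf1 Hg2). exact Rmult_comm.
      * apply (is_derive_mult (K := R_AbsRing) _ _ _ _ _ Hf2 Hg1). exact Rmult_comm.
    + unfold minus, plus, opp, mult; simpl. ring.
Qed.

Lemma isRC_plus (f g : R -> C) t l m :
  isRC f t l -> isRC g t m -> isRC (fun s => f s + g s)%C t (l + m)%C.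
Proof.
  intros [Hf1 Hf2] [Hg1 Hg2]. split; simpl;
    apply (is_derive_plus (K := R_AbsRing) (V := R_NormedModule)); auto.
Qed.

Lemma isRC_const (c : C) t : isRC (fun _ => c) t 0%C.
Proof. split; apply (is_derive_const (K := R_AbsRing) (V := R_NormedModule)). Qed.

Lemma isRC_RtoC t : isRC (fun s => RtoC s) t 1%C.
Proof.
  split; simpl.
  - apply (is_derive_id (K := R_AbsRing)).
  - apply (is_derive_const (K := R_AbsRing) (V := R_NormedModule)).
Qed.

Lemma isRC_eq g t l m : isRC g t l -> l = m -> isRC g t m.
Proof. intros H <-; exact H. Qed.

Lemma isRC_cont g t d : isRC g t d -> continuous (U := C_UniformSpace) g t.
Proof.
  intros [H1 H2]. apply cont_pair. split;
   apply (ex_derive_continuous (K := R_AbsRing) (V := R_NormedModule)); eexists; eassumption.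
Qed.

(** * Cauchy's formula *)

(** Only circles are integrated over, always parametrized by [[0, 2 PI]]; taking components makes
    the real fundamental theorem of calculus applicable. *)
Definition CInt (g : R -> C) : C :=
  (RInt (fun t => fst (g t)) 0 (2 * PI), RInt (fun t => snd (g t)) 0 (2 * PI)).

Definition ccont (g : R -> C) : Prop := forall t, continuous (U := C_UniformSpace) g t.

Lemma ccont_fst g t : ccont g -> continuous (fun s => fst (g s)) t.
Proof. intros H. apply (proj1 (cont_pair g t)). apply H. Qed.

Lemma ccont_snd g t : ccont g -> continuous (fun s => snd (g s)) t.
Proof. intros H. apply (proj1 (cont_pair g t)). apply H. Qed.

Lemma ccont_ex_fst g a b : ccont g -> ex_RInt (fun s => fst (g s)) a b.
Proof.
  intros H. apply (ex_RInt_continuous (V := R_CompleteNormedModule)).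
  intros z _. apply ccont_fst; auto.
Qed.

Lemma ccont_ex_snd g a b : ccont g -> ex_RInt (fun s => snd (g s)) a b.
Proof.
  intros H. apply (ex_RInt_continuous (V := R_CompleteNormedModule)).
  intros z _. apply ccont_snd; auto.
Qed.

Lemma CInt_ext f g : (forall t, f t = g t) -> CInt f = CInt g.
Proof.
  intros H. unfold CInt. f_equal; apply RInt_ext; intros; rewrite H; auto.
Qed.

Lemma CInt_plus f g : ccont f -> ccont g -> CInt (fun t => f t + g t)%C = (CInt f + CInt g)%C.
Proof.
  intros Hf Hg. unfold CInt, Cplus; simpl. f_equal.
  - apply (RInt_plus (V := R_CompleteNormedModule)); apply ccont_ex_fst; auto.
  - apply (RInt_plus (V := R_CompleteNormedModule)); apply ccont_ex_snd; auto.
Qed.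

Lemma CInt_scal c f : ccont f -> CInt (fun t => c * f t)%C = (c * CInt f)%C.
Proof.
  intros Hf. pose proof (ccont_ex_fst f 0 (2 * PI) Hf) as E1.
  pose proof (ccont_ex_snd f 0 (2 * PI) Hf) as E2.
  unfold CInt, Cmult; simpl. f_equal; apply is_RInt_unique.
  - apply (is_RInt_minus (V := R_NormedModule));
      apply (is_RInt_scal (V := R_NormedModule)); apply (RInt_correct (V := R_CompleteNormedModule)); auto.
  - apply (is_RInt_plus (V := R_NormedModule));
      apply (is_RInt_scal (V := R_NormedModule)); apply (RInt_correct (V := R_CompleteNormedModule)); auto.
Qed.

Lemma CInt_const c : CInt (fun _ => c) = (RtoC (2 * PI) * c)%C.
Proof.
  unfold CInt. rewrite !RInt_const. unfold Cmult, scal; simpl. unfold mult; simpl.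
  f_equal; ring.
Qed.

(** The two components are bounded separately, whence [4 * PI] instead of the sharp [2 * PI]. This
    is the origin of the extra factor [2] in the Cauchy estimates below. *)
Lemma CInt_bound g M :
  ccont g -> (forall t, 0 <= t <= 2 * PI -> Cmod (g t) <= M) -> Cmod (CInt g) <= 4 * PI * M.
Proof.
  intros Hg HM. eapply Rle_trans; [apply Cmod_le_abs |]. simpl.
  pose proof PI_RGT_0.
  assert (A : forall f : R -> R, (forall t, continuous f t) ->
     (forall t, 0 <= t <= 2 * PI -> Rabs (f t) <= M) ->
     Rabs (RInt f 0 (2 * PI)) <= (2 * PI - 0) * M).
  { intros f Hf Hb. apply abs_RInt_le_const; auto; [lra |].
    apply (ex_RInt_continuous (V := R_CompleteNormedModule)). auto. }
  apply Rle_trans with ((2 * PI - 0) * M + (2 * PI - 0) * M); [| right; ring].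
  apply Rplus_le_compat; apply A; intros t.
  - apply ccont_fst; auto.
  - intros Ht. eapply Rle_trans; [apply abs_fst_le | apply HM; auto].
  - apply ccont_snd; auto.
  - intros Ht. eapply Rle_trans; [apply abs_snd_le | apply HM; auto].
Qed.

Lemma CInt_deriv G g :
  ccont g -> (forall t, isRC G t (g t)) -> CInt g = (G (2 * PI)%R - G 0)%C.
Proof.
  intros Hg HG. unfold CInt, Cminus, Cplus, Copp; simpl. f_equal; apply is_RInt_unique.
  - apply (is_RInt_derive (V := R_CompleteNormedModule) (fun t => fst (G t)));
      intros; [apply HG | apply ccont_fst; auto].
  - apply (is_RInt_derive (V := R_CompleteNormedModule) (fun t => snd (G t)));
      intros; [apply HG | apply ccont_snd; auto].
Qed.

Lemma locally_open_interval (a b t : R) : a < t < b -> locally t (fun s => a < s < b).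
Proof.
  intros [H1 H2]. apply (locally_interval _ t a b); simpl; auto.
Qed.

(** Differentiation under the integral sign with the derivative supplied explicitly. The open
    interval leaves room around the end points [0] and [1] of a homotopy. *)
Lemma is_derive_RInt_param' (f d : R -> R -> R) a b l r t :
  (forall s x, a < s < b -> is_derive (fun u => f u x) s (d s x)) ->
  (forall s x, a < s < b -> continuous (fun z : R * R => d (fst z) (snd z)) (s, x)) ->
  (forall s x, a < s < b -> continuous (f s) x) ->
  a < t < b ->
  is_derive (fun s => RInt (f s) l r) t (RInt (d t) l r).
Proof.
  intros Hd Hc Hf Ht.
  assert (Hl := locally_open_interval a b t Ht).
  evar_last.
  - apply (is_derive_RInt_param f l r t).
    + revert Hl. apply filter_imp. intros s Hs x _. eexists. apply Hd; auto.
    + intros x _.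
      apply (continuity_2d_pt_ext_loc d).
      * destruct Hl as [e He]. exists e. intros u v Hu _. symmetry.
        apply is_derive_unique. apply Hd. apply He. exact Hu.
      * apply continuity_2d_pt_filterlim. apply Hc. auto.
    + revert Hl. apply filter_imp. intros s Hs.
      apply (ex_RInt_continuous (V := R_CompleteNormedModule)). intros z _. apply Hf; auto.
  - apply RInt_ext. intros x _. apply is_derive_unique. apply Hd; auto.
Qed.

Lemma CInt_param (F D : R -> R -> C) a b t :
  (forall s x, a < s < b -> isRC (fun u => F u x) s (D s x)) ->
  (forall s x, a < s < b ->
     continuous (U := C_UniformSpace) (fun z : R * R => D (fst z) (snd z)) (s, x)) ->
  (forall s, a < s < b -> ccont (F s)) ->
  a < t < b ->
  isRC (fun s => CInt (F s)) t (CInt (D t)).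
Proof.
  intros Hd Hc Hf Ht. split; simpl.
  - apply (is_derive_RInt_param' (fun s x => fst (F s x)) (fun s x => fst (D s x)) a b); auto.
    + intros s x Hs. apply (Hd s x Hs).
    + intros s x Hs. apply (proj1 (cont_pair _ _) (Hc s x Hs)).
    + intros s x Hs. apply (ccont_fst (F s)). auto.
  - apply (is_derive_RInt_param' (fun s x => snd (F s x)) (fun s x => snd (D s x)) a b); auto.
    + intros s x Hs. apply (Hd s x Hs).
    + intros s x Hs. apply (proj1 (cont_pair _ _) (Hc s x Hs)).
    + intros s x Hs. apply (ccont_snd (F s)). auto.
Qed.

Lemma isRC_zero_const (g : R -> C) :
  (forall t, 0 <= t <= 1 -> isRC g t 0%C) -> g 0 = g 1.
Proof.
  intros H. apply injective_projections.
  - apply (eq_is_derive (V := R_NormedModule) (fun t => fst (g t))); [| lra].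
    intros t Ht. apply (H t Ht).
  - apply (eq_is_derive (V := R_NormedModule) (fun t => snd (g t))); [| lra].
    intros t Ht. apply (H t Ht).
Qed.

Definition eit (t : R) : C := (cos t, sin t).

Lemma eit_deriv t : isRC eit t (Ci * eit t)%C.
Proof.
  split; simpl; auto_derive; auto; ring.
Qed.

Lemma eit_cont : ccont eit.
Proof. intros t. eapply isRC_cont. apply eit_deriv. Qed.

Lemma eit_mod t : Cmod (eit t) = 1.
Proof.
  unfold Cmod, eit; simpl. rewrite !Rmult_1_r.
  replace (cos t * cos t + sin t * sin t) with (Rsqr (sin t) + Rsqr (cos t)) by (unfold Rsqr; ring).
  rewrite sin2_cos2. apply sqrt_1.
Qed.

Lemma eit_0 : eit 0 = 1%C.
Proof. unfold eit. rewrite cos_0, sin_0. reflexivity. Qed.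

Lemma eit_2PI : eit (2 * PI) = 1%C.
Proof. unfold eit. rewrite cos_2PI, sin_2PI. reflexivity. Qed.

Lemma eit_neq_0 t : eit t <> 0%C.
Proof. apply (proj2 (Cmod_gt_0 _)). rewrite eit_mod. lra. Qed.

Lemma Cmod_minus_ge (a b : C) : Cmod a - Cmod b <= Cmod (a - b).
Proof.
  assert (Cmod a <= Cmod (a - b) + Cmod b); [| lra].
  replace a with ((a - b) + b)%C at 1 by ring. apply Cmod_triangle.
Qed.

Lemma Cmod_minus_sym (a b : C) : Cmod (a - b) = Cmod (b - a).
Proof. replace (a - b)%C with (- (b - a))%C by ring. apply Cmod_opp. Qed.

Lemma eit_minus_ge t p : 1 - Cmod p <= Cmod (eit t - p).
Proof. rewrite <- (eit_mod t). apply Cmod_minus_ge. Qed.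

Lemma eit_minus_neq t p : Cmod p < 1 -> (eit t - p)%C <> 0%C.
Proof.
  intros H. apply (proj2 (Cmod_gt_0 _)). pose proof (eit_minus_ge t p). lra.
Qed.

Lemma ccont_mult f g : ccont f -> ccont g -> ccont (fun t => f t * g t)%C.
Proof. intros Hf Hg t. apply cont_Cmult; auto. Qed.

Lemma ccont_const c : ccont (fun _ => c).
Proof. intros t. apply cont_Cconst. Qed.

Lemma ccont_plus f g : ccont f -> ccont g -> ccont (fun t => f t + g t)%C.
Proof. intros Hf Hg t. apply cont_Cplus; auto. Qed.

Ltac ccont_tac := repeat match goal with
  | H : ccont ?f |- ccont ?f => exact H
  | |- ccont (fun t => (@?f t * @?g t)%C) => apply (ccont_mult f g)
  | |- ccont (fun t => (@?f t + @?g t)%C) => apply (ccont_plus f g)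
  end; auto using eit_cont, ccont_const.

Lemma ccont_kernel p : Cmod p < 1 -> ccont (fun t => / (eit t - p))%C.
Proof.
  intros Hp t. apply (cont_Cinv (fun t => eit t - p)%C).
  - apply cont_Cminus; [apply eit_cont | apply cont_Cconst].
  - apply eit_minus_neq; auto.
Qed.

Lemma cont_of_snd {U : UniformSpace} (g : R -> U) (z : R * R) :
  continuous g (snd z) -> continuous (fun z : R * R => g (snd z)) z.
Proof.
  intros H. apply (continuous_comp snd g); auto. destruct z. apply continuous_snd.
Qed.

Lemma cont_of_fst {U : UniformSpace} (g : R -> U) (z : R * R) :
  continuous g (fst z) -> continuous (fun z : R * R => g (fst z)) z.
Proof.
  intros H. apply (continuous_comp fst g); auto. destruct z. apply continuous_fst.
Qed.

Lemma cont_RtoC t : continuous (U := C_UniformSpace) RtoC t.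
Proof. eapply isRC_cont. apply isRC_RtoC. Qed.

(* Homotopy [s p] of the pole: the [s]-derivative of the integrand is the
   [x]-derivative of a constant multiple of [/ (e^{ix} - s p)]. *)
Lemma CInt_kernel p : Cmod p < 1 -> CInt (fun x => eit x / (eit x - p))%C = RtoC (2 * PI).
Proof.
  intros Hp.
  (* With this margin the pole [s p] stays inside the unit disk for all [s] in a neighbourhood of
     [[0, 1]]. *)
  set (eta := (1 - Cmod p) / 2).
  pose proof (Cmod_ge_0 p) as Hp0.
  assert (Hr : forall s, - eta < s < 1 + eta -> Cmod (RtoC s * p) < 1).
  { intros s Hs. rewrite Cmod_mult, Cmod_R. unfold eta in Hs.
    assert (Rabs s < 1 + (1 - Cmod p) / 2) by (apply Rabs_def1; lra).
    pose proof (Rabs_pos s). nra. }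
  assert (H0 : forall s, - eta < s < 1 + eta ->
     isRC (fun s => CInt (fun x => eit x / (eit x - RtoC s * p))%C) s
       (CInt (fun x => eit x * p * (/ (eit x - RtoC s * p) * / (eit x - RtoC s * p)))%C)).
  { intros s Hs.
    apply (CInt_param (fun s x => eit x / (eit x - RtoC s * p))%C
      (fun s x => eit x * p * (/ (eit x - RtoC s * p) * / (eit x - RtoC s * p)))%C
      (- eta) (1 + eta)); auto.
    - intros u x Hu. specialize (Hr u Hu). pose proof (eit_minus_neq x _ Hr) as Hn.
      eapply isRC_eq.
      + apply isRC_mult; [apply isRC_const |].
        apply (isC_curve (fun z => / (eit x - z * p))%C RtoC); [| apply isRC_RtoC].
        apply (isC_inv (fun z => eit x - z * p)%C); auto.
        apply isC_minus; [apply isC_const |]. apply isC_mult; [apply isC_id | apply isC_const].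
      + simpl. field. exact Hn.
    - intros u x Hu. specialize (Hr u Hu). pose proof (eit_minus_neq x _ Hr) as Hn.
      assert (continuous (U := C_UniformSpace)
        (fun z : R * R => / (eit (snd z) - RtoC (fst z) * p))%C (u, x)).
      { apply (cont_Cinv (fun z : R * R => eit (snd z) - RtoC (fst z) * p)%C); auto.
        apply cont_Cminus. { apply cont_of_snd. apply eit_cont. }
        apply cont_Cmult; [| apply cont_Cconst]. apply cont_of_fst. apply cont_RtoC. }
      apply cont_Cmult; [| apply cont_Cmult; auto].
      apply cont_Cmult; [| apply cont_Cconst]. apply cont_of_snd. apply eit_cont.
    - intros u Hu. apply ccont_mult; [apply eit_cont |]. apply ccont_kernel; auto. }
  assert (He : 0 < eta) by (unfold eta; lra).
  assert (HE : CInt (fun x => eit x / (eit x - RtoC 0 * p))%C = CInt (fun x => eit x / (eit x - RtoC 1 * p))%C).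
  { apply (isRC_zero_const (fun s => CInt (fun x => eit x / (eit x - RtoC s * p))%C)).
    intros t Ht. assert (Ht' : - eta < t < 1 + eta) by lra.
    eapply isRC_eq; [apply H0; auto |].
    rewrite (CInt_deriv (fun x => Ci * p * / (eit x - RtoC t * p))%C).
    - rewrite eit_0, eit_2PI. ring.
    - specialize (Hr t Ht'). repeat apply ccont_mult; auto using eit_cont, ccont_const, ccont_kernel.
    - intros x. specialize (Hr t Ht'). pose proof (eit_minus_neq x _ Hr) as Hn.
      eapply isRC_eq.
      + apply isRC_mult; [apply isRC_const |].
        apply (isC_curve (fun z => / (z - RtoC t * p))%C eit); [| apply eit_deriv].
        apply (isC_inv (fun z => z - RtoC t * p)%C); auto.
        apply isC_minus; [apply isC_id | apply isC_const].
      + simpl. replace (eit x * p)%C with (- (Ci * Ci) * (eit x * p))%C.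
        2:{ replace (Ci * Ci)%C with (-(1))%C; [ring |].
            unfold Ci, Cmult, Copp; simpl. unfold RtoC. f_equal; ring. }
        field. exact Hn. }
  rewrite (CInt_ext _ (fun x => eit x / (eit x - RtoC 1 * p))%C).
  2:{ intros t. rewrite Cmult_1_l. reflexivity. }
  rewrite <- HE.
  rewrite (CInt_ext _ (fun _ => 1%C)).
  - rewrite CInt_const. ring.
  - intros t. rewrite Cmult_0_l. field.
    replace (eit t - 0)%C with (eit t) by ring. apply eit_neq_0.
Qed.

(** The derivative is carried as data and is continuous: differentiation under the integral sign
    needs this, and Goursat's theorem is thereby avoided. *)
Definition HolD (U : C -> Prop) (f f' : C -> C) : Prop :=
  forall p, U p -> isC f p (f' p) /\ contC f' p.

Definition cball (c : C) (r : R) (q : C) : Prop := Cmod (q - c) < r.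

Lemma disk_cball r p : disk r p <-> cball 0 r p.
Proof. unfold disk, cball. replace (p - 0)%C with p by ring. tauto. Qed.

Lemma ccont_bounded g : ccont g -> exists B, 0 <= B /\ forall t, 0 <= t <= 2 * PI -> Cmod (g t) <= B.
Proof.
  intros Hg. pose proof PI_RGT_0.
  assert (A : forall f : R -> R, (forall t, continuous f t) ->
     exists M, forall t, 0 <= t <= 2 * PI -> Rabs (f t) <= M).
  { intros f Hf.
    destruct (continuity_ab_maj (fun t => Rabs (f t)) 0 (2 * PI)) as [m [Hm _]]; [lra | |].
    - intros c _. apply continuity_pt_filterlim.
      apply (continuous_comp f Rabs); auto.
      apply continuity_pt_filterlim. apply Rcontinuity_abs.
    - exists (Rabs (f m)). exact Hm. }
  destruct (A (fun t => fst (g t))) as [M1 H1]; [intros; apply ccont_fst; auto |].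
  destruct (A (fun t => snd (g t))) as [M2 H2]; [intros; apply ccont_snd; auto |].
  exists (M1 + M2). split.
  - assert (H0 : 0 <= 0 <= 2 * PI) by lra.
    specialize (H1 0 H0). specialize (H2 0 H0).
    pose proof (Rabs_pos (fst (g 0))). pose proof (Rabs_pos (snd (g 0))). lra.
  - intros t Ht. eapply Rle_trans; [apply Cmod_le_abs |].
    apply Rplus_le_compat; auto.
Qed.

Lemma RtoC_2PI_neq : RtoC (2 * PI) <> 0%C.
Proof. intros H. apply RtoC_inj in H. pose proof PI_RGT_0. lra. Qed.

(* Homotopy: for [f] holomorphic the integral of
   [f (p + t (e^{ix} - p))] against the Cauchy kernel does not depend on [t];
   its [t]-derivative is, up to a factor, the integral of an [x]-derivative. *)
Lemma cauchy_unit rho f f' p :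
  1 < rho -> HolD (disk rho) f f' -> Cmod p < 1 ->
  CInt (fun x => f (eit x) * (eit x / (eit x - p)))%C = (RtoC (2 * PI) * f p)%C.
Proof.
  intros Hrho Hf Hp.
  set (eta := (rho - 1) / 2).

  assert (He : 0 < eta) by (unfold eta; lra).
  set (m := fun (s x : R) => (p + RtoC s * (eit x - p))%C).
  assert (Hr : forall s x, - eta < s < 1 + eta -> disk rho (m s x)).
  { intros s x Hs. unfold disk, m.
    replace (p + RtoC s * (eit x - p))%C with (RtoC (1 - s) * p + RtoC s * eit x)%C
      by (rewrite RtoC_minus; ring).
    eapply Rle_lt_trans; [apply Cmod_triangle |].
    rewrite !Cmod_mult, !Cmod_R, eit_mod. unfold eta in Hs.
    apply Rle_lt_trans with (Rabs (1 - s) + Rabs s).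
    - pose proof (Rabs_pos (1 - s)). nra.
    - unfold Rabs. destruct (Rcase_abs (1 - s)), (Rcase_abs s); lra. }
  assert (Hm : forall s x, continuous (U := C_UniformSpace) (fun z : R * R => m (fst z) (snd z)) (s, x)).
  { intros s x. apply cont_Cplus; [apply cont_Cconst |].
    apply cont_Cmult; [apply cont_of_fst; apply cont_RtoC |].
    apply cont_Cminus; [apply cont_of_snd; apply eit_cont | apply cont_Cconst]. }
  assert (Hmx : forall s, ccont (m s)).
  { intros s x. apply cont_Cplus; [apply cont_Cconst |].
    apply cont_Cmult; [apply cont_Cconst |].
    apply cont_Cminus; [apply eit_cont | apply cont_Cconst]. }
  assert (Hd : forall s x, - eta < s < 1 + eta ->
    isRC (fun u => f (m u x)) s ((eit x - p) * f' (m s x))%C).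
  { intros s x Hs. apply isC_curve; [apply Hf; auto |].
    unfold m. eapply isRC_eq.
    - apply isRC_plus; [apply isRC_const |].
      apply isRC_mult; [apply isRC_RtoC | apply isRC_const].
    - simpl. ring. }
  assert (Hdx : forall s x, - eta < s < 1 + eta ->
    isRC (fun y => f (m s y)) x (RtoC s * (Ci * eit x) * f' (m s x))%C).
  { intros s x Hs. apply (isC_curve f (m s)); [apply Hf; auto |].
    unfold m. eapply isRC_eq.
    - apply isRC_plus; [apply isRC_const |].
      apply isRC_mult; [apply isRC_const |].
      apply isRC_plus; [apply eit_deriv | apply isRC_const].
    - simpl. ring. }
  assert (Hc' : forall s, - eta < s < 1 + eta -> ccont (fun x => f' (m s x))).
  { intros s Hs x. apply (continuous_comp (m s) f'); [apply Hmx |]. apply Hf. auto. }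
  assert (H0 : forall s, - eta < s < 1 + eta ->
     isRC (fun s => CInt (fun x => f (m s x) * (eit x / (eit x - p)))%C) s
       (CInt (fun x => eit x * f' (m s x))%C)).
  { intros s Hs.
    apply (CInt_param (fun s x => f (m s x) * (eit x / (eit x - p)))%C
      (fun s x => eit x * f' (m s x))%C (- eta) (1 + eta)); auto.
    - intros u x Hu. pose proof (eit_minus_neq x _ Hp) as Hn.
      eapply isRC_eq.
      + apply isRC_mult; [apply Hd; auto | apply isRC_const].
      + simpl. field. exact Hn.
    - intros u x Hu. apply cont_Cmult. { apply cont_of_snd. apply eit_cont. }
      apply (continuous_comp (fun z : R * R => m (fst z) (snd z)) f'); [apply Hm |].
      apply Hf. apply Hr. exact Hu.
    - intros u Hu. apply ccont_mult.
      + intros x. eapply isRC_cont. apply Hdx; auto.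
      + apply ccont_mult; [apply eit_cont |]. apply ccont_kernel; auto. }
  assert (HE : CInt (fun x => f (m 0 x) * (eit x / (eit x - p)))%C
             = CInt (fun x => f (m 1 x) * (eit x / (eit x - p)))%C).
  { apply (isRC_zero_const (fun s => CInt (fun x => f (m s x) * (eit x / (eit x - p)))%C)).
    intros t Ht. assert (Ht' : - eta < t < 1 + eta) by lra.
    eapply isRC_eq; [apply H0; auto |].
    assert (Hk : ccont (fun x => eit x * f' (m t x))%C).
    { apply ccont_mult; [apply eit_cont | auto]. }
    (* The [x]-derivative of [f (m t x)] contains the factor [t]. For [t = 0] it says nothing, but
       then [m] is constant and the integrand is a multiple of the derivative of [eit]. *)
    destruct (Req_dec t 0) as [Ht0 | Ht0].
    - subst t. rewrite (CInt_ext _ (fun x => (f' p * / Ci) * (Ci * eit x))%C).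
      + rewrite CInt_scal by (apply ccont_mult; [apply ccont_const | apply eit_cont]).
        rewrite (CInt_deriv eit).
        * rewrite eit_0, eit_2PI. ring.
        * apply ccont_mult; [apply ccont_const | apply eit_cont].
        * apply eit_deriv.
      + intros x. unfold m. replace (p + 0 * (eit x - p))%C with p by ring.
        field. apply Ci_nz.
    - assert (Htc : RtoC t <> 0%C) by (intros E; apply RtoC_inj in E; auto).
      assert (E : (RtoC t * Ci * CInt (fun x => eit x * f' (m t x)))%C = 0%C).
      { rewrite <- CInt_scal by auto.
        rewrite (CInt_deriv (fun x => f (m t x))).
        - unfold m. rewrite eit_0, eit_2PI. ring.
        - apply ccont_mult; [apply ccont_const | auto].
        - intros x. eapply isRC_eq; [apply Hdx; auto |]. ring. }
      destruct (Ceq_dec (CInt (fun x => eit x * f' (m t x)))%C 0%C) as [E1 | E1]; auto.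
      exfalso. revert E. repeat apply Cmult_neq_0; auto. apply Ci_nz. }
  rewrite (CInt_ext _ (fun x => f (m 1 x) * (eit x / (eit x - p)))%C).
  2:{ intros t. unfold m. f_equal. f_equal. ring. }
  rewrite <- HE.
  rewrite (CInt_ext _ (fun x => f p * (eit x / (eit x - p)))%C).
  2:{ intros t. unfold m. f_equal. f_equal. ring. }
  rewrite CInt_scal.
  - rewrite CInt_kernel; auto. ring.
  - apply ccont_mult; [apply eit_cont | apply ccont_kernel; auto].
Qed.

(** A point within half the distance of [p] from the circle still has that half distance to the
    circle, so the kernels are bounded uniformly near [p]. *)
Lemma kernel_bound p q t :
  Cmod p < 1 -> Cmod (q - p) < (1 - Cmod p) / 2 ->
  Cmod q < 1 /\ Cmod (/ (eit t - q)) <= / ((1 - Cmod p) / 2).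
Proof.
  intros Hp Hq.
  assert (Hq1 : Cmod q < 1 - (1 - Cmod p) / 2).
  { replace q with (p + (q - p))%C by ring.
    eapply Rle_lt_trans; [apply Cmod_triangle |]. lra. }
  split; [lra |].
  rewrite Cmod_inv by (apply eit_minus_neq; lra).
  apply Rinv_le_contravar; [lra |]. pose proof (eit_minus_ge t q). lra.
Qed.

Ltac prod_le_tac := repeat match goal with
  | |- ?a * ?b <= ?c * ?d => apply Rmult_le_compat
  | |- 0 <= ?a * ?b => apply Rmult_le_pos
  | |- 0 <= Cmod _ => apply Cmod_ge_0
  end; auto.

(** * Cauchy integrals of a continuous function on the circle *)

Section Transform.
Variable g : R -> C.
Hypothesis Hg : ccont g.

(** Up to constants these three represent [f], [f'] and [f'']. No higher power occurs, because
    [HolD] for [f'] asks only for the continuity of [f'']. *)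
Definition cauchy_int1 p := CInt (fun x => g x * / (eit x - p))%C.
Definition cauchy_int2 p := CInt (fun x => g x * (/ (eit x - p) * / (eit x - p)))%C.
Definition cauchy_int3 p := CInt (fun x => g x * (/ (eit x - p) * (/ (eit x - p) * / (eit x - p))))%C.

Lemma cauchy_int1_deriv p : Cmod p < 1 -> isC cauchy_int1 p (cauchy_int2 p).
Proof.
  intros Hp. destruct (ccont_bounded g Hg) as [B [B0 HB]].
  set (d := (1 - Cmod p) / 2).
  assert (d0 : 0 < d) by (unfold d; lra).

  apply (isC_quadratic _ _ _ (4 * PI * (B * (/ d * / d * / d))) d d0).
  intros q Hq. destruct (kernel_bound p q 0 Hp Hq) as [Hq1 _].
  pose proof (ccont_kernel p Hp) as Kp. pose proof (ccont_kernel q Hq1) as Kq.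
  (* Finite geometric expansion of the kernel in powers of [q - p], with its exact remainder. *)
  assert (E : (cauchy_int1 q - cauchy_int1 p - (q - p) * cauchy_int2 p)%C = ((q - p) * (q - p) *
    CInt (fun x => g x * (/ (eit x - p) * / (eit x - p) * / (eit x - q))))%C).
  { unfold cauchy_int1, cauchy_int2.
    rewrite (CInt_ext (fun x => g x * / (eit x - q))%C (fun x =>
      g x * / (eit x - p) + ((q - p) * (g x * (/ (eit x - p) * / (eit x - p)))
       + (q - p) * (q - p) * (g x * (/ (eit x - p) * / (eit x - p) * / (eit x - q)))))%C).
    - assert (A1 : ccont (fun x => g x * / (eit x - p))%C) by ccont_tac.
      assert (A2 : ccont (fun x => g x * (/ (eit x - p) * / (eit x - p)))%C)
        by (ccont_tac).
      assert (A3 : ccont (fun x => g x * (/ (eit x - p) * / (eit x - p) * / (eit x - q)))%C)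
        by (ccont_tac).
      rewrite !CInt_plus; auto.
      + rewrite !CInt_scal; auto. ring.
      + ccont_tac.
      + ccont_tac.
      + ccont_tac.
    - intros t. field. split; apply eit_minus_neq; auto. }
  rewrite E, !Cmod_mult. rewrite (Rmult_comm (4 * PI * _)).
  apply Rmult_le_compat_l; [apply Rmult_le_pos; apply Cmod_ge_0 |].
  apply CInt_bound; [ccont_tac |].
  intros t Ht. rewrite !Cmod_mult.
  assert (Hpp : Cmod (p - p) < (1 - Cmod p) / 2).
  { replace (p - p)%C with (0 : C) by ring. rewrite Cmod_0. lra. }
  pose proof (proj2 (kernel_bound p p t Hp Hpp)). pose proof (proj2 (kernel_bound p q t Hp Hq)).
  prod_le_tac.
Qed.

Lemma cauchy_int2_deriv p : Cmod p < 1 -> isC cauchy_int2 p (2 * cauchy_int3 p)%C.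
Proof.
  intros Hp. destruct (ccont_bounded g Hg) as [B [B0 HB]].
  set (d := (1 - Cmod p) / 2).
  assert (d0 : 0 < d) by (unfold d; lra).

  apply (isC_quadratic _ _ _ (4 * PI * (B * (/ d * / d * / d * (/ d + 2 * / d)))) d d0).
  intros q Hq. destruct (kernel_bound p q 0 Hp Hq) as [Hq1 _].
  pose proof (ccont_kernel p Hp) as Kp. pose proof (ccont_kernel q Hq1) as Kq.

  assert (E : (cauchy_int2 q - cauchy_int2 p - (q - p) * (2 * cauchy_int3 p))%C = ((q - p) * (q - p) *
    CInt (fun x => g x * (/ (eit x - p) * / (eit x - p) * / (eit x - q) *
       (/ (eit x - q) + 2 * / (eit x - p)))))%C).
  { unfold cauchy_int2, cauchy_int3.
    rewrite (CInt_ext (fun x => g x * (/ (eit x - q) * / (eit x - q)))%C (fun x =>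
      g x * (/ (eit x - p) * / (eit x - p)) +
       ((q - p) * 2 * (g x * (/ (eit x - p) * (/ (eit x - p) * / (eit x - p))))
       + (q - p) * (q - p) * (g x * (/ (eit x - p) * / (eit x - p) * / (eit x - q) *
       (/ (eit x - q) + 2 * / (eit x - p))))))%C).
    - assert (A1 : ccont (fun x => g x * (/ (eit x - p) * / (eit x - p)))%C) by (ccont_tac).
      assert (A2 : ccont (fun x => g x * (/ (eit x - p) * (/ (eit x - p) * / (eit x - p))))%C)
        by (ccont_tac).
      assert (A3 : ccont (fun x => g x * (/ (eit x - p) * / (eit x - p) * / (eit x - q) *
         (/ (eit x - q) + 2 * / (eit x - p))))%C)
        by (ccont_tac).
      rewrite !CInt_plus; auto.
      + rewrite !CInt_scal; auto. ring.
      + ccont_tac.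
      + ccont_tac.
      + ccont_tac.
    - intros t. field. split; apply eit_minus_neq; auto. }
  rewrite E, !Cmod_mult. rewrite (Rmult_comm (4 * PI * _)).
  apply Rmult_le_compat_l; [apply Rmult_le_pos; apply Cmod_ge_0 |].
  apply CInt_bound; [ccont_tac |].
  intros t Ht. rewrite !Cmod_mult.
  assert (Hpp : Cmod (p - p) < (1 - Cmod p) / 2).
  { replace (p - p)%C with (0 : C) by ring. rewrite Cmod_0. lra. }
  pose proof (proj2 (kernel_bound p p t Hp Hpp)). pose proof (proj2 (kernel_bound p q t Hp Hq)).
  assert (Cmod (/ (eit t - q) + 2 * / (eit t - p)) <= / d + 2 * / d).
  { eapply Rle_trans; [apply Cmod_triangle |]. rewrite Cmod_mult, Cmod_R, Rabs_right by lra.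
    apply Rplus_le_compat; auto. apply Rmult_le_compat_l; [lra | auto]. }
  prod_le_tac.
Qed.

Lemma cauchy_int3_cont p : Cmod p < 1 -> contC cauchy_int3 p.
Proof.
  intros Hp. destruct (ccont_bounded g Hg) as [B [B0 HB]].
  set (d := (1 - Cmod p) / 2).
  assert (d0 : 0 < d) by (unfold d; lra).
  assert (b0 : 0 < / d) by (apply Rinv_0_lt_compat; auto).
  set (b := / d). set (K := 4 * PI * (B * (b * b * (b * b + b * b + b * b)))).
  assert (K0 : 0 <= K).
  { unfold K. pose proof PI_RGT_0. assert (0 < b) by exact b0. assert (0 < b * b) by nra.
    apply Rmult_le_pos; [lra |]. apply Rmult_le_pos; [lra |]. apply Rmult_le_pos; lra. }
  apply contC_eps. intros eps He.
  exists (Rmin d (eps / (K + 1))). split.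
  { apply Rmin_pos; auto. apply Rdiv_lt_0_compat; lra. }
  intros q Hq0.
  assert (Hq : Cmod (q - p) < d) by (eapply Rlt_le_trans; [exact Hq0 | apply Rmin_l]).
  assert (Hq2 : Cmod (q - p) < eps / (K + 1)) by (eapply Rlt_le_trans; [exact Hq0 | apply Rmin_r]).
  destruct (kernel_bound p q 0 Hp Hq) as [Hq1 _].
  pose proof (ccont_kernel p Hp) as Kp. pose proof (ccont_kernel q Hq1) as Kq.
  set (u := fun x => (/ (eit x - p))%C). set (v := fun x => (/ (eit x - q))%C).
  fold u in Kp. fold v in Kq.

  assert (A3 : ccont (fun x => g x * (u x * v x * (v x * v x + u x * v x + u x * u x)))%C)
    by (ccont_tac).
  assert (E : (cauchy_int3 q - cauchy_int3 p)%C = ((q - p) *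
    CInt (fun x => g x * (u x * v x * (v x * v x + u x * v x + u x * u x))))%C).
  { unfold cauchy_int3.
    rewrite (CInt_ext (fun x => g x * (/ (eit x - q) * (/ (eit x - q) * / (eit x - q))))%C (fun x =>
      g x * (u x * (u x * u x)) +
       (q - p) * (g x * (u x * v x * (v x * v x + u x * v x + u x * u x))))%C).
    - assert (A1 : ccont (fun x => g x * (u x * (u x * u x)))%C) by (ccont_tac).
      rewrite !CInt_plus; auto.
      + rewrite !CInt_scal; auto. unfold u; ring.
      + ccont_tac.
    - intros t. unfold u, v. field. split; apply eit_minus_neq; auto. }
  rewrite E, Cmod_mult.
  assert (HK : Cmod (CInt (fun x => g x * (u x * v x * (v x * v x + u x * v x + u x * u x))))%C <= K).
  { apply CInt_bound; auto.
    intros t Ht. rewrite !Cmod_mult.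
    assert (Hpp : Cmod (p - p) < (1 - Cmod p) / 2).
    { replace (p - p)%C with (0 : C) by ring. rewrite Cmod_0. lra. }
    assert (Hu : Cmod (u t) <= b) by exact (proj2 (kernel_bound p p t Hp Hpp)).
    assert (Hv : Cmod (v t) <= b) by exact (proj2 (kernel_bound p q t Hp Hq)).
    pose proof (Cmod_ge_0 (u t)). pose proof (Cmod_ge_0 (v t)).
    assert (Cmod (v t * v t + u t * v t + u t * u t) <= b * b + b * b + b * b).
    { eapply Rle_trans; [apply Cmod_triangle |].
      apply Rplus_le_compat; [eapply Rle_trans; [apply Cmod_triangle |]; apply Rplus_le_compat |];
        rewrite Cmod_mult; apply Rmult_le_compat; auto. }
    prod_le_tac. }
  pose proof (Cmod_ge_0 (q - p)).
  apply Rle_lt_trans with (Cmod (q - p) * (K + 1)).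
  { apply Rmult_le_compat_l; auto. lra. }
  apply Rlt_le_trans with (eps / (K + 1) * (K + 1)); [| right; field; lra].
  apply Rmult_lt_compat_r; lra.
Qed.
End Transform.

Lemma RtoC_neq (x : R) : x <> 0 -> RtoC x <> 0%C.
Proof. intros H E. apply RtoC_inj in E. auto. Qed.

Lemma HolD_eit_cont rho f f' : 1 < rho -> HolD (disk rho) f f' -> ccont (fun x => f (eit x)).
Proof.
  intros Hr Hf x. apply (continuous_comp eit f); [apply eit_cont |].
  eapply isC_cont. apply Hf. unfold disk. rewrite eit_mod. exact Hr.
Qed.

(** The formula for [f'] follows from that for [f] by differentiating the Cauchy integral and
    comparing derivatives. *)
Lemma unit_repr rho f f' : 1 < rho -> HolD (disk rho) f f' ->
  ccont (fun x => f (eit x) * eit x)%C /\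
  (forall p, Cmod p < 1 -> f p = (/ RtoC (2 * PI) * cauchy_int1 (fun x => f (eit x) * eit x)%C p)%C) /\
  (forall p, Cmod p < 1 -> f' p = (/ RtoC (2 * PI) * cauchy_int2 (fun x => f (eit x) * eit x)%C p)%C).
Proof.
  intros Hr Hf.
  assert (Hg : ccont (fun x => f (eit x) * eit x)%C).
  { apply ccont_mult; [eapply HolD_eit_cont; eauto | apply eit_cont]. }
  split; auto.
  assert (H1 : forall p, Cmod p < 1 -> f p = (/ RtoC (2 * PI) * cauchy_int1 (fun x => f (eit x) * eit x)%C p)%C).
  { intros p Hp. unfold cauchy_int1.
    rewrite (CInt_ext _ (fun x => f (eit x) * (eit x / (eit x - p)))%C)
      by (intros; unfold Cdiv; ring).
    rewrite (cauchy_unit rho f f' p); auto. field. apply RtoC_2PI_neq. }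
  split; auto.
  intros p Hp. apply (isC_unique f p).
  - apply Hf. unfold disk. lra.
  - apply (isC_ext_loc (fun q => / RtoC (2 * PI) * cauchy_int1 (fun x => f (eit x) * eit x) q)%C).
    + exists (1 - Cmod p). split; [lra |]. intros q Hq. symmetry. apply H1.
      replace q with (p + (q - p))%C by ring. eapply Rle_lt_trans; [apply Cmod_triangle |]. lra.
    + eapply isC_eq; [apply isC_mult; [apply isC_const | apply cauchy_int1_deriv; auto] |]. simpl. ring.
Qed.

Lemma HolD_affine (c : C) (R0 r : R) f f' : 0 < R0 -> HolD (cball c r) f f' ->
  HolD (disk (r / R0)) (fun z => f (c + RtoC R0 * z)%C) (fun z => RtoC R0 * f' (c + RtoC R0 * z))%C.
Proof.
  intros HR Hf p Hp.
  assert (Hc : cball c r (c + RtoC R0 * p)%C).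
  { unfold cball. replace (c + RtoC R0 * p - c)%C with (RtoC R0 * p)%C by ring.
    rewrite Cmod_mult, Cmod_R, Rabs_right by lra. unfold disk in Hp.
    replace r with (R0 * (r / R0)) by (field; lra). apply Rmult_lt_compat_l; auto. }
  assert (Ha : isC (fun z => c + RtoC R0 * z)%C p (RtoC R0)).
  { eapply isC_eq; [apply isC_plus; [apply isC_const | apply isC_mult; [apply isC_const | apply isC_id]] |].
    simpl. ring. }
  split.
  - apply (isC_comp f (fun z => c + RtoC R0 * z)%C); auto. apply Hf; auto.
  - apply cont_Cmult; [apply cont_Cconst |].
    apply (contC_comp f' (fun z => c + RtoC R0 * z)%C).
    + apply Hf; auto.
    + eapply isC_cont; eauto.
Qed.

(** * Cauchy estimates on arbitrary disks *)

Lemma cauchy_ball c r R0 f f' p : 0 < R0 < r -> HolD (cball c r) f f' -> Cmod (p - c) < R0 ->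
  CInt (fun x => f (c + RtoC R0 * eit x) * (eit x / (eit x - (p - c) / RtoC R0)))%C
  = (RtoC (2 * PI) * f p)%C.
Proof.
  intros HR Hf Hp. assert (HR0 : RtoC R0 <> 0%C) by (apply RtoC_neq; lra).
  rewrite (cauchy_unit (r / R0) (fun z => f (c + RtoC R0 * z)%C) (fun z => RtoC R0 * f' (c + RtoC R0 * z))%C).
  - f_equal. f_equal. field. exact HR0.
  - apply Rmult_lt_reg_r with R0; [lra |]. unfold Rdiv. rewrite Rmult_assoc, Rinv_l; lra.
  - apply HolD_affine; auto. lra.
  - rewrite Cmod_div, Cmod_R, Rabs_right by (auto; lra).
    apply Rmult_lt_reg_r with R0; [lra |]. unfold Rdiv. rewrite Rmult_assoc, Rinv_l; lra.
Qed.

Lemma ball_eit_cont c r R0 f f' : 0 < R0 < r -> HolD (cball c r) f f' ->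
  ccont (fun x => f (c + RtoC R0 * eit x)%C).
Proof.
  intros HR Hf. apply (HolD_eit_cont (r / R0) (fun z => f (c + RtoC R0 * z)%C) (fun z => RtoC R0 * f' (c + RtoC R0 * z))%C).
  - apply Rmult_lt_reg_r with R0; [lra |]. unfold Rdiv. rewrite Rmult_assoc, Rinv_l; lra.
  - apply HolD_affine; auto. lra.
Qed.

Lemma cauchy_ball_bound c r R0 f f' p M : 0 < R0 < r -> HolD (cball c r) f f' -> Cmod (p - c) < R0 ->
  (forall x, 0 <= x <= 2 * PI -> Cmod (f (c + RtoC R0 * eit x)%C) <= M) ->
  Cmod (f p) <= 2 * M * R0 / (R0 - Cmod (p - c)).
Proof.
  intros HR Hf Hp HM. pose proof (cauchy_ball c r R0 f f' p HR Hf Hp) as HC.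
  pose proof PI_RGT_0 as HPI. assert (HR0 : RtoC R0 <> 0%C) by (apply RtoC_neq; lra).

  assert (Hp1 : Cmod ((p - c) / RtoC R0) < 1).
  { rewrite Cmod_div, Cmod_R, Rabs_right by (auto; lra).
    apply Rmult_lt_reg_r with R0; [lra |]. unfold Rdiv. rewrite Rmult_assoc, Rinv_l; lra. }
  assert (HB : Cmod (RtoC (2 * PI) * f p) <= 4 * PI * (M * (R0 / (R0 - Cmod (p - c))))).
  { rewrite <- HC. apply CInt_bound.
    - apply ccont_mult; [eapply ball_eit_cont; eauto |].
      apply ccont_mult; [apply eit_cont | apply ccont_kernel; auto].
    - intros t Ht. rewrite Cmod_mult.
      apply Rmult_le_compat; try apply Cmod_ge_0; auto.
      rewrite Cmod_div, eit_mod by (apply eit_minus_neq; auto).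
      unfold Rdiv at 1. rewrite Rmult_1_l.
      replace (R0 / (R0 - Cmod (p - c))) with (/ (1 - Cmod ((p - c) / RtoC R0))).
      + apply Rinv_le_contravar; [lra |]. apply eit_minus_ge.
      + rewrite Cmod_div, Cmod_R, Rabs_right by (auto; lra). field. lra. }
  rewrite Cmod_mult, Cmod_R, Rabs_right in HB by lra.
  apply Rmult_le_reg_l with (2 * PI); [lra |].
  eapply Rle_trans; [exact HB |]. right. field. lra.
Qed.

Lemma cauchy_deriv_bound c r R0 f f' M : 0 < R0 < r -> HolD (cball c r) f f' ->
  (forall x, 0 <= x <= 2 * PI -> Cmod (f (c + RtoC R0 * eit x)%C) <= M) ->
  Cmod (f' c) <= 2 * M / R0.
Proof.
  intros HR Hf HM. pose proof PI_RGT_0 as HPI.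

  assert (Hrr : 1 < r / R0).
  { apply Rmult_lt_reg_r with R0; [lra |]. unfold Rdiv. rewrite Rmult_assoc, Rinv_l; lra. }
  destruct (unit_repr (r / R0) _ _ Hrr (HolD_affine c R0 r f f' (proj1 HR) Hf)) as [Hg [_ H2]].
  assert (H01 : Cmod 0 < 1) by (rewrite Cmod_0; lra).
  specialize (H2 0%C H01).
  assert (HB : Cmod (cauchy_int2 (fun x => f (c + RtoC R0 * eit x) * eit x)%C 0) <= 4 * PI * M).
  { pose proof (ccont_kernel 0 H01) as Hk. apply CInt_bound; [ccont_tac |].
    intros t Ht. rewrite !Cmod_mult, Cmod_inv by (apply eit_minus_neq; auto).
    replace (eit t - 0)%C with (eit t) by ring. rewrite eit_mod.
    replace (Cmod (f (c + RtoC R0 * eit t)%C) * 1 * (/ 1 * / 1))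
      with (Cmod (f (c + RtoC R0 * eit t)%C)) by field. auto. }
  replace (c + RtoC R0 * 0)%C with c in H2 by ring.
  assert (E : Cmod (RtoC R0 * f' c) <= / (2 * PI) * (4 * PI * M)).
  { rewrite H2, Cmod_mult, Cmod_inv, Cmod_R, Rabs_right by (try apply RtoC_2PI_neq; lra).
    apply Rmult_le_compat_l; auto. left; apply Rinv_0_lt_compat; lra. }
  rewrite Cmod_mult, Cmod_R, Rabs_right in E by lra.
  apply Rmult_le_reg_l with R0; [lra |]. eapply Rle_trans; [exact E |]. right. field. lra.
Qed.

(** Near each point a Cauchy integral over a larger circle provides a second derivative. The total
    function [C_derive f'] agrees with all these local candidates by uniqueness, so nothing has to
    be chosen. *)
Lemma HolD_deriv c r f f' : HolD (cball c r) f f' -> exists f'', HolD (cball c r) f' f''.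
Proof.
  intros Hf.
  assert (HL : forall p, cball c r p -> exists (d : R) (f2 : C -> C), 0 < d /\ HolD (cball p d) f' f2).
  { intros p Hp. unfold cball in Hp. pose proof (Cmod_ge_0 (p - c)) as Hp0.
    set (R0 := (Cmod (p - c) + r) / 2).
    assert (HR : 0 < R0 < r) by (unfold R0; lra).
    assert (HR0 : RtoC R0 <> 0%C) by (apply RtoC_neq; lra).
    assert (Hrr : 1 < r / R0).
    { apply Rmult_lt_reg_r with R0; [lra |]. unfold Rdiv. rewrite Rmult_assoc, Rinv_l; lra. }
    destruct (unit_repr (r / R0) _ _ Hrr (HolD_affine c R0 r f f' (proj1 HR) Hf)) as [Hg [_ H2]].
    set (g := (fun x : R => (f (c + RtoC R0 * eit x) * eit x)%C)) in *.
    exists (R0 - Cmod (p - c)).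
    exists (fun q => / RtoC R0 * (/ RtoC (2 * PI) * (/ RtoC R0 * (2 * cauchy_int3 g (/ RtoC R0 * (q - c))))))%C.
    split; [unfold R0; lra |].
    assert (Hin : forall q, cball p (R0 - Cmod (p - c)) q -> Cmod (/ RtoC R0 * (q - c)) < 1).
    { intros q Hq. unfold cball in Hq. rewrite Cmod_mult, Cmod_inv, Cmod_R, Rabs_right by (auto; lra).
      apply Rmult_lt_reg_l with R0; [lra |]. rewrite <- Rmult_assoc, Rinv_r, Rmult_1_l by lra.
      replace (q - c)%C with ((q - p) + (p - c))%C by ring.
      eapply Rle_lt_trans; [apply Cmod_triangle |]. lra. }
    assert (Ha : forall q, isC (fun z => / RtoC R0 * (z - c))%C q (/ RtoC R0)%C).
    { intros q. eapply isC_eq.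
      - apply isC_mult; [apply isC_const |]. apply isC_minus; [apply isC_id | apply isC_const].
      - simpl. ring. }
    assert (HE : forall q, cball p (R0 - Cmod (p - c)) q ->
       f' q = (/ RtoC R0 * (/ RtoC (2 * PI) * cauchy_int2 g (/ RtoC R0 * (q - c))))%C).
    { intros q Hq. specialize (H2 _ (Hin q Hq)).
      replace (c + RtoC R0 * (/ RtoC R0 * (q - c)))%C with q in H2 by (field; auto).
      rewrite <- H2. field. auto. }
    intros q Hq. split.
    - apply (isC_ext_loc (fun q => / RtoC R0 * (/ RtoC (2 * PI) * cauchy_int2 g (/ RtoC R0 * (q - c))))%C).
      + exists (R0 - Cmod (p - c) - Cmod (q - p)). split; [unfold cball in Hq; lra |].
        intros z Hz. symmetry. apply HE. unfold cball in *.
        replace (z - p)%C with ((z - q) + (q - p))%C by ring.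
        eapply Rle_lt_trans; [apply Cmod_triangle |]. lra.
      + eapply isC_eq.
        * apply isC_mult; [apply isC_const |]. apply isC_mult; [apply isC_const |].
          apply (isC_comp (cauchy_int2 g) (fun q => / RtoC R0 * (q - c))%C); [apply cauchy_int2_deriv; auto | apply Ha].
        * simpl. ring.
    - apply cont_Cmult; [apply cont_Cconst |].
      apply cont_Cmult; [apply cont_Cconst |].
      apply cont_Cmult; [apply cont_Cconst |].
      apply cont_Cmult; [apply cont_Cconst |].
      apply (contC_comp (cauchy_int3 g) (fun q => / RtoC R0 * (q - c))%C); [apply cauchy_int3_cont; auto |].
      eapply isC_cont. apply Ha. }
  exists (C_derive f'). intros p Hp.
  destruct (HL p Hp) as [d [f2 [d0 H2]]].
  assert (Hpp : cball p d p).
  { unfold cball. replace (p - p)%C with (0 : C) by ring. rewrite Cmod_0. auto. }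
  assert (HE : forall q, cball p d q -> C_derive f' q = f2 q).
  { intros q Hq. apply is_C_derive_unique. apply H2. auto. }
  split.
  - rewrite HE by auto. apply H2. auto.
  - apply (continuous_ext_loc _ f2); [| apply H2; auto].
    apply locally_Cmod. exists d. split; auto. intros q Hq. symmetry. apply HE. exact Hq.
Qed.

(** * Removable singularities and factorisation at the origin *)

Lemma cball_center c r : 0 < r -> cball c r c.
Proof. intros H. unfold cball. replace (c - c)%C with (0 : C) by ring. rewrite Cmod_0. auto. Qed.

Lemma cball_sub c r p q : cball c r p -> Cmod (q - p) < r - Cmod (p - c) -> cball c r q.
Proof.
  unfold cball. intros Hp Hq. replace (q - c)%C with ((q - p) + (p - c))%C by ring.
  eapply Rle_lt_trans; [apply Cmod_triangle |]. lra.
Qed.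

Lemma HolD_sub (U V : C -> Prop) f f' : (forall p, V p -> U p) -> HolD U f f' -> HolD V f f'.
Proof. intros H Hf p Hp. apply Hf. auto. Qed.

Lemma HolD_ext (U : C -> Prop) f g f' :
  (forall p, U p -> exists d, 0 < d /\ forall q, cball p d q -> f q = g q) ->
  HolD U f f' -> HolD U g f'.
Proof.
  intros H Hf p Hp. split; [| apply Hf; auto].
  apply (isC_ext_loc f); [apply (H p Hp) | apply Hf; auto].
Qed.

Lemma HolD_glue (U : C -> Prop) f :
  (forall p, U p -> exists d f1 f1', 0 < d /\ HolD (cball p d) f1 f1' /\
     forall q, cball p d q -> f q = f1 q) ->
  HolD U f (C_derive f).
Proof.
  intros H p Hp. destruct (H p Hp) as [d [f1 [f1' [d0 [H1 HE]]]]].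
  assert (HD : forall q, cball p d q -> isC f q (f1' q)).
  { intros q Hq. apply (isC_ext_loc f1); [| apply H1; auto].
    exists (d - Cmod (q - p)). split; [unfold cball in Hq; lra |].
    intros z Hz. symmetry. apply HE. eapply cball_sub; eauto. }
  assert (HC : forall q, cball p d q -> C_derive f q = f1' q).
  { intros q Hq. apply is_C_derive_unique. apply HD; auto. }
  pose proof (cball_center p d d0) as Hpp.
  split.
  - rewrite HC by auto. apply HD; auto.
  - apply (continuous_ext_loc _ f1'); [| apply H1; auto].
    apply locally_Cmod. exists d. split; auto. intros q Hq. symmetry. apply HC. exact Hq.
Qed.

Lemma pdisk_ball r p q : pdisk r p -> Cmod (q - p) < Rmin (r - Cmod p) (Cmod p) -> pdisk r q.
Proof.
  intros [Hp Hp0] Hq. split.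
  - replace q with ((q - p) + p)%C by ring. eapply Rle_lt_trans; [apply Cmod_triangle |].
    assert (Cmod (q - p) < r - Cmod p) by (eapply Rlt_le_trans; [exact Hq | apply Rmin_l]). lra.
  - intros E. subst q.
    assert (H : Cmod (0 - p) < Cmod p) by (eapply Rlt_le_trans; [exact Hq | apply Rmin_r]).
    replace (0 - p)%C with (- p)%C in H by ring. rewrite Cmod_opp in H. lra.
Qed.

Lemma pdisk_open r p : pdisk r p -> exists d, 0 < d /\ forall q, cball p d q -> pdisk r q.
Proof.
  intros Hp. exists (Rmin (r - Cmod p) (Cmod p)). split.
  - destruct Hp as [H1 H2]. apply Rmin_pos; [lra |]. exact (proj1 (Cmod_gt_0 p) H2).
  - intros q Hq. apply (pdisk_ball r p); auto.
Qed.

Lemma pdisk_disk r p : pdisk r p -> disk r p.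
Proof. intros [H _]; exact H. Qed.

Lemma HolD_mult (U : C -> Prop) f f' g g' : HolD U f f' -> HolD U g g' ->
  HolD U (fun z => f z * g z)%C (fun z => f' z * g z + f z * g' z)%C.
Proof.
  intros Hf Hg p Hp. destruct (Hf p Hp) as [F1 F2]. destruct (Hg p Hp) as [G1 G2].
  split; [apply isC_mult; auto |].
  apply cont_Cplus; apply cont_Cmult; auto; eapply isC_cont; eauto.
Qed.

Lemma HolD_plus (U : C -> Prop) f f' g g' : HolD U f f' -> HolD U g g' ->
  HolD U (fun z => f z + g z)%C (fun z => f' z + g' z)%C.
Proof.
  intros Hf Hg p Hp. destruct (Hf p Hp) as [F1 F2]. destruct (Hg p Hp) as [G1 G2].
  split; [apply isC_plus; auto |]. apply cont_Cplus; auto.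
Qed.

Lemma HolD_const (U : C -> Prop) c : HolD U (fun _ => c) (fun _ => 0%C).
Proof. intros p Hp. split; [apply isC_const | apply cont_Cconst]. Qed.

Lemma HolD_id (U : C -> Prop) : HolD U (fun z => z) (fun _ => 1%C).
Proof. intros p Hp. split; [apply isC_id | apply cont_Cconst]. Qed.

Lemma HolD_inv (U : C -> Prop) f f' : HolD U f f' -> (forall p, U p -> f p <> 0%C) ->
  HolD U (fun z => / f z)%C (fun z => - f' z / (f z * f z))%C.
Proof.
  intros Hf H0 p Hp. destruct (Hf p Hp) as [F1 F2].
  split; [apply isC_inv; auto |].
  apply cont_Cmult; [apply cont_Copp; auto |].
  apply (cont_Cinv (fun z => f z * f z)%C).
  - apply cont_Cmult; eapply isC_cont; eauto.
  - apply Cmult_neq_0; auto.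
Qed.

(** The square is what makes the product differentiable at the origin with continuous derivative:
    there [z^2 f] is [O(z^2)], and the Cauchy estimate on the disk of radius [|q| / 2] gives
    [|f' q| <= 4 M / |q|], so [2 q f + q^2 f'] tends to [0]. The arbitrary value [f 0] is multiplied
    by zero. *)
Lemma removable_sq r r0 M f f' : 0 < r0 <= r -> 0 <= M -> HolD (pdisk r) f f' ->
  (forall p, pdisk r0 p -> Cmod (f p) <= M) ->
  HolD (disk r) (fun z => z * z * f z)%C (fun z => (1 * z + z * 1) * f z + z * z * f' z)%C.
Proof.
  intros Hr HM0 Hf HM p Hp. destruct (Ceq_dec p 0%C) as [E | E].
  2:{ assert (Hpp : pdisk r p) by (split; auto).
      destruct (HolD_mult (pdisk r) _ _ _ _ (HolD_mult (pdisk r) _ _ _ _ (HolD_id _) (HolD_id _)) Hf p Hpp).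
      split; auto. }
  subst p. split.
  - apply (isC_eq _ _ 0%C); [| ring].
    apply (isC_quadratic _ _ _ M r0); [lra |].
    intros q Hq. replace (q * q * f q - 0 * 0 * f 0 - (q - 0) * 0)%C with (q * q * f q)%C by ring.
    replace (q - 0)%C with q in * by ring.
    rewrite !Cmod_mult. destruct (Ceq_dec q 0%C) as [Eq | Eq].
    + subst q. rewrite Cmod_0. lra.
    + rewrite Rmult_comm. apply Rmult_le_compat_r; [apply Rmult_le_pos; apply Cmod_ge_0 |].
      apply HM. split; auto.
  - apply contC_eps. intros eps He.
    exists (Rmin (r0 / 2) (eps / (6 * M + 1))). split.
    { apply Rmin_pos; [lra |]. apply Rdiv_lt_0_compat; lra. }
    intros q Hq.
    replace ((1 * q + q * 1) * f q + q * q * f' q - ((1 * 0 + 0 * 1) * f 0 + 0 * 0 * f' 0))%C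
      with (2 * q * f q + q * q * f' q)%C by ring.
    replace (q - 0)%C with q in Hq by ring.
    destruct (Ceq_dec q 0%C) as [Eq | Eq].
    { subst q. replace (2 * 0 * f 0 + 0 * 0 * f' 0)%C with (0 : C) by ring. rewrite Cmod_0. lra. }
    assert (Hq1 : Cmod q < r0 / 2) by (eapply Rlt_le_trans; [exact Hq | apply Rmin_l]).
    assert (Hq2 : Cmod q < eps / (6 * M + 1)) by (eapply Rlt_le_trans; [exact Hq | apply Rmin_r]).
    assert (Hq0 : 0 < Cmod q) by exact (proj1 (Cmod_gt_0 q) Eq).
    assert (Hb : forall z, cball q (Cmod q) z -> pdisk r0 z).
    { intros z Hz. apply (pdisk_ball r0 q); [split; auto; lra |].
      unfold cball in Hz. rewrite Rmin_right; [exact Hz | lra]. }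
    assert (Hd : Cmod (f' q) <= 2 * M / (Cmod q / 2)).
    { apply (cauchy_deriv_bound q (Cmod q) (Cmod q / 2) f f' M); [lra | |].
      - apply (HolD_sub (pdisk r)); auto. intros z Hz. destruct (Hb z Hz). split; auto. lra.
      - intros x _. apply HM. apply Hb. unfold cball.
        replace (q + RtoC (Cmod q / 2) * eit x - q)%C with (RtoC (Cmod q / 2) * eit x)%C by ring.
        rewrite Cmod_mult, eit_mod, Cmod_R, Rabs_right; lra. }
    assert (Hf0 : Cmod (f q) <= M) by (apply HM; split; auto; lra).
    eapply Rle_lt_trans; [apply Cmod_triangle |].
    rewrite !Cmod_mult, Cmod_R, Rabs_right by lra.
    apply Rle_lt_trans with (Cmod q * (6 * M + 1)).
    + apply Rle_trans with (2 * Cmod q * M + Cmod q * Cmod q * (2 * M / (Cmod q / 2))).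
      * apply Rplus_le_compat; apply Rmult_le_compat_l; auto; nra.
      * replace (2 * Cmod q * M + Cmod q * Cmod q * (2 * M / (Cmod q / 2)))
          with (6 * Cmod q * M) by (field; lra). nra.
    + apply Rlt_le_trans with (eps / (6 * M + 1) * (6 * M + 1)); [| right; field; lra].
      apply Rmult_lt_compat_r; lra.
Qed.

(** Cauchy's formula for [z^2 f], divided by [R0^2], reads [2 PI s^2 f (R0 s) = A0 + s A1 + s^2 T s]
    with a Cauchy integral [T]. Evaluation at [s = 0] gives [A0 = 0], boundedness of [f] gives
    [A1 = 0], and then [T / (2 PI)] is the extension. *)
Lemma removable r r0 M f f' : 0 < r0 <= r -> HolD (pdisk r) f f' ->
  (forall p, pdisk r0 p -> Cmod (f p) <= M) ->
  exists fe fe', HolD (disk r) fe fe' /\ forall p, pdisk r p -> fe p = f p.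
Proof.
  intros Hr Hf HM.
  assert (HM0 : 0 <= M).
  { assert (H : pdisk r0 (RtoC (r0 / 2))).
    { split; [rewrite Cmod_R, Rabs_right; lra | apply RtoC_neq; lra]. }
    eapply Rle_trans; [apply Cmod_ge_0 | apply (HM _ H)]. }
  pose proof (removable_sq r r0 M f f' Hr HM0 Hf HM) as Hh.
  set (R0 := r / 2). assert (HR : 0 < R0 < r) by (unfold R0; lra).
  assert (HR0 : RtoC R0 <> 0%C) by (apply RtoC_neq; lra).
  assert (Hhc : HolD (cball 0 r) (fun z => z * z * f z)%C (fun z => (1 * z + z * 1) * f z + z * z * f' z)%C).
  { apply (HolD_sub (disk r)); auto. intros p. apply disk_cball. }
  set (phi := fun x => f (RtoC R0 * eit x)%C).
  assert (Hphi : ccont phi).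
  { intros x. apply (continuous_comp (fun x => RtoC R0 * eit x)%C f).
    - apply cont_Cmult; [apply cont_Cconst | apply eit_cont].
    - eapply isC_cont. apply Hf. split.
      + rewrite Cmod_mult, eit_mod, Cmod_R, Rabs_right; lra.
      + apply Cmult_neq_0; auto. apply eit_neq_0. }
  set (g := fun x => (phi x * eit x)%C).
  assert (Hg : ccont g) by (unfold g; ccont_tac).
  set (A0 := CInt (fun x => phi x * (eit x * eit x))%C). set (A1 := CInt g).
  assert (HI : forall s, Cmod s < 1 ->
    (RtoC (2 * PI) * (s * s * f (RtoC R0 * s)) = A0 + s * A1 + s * s * cauchy_int1 g s)%C).
  { intros s Hs.
    pose proof (cauchy_ball 0 r R0 _ _ (RtoC R0 * s)%C HR Hhc) as HC.
    assert (Hs' : Cmod (RtoC R0 * s - 0) < R0).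
    { replace (RtoC R0 * s - 0)%C with (RtoC R0 * s)%C by ring.
      rewrite Cmod_mult, Cmod_R, Rabs_right by lra. nra. }
    specialize (HC Hs'). simpl in HC.

    pose proof (ccont_kernel s Hs) as Hk.
    replace (RtoC (2 * PI) * (s * s * f (RtoC R0 * s)))%C with
      (/ (RtoC R0 * RtoC R0) * (RtoC (2 * PI) * (RtoC R0 * s * (RtoC R0 * s) * f (RtoC R0 * s))))%C
      by (field; auto).
    rewrite <- HC.
    rewrite (CInt_ext _ (fun x => RtoC R0 * RtoC R0 * (phi x * (eit x * eit x)
       + (s * g x + s * s * (g x * / (eit x - s)))))%C).
    - rewrite CInt_scal by ccont_tac. rewrite !CInt_plus by ccont_tac. rewrite !CInt_scal by ccont_tac.
      unfold A0, A1, cauchy_int1. field. auto.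
    - intros x. unfold g, phi.
      replace (0 + RtoC R0 * eit x)%C with (RtoC R0 * eit x)%C by ring.
      replace ((RtoC R0 * s - 0) / RtoC R0)%C with s by (field; auto).
      field. apply eit_minus_neq; auto. }
  assert (HA0 : A0 = 0%C).
  { assert (H01 : Cmod 0 < 1) by (rewrite Cmod_0; lra).
    specialize (HI 0%C H01).
    replace (A0 + 0 * A1 + 0 * 0 * cauchy_int1 g 0)%C with A0 in HI by ring.
    rewrite <- HI. ring. }
  assert (HI2 : forall s, Cmod s < 1 -> s <> 0%C ->
    (RtoC (2 * PI) * (s * f (RtoC R0 * s)) = A1 + s * cauchy_int1 g s)%C).
  { intros s Hs Hs0. specialize (HI s Hs). rewrite HA0 in HI.
    replace (RtoC (2 * PI) * (s * f (RtoC R0 * s)))%C with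
      (/ s * (RtoC (2 * PI) * (s * s * f (RtoC R0 * s))))%C by (field; auto).
    rewrite HI. field; auto. }
  assert (H01 : Cmod 0 < 1) by (rewrite Cmod_0; lra).
  assert (HA1 : A1 = 0%C).
  { pose proof (isC_cont _ _ _ (cauchy_int1_deriv g Hg 0%C H01)) as HT.
    destruct (proj1 (contC_eps _ _) HT 1 Rlt_0_1) as [d [d0 Hd]].
    destruct (Ceq_dec A1 0%C) as [E | E]; auto. exfalso.
    assert (HA : 0 < Cmod A1) by exact (proj1 (Cmod_gt_0 A1) E).
    set (K := 2 * PI * M + Cmod (cauchy_int1 g 0) + 1).
    pose proof PI_RGT_0. pose proof (Cmod_ge_0 (cauchy_int1 g 0)).
    assert (HK : 0 < K) by (unfold K; nra).
    (* The four bounds on [t] serve, in order, the continuity of the Cauchy integral at [0],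
       membership in the unit disk, the bound [M] at [R0 t], and the contradiction
       [t K <= |A1| / 2]. *)
    set (t := Rmin (Rmin (d / 2) (1 / 2)) (Rmin (r0 / r) (Cmod A1 / (2 * K)))).
    assert (Hr0r : 0 < r0 / r) by (apply Rdiv_lt_0_compat; lra).
    assert (t0 : 0 < t).
    { unfold t. repeat apply Rmin_pos; try lra. apply Rdiv_lt_0_compat; lra. }
    assert (t1 : t <= d / 2) by (unfold t; eapply Rle_trans; [apply Rmin_l | apply Rmin_l]).
    assert (t2 : t <= 1 / 2) by (unfold t; eapply Rle_trans; [apply Rmin_l | apply Rmin_r]).
    assert (t3 : t <= r0 / r) by (unfold t; eapply Rle_trans; [apply Rmin_r | apply Rmin_l]).
    assert (t4 : t <= Cmod A1 / (2 * K)) by (unfold t; eapply Rle_trans; [apply Rmin_r | apply Rmin_r]).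
    assert (Hms : Cmod (RtoC t) = t) by (rewrite Cmod_R, Rabs_right; lra).
    assert (Hts : Cmod (RtoC t) < 1) by lra.
    assert (Htn : RtoC t <> 0%C) by (apply RtoC_neq; lra).
    specialize (HI2 (RtoC t) Hts Htn).
    assert (HT1 : Cmod (cauchy_int1 g (RtoC t)) <= Cmod (cauchy_int1 g 0) + 1).
    { assert (Cmod (cauchy_int1 g (RtoC t) - cauchy_int1 g 0) < 1).
      { apply Hd. replace (RtoC t - 0)%C with (RtoC t) by ring. lra. }
      replace (cauchy_int1 g (RtoC t)) with ((cauchy_int1 g (RtoC t) - cauchy_int1 g 0) + cauchy_int1 g 0)%C by ring.
      eapply Rle_trans; [apply Cmod_triangle |]. lra. }
    assert (Hfb : Cmod (f (RtoC R0 * RtoC t)%C) <= M).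
    { apply HM. split; [| apply Cmult_neq_0; auto].
      rewrite Cmod_mult, Hms, Cmod_R, Rabs_right by lra.
      apply Rle_lt_trans with (R0 * (r0 / r)); [apply Rmult_le_compat_l; lra |].
      unfold R0. replace (r / 2 * (r0 / r)) with (r0 / 2) by (field; lra). lra. }
    assert (HB : Cmod A1 <= t * K).
    { replace A1 with (RtoC t * (RtoC (2 * PI) * f (RtoC R0 * RtoC t)%C + - cauchy_int1 g (RtoC t)))%C.
      - rewrite Cmod_mult, Hms. apply Rmult_le_compat_l; [lra |].
        eapply Rle_trans; [apply Cmod_triangle |]. rewrite Cmod_opp, Cmod_mult, Cmod_R, Rabs_right by lra.
        unfold K. assert (2 * PI * Cmod (f (RtoC R0 * RtoC t)%C) <= 2 * PI * M)
          by (apply Rmult_le_compat_l; lra). lra.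
      - replace A1 with (A1 + RtoC t * cauchy_int1 g (RtoC t) - RtoC t * cauchy_int1 g (RtoC t))%C by ring.
        rewrite <- HI2. ring. }
    assert (t * K <= Cmod A1 / 2); [| lra].
    apply Rle_trans with (Cmod A1 / (2 * K) * K); [apply Rmult_le_compat_r; lra |].
    right. field. lra. }
  set (F := fun z => (/ RtoC (2 * PI) * cauchy_int1 g (/ RtoC R0 * z))%C).
  assert (HF : forall z, disk R0 z -> z <> 0%C -> f z = F z).
  { intros z Hz Hz0. unfold disk in Hz.
    assert (Hs : Cmod (/ RtoC R0 * z) < 1).
    { rewrite Cmod_mult, Cmod_inv, Cmod_R, Rabs_right by (auto; lra).
      apply Rmult_lt_reg_l with R0; [lra |]. rewrite <- Rmult_assoc, Rinv_r; lra. }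
    assert (Hs0 : (/ RtoC R0 * z)%C <> 0%C).
    { intros E. apply Hz0. replace z with (RtoC R0 * (/ RtoC R0 * z))%C by (field; auto).
      rewrite E. ring. }
    specialize (HI2 _ Hs Hs0). rewrite HA1 in HI2.
    replace (RtoC R0 * (/ RtoC R0 * z))%C with z in HI2 by (field; auto).
    unfold F.
    replace (cauchy_int1 g (/ RtoC R0 * z)%C) with (/ (/ RtoC R0 * z) * (0 + / RtoC R0 * z * cauchy_int1 g (/ RtoC R0 * z)))%C
      by (field; auto).
    rewrite <- HI2. field. repeat split; auto. apply RtoC_2PI_neq. }
  assert (HFH : exists F', HolD (disk R0) F F').
  { eexists (fun z => / RtoC (2 * PI) * (/ RtoC R0 * cauchy_int2 g (/ RtoC R0 * z)))%C.
    intros z Hz. unfold disk in Hz.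
    assert (Hs : Cmod (/ RtoC R0 * z) < 1).
    { rewrite Cmod_mult, Cmod_inv, Cmod_R, Rabs_right by (auto; lra).
      apply Rmult_lt_reg_l with R0; [lra |]. rewrite <- Rmult_assoc, Rinv_r; lra. }
    assert (Ha : isC (fun z => / RtoC R0 * z)%C z (/ RtoC R0)%C).
    { eapply isC_eq; [apply isC_mult; [apply isC_const | apply isC_id] |]. simpl. ring. }
    split.
    - eapply isC_eq.
      + apply isC_mult; [apply isC_const |].
        apply (isC_comp (cauchy_int1 g) (fun z => / RtoC R0 * z)%C); [apply cauchy_int1_deriv; auto | exact Ha].
      + simpl. ring.
    - apply cont_Cmult; [apply cont_Cconst |]. apply cont_Cmult; [apply cont_Cconst |].
      apply (contC_comp (cauchy_int2 g) (fun z => / RtoC R0 * z)%C).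
      + eapply isC_cont. apply cauchy_int2_deriv; auto.
      + eapply isC_cont. exact Ha. }
  destruct HFH as [F' HFH].
  set (fe := fun z => if Ceq_dec z 0%C then F 0%C else f z).
  exists fe, (C_derive fe).
  assert (Hfe : forall p : C, p <> 0%C -> fe p = f p).
  { intros p Hp. unfold fe. destruct (Ceq_dec p 0%C); [contradiction | reflexivity]. }
  split; [| intros p [_ Hp]; apply Hfe; auto].
  apply HolD_glue. intros p Hp. destruct (Ceq_dec p 0%C) as [E | E].
  - subst p. exists R0, F, F'. split; [lra |]. split.
    + apply (HolD_sub (disk R0)); auto. intros q. apply disk_cball.
    + intros q Hq. unfold fe. destruct (Ceq_dec q 0%C) as [Eq | Eq].
      * subst q; auto.
      * apply HF; auto. apply disk_cball; auto.
  - assert (Hpp : pdisk r p) by (split; auto).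
    destruct (pdisk_open r p Hpp) as [d [d0 Hd]].
    exists d, f, f'. split; auto. split.
    + apply (HolD_sub (pdisk r)); auto.
    + intros q Hq. apply Hfe. apply (Hd q Hq).
Qed.

(** Differentiability at the origin bounds [f z / z] by [1 + |f' 0|], so its singularity is
    removable. *)
Lemma HolD_divide r f f' : 0 < r -> HolD (disk r) f f' -> f 0%C = 0%C ->
  exists g g', HolD (disk r) g g' /\ forall p, disk r p -> f p = (p * g p)%C.
Proof.
  intros Hr Hf H0.
  assert (Hq : HolD (pdisk r) (fun z => f z * / z)%C (fun z => f' z * / z + f z * (- (1) / (z * z)))%C).
  { apply HolD_mult.
    - apply (HolD_sub (disk r)); auto. apply pdisk_disk.
    - apply (HolD_inv _ (fun z => z) (fun _ => 1%C)); [apply HolD_id |]. intros p [_ Hp]; exact Hp. }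
  assert (H0d : disk r 0) by (unfold disk; rewrite Cmod_0; lra).
  destruct (proj1 (isC_eps _ _ _) (proj1 (Hf _ H0d)) 1 Rlt_0_1) as [d [d0 Hd]].
  edestruct (removable r (Rmin d r) (1 + Cmod (f' 0%C))) as [g [g' [Hg HE]]]; [| exact Hq | |].
  - split; [apply Rmin_pos; auto | apply Rmin_r].
  - intros p [Hp Hp0].
    assert (Hpd : Cmod (p - 0) < d).
    { replace (p - 0)%C with p by ring. eapply Rlt_le_trans; [exact Hp | apply Rmin_l]. }
    specialize (Hd p Hpd). rewrite H0 in Hd.
    replace (p - 0)%C with p in Hd by ring.
    assert (Hm : 0 < Cmod p) by exact (proj1 (Cmod_gt_0 p) Hp0).
    rewrite Cmod_mult, Cmod_inv by auto.
    apply Rmult_le_reg_r with (Cmod p); auto. rewrite Rmult_assoc, Rinv_l, Rmult_1_r by lra.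
    replace (f p) with ((f p - 0 - p * f' 0%C) + p * f' 0%C)%C by ring.
    eapply Rle_trans; [apply Cmod_triangle |]. rewrite Cmod_mult. lra.
  - exists g, g'. split; auto. intros p Hp. destruct (Ceq_dec p 0%C) as [E | E].
    + subst p. rewrite H0. ring.
    + rewrite HE by (split; auto). field. auto.
Qed.

(* If every power of [z] divides [f], the Cauchy estimate bounds
   [f p] by a constant times [(|p| / R)^k] for all [k]. *)
Lemma HolD_order r f f' p0 : 0 < r -> HolD (disk r) f f' -> Cmod p0 < r / 2 -> f p0 <> 0%C ->
  exists k g g', HolD (disk r) g g' /\ g 0%C <> 0%C /\ forall p, disk r p -> f p = (p ^ k * g p)%C.
Proof.
  intros Hr Hf Hp0 Hfp. apply NNPP. intros Hno.
  assert (Hall : forall k, exists g g', HolD (disk r) g g' /\ forall p, disk r p -> f p = (p ^ k * g p)%C).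
  { induction k as [|k [g [g' [Hg HE]]]].
    - exists f, f'. split; auto. intros p _. simpl. ring.
    - destruct (Ceq_dec (g 0%C) 0%C) as [E | E].
      + destruct (HolD_divide r g g' Hr Hg E) as [h [h' [Hh HE2]]].
        exists h, h'. split; auto. intros p Hp. rewrite HE, HE2 by auto. simpl. ring.
      + exfalso. apply Hno. exists k, g, g'. auto. }
  (* Since [|p0| < r / 2 = (2 / 3) R0], the ratio of the radii is at most [2 / 3]. *)
  set (R0 := 3 * r / 4).
  assert (HR : 0 < R0 < r) by (unfold R0; lra).
  assert (HB : HolD (cball 0 r) f f').
  { apply (HolD_sub (disk r)); auto. intros p. apply disk_cball. }
  destruct (ccont_bounded _ (ball_eit_cont 0%C r R0 f f' HR HB)) as [M [M0 HM]].
  set (K := 2 * M * R0 / (R0 - Cmod p0)).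
  pose proof (Cmod_ge_0 p0).
  assert (HK : forall k, Cmod (f p0) <= (2 / 3) ^ k * K).
  { intros k. destruct (Hall k) as [g [g' [Hg HE]]].
    assert (HRk : 0 < R0 ^ k) by (apply pow_lt; lra).
    assert (Hgb : Cmod (g p0) <= 2 * (M / R0 ^ k) * R0 / (R0 - Cmod (p0 - 0))).
    { apply (cauchy_ball_bound 0%C r R0 g g'); auto.
      - apply (HolD_sub (disk r)); auto. intros p. apply disk_cball.
      - replace (p0 - 0)%C with p0 by ring. unfold R0. lra.
      - intros x Hx. specialize (HM x Hx).
        assert (Hmod : Cmod (0 + RtoC R0 * eit x) = R0).
        { replace (0 + RtoC R0 * eit x)%C with (RtoC R0 * eit x)%C by ring.
          rewrite Cmod_mult, eit_mod, Cmod_R, Rabs_right; lra. }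
        rewrite HE, Cmod_mult, Cmod_pow, Hmod in HM by (unfold disk; lra).
        apply Rmult_le_reg_l with (R0 ^ k); auto.
        eapply Rle_trans; [exact HM |]. right. field. lra. }
    replace (p0 - 0)%C with p0 in Hgb by ring.
    rewrite HE, Cmod_mult, Cmod_pow by (unfold disk; lra).
    apply Rle_trans with ((2 / 3 * R0) ^ k * (2 * (M / R0 ^ k) * R0 / (R0 - Cmod p0))).
    - apply Rmult_le_compat; auto; try apply Cmod_ge_0.
      + apply pow_le; auto.
      + apply pow_incr. unfold R0. lra.
    - rewrite Rpow_mult_distr. unfold K. right. field. unfold R0 in *. lra. }
  assert (Hpos : 0 < Cmod (f p0)) by exact (proj1 (Cmod_gt_0 _) Hfp).
  assert (HK0 : 0 <= K).
  { specialize (HK 0%nat). simpl in HK. lra. }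
  destruct (pow_lt_1_zero (2 / 3)) with (y := Cmod (f p0) / (K + 1)) as [N HN].
  { rewrite Rabs_right; lra. }
  { apply Rdiv_lt_0_compat; lra. }
  specialize (HN N (le_n N)). specialize (HK N).
  assert (0 < (2 / 3) ^ N) by (apply pow_lt; lra).
  rewrite Rabs_right in HN by lra.
  assert ((2 / 3) ^ N * (K + 1) < Cmod (f p0) / (K + 1) * (K + 1)) by (apply Rmult_lt_compat_r; lra).
  replace (Cmod (f p0) / (K + 1) * (K + 1)) with (Cmod (f p0)) in * by (field; lra).
  nra.
Qed.

(** * Growth of solutions of a Riccati equation *)

Lemma HolD_cball_bounded c r f f' R0 : 0 < R0 < r -> HolD (cball c r) f f' ->
  exists M, forall p, cball c R0 p -> Cmod (f p) <= M.
Proof.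
  intros HR Hf. set (R1 := (R0 + r) / 2).
  assert (HR1 : 0 < R1 < r) by (unfold R1; lra).
  destruct (ccont_bounded _ (ball_eit_cont c r R1 f f' HR1 Hf)) as [M [M0 HM]].
  exists (2 * M * R1 / (R1 - R0)). intros p Hp. unfold cball in Hp.
  assert (R0 < R1) by (unfold R1; lra).
  eapply Rle_trans; [apply (cauchy_ball_bound c r R1 f f' p M); auto; lra |].
  unfold Rdiv. apply Rmult_le_compat_l; [nra |]. apply Rinv_le_contravar; lra.
Qed.

(* Maximise [(R - |z - z0|) |Y z|] over the ball of radius [R = |z0| / 2]: near
   a maximiser the Cauchy estimate bounds [Y'] by the square of the distance,
   while the equation makes [Y'] at least quadratic in [Y]. *)
Lemma riccati_bound r Y Y' (a b : C -> C) (k : C) al B :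
  0 < al -> 0 <= B -> HolD (pdisk r) Y Y' ->
  (forall z, pdisk r z -> al <= Cmod (a z) /\ Cmod (b z) <= B) ->
  (forall z, pdisk r z -> z * Y' z = k * Y z + a z * (Y z * Y z) - b z)%C ->
  forall z, pdisk (r / 2) z -> Cmod (Y z) <= 1 + 4 * (24 + Cmod k + B) / al.
Proof.
  intros Hal HB HY Hab HE z0 [Hz0 Hz0n].
  assert (Hm : 0 < Cmod z0) by exact (proj1 (Cmod_gt_0 z0) Hz0n).
  set (R0 := Cmod z0 / 2). assert (HR : 0 < R0) by (unfold R0; lra).
  (* A slightly larger ball on which [Y] is still holomorphic: it bounds [Y] on the ball of radius
     [R0], so that the supremum [S] is finite. *)
  set (R1 := 3 * Cmod z0 / 4). assert (HR1 : 0 < R0 < R1) by (unfold R1, R0; lra).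
  assert (Hsub : forall z, cball z0 R1 z -> pdisk r z).
  { intros z Hz. apply (pdisk_ball r z0); [split; auto; lra |].
    unfold cball, R1 in Hz. apply Rlt_le_trans with (3 * Cmod z0 / 4); auto.
    apply Rmin_glb; lra. }
  assert (HYb : HolD (cball z0 R1) Y Y') by (apply (HolD_sub (pdisk r)); auto).
  destruct (HolD_cball_bounded z0 R1 Y Y' R0 HR1 HYb) as [M HM].
  set (E := fun s => exists z, cball z0 R0 z /\ s = (R0 - Cmod (z - z0)) * Cmod (Y z)).
  assert (Hbd : bound E).
  { exists (R0 * M). intros s [z [Hz ->]]. specialize (HM z Hz). unfold cball in Hz.
    pose proof (Cmod_ge_0 (z - z0)). pose proof (Cmod_ge_0 (Y z)).
    apply Rmult_le_compat; lra. }
  assert (Hin : E (R0 * Cmod (Y z0))).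
  { exists z0. split; [apply cball_center; auto |].
    replace (z0 - z0)%C with (0 : C) by ring. rewrite Cmod_0. ring. }
  destruct (completeness E Hbd (ex_intro _ _ Hin)) as [S [Hub Hlub]].
  pose proof (Hub _ Hin) as HS0. pose proof (Cmod_ge_0 (Y z0)) as HYz0.
  set (kk := Cmod k). assert (Hkk : 0 <= kk) by apply Cmod_ge_0.
  destruct (Rle_lt_dec S 0) as [HSn | HSp].
  { assert (Cmod (Y z0) = 0) by nra.
    assert (0 <= 4 * (24 + kk + B) / al) by (apply Rdiv_le_0_compat; lra). lra. }
  (* A point with half of the supremum replaces a maximiser, so no compactness is involved. *)
  assert (Hz1 : exists z1, cball z0 R0 z1 /\ S / 2 <= (R0 - Cmod (z1 - z0)) * Cmod (Y z1)).
  { apply NNPP. intros Hn.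
    assert (S <= S / 2); [| lra]. apply Hlub. intros s [z [Hz ->]].
    destruct (Rle_lt_dec ((R0 - Cmod (z - z0)) * Cmod (Y z)) (S / 2)); auto.
    exfalso. apply Hn. exists z. split; auto. lra. }
  destruct Hz1 as [z1 [Hz1 Hs1]]. unfold cball in Hz1.
  set (d := R0 - Cmod (z1 - z0)) in *. assert (Hd : 0 < d) by (unfold d; lra).
  assert (HdR : d <= R0) by (unfold d; pose proof (Cmod_ge_0 (z1 - z0)); lra).
  set (y := Cmod (Y z1)) in *.
  assert (Hs2 : d * y <= S) by (apply Hub; exists z1; split; auto).
  assert (Hz1R : cball z0 R1 z1) by (unfold cball; lra).
  destruct (Hab z1 (Hsub z1 Hz1R)) as [Ha1 Hb1]. specialize (HE z1 (Hsub z1 Hz1R)).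
  (* On the circle of radius [d / 2] about [z1] the distance to the boundary is at least [d / 2],
     hence [|Y| <= 2 S / d] there. *)
  assert (HD : Cmod (Y' z1) <= 2 * (2 * S / d) / (d / 2)).
  { apply (cauchy_deriv_bound z1 d (d / 2) Y Y'); [lra | |].
    - apply (HolD_sub (cball z0 R1)); auto. intros q Hq. unfold cball in *.
      replace (q - z0)%C with ((q - z1) + (z1 - z0))%C by ring.
      eapply Rle_lt_trans; [apply Cmod_triangle |]. unfold d in Hq. lra.
    - intros x _. set (q := (z1 + RtoC (d / 2) * eit x)%C).
      assert (Hq : Cmod (q - z1) = d / 2).
      { unfold q. replace (z1 + RtoC (d / 2) * eit x - z1)%C with (RtoC (d / 2) * eit x)%C by ring.
        rewrite Cmod_mult, eit_mod, Cmod_R, Rabs_right; lra. }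
      assert (Hq0 : Cmod (q - z0) <= d / 2 + Cmod (z1 - z0)).
      { replace (q - z0)%C with ((q - z1) + (z1 - z0))%C by ring.
        eapply Rle_trans; [apply Cmod_triangle |]. lra. }
      assert (Hq1 : (R0 - Cmod (q - z0)) * Cmod (Y q) <= S).
      { apply Hub. exists q. split; auto. unfold cball. unfold d in Hq0. lra. }

      assert (d / 2 * Cmod (Y q) <= S) by (unfold d in *; nra).
      apply Rmult_le_reg_l with (d / 2); [lra |]. eapply Rle_trans; [eassumption |].
      right. field. lra. }
  assert (Hz1m : Cmod z1 <= 3 * R0).
  { replace z1 with ((z1 - z0) + z0)%C by ring. eapply Rle_trans; [apply Cmod_triangle |].
    unfold R0 in *. lra. }
  assert (HQ : al * (y * y) <= 3 * R0 * (2 * (2 * S / d) / (d / 2)) + kk * y + B).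
  { apply Rle_trans with (Cmod (a z1 * (Y z1 * Y z1))).
    - rewrite !Cmod_mult. apply Rmult_le_compat_r; auto. nra.
    - replace (a z1 * (Y z1 * Y z1))%C with (z1 * Y' z1 + - (k * Y z1) + b z1)%C by (rewrite HE; ring).
      eapply Rle_trans; [apply Cmod_triangle |]. apply Rplus_le_compat; auto.
      eapply Rle_trans; [apply Cmod_triangle |]. rewrite Cmod_opp, !Cmod_mult.
      apply Rplus_le_compat; [| apply Rle_refl]. apply Rmult_le_compat; auto; apply Cmod_ge_0. }
  set (s := d * y) in *.
  assert (HQ2 : al * (s * s) <= 24 * R0 * S + kk * s * d + B * (d * d)).
  { replace (24 * R0 * S + kk * s * d + B * (d * d))
      with (d * d * (3 * R0 * (2 * (2 * S / d) / (d / 2)) + kk * y + B)) by (unfold s; field; lra).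
    replace (al * (s * s)) with (d * d * (al * (y * y))) by (unfold s; ring).
    apply Rmult_le_compat_l; auto. nra. }

  assert (HQ3 : al * (S * S) / 4 <= (24 + kk) * R0 * S + B * (R0 * R0)).
  { apply Rle_trans with (al * (s * s)).
    - replace (al * (S * S) / 4) with (al * ((S / 2) * (S / 2))) by field.
      apply Rmult_le_compat_l; [lra |]. apply Rmult_le_compat; lra.
    - eapply Rle_trans; [exact HQ2 |].
      assert (kk * s * d <= kk * S * R0).
      { apply Rmult_le_compat; try nra. }
      assert (B * (d * d) <= B * (R0 * R0)).
      { apply Rmult_le_compat_l; auto. apply Rmult_le_compat; lra. }
      lra. }
  (* The factor [z] in front of [Y'] makes the inequality homogeneous: because [|z1| <= 3 R0],
     dividing by [R0^2] leaves a bound that does not depend on [z0]. *)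
  set (x := S / R0). assert (Hx : S = x * R0) by (unfold x; field; lra).
  assert (Hx0 : Cmod (Y z0) <= x) by (apply Rmult_le_reg_r with R0; lra).
  assert (HQ4 : al * (x * x) / 4 <= (24 + kk) * x + B).
  { rewrite Hx in HQ3. apply Rmult_le_reg_r with (R0 * R0); [nra |].
    eapply Rle_trans; [| eapply Rle_trans; [exact HQ3 |]]; right; field. }
  apply Rle_trans with x; auto.
  destruct (Rle_lt_dec x 1) as [Hx1 | Hx1].
  { assert (0 <= 4 * (24 + kk + B) / al) by (apply Rdiv_le_0_compat; lra). lra. }
  assert (al * x / 4 <= 24 + kk + B).
  { apply Rmult_le_reg_r with x; [lra |]. nra. }
  assert (x <= 4 * (24 + kk + B) / al); [| fold kk; lra].
  apply Rmult_le_reg_l with al; auto.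
  replace (al * (4 * (24 + kk + B) / al)) with (4 * (24 + kk + B)) by (field; lra). lra.
Qed.

(* [w] is the complex gradient [h_u - i h_v] of the real function [h] at [p]. *)
Definition isG (h : C -> R) (p w : C) : Prop :=
  forall eps, 0 < eps -> exists d, 0 < d /\ forall q, Cmod (q - p) < d ->
    Rabs (h q - h p - fst ((q - p) * w)%C) <= eps * Cmod (q - p).

Lemma isG_curve h (g : R -> C) t w d :
  isG h (g t) w -> isRC g t d -> is_derive (fun s => h (g s)) t (fst (d * w)%C).
Proof.
  intros Hf Hg. apply isR_eps. intros eps He.
  rewrite isRC_eps in Hg.
  pose proof (Cmod_ge_0 w) as Hl. pose proof (Cmod_ge_0 d) as Hd.
  assert (A1 : 0 < eps / (2 * (Cmod d + 1))) by (apply Rdiv_lt_0_compat; lra).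
  assert (A2 : 0 < eps / (2 * (Cmod w + 1))) by (apply Rdiv_lt_0_compat; lra).
  destruct (Hf _ A1) as [e1 [e10 H1]].
  destruct (Hg _ A2) as [e2 [e20 H2]].
  destruct (Hg 1 Rlt_0_1) as [e3 [e30 H3]].
  assert (A4 : 0 < e1 / (Cmod d + 1)) by (apply Rdiv_lt_0_compat; lra).
  exists (Rmin (Rmin e2 e3) (e1 / (Cmod d + 1))). split; [repeat apply Rmin_pos; auto |].
  intros s Hs.
  assert (Hs2 : Rabs (s - t) < e2).
  { eapply Rlt_le_trans; [exact Hs |]. eapply Rle_trans; [apply Rmin_l | apply Rmin_l]. }
  assert (Hs3 : Rabs (s - t) < e3).
  { eapply Rlt_le_trans; [exact Hs |]. eapply Rle_trans; [apply Rmin_l | apply Rmin_r]. }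
  assert (Hs1 : Rabs (s - t) < e1 / (Cmod d + 1)).
  { eapply Rlt_le_trans; [exact Hs |]. apply Rmin_r. }
  specialize (H2 s Hs2). specialize (H3 s Hs3).
  assert (H4 : Cmod (g s - g t) <= (Cmod d + 1) * Rabs (s - t)).
  { replace (g s - g t)%C with ((g s - g t - RtoC (s - t) * d) + RtoC (s - t) * d)%C by ring.
    eapply Rle_trans; [apply Cmod_triangle |]. rewrite Cmod_mult, Cmod_R. lra. }
  assert (H5 : Cmod (g s - g t) < e1).
  { eapply Rle_lt_trans; [exact H4 |].
    apply Rlt_le_trans with ((Cmod d + 1) * (e1 / (Cmod d + 1))).
    - apply Rmult_lt_compat_l; lra.
    - right; field; lra. }
  specialize (H1 _ H5).
  replace (h (g s) - h (g t) - (s - t) * fst (d * w)%C)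
    with ((h (g s) - h (g t) - fst ((g s - g t) * w)%C) + fst ((g s - g t - RtoC (s - t) * d) * w)%C)
    by (simpl; ring).
  eapply Rle_trans; [apply Rabs_triang |].
  apply Rle_trans with (eps / 2 * Rabs (s - t) + eps / 2 * Rabs (s - t)); [| lra].
  pose proof (Rabs_pos (s - t)) as Hp.
  apply Rplus_le_compat.
  - eapply Rle_trans; [exact H1 |].
    eapply Rle_trans; [apply Rmult_le_compat_l; [lra | exact H4] |].
    right; field; lra.
  - eapply Rle_trans; [apply abs_fst_le |]. rewrite Cmod_mult.
    eapply Rle_trans; [apply Rmult_le_compat_r; [exact Hl | exact H2] |].
    apply Rle_trans with (eps / (2 * (Cmod w + 1)) * Rabs (s - t) * (Cmod w + 1)).
    + apply Rmult_le_compat_l; [| lra]. apply Rmult_le_pos; lra.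
    + right; field; lra.
Qed.

Lemma CInt_conj f : ccont f -> CInt (fun t => Cconj (f t)) = Cconj (CInt f).
Proof.
  intros Hf. unfold CInt, Cconj; simpl. f_equal.
  apply is_RInt_unique. apply (is_RInt_opp (V := R_NormedModule)).
  apply (RInt_correct (V := R_CompleteNormedModule)). apply ccont_ex_snd; auto.
Qed.

Lemma ccont_conj f : ccont f -> ccont (fun t => Cconj (f t)).
Proof.
  intros Hf t. apply cont_pair. split; simpl.
  - apply ccont_fst; auto.
  - apply (continuous_opp (V := R_NormedModule)). apply ccont_snd; auto.
Qed.

Lemma eit_conj t : Cconj (eit t) = (/ eit t)%C.
Proof.
  assert (E : (eit t * Cconj (eit t) = 1)%C).
  { rewrite <- Cmod2_conj, eit_mod. f_equal. ring. }
  replace (Cconj (eit t)) with (/ eit t * (eit t * Cconj (eit t)))%C by (field; apply eit_neq_0).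
  rewrite E. ring.
Qed.

(** The second integral is Cauchy's formula at the centre for [f z * (z - c)^2], which vanishes
    there. *)
Lemma cauchy_center c r R0 f f' : 0 < R0 < r -> HolD (cball c r) f f' ->
  CInt (fun x => f (c + RtoC R0 * eit x))%C = (RtoC (2 * PI) * f c)%C /\
  CInt (fun x => f (c + RtoC R0 * eit x) * (eit x * eit x))%C = 0%C.
Proof.
  intros HR Hf. assert (HR0 : RtoC R0 <> 0%C) by (apply RtoC_neq; lra).
  assert (Hcc : Cmod (c - c) < R0) by (replace (c - c)%C with (0 : C) by ring; rewrite Cmod_0; lra).
  assert (HK : forall x, (eit x / (eit x - (c - c) / RtoC R0) = 1)%C).
  { intros x. replace ((c - c) / RtoC R0)%C with (0 : C) by (field; auto).
    replace (eit x - 0)%C with (eit x) by ring. field. apply eit_neq_0. }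
  split.
  - rewrite <- (cauchy_ball c r R0 f f' c HR Hf Hcc). apply CInt_ext. intros x. rewrite HK. ring.
  - destruct (HolD_mult _ _ _ _ _ Hf (HolD_mult (cball c r) _ _ _ _
      (HolD_plus (cball c r) _ _ _ _ (HolD_id _) (HolD_const _ (- c)%C))
      (HolD_plus (cball c r) _ _ _ _ (HolD_id _) (HolD_const _ (- c)%C))) c) as [_ _].
    { apply cball_center. lra. }
    pose proof (cauchy_ball c r R0 _ _ c HR (HolD_mult _ _ _ _ _ Hf (HolD_mult (cball c r) _ _ _ _
      (HolD_plus (cball c r) _ _ _ _ (HolD_id _) (HolD_const _ (- c)%C))
      (HolD_plus (cball c r) _ _ _ _ (HolD_id _) (HolD_const _ (- c)%C)))) Hcc) as H.
    simpl in H.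
    rewrite (CInt_ext _ (fun x => RtoC R0 * RtoC R0 * (f (c + RtoC R0 * eit x) * (eit x * eit x)))%C) in H.
    2:{ intros x. rewrite HK. ring. }
    pose proof (ball_eit_cont c r R0 f f' HR Hf) as Hc.
    rewrite CInt_scal in H by ccont_tac.
    replace (CInt (fun x => f (c + RtoC R0 * eit x) * (eit x * eit x)))%C
      with (/ (RtoC R0 * RtoC R0) * (RtoC R0 * RtoC R0 * CInt (fun x => f (c + RtoC R0 * eit x) * (eit x * eit x))))%C
      by (field; auto).
    rewrite H. ring.
Qed.

Lemma re_half (w : C) : RtoC (fst w) = (/ 2 * (w + Cconj w))%C.
Proof.
  destruct w as [x y]. unfold Cconj, RtoC, Cplus, Cmult, Cinv; simpl. f_equal; field.
Qed.

(* Integrate the derivative of [h / e^{i x}] over the circle. *)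
Lemma harmonic_gradient_bound c r R0 (h : C -> R) F F' l eta : 0 < R0 < r ->
  HolD (cball c r) F F' -> (forall p, cball c r p -> isG h p (F p)) ->
  (forall x, Rabs (h (c + RtoC R0 * eit x)%C - l) <= eta) ->
  Cmod (F c) <= 4 * eta / R0.
Proof.
  intros HR HF HG Heta.
  pose proof PI_RGT_0 as HPI.
  set (m := fun x => (c + RtoC R0 * eit x)%C).
  assert (Hm : forall x, isRC m x (RtoC R0 * (Ci * eit x))%C).
  { intros x. unfold m. eapply isRC_eq.
    - apply isRC_plus; [apply isRC_const |]. apply isRC_mult; [apply isRC_const | apply eit_deriv].
    - simpl. ring. }
  assert (Hin : forall x, cball c r (m x)).
  { intros x. unfold cball, m. replace (c + RtoC R0 * eit x - c)%C with (RtoC R0 * eit x)%C by ring.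
    rewrite Cmod_mult, eit_mod, Cmod_R, Rabs_right; lra. }
  pose proof (ball_eit_cont c r R0 F F' HR HF) as HFc. fold m in HFc.

  set (H := fun x => RtoC (h (m x) - l)).
  assert (HH : forall x, isRC H x (RtoC (fst (RtoC R0 * (Ci * eit x) * F (m x))%C))).
  { intros x. split.
    - unfold H. simpl fst at 1.
      evar_last.
      + apply (is_derive_minus (K := R_AbsRing) (V := R_NormedModule)).
        * apply (isG_curve h m x (F (m x)) _ (HG _ (Hin x)) (Hm x)).
        * apply (is_derive_const (K := R_AbsRing) (V := R_NormedModule)).
      + unfold minus, plus, opp, zero; simpl. ring.
    - apply (is_derive_const (K := R_AbsRing) (V := R_NormedModule) 0). }
  assert (HHc : ccont H) by (intros x; eapply isRC_cont; apply HH).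
  assert (Hic : ccont (fun x => / eit x)%C).
  { intros x. apply (cont_Cinv eit); [apply eit_cont | apply eit_neq_0]. }
  set (F2 := fun x => (F (m x) * (eit x * eit x))%C).
  assert (HF2 : ccont F2) by (unfold F2; ccont_tac).
  pose proof (ccont_conj _ HF2) as HF2c.
  destruct (cauchy_center c r R0 F F' HR HF) as [HC1 HC2].
  (* The real part in the derivative of [H] is half the sum with the conjugate. The term in [F]
     integrates to a multiple of [F c], the conjugate term to [0], and the last term contains [h]
     undifferentiated. *)
  assert (HI : CInt (fun x => (RtoC R0 * Ci * / 2) * F (m x)
     + ((RtoC R0 * - Ci * / 2) * Cconj (F2 x) + (- Ci) * (H x * / eit x)))%C = 0%C).
  { rewrite (CInt_deriv (fun x => H x * / eit x)%C).
    - rewrite eit_0, eit_2PI. unfold H, m. rewrite eit_0, eit_2PI. ring.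
    - ccont_tac.
    - intros x. eapply isRC_eq.
      + apply isRC_mult; [apply HH |].
        apply (isC_curve (fun z => / z)%C eit); [| apply eit_deriv].
        apply isC_inv_at. apply eit_neq_0.
      + rewrite re_half. unfold F2. rewrite !Cmult_conj, eit_conj.
        replace (Cconj (RtoC R0)) with (RtoC R0) by (unfold Cconj, RtoC; simpl; f_equal; ring).
        replace (Cconj Ci) with (- Ci)%C by (unfold Cconj, Ci, Copp; simpl; f_equal; ring).
        field. apply eit_neq_0. }
  rewrite !CInt_plus in HI by ccont_tac. rewrite !CInt_scal in HI by ccont_tac.
  rewrite CInt_conj in HI by auto.
  unfold F2 in HI. unfold m in HI at 1 2. rewrite HC1, HC2 in HI.
  assert (E : (RtoC (R0 * PI) * F c = CInt (fun x => H x * / eit x))%C).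
  { replace (Cconj 0) with (0 : C) in HI by (unfold Cconj, RtoC; simpl; f_equal; ring).

    assert (E1 : (RtoC (R0 * PI) * F c - CInt (fun x => H x * / eit x))%C = (/ Ci * 0)%C).
    { rewrite <- HI. rewrite !RtoC_mult. field. apply Ci_nz. }
    replace (RtoC (R0 * PI) * F c)%C with ((RtoC (R0 * PI) * F c - CInt (fun x => H x * / eit x)) + CInt (fun x => H x * / eit x))%C by ring.
    rewrite E1. ring. }
  assert (HB : Cmod (CInt (fun x => H x * / eit x)%C) <= 4 * PI * eta).
  { apply CInt_bound; [ccont_tac |]. intros t _.
    rewrite Cmod_mult, Cmod_inv, eit_mod by apply eit_neq_0.
    unfold H. rewrite Cmod_R. rewrite Rinv_1, Rmult_1_r. apply Heta. }
  rewrite <- E, Cmod_mult, Cmod_R, Rabs_right in HB by nra.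
  apply Rmult_le_reg_l with (R0 * PI); [nra |].
  eapply Rle_trans; [exact HB |]. right. field. lra.
Qed.

Lemma locally'_Cmod (P : C -> Prop) :
  locally' (T := C_UniformSpace) (RtoC 0) P <->
  exists d, 0 < d /\ forall q, pdisk d q -> P q.
Proof.
  unfold locally', within. rewrite locally_Cmod. split.
  - intros [d [d0 H]]. exists d. split; auto. intros q [Hq Hq0]. apply H; auto.
    replace (q - 0)%C with q by ring. auto.
  - intros [d [d0 H]]. exists d. split; auto. intros q Hq Hq0. apply H. split; auto.
    replace (q - 0)%C with q in Hq by ring. auto.
Qed.

(** Where [h] is within [eta] of [l], the gradient estimate on the disk of radius [|z| / 2] about
    [z] gives [|z F z| <= 8 eta]. Thus [z F z] extends with value [0] and can be divided by [z];
    mere boundedness of [z F z] would still allow a simple pole of [F]. *)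
Lemma height_removable r (h : C -> R) F F' l : 0 < r -> HolD (pdisk r) F F' ->
  (forall p, pdisk r p -> isG h p (F p)) ->
  filterlim h (locally' (T := C_UniformSpace) (RtoC 0)) (locally l) ->
  exists g g', HolD (disk r) g g' /\ forall p, pdisk r p -> g p = F p.
Proof.
  intros Hr HF HG Hl.
  assert (HS : forall eta, 0 < eta -> exists d, 0 < d <= r /\ forall z, pdisk d z -> Cmod (z * F z) <= 8 * eta).
  { intros eta He.
    destruct (proj1 (locally'_Cmod _) (Hl _ (locally_ball l (mkposreal eta He)))) as [d [d0 Hd]].
    exists (Rmin (d / 2) (r / 2)). split.
    { split; [apply Rmin_pos; lra |]. eapply Rle_trans; [apply Rmin_r | lra]. }
    intros z [Hz Hz0].
    assert (Hz1 : Cmod z < d / 2) by (eapply Rlt_le_trans; [exact Hz | apply Rmin_l]).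
    assert (Hz2 : Cmod z < r / 2) by (eapply Rlt_le_trans; [exact Hz | apply Rmin_r]).
    assert (Hm : 0 < Cmod z) by exact (proj1 (Cmod_gt_0 z) Hz0).
    assert (Hb : forall q, cball z (Cmod z) q -> pdisk d q /\ pdisk r q).
    { intros q Hq. unfold cball in Hq. split.
      - apply (pdisk_ball d z); [split; auto; lra |]. rewrite Rmin_right; lra.
      - apply (pdisk_ball r z); [split; auto; lra |]. rewrite Rmin_right; lra. }
    assert (HB : Cmod (F z) <= 4 * eta / (Cmod z / 2)).
    { apply (harmonic_gradient_bound z (Cmod z) (Cmod z / 2) h F F' l eta); [lra | | |].
      - apply (HolD_sub (pdisk r)); auto. apply Hb.
      - intros p Hp. apply HG. apply Hb; auto.
      - intros x. left. apply (Hd (z + RtoC (Cmod z / 2) * eit x)%C).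
        apply Hb. unfold cball.
        replace (z + RtoC (Cmod z / 2) * eit x - z)%C with (RtoC (Cmod z / 2) * eit x)%C by ring.
        rewrite Cmod_mult, eit_mod, Cmod_R, Rabs_right; lra. }
    rewrite Cmod_mult. apply Rle_trans with (Cmod z * (4 * eta / (Cmod z / 2))).
    - apply Rmult_le_compat_l; lra.
    - right. field. lra. }
  destruct (HS 1 Rlt_0_1) as [d [Hd HM]].
  destruct (removable r d (8 * 1) _ _ Hd (HolD_mult _ _ _ _ _ (HolD_id _) HF) HM) as [f [f' [Hf HE]]].
  assert (Hf0 : f 0%C = 0%C).
  { destruct (Ceq_dec (f 0%C) 0%C) as [E | E]; auto. exfalso.
    assert (Hm : 0 < Cmod (f 0%C)) by exact (proj1 (Cmod_gt_0 _) E).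
    assert (H0d : disk r 0) by (unfold disk; rewrite Cmod_0; lra).
    destruct (proj1 (contC_eps _ _) (isC_cont _ _ _ (proj1 (Hf _ H0d))) (Cmod (f 0%C) / 2)) as [e [e0 H1]]; [lra |].
    destruct (HS (Cmod (f 0%C) / 32)) as [e2 [He2 H2]]; [lra |].
    set (t := Rmin e e2 / 2).
    assert (Ht : 0 < t) by (unfold t; assert (0 < Rmin e e2) by (apply Rmin_pos; lra); lra).
    assert (Ht1 : t < e) by (pose proof (Rmin_l e e2); unfold t in *; lra).
    assert (Ht2 : t < e2) by (pose proof (Rmin_r e e2); unfold t in *; lra).
    assert (Hmt : Cmod (RtoC t) = t) by (rewrite Cmod_R, Rabs_right; lra).
    assert (Htn : RtoC t <> 0%C) by (apply RtoC_neq; lra).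
    assert (A : Cmod (f (RtoC t) - f 0%C) < Cmod (f 0%C) / 2).
    { apply H1. replace (RtoC t - 0)%C with (RtoC t) by ring. lra. }
    assert (B : Cmod (f (RtoC t)) <= 8 * (Cmod (f 0%C) / 32)).
    { rewrite HE by (split; auto; lra). apply H2. split; auto; lra. }
    pose proof (Cmod_minus_ge (f 0%C) (f (RtoC t))). rewrite Cmod_minus_sym in A. lra. }
  destruct (HolD_divide r f f' Hr Hf Hf0) as [g [g' [Hg HE2]]].
  exists g, g'. split; auto. intros p Hp. specialize (HE p Hp).
  rewrite HE2 in HE by (apply pdisk_disk; auto). destruct Hp as [_ Hp0].
  replace (g p) with (/ p * (p * g p))%C by (field; auto). rewrite HE. field. auto.
Qed.

(** * Partial and Wirtinger derivatives *)

(** A relation, because [pd] returns a value even where the derivative does not exist. *)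
Definition isd (i : dir) (f : C -> R) (p : C) (l : R) : Prop :=
  match i with
  | du => is_derive (fun u => f (u, snd p)) (fst p) l
  | dv => is_derive (fun v => f (fst p, v)) (snd p) l
  end.

Lemma isd_pd i f p l : isd i f p l -> pd i f p = l.
Proof. destruct i; apply is_derive_unique. Qed.

Lemma isd_eq i f p l m : isd i f p l -> l = m -> isd i f p m.
Proof. intros H <-; exact H. Qed.

Lemma isd_const i c p : isd i (fun _ => c) p 0.
Proof.
  destruct i.
  - exact (is_derive_const (K := R_AbsRing) (V := R_NormedModule) c (fst p)).
  - exact (is_derive_const (K := R_AbsRing) (V := R_NormedModule) c (snd p)).
Qed.

Lemma isd_plus i f g p l m : isd i f p l -> isd i g p m -> isd i (fun q => f q + g q) p (l + m).
Proof.
  destruct i; intros Hf Hg; apply (is_derive_plus (K := R_AbsRing) (V := R_NormedModule)); auto.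
Qed.

Lemma isd_opp i f p l : isd i f p l -> isd i (fun q => - f q) p (- l).
Proof. destruct i; intros Hf; apply (is_derive_opp (K := R_AbsRing) (V := R_NormedModule)); auto. Qed.

Lemma isd_minus i f g p l m : isd i f p l -> isd i g p m -> isd i (fun q => f q - g q) p (l - m).
Proof. intros Hf Hg. apply isd_plus; auto. apply isd_opp; auto. Qed.

Lemma isd_mult i f g p l m :
  isd i f p l -> isd i g p m -> isd i (fun q => f q * g q) p (l * g p + f p * m).
Proof.
  destruct p as [u v].
  destruct i; intros Hf Hg; simpl in *;
    apply (is_derive_mult (K := R_AbsRing) _ _ _ _ _ Hf Hg); exact Rmult_comm.
Qed.

Lemma isd_inv i f p l : isd i f p l -> f p <> 0 -> isd i (fun q => / f q) p (- l / f p ^ 2).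
Proof.
  destruct p as [u v]. destruct i; intros Hf H0; simpl isd in *.
  - apply (is_derive_inv (fun u => f (u, v)) u l); auto.
  - apply (is_derive_inv (fun v => f (u, v)) v l); auto.
Qed.

Lemma isd_sqrt i f p l : isd i f p l -> 0 < f p -> isd i (fun q => sqrt (f q)) p (l / (2 * sqrt (f p))).
Proof.
  destruct p as [u v]. destruct i; intros Hf H0; simpl isd in *.
  - apply (is_derive_sqrt (fun u => f (u, v)) u l); auto.
  - apply (is_derive_sqrt (fun v => f (u, v)) v l); auto.
Qed.

Lemma cball_line_u p d : 0 < d -> locally (fst p) (fun u => cball p d (u, snd p)).
Proof.
  intros d0. exists (mkposreal d d0). intros u Hu. unfold cball.
  replace ((u, snd p) - p)%C with (RtoC (u - fst p)).
  - rewrite Cmod_R. exact Hu.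
  - destruct p. unfold RtoC, Cminus, Cplus, Copp; simpl. f_equal; ring.
Qed.

Lemma cball_line_v p d : 0 < d -> locally (snd p) (fun v => cball p d (fst p, v)).
Proof.
  intros d0. exists (mkposreal d d0). intros v Hv. unfold cball.
  replace ((fst p, v) - p)%C with (Ci * RtoC (v - snd p))%C.
  - rewrite Cmod_mult, Cmod_Ci, Cmod_R, Rmult_1_l. exact Hv.
  - destruct p. unfold RtoC, Ci, Cmult, Cminus, Cplus, Copp; simpl. f_equal; ring.
Qed.

Lemma isd_ext i f g p l d :
  0 < d -> (forall q, cball p d q -> f q = g q) -> isd i f p l -> isd i g p l.
Proof.
  intros d0 H. destruct i; simpl; apply is_derive_ext_loc.
  - generalize (cball_line_u p d d0). apply filter_imp. intros u Hu. apply H; auto.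
  - generalize (cball_line_v p d d0). apply filter_imp. intros u Hu. apply H; auto.
Qed.

Lemma smooth_isd U f i p : smooth U f -> U p -> isd i f p (pd i f p).
Proof.
  intros Hf Hp. destruct (Hf 1%nat p Hp) as [_ [H1 [H2 _]]].
  destruct i; simpl; apply Derive_correct; auto.
Qed.

Lemma smooth_pd U f i : smooth U f -> smooth U (pd i f).
Proof.
  intros Hf n p Hp. destruct (Hf (S n) p Hp) as [_ [_ [_ [H3 H4]]]].
  destruct i; [exact H3 | exact H4].
Qed.

Lemma smooth_cont U f p : smooth U f -> U p -> continuous (T := C_UniformSpace) f p.
Proof.
  intros Hf Hp. destruct (Hf 0%nat p Hp) as [H _].
  apply continuity_2d_pt_filterlim in H.
  assert (E : p = (fst p, snd p)) by (destruct p; auto). rewrite E.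
  apply (continuous_ext_loc _ (fun z : R * R => f (fst z, snd z))); [| exact H].
  exists (mkposreal 1 Rlt_0_1). intros [a b] _. reflexivity.
Qed.

Definition isopen (U : C -> Prop) : Prop :=
  forall p, U p -> exists d, 0 < d /\ forall q, cball p d q -> U q.

Lemma Cmod_prod_norm (x : C) :
  norm (K := R_AbsRing) (V := prod_NormedModule R_AbsRing R_NormedModule R_NormedModule) x = Cmod x.
Proof.
  unfold norm; simpl. unfold prod_norm, Cmod. f_equal.
  unfold norm; simpl. unfold abs; simpl. rewrite !Rmult_1_r.
  f_equal; [rewrite <- Rabs_mult | rewrite <- Rabs_mult]; apply Rabs_right; nra.
Qed.

Lemma smooth_isG U f p : isopen U -> smooth U f -> U p -> isG f p (pd du f p, - pd dv f p).
Proof.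
  intros HU Hf Hp. destruct (HU p Hp) as [d [d0 Hd]].
  assert (HD : filterdiff (K := R_AbsRing) (fun u : R * R => f (fst u, snd u)) (locally (fst p, snd p))
    (fun u : R * R => plus (scal (fst u) (pd du f p)) (scal (snd u) (pd dv f p)))).
  { pose proof (is_derive_filterdiff (fun u v => f (u, v)) (fst p) (snd p)
      (fun u v => pd du f (u, v)) (pd dv f p)) as HK.
    assert (Ep : (fst p, snd p) = p) by (destruct p; auto).
    rewrite Ep in *. apply HK.
    - apply locally_Cmod. exists d. split; auto. intros [u v] Hq.
      apply (smooth_isd U f du (u, v)); auto.
    - apply (smooth_isd U f dv p); auto.
    - apply (continuous_ext (fun q : C => pd du f q)).
      + intros [a b]. reflexivity.
      + apply (smooth_cont U); auto. apply smooth_pd; auto. }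
  intros eps He. destruct HD as [_ HD].
  destruct (HD (fst p, snd p) (fun P HP => HP) (mkposreal eps He)) as [e He2].
  exists (e / 2). pose proof (cond_pos e). split; [lra |].
  intros q Hq.
  assert (Hb : ball (fst p, snd p) e q).
  { split.
    - apply Rle_lt_trans with (Cmod (q - p)); [apply (abs_fst_le (q - p)%C) | lra].
    - apply Rle_lt_trans with (Cmod (q - p)); [apply (abs_snd_le (q - p)%C) | lra]. }
  specialize (He2 q Hb). rewrite Cmod_prod_norm in He2.
  eapply Rle_trans; [| eapply Rle_trans; [exact He2 |]].
  - right. destruct p as [a b], q as [u v]. unfold norm; simpl. unfold abs; simpl. f_equal.
    unfold minus, plus, opp, scal; simpl. unfold mult; simpl. unfold plus, opp; simpl. ring.
  - right. destruct p, q. reflexivity.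
Qed.

Lemma schwarz U f p : isopen U -> smooth U f -> U p ->
  pd du (pd dv f) p = pd dv (pd du f) p.
Proof.
  intros HU Hf Hp. destruct (HU p Hp) as [d [d0 Hd]].
  assert (S1 := smooth_pd U f du Hf). assert (S2 := smooth_pd U f dv Hf).
  assert (S12 := smooth_pd U _ dv S1). assert (S21 := smooth_pd U _ du S2).
  symmetry. symmetry.
  apply (Schwarz (fun u v => f (u, v)) (fst p) (snd p)).
  - assert (H2 : 0 < d / 2) by lra. exists (mkposreal _ H2). intros u v Hu Hv.
    simpl in Hu, Hv.
    assert (Hq : U (u, v)).
    { apply Hd. unfold cball. eapply Rle_lt_trans; [apply Cmod_le_abs |]. simpl.
      unfold Rminus in *. lra. }
    repeat split.
    + eexists. apply (smooth_isd U f du (u, v)); auto.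
    + eexists. apply (smooth_isd U f dv (u, v)); auto.
    + eexists. apply (smooth_isd U _ du (u, v) S2); auto.
    + eexists. apply (smooth_isd U _ dv (u, v) S1); auto.
  - destruct (S21 0%nat p Hp) as [H _]. exact H.
  - destruct (S12 0%nat p Hp) as [H _]. exact H.
Qed.

(** The two hypotheses together are the Cauchy-Riemann equations, since the imaginary part of a
    number [x] is the real part of [- i x]. *)
Lemma isC_isG f p w : isG (fun q => fst (f q)) p w -> isG (fun q => snd (f q)) p (- Ci * w)%C -> isC f p w.
Proof.
  intros H1 H2. apply isC_eps. intros eps He.
  destruct (H1 (eps / 2)) as [d1 [d10 Hd1]]; [lra |].
  destruct (H2 (eps / 2)) as [d2 [d20 Hd2]]; [lra |].
  exists (Rmin d1 d2). split; [apply Rmin_pos; auto |]. intros q Hq.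
  specialize (Hd1 q (Rlt_le_trans _ _ _ Hq (Rmin_l _ _))).
  specialize (Hd2 q (Rlt_le_trans _ _ _ Hq (Rmin_r _ _))).
  eapply Rle_trans; [apply Cmod_le_abs |].
  apply Rle_trans with (eps / 2 * Cmod (q - p) + eps / 2 * Cmod (q - p)); [| lra].
  apply Rplus_le_compat.
  - eapply Rle_trans; [| exact Hd1]. right. f_equal.
  - eapply Rle_trans; [| exact Hd2]. right. f_equal. simpl. ring.
Qed.

(* [a] and [b] are the Wirtinger derivatives of [f] with respect to [z] and its conjugate. *)
Definition isW (f : C -> C) (p a b : C) : Prop :=
  forall eps, 0 < eps -> exists d, 0 < d /\ forall q, Cmod (q - p) < d ->
    Cmod (f q - f p - (q - p) * a - Cconj (q - p) * b) <= eps * Cmod (q - p).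

Lemma isW_isC f p a : isW f p a 0%C <-> isC f p a.
Proof.
  rewrite isC_eps. split; intros H eps He; destruct (H eps He) as [d [d0 Hd]];
    exists d; (split; [auto |]); intros q Hq; specialize (Hd q Hq).
  - replace (f q - f p - (q - p) * a)%C
      with (f q - f p - (q - p) * a - Cconj (q - p) * 0)%C by ring. exact Hd.
  - replace (f q - f p - (q - p) * a - Cconj (q - p) * 0)%C
      with (f q - f p - (q - p) * a)%C by ring. exact Hd.
Qed.

Lemma isW_eq f p a b a' b' : isW f p a b -> a = a' -> b = b' -> isW f p a' b'.
Proof. intros H <- <-. exact H. Qed.

Lemma isW_ext f g p a b d :
  0 < d -> (forall q, cball p d q -> f q = g q) -> isW f p a b -> isW g p a b.
Proof.
  intros d0 HE H eps He. destruct (H eps He) as [e [e0 He2]].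
  exists (Rmin d e). split; [apply Rmin_pos; auto |]. intros q Hq.
  rewrite <- !HE.
  - apply He2. eapply Rlt_le_trans; [exact Hq | apply Rmin_r].
  - apply cball_center; auto.
  - eapply Rlt_le_trans; [exact Hq | apply Rmin_l].
Qed.

Lemma isW_const (c p : C) : isW (fun _ => c) p 0%C 0%C.
Proof. apply isW_isC. apply isC_const. Qed.

Lemma isW_plus f g p a b a' b' : isW f p a b -> isW g p a' b' ->
  isW (fun q => f q + g q)%C p (a + a')%C (b + b')%C.
Proof.
  intros Hf Hg eps He.
  destruct (Hf (eps / 2)) as [d1 [d10 Hd1]]; [lra |].
  destruct (Hg (eps / 2)) as [d2 [d20 Hd2]]; [lra |].
  exists (Rmin d1 d2). split; [apply Rmin_pos; auto |]. intros q Hq.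
  specialize (Hd1 q (Rlt_le_trans _ _ _ Hq (Rmin_l _ _))).
  specialize (Hd2 q (Rlt_le_trans _ _ _ Hq (Rmin_r _ _))).
  replace (f q + g q - (f p + g p) - (q - p) * (a + a') - Cconj (q - p) * (b + b'))%C
    with ((f q - f p - (q - p) * a - Cconj (q - p) * b)
      + (g q - g p - (q - p) * a' - Cconj (q - p) * b'))%C by ring.
  eapply Rle_trans; [apply Cmod_triangle |]. lra.
Qed.

Lemma isW_conj f p a b : isW f p a b -> isW (fun q => Cconj (f q)) p (Cconj b) (Cconj a).
Proof.
  intros Hf eps He. destruct (Hf eps He) as [d [d0 Hd]].
  exists d. split; auto. intros q Hq. specialize (Hd q Hq).
  rewrite <- Cmod_conj in Hd. eapply Rle_trans; [| exact Hd]. right. f_equal.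
  rewrite !Cminus_conj, !Cmult_conj, !Cminus_conj, !Cconj_conj. ring.
Qed.

(* The estimate is that of [isC_curve], with the parameter interval replaced by a disk. *)
Lemma isW_comp f g p l a b : isC f (g p) l -> isW g p a b ->
  isW (fun q => f (g q)) p (l * a)%C (l * b)%C.
Proof.
  intros Hf Hg eps He.
  rewrite isC_eps in Hf.
  pose proof (Cmod_ge_0 l) as Hl. pose proof (Cmod_ge_0 a) as Ha. pose proof (Cmod_ge_0 b) as Hb.
  set (K := Cmod a + Cmod b + 1).
  assert (HK : 0 < K) by (unfold K; lra).
  assert (A1 : 0 < eps / (2 * K)) by (apply Rdiv_lt_0_compat; lra).
  assert (A2 : 0 < eps / (2 * (Cmod l + 1))) by (apply Rdiv_lt_0_compat; lra).
  destruct (Hf _ A1) as [e1 [e10 H1]].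
  destruct (Hg _ A2) as [e2 [e20 H2]].
  destruct (Hg 1 Rlt_0_1) as [e3 [e30 H3]].
  assert (A4 : 0 < e1 / K) by (apply Rdiv_lt_0_compat; lra).
  exists (Rmin (Rmin e2 e3) (e1 / K)). split; [repeat apply Rmin_pos; auto |].
  intros q Hq.
  assert (Hs2 : Cmod (q - p) < e2).
  { eapply Rlt_le_trans; [exact Hq |]. eapply Rle_trans; [apply Rmin_l | apply Rmin_l]. }
  assert (Hs3 : Cmod (q - p) < e3).
  { eapply Rlt_le_trans; [exact Hq |]. eapply Rle_trans; [apply Rmin_l | apply Rmin_r]. }
  assert (Hs1 : Cmod (q - p) < e1 / K).
  { eapply Rlt_le_trans; [exact Hq |]. apply Rmin_r. }
  specialize (H2 q Hs2). specialize (H3 q Hs3). pose proof (Cmod_ge_0 (q - p)) as Hp.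
  assert (H4 : Cmod (g q - g p) <= K * Cmod (q - p)).
  { replace (g q - g p)%C with ((g q - g p - (q - p) * a - Cconj (q - p) * b)
      + ((q - p) * a + Cconj (q - p) * b))%C by ring.
    eapply Rle_trans; [apply Cmod_triangle |].
    pose proof (Cmod_triangle ((q - p) * a) (Cconj (q - p) * b)) as HT.
    rewrite !Cmod_mult, Cmod_conj in HT. unfold K. lra. }
  assert (H5 : Cmod (g q - g p) < e1).
  { eapply Rle_lt_trans; [exact H4 |].
    apply Rlt_le_trans with (K * (e1 / K)).
    - apply Rmult_lt_compat_l; lra.
    - right; field; lra. }
  specialize (H1 _ H5).
  replace (f (g q) - f (g p) - (q - p) * (l * a) - Cconj (q - p) * (l * b))%C
    with ((f (g q) - f (g p) - (g q - g p) * l)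
      + (g q - g p - (q - p) * a - Cconj (q - p) * b) * l)%C by ring.
  eapply Rle_trans; [apply Cmod_triangle |]. rewrite Cmod_mult.
  apply Rle_trans with (eps / 2 * Cmod (q - p) + eps / 2 * Cmod (q - p)); [| lra].
  apply Rplus_le_compat.
  - eapply Rle_trans; [exact H1 |].
    eapply Rle_trans; [apply Rmult_le_compat_l; [lra | exact H4] |].
    right; field; lra.
  - eapply Rle_trans; [apply Rmult_le_compat_r; [exact Hl | exact H2] |].
    apply Rle_trans with (eps / (2 * (Cmod l + 1)) * Cmod (q - p) * (Cmod l + 1)).
    + apply Rmult_le_compat_l; [| lra]. apply Rmult_le_pos; lra.
    + right; field; lra.
Qed.

Lemma isW_scal (c : C) f p a b : isW f p a b -> isW (fun q => c * f q)%C p (c * a)%C (c * b)%C.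
Proof.
  intros Hf. apply (isW_comp (fun z => c * z)%C f); auto.
  eapply isC_eq; [apply isC_mult; [apply isC_const | apply isC_id] |]. simpl. ring.
Qed.

Lemma isW_opp f p a b : isW f p a b -> isW (fun q => - f q)%C p (- a)%C (- b)%C.
Proof.
  intros Hf. apply (isW_eq _ p (- (1) * a)%C (- (1) * b)%C); [| ring | ring].
  apply (isW_comp (fun z => - z)%C f); auto. apply isC_opp. apply isC_id.
Qed.

Lemma isW_minus f g p a b a' b' : isW f p a b -> isW g p a' b' ->
  isW (fun q => f q - g q)%C p (a - a')%C (b - b')%C.
Proof. intros Hf Hg. apply isW_plus; auto. apply isW_opp; auto. Qed.

(* By polarization, from the chain rule for the square. *)
Lemma isW_mult f g p a b a' b' : isW f p a b -> isW g p a' b' ->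
  isW (fun q => f q * g q)%C p (a * g p + f p * a')%C (b * g p + f p * b')%C.
Proof.
  intros Hf Hg.
  assert (Hs : forall z, isC (fun z => z * z)%C z (2 * z)%C).
  { intros z. eapply isC_eq; [apply isC_mult; apply isC_id |]. cbv beta; ring. }
  assert (H := isW_scal (/ 4)%C _ _ _ _ (isW_minus _ _ _ _ _ _ _
    (isW_comp (fun z => z * z)%C (fun q => f q + g q)%C p _ _ _ (Hs _) (isW_plus _ _ _ _ _ _ _ Hf Hg))
    (isW_comp (fun z => z * z)%C (fun q => f q - g q)%C p _ _ _ (Hs _) (isW_minus _ _ _ _ _ _ _ Hf Hg)))).
  cbv beta in H.
  apply (isW_ext _ (fun q => f q * g q)%C _ _ _ 1) in H; [| lra |].
  - eapply isW_eq; [exact H | |]; field.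
  - intros q _. field.
Qed.

Lemma isW_inv f p a b : isW f p a b -> f p <> 0%C ->
  isW (fun q => / f q)%C p (- a / (f p * f p))%C (- b / (f p * f p))%C.
Proof.
  intros Hf H0. apply (isW_eq _ p (- / (f p * f p) * a)%C (- / (f p * f p) * b)%C).
  - apply (isW_comp (fun z => / z)%C f); auto. apply isC_inv_at; auto.
  - field; auto.
  - field; auto.
Qed.

Lemma isG_isW h p w : isG h p w -> isW (fun q => RtoC (h q)) p (w / 2)%C (Cconj w / 2)%C.
Proof.
  intros H eps He. destruct (H eps He) as [d [d0 Hd]].
  exists d. split; auto. intros q Hq. specialize (Hd q Hq).
  eapply Rle_trans; [| exact Hd]. right.
  replace (RtoC (h q) - RtoC (h p) - (q - p) * (w / 2) - Cconj (q - p) * (Cconj w / 2))%C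
    with (RtoC (h q - h p - fst ((q - p) * w)%C)).
  - apply Cmod_R.
  - rewrite !RtoC_minus, re_half, Cmult_conj. field.
Qed.

Lemma isW_isd f p a b : isW f p a b ->
  isd du (fun q => fst (f q)) p (fst (a + b)%C) /\
  isd du (fun q => snd (f q)) p (snd (a + b)%C) /\
  isd dv (fun q => fst (f q)) p (fst (Ci * (a - b))%C) /\
  isd dv (fun q => snd (f q)) p (snd (Ci * (a - b))%C).
Proof.
  intros H. destruct p as [u v].
  assert (A : isRC (fun s => f (s, v)) u (a + b)%C).
  { apply isRC_eps. intros eps He. destruct (H eps He) as [d [d0 Hd]].
    exists d. split; auto. intros s Hs.
    assert (E : ((s, v) - (u, v))%C = RtoC (s - u)).
    { unfold RtoC, Cminus, Cplus, Copp; simpl. f_equal; ring. }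
    specialize (Hd (s, v)). rewrite E, Cmod_R in Hd. specialize (Hd Hs).
    replace (f (s, v) - f (u, v) - RtoC (s - u) * (a + b))%C
      with (f (s, v) - f (u, v) - RtoC (s - u) * a - Cconj (RtoC (s - u)) * b)%C; auto.
    replace (Cconj (RtoC (s - u))) with (RtoC (s - u)) by (unfold Cconj, RtoC; simpl; f_equal; ring).
    ring. }
  assert (B : isRC (fun s => f (u, s)) v (Ci * (a - b))%C).
  { apply isRC_eps. intros eps He. destruct (H eps He) as [d [d0 Hd]].
    exists d. split; auto. intros s Hs.
    assert (E : ((u, s) - (u, v))%C = (Ci * RtoC (s - v))%C).
    { unfold RtoC, Ci, Cmult, Cminus, Cplus, Copp; simpl. f_equal; ring. }
    specialize (Hd (u, s)). rewrite E, Cmod_mult, Cmod_Ci, Cmod_R, Rmult_1_l in Hd. specialize (Hd Hs).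
    replace (f (u, s) - f (u, v) - RtoC (s - v) * (Ci * (a - b)))%C
      with (f (u, s) - f (u, v) - Ci * RtoC (s - v) * a - Cconj (Ci * RtoC (s - v)) * b)%C; auto.
    replace (Cconj (Ci * RtoC (s - v))) with (- (Ci * RtoC (s - v)))%C
      by (unfold Cconj, Copp, Ci, Cmult, RtoC; simpl; f_equal; ring).
    ring. }
  destruct A as [A1 A2], B as [B1 B2]. exact (conj A1 (conj A2 (conj B1 B2))).
Qed.

(** The bridge between the Wirtinger calculus and [pd3]: the calculus rules provide [a] and [b], and
    the real partial derivatives identify them, or conversely. *)
Lemma isW_real h p a b l m : isW (fun q => RtoC (h q)) p a b -> isd du h p l -> isd dv h p m ->
  a = Cdiv (l, - m) 2 /\ b = Cdiv (l, m) 2.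
Proof.
  intros H Hu Hv. destruct (isW_isd _ _ _ _ H) as [A [B [D E]]].
  apply isd_pd in A, B, D, E, Hu, Hv. simpl in *.
  assert (Z1 : pd du (fun _ => 0) p = 0) by (apply isd_pd; apply isd_const).
  assert (Z2 : pd dv (fun _ => 0) p = 0) by (apply isd_pd; apply isd_const).
  simpl in Z1, Z2.
  change (fun q : R * R => h q) with h in *.
  rewrite Z1 in B. rewrite Z2 in E. rewrite Hu in A. rewrite Hv in D.
  destruct a as [a1 a2], b as [b1 b2]. simpl in *.
  split; unfold Cdiv, Cinv, Cmult, RtoC; simpl; f_equal; field_simplify; lra.
Qed.

(** * Minimal immersions and adapted frames *)

Lemma vext (V W : R3) : x1 V = x1 W -> x2 V = x2 W -> x3 V = x3 W -> V = W.
Proof.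
  destruct V as [[a b] c], W as [[a' b'] c']. unfold x1, x2, x3; simpl. congruence.
Qed.

Ltac vunf := unfold dot, cross, vscal, vadd, vsub, vadd, vscal, v0, x1, x2, x3; simpl fst; simpl snd.

Definition isd3 (i : dir) (A : C -> R3) (p : C) (V : R3) : Prop :=
  isd i (fun q => x1 (A q)) p (x1 V) /\ isd i (fun q => x2 (A q)) p (x2 V) /\
  isd i (fun q => x3 (A q)) p (x3 V).

Lemma isd3_pd3 i A p V : isd3 i A p V -> pd3 i A p = V.
Proof.
  intros [H1 [H2 H3]]. apply isd_pd in H1, H2, H3. unfold pd3. rewrite H1, H2, H3.
  destruct V as [[a b] c]. reflexivity.
Qed.

Lemma isd3_eq i A p V W : isd3 i A p V -> V = W -> isd3 i A p W.
Proof. intros H <-; exact H. Qed.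

Lemma isd3_ext i A B p V d :
  0 < d -> (forall q, cball p d q -> A q = B q) -> isd3 i A p V -> isd3 i B p V.
Proof.
  intros d0 HE [H1 [H2 H3]].
  repeat split; (eapply isd_ext; [exact d0 | | eassumption]); intros q Hq; cbv beta; rewrite HE; auto.
Qed.

Lemma isd3_smooth U A i p : smooth3 U A -> U p -> isd3 i A p (pd3 i A p).
Proof. intros [H1 [H2 H3]] Hp. split; [| split]; eapply smooth_isd; eauto. Qed.

Lemma smooth3_pd3 U A i : smooth3 U A -> smooth3 U (pd3 i A).
Proof. intros [H1 [H2 H3]]. split; [| split]; apply smooth_pd; auto. Qed.

Lemma isd_dot i A B p V W : isd3 i A p V -> isd3 i B p W ->
  isd i (fun q => dot (A q) (B q)) p (dot V (B p) + dot (A p) W).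
Proof.
  intros [H1 [H2 H3]] [K1 [K2 K3]]. unfold dot. eapply isd_eq.
  - apply isd_plus; [apply isd_plus |]; apply isd_mult; eassumption.
  - simpl. ring.
Qed.

Lemma isd3_const i V p : isd3 i (fun _ => V) p v0.
Proof. repeat split; apply isd_const. Qed.

Lemma isd3_vscal i k A p l V : isd i k p l -> isd3 i A p V ->
  isd3 i (fun q => vscal (k q) (A q)) p (vadd (vscal l (A p)) (vscal (k p) V)).
Proof.
  intros Hk [H1 [H2 H3]].
  split; [| split].
  - exact (isd_mult i k (fun q => x1 (A q)) p _ _ Hk H1).
  - exact (isd_mult i k (fun q => x2 (A q)) p _ _ Hk H2).
  - exact (isd_mult i k (fun q => x3 (A q)) p _ _ Hk H3).
Qed.

Lemma isd3_vadd i A B p V W : isd3 i A p V -> isd3 i B p W ->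
  isd3 i (fun q => vadd (A q) (B q)) p (vadd V W).
Proof.
  intros [H1 [H2 H3]] [K1 [K2 K3]].
  split; [| split].
  - exact (isd_plus i _ _ p _ _ H1 K1).
  - exact (isd_plus i _ _ p _ _ H2 K2).
  - exact (isd_plus i _ _ p _ _ H3 K3).
Qed.

Lemma isd3_vsub i A B p V W : isd3 i A p V -> isd3 i B p W ->
  isd3 i (fun q => vsub (A q) (B q)) p (vsub V W).
Proof.
  intros H K. apply (isd3_vadd i A (fun q => vscal (-1) (B q))); auto.
  eapply isd3_eq; [apply isd3_vscal; [apply isd_const | exact K] |].
  apply vext; vunf; ring.
Qed.

Lemma isd3_cross i A B p V W : isd3 i A p V -> isd3 i B p W ->
  isd3 i (fun q => cross (A q) (B q)) p (vadd (cross V (B p)) (cross (A p) W)).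
Proof.
  intros [H1 [H2 H3]] [K1 [K2 K3]].
  split; [| split].
  - eapply isd_eq; [exact (isd_minus i _ _ p _ _ (isd_mult i _ _ p _ _ H2 K3) (isd_mult i _ _ p _ _ H3 K2)) |].
    vunf; ring.
  - eapply isd_eq; [exact (isd_minus i _ _ p _ _ (isd_mult i _ _ p _ _ H3 K1) (isd_mult i _ _ p _ _ H1 K3)) |].
    vunf; ring.
  - eapply isd_eq; [exact (isd_minus i _ _ p _ _ (isd_mult i _ _ p _ _ H1 K2) (isd_mult i _ _ p _ _ H2 K1)) |].
    vunf; ring.
Qed.

Lemma dot_pos V : V <> v0 -> 0 < dot V V.
Proof.
  intros H. destruct (Rle_lt_dec (dot V V) 0) as [H1 | H1]; auto. exfalso. apply H.
  destruct V as [[a b] c]. unfold dot, x1, x2, x3 in H1; simpl in H1.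
  assert (a = 0) by nra. assert (b = 0) by nra. assert (c = 0) by nra. subst. reflexivity.
Qed.

Lemma dot_zero V : dot V V <= 0 -> V = v0.
Proof.
  intros H. apply NNPP. intros H1. apply dot_pos in H1. lra.
Qed.

(** Lagrange's identity for [V] and [cross a b], with [V x (a x b)] expanded by the triple product
    rule. *)
Lemma vec_zero V a b :
  dot V a = 0 -> dot V b = 0 -> dot V (cross a b) = 0 -> cross a b <> v0 -> V = v0.
Proof.
  intros H1 H2 H3 H4. apply dot_pos in H4. apply dot_zero.
  assert (E : dot V V * dot (cross a b) (cross a b) = (dot V (cross a b)) ^ 2
    + dot (vsub (vscal (dot V b) a) (vscal (dot V a) b)) (vsub (vscal (dot V b) a) (vscal (dot V a) b))).
  { vunf. ring. }
  rewrite H1, H2, H3 in E.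
  replace (dot (vsub (vscal 0 a) (vscal 0 b)) (vsub (vscal 0 a) (vscal 0 b))) with 0 in E by (vunf; ring).
  nra.
Qed.

Lemma vnorm_pos V : V <> v0 -> 0 < vnorm V.
Proof. intros H. apply sqrt_lt_R0. apply dot_pos; auto. Qed.

Lemma vnorm_sq V : vnorm V * vnorm V = dot V V.
Proof. apply sqrt_sqrt. unfold dot. nra. Qed.

Section Immersion.
Variables (U : C -> Prop) (X : C -> R3).
Hypothesis HU : isopen U.
Hypothesis HX : immersion U X.

Let Hs : smooth3 U X := proj1 HX.

Lemma gauss_dot p i : U p -> dot (gauss X p) (pd3 i X p) = 0.
Proof. intros _. unfold gauss. destruct i; vunf; ring. Qed.

Lemma gauss_unit p : U p -> dot (gauss X p) (gauss X p) = 1.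
Proof.
  intros Hp. pose proof (vnorm_pos _ (proj2 HX p Hp)) as H.
  pose proof (vnorm_sq (cross (pd3 du X p) (pd3 dv X p))) as H2.
  unfold gauss. set (n := cross _ _) in *. set (k := vnorm n) in *.
  replace (dot (vscal (/ k) n) (vscal (/ k) n)) with (/ k * / k * dot n n) by (vunf; ring).
  rewrite <- H2. field. lra.
Qed.

Lemma gauss_isd3 i p : U p -> isd3 i (gauss X) p (pd3 i (gauss X) p).
Proof.
  intros Hp.
  assert (H : exists V, isd3 i (gauss X) p V).
  { eexists. unfold gauss.
    pose proof (isd3_smooth U _ i p (smooth3_pd3 U X du Hs) Hp) as A.
    pose proof (isd3_smooth U _ i p (smooth3_pd3 U X dv Hs) Hp) as B.
    pose proof (isd3_cross i _ _ p _ _ A B) as N.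
    apply isd3_vscal; [| exact N].
    apply isd_inv.
    - unfold vnorm. apply isd_sqrt; [apply isd_dot; exact N |].
      apply dot_pos. apply (proj2 HX p Hp).
    - pose proof (vnorm_pos _ (proj2 HX p Hp)). lra. }
  destruct H as [V HV]. rewrite (isd3_pd3 _ _ _ _ HV). exact HV.
Qed.

Lemma isd_zero_open i f p : U p -> (forall q, U q -> f q = 0) -> isd i f p 0.
Proof.
  intros Hp H. destruct (HU p Hp) as [d [d0 Hd]].
  apply (isd_ext i (fun _ => 0) f p 0 d d0); [| apply isd_const].
  intros q Hq. symmetry. apply H. auto.
Qed.

Lemma isd_unique i f p l m : isd i f p l -> isd i f p m -> l = m.
Proof. intros H1 H2. rewrite <- (isd_pd _ _ _ _ H1). apply isd_pd; auto. Qed.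

(** Derivative of the orthogonality of the normal and the tangent vector [pd3 j X]. Together with
    the symmetry of second derivatives it makes the second fundamental form symmetric. *)
Lemma gauss_second i j p : U p ->
  dot (pd3 i (gauss X) p) (pd3 j X p) + dot (gauss X p) (pd3 i (pd3 j X) p) = 0.
Proof.
  intros Hp. apply (isd_unique i (fun q => dot (gauss X q) (pd3 j X q)) p).
  - apply isd_dot; [apply gauss_isd3; auto |].
    apply (isd3_smooth U); auto. apply smooth3_pd3; auto.
  - apply isd_zero_open; auto. intros q Hq. apply gauss_dot; auto.
Qed.

Lemma gauss_dgauss i p : U p -> dot (gauss X p) (pd3 i (gauss X) p) = 0.
Proof.
  intros Hp.
  assert (H : isd i (fun q => dot (gauss X q) (gauss X q)) p
     (dot (pd3 i (gauss X) p) (gauss X p) + dot (gauss X p) (pd3 i (gauss X) p))).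
  { apply isd_dot; apply gauss_isd3; auto. }
  assert (H0 : isd i (fun q => dot (gauss X q) (gauss X q)) p 0).
  { destruct (HU p Hp) as [d [d0 Hd]].
    apply (isd_ext i (fun _ => 1) _ p 0 d d0); [| apply isd_const].
    intros q Hq. symmetry. apply gauss_unit. auto. }
  pose proof (isd_unique _ _ _ _ _ H H0) as E.
  replace (dot (pd3 i (gauss X) p) (gauss X p)) with (dot (gauss X p) (pd3 i (gauss X) p)) in E by (vunf; ring).
  lra.
Qed.

Lemma schwarz3 p : U p -> pd3 du (pd3 dv X) p = pd3 dv (pd3 du X) p.
Proof.
  intros Hp. destruct Hs as [H1 [H2 H3]].
  apply vext.
  - exact (schwarz U (fun q => x1 (X q)) p HU H1 Hp).
  - exact (schwarz U (fun q => x2 (X q)) p HU H2 Hp).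
  - exact (schwarz U (fun q => x3 (X q)) p HU H3 Hp).
Qed.

Lemma ff2_sym i j p : U p -> dot (pd3 i (gauss X) p) (pd3 j X p) = - ff2 X i j p.
Proof.
  intros Hp. unfold ff2.
  replace (dot (pd3 i X p) (pd3 j (gauss X) p)) with (dot (pd3 j (gauss X) p) (pd3 i X p)) by (vunf; ring).
  pose proof (gauss_second i j p Hp). pose proof (gauss_second j i p Hp).
  assert (pd3 i (pd3 j X) p = pd3 j (pd3 i X) p).
  { destruct i, j; auto; [| symmetry]; apply schwarz3; auto. }
  rewrite H1 in H. lra.
Qed.

Hypothesis HC : conformal U X.

Lemma conformal_E p : U p -> 0 < ff1 X du du p /\
  vnorm (cross (pd3 du X p) (pd3 dv X p)) = ff1 X du du p /\ det1 X p = ff1 X du du p * ff1 X du du p.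
Proof.
  intros Hp. destruct (HC p Hp) as [H1 H2].
  assert (E : dot (cross (pd3 du X p) (pd3 dv X p)) (cross (pd3 du X p) (pd3 dv X p))
    = ff1 X du du p * ff1 X dv dv p - ff1 X du dv p * ff1 X du dv p).
  { unfold ff1. vunf. ring. }
  rewrite <- H1, H2 in E. rewrite Rmult_0_l, Rminus_0_r in E.
  pose proof (dot_pos _ (proj2 HX p Hp)) as H3. rewrite E in H3.
  assert (H0 : 0 <= ff1 X du du p) by (unfold ff1, dot; nra).
  assert (H4 : 0 < ff1 X du du p) by nra.
  split; auto. split.
  - unfold vnorm. rewrite E. apply sqrt_square. lra.
  - unfold det1. rewrite <- H1, H2. ring.
Qed.

(** In a conformal parametrization the cross product with the normal is the rotation by a right
    angle of the tangent plane, that is, multiplication by [i] in the parameter. All relations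
    between the Gauss map and the Weierstrass forms come from this. *)
Lemma gauss_cross p : U p ->
  cross (gauss X p) (pd3 du X p) = pd3 dv X p /\
  cross (gauss X p) (pd3 dv X p) = vscal (-1) (pd3 du X p).
Proof.
  intros Hp. destruct (conformal_E p Hp) as [H0 [H1 _]]. destruct (HC p Hp) as [H2 H3].
  unfold gauss. rewrite H1. set (E := ff1 X du du p) in *.
  assert (HE : / E * E = 1) by (field; lra).
  unfold ff1 in *. set (a := pd3 du X p) in *. set (b := pd3 dv X p) in *.
  split.
  - replace (cross (vscal (/ E) (cross a b)) a) with (vsub (vscal (/ E * dot a a) b) (vscal (/ E * dot a b) a))
      by (apply vext; vunf; ring).
    fold E. rewrite H3, HE. apply vext; vunf; ring.
  - replace (cross (vscal (/ E) (cross a b)) b) with (vsub (vscal (/ E * dot a b) b) (vscal (/ E * dot b b) a))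
      by (apply vext; vunf; ring).
    rewrite <- H2, H3, HE. apply vext; vunf; ring.
Qed.

Hypothesis HM : forall p, U p -> mean_curvature X p = 0.

(** Differentiating the two conformality relations shows that the Laplacian is orthogonal to both
    tangent vectors; its normal component is a multiple of the mean curvature. *)
Lemma laplace_zero p : U p -> vadd (pd3 du (pd3 du X) p) (pd3 dv (pd3 dv X) p) = v0.
Proof.
  intros Hp. destruct (conformal_E p Hp) as [H0 [H1 HD]]. destruct (HC p Hp) as [H2 H3].
  assert (Suu := isd3_smooth U _ du p (smooth3_pd3 U X du Hs) Hp).
  assert (Suv := isd3_smooth U _ du p (smooth3_pd3 U X dv Hs) Hp).
  assert (Svu := isd3_smooth U _ dv p (smooth3_pd3 U X du Hs) Hp).
  assert (Svv := isd3_smooth U _ dv p (smooth3_pd3 U X dv Hs) Hp).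
  assert (A : forall i, isd i (fun q => dot (pd3 du X q) (pd3 du X q) - dot (pd3 dv X q) (pd3 dv X q)) p 0).
  { intros i. apply isd_zero_open; auto. intros q Hq. destruct (HC q Hq) as [E _].
    unfold ff1 in E. lra. }
  assert (B : forall i, isd i (fun q => dot (pd3 du X q) (pd3 dv X q)) p 0).
  { intros i. apply isd_zero_open; auto. intros q Hq. destruct (HC q Hq) as [_ E]. exact E. }
  pose proof (isd_unique _ _ _ _ _ (isd_minus _ _ _ _ _ _ (isd_dot _ _ _ _ _ _ Suu Suu) (isd_dot _ _ _ _ _ _ Suv Suv)) (A du)) as Au.
  pose proof (isd_unique _ _ _ _ _ (isd_minus _ _ _ _ _ _ (isd_dot _ _ _ _ _ _ Svu Svu) (isd_dot _ _ _ _ _ _ Svv Svv)) (A dv)) as Av.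
  pose proof (isd_unique _ _ _ _ _ (isd_dot _ _ _ _ _ _ Suu Suv) (B du)) as Bu.
  pose proof (isd_unique _ _ _ _ _ (isd_dot _ _ _ _ _ _ Svu Svv) (B dv)) as Bv.
  pose proof (gauss_second du du p Hp) as Nu. pose proof (gauss_second dv dv p Hp) as Nv.
  pose proof (HM p Hp) as Hm. unfold mean_curvature in Hm. rewrite HD, <- H2, H3 in Hm.
  assert (Hf : ff2 X du du p + ff2 X dv dv p = 0).
  { assert (EE : ff2 X du du p + ff2 X dv dv p = 2 * ff1 X du du p *
     ((ff2 X du du p * ff1 X du du p - 2 * ff2 X du dv p * 0 + ff2 X dv dv p * ff1 X du du p) /
        (2 * (ff1 X du du p * ff1 X du du p)))) by (field; lra).
    rewrite EE, Hm. ring. }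
  pose proof (ff2_sym du du p Hp) as Su. pose proof (ff2_sym dv dv p Hp) as Sv.
  rewrite <- (schwarz3 p Hp) in *.
  set (a := pd3 du X p) in *. set (b := pd3 dv X p) in *.
  set (uu := pd3 du (pd3 du X) p) in *. set (uv := pd3 du (pd3 dv X) p) in *.
  set (vv := pd3 dv (pd3 dv X) p) in *.
  assert (dsym : forall V W, dot V W = dot W V) by (intros; vunf; ring).
  assert (dadd : forall V W Y, dot (vadd V W) Y = dot V Y + dot W Y) by (intros; vunf; ring).
  apply (vec_zero _ a b).
  - rewrite dadd. rewrite (dsym a uu), (dsym b uv) in Au. rewrite (dsym a vv) in Bv. lra.
  - rewrite dadd. rewrite (dsym a uv), (dsym b vv) in Av. rewrite (dsym a uv) in Bu. lra.
  - assert (dot (vadd uu vv) (gauss X p) = 0).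
    { rewrite dadd, (dsym uu), (dsym vv). lra. }
    unfold gauss in H. fold a b in H.
    replace (dot (vadd uu vv) (vscal (/ vnorm (cross a b)) (cross a b)))
      with (/ vnorm (cross a b) * dot (vadd uu vv) (cross a b)) in H by (vunf; ring).
    apply Rmult_integral in H. destruct H as [H | H]; auto.
    exfalso. assert (0 < / vnorm (cross a b)); [| lra]. apply Rinv_0_lt_compat.
    rewrite H1. exact H0.
  - apply (proj2 HX p Hp).
Qed.

Definition xcoord (x : R3 -> R) : Prop := x = x1 \/ x = x2 \/ x = x3.

(** The Cauchy-Riemann equations for [h_u - i h_v] are the harmonicity of [h] and the symmetry of
    its mixed derivatives. *)
Lemma weierstrass_HolD x : xcoord x ->
  HolD U (weierstrass_form x X)
    (fun p => (pd du (pd du (fun q => x (X q))) p, - pd du (pd dv (fun q => x (X q))) p)).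
Proof.
  intros Hx p Hp. set (h := fun q => x (X q)).
  assert (Sh : smooth U h).
  { destruct Hs as [H1 [H2 H3]]. destruct Hx as [-> | [-> | ->]]; assumption. }
  assert (Hl : pd du (pd du h) p + pd dv (pd dv h) p = 0).
  { pose proof (laplace_zero p Hp) as HL.
    destruct Hx as [E | [E | E]]; unfold h; rewrite E.
    - apply (f_equal x1) in HL. exact HL.
    - apply (f_equal x2) in HL. exact HL.
    - apply (f_equal x3) in HL. exact HL. }
  pose proof (schwarz U h p HU Sh Hp) as HS.
  pose proof (smooth_pd U h du Sh) as Su. pose proof (smooth_pd U h dv Sh) as Sv.
  split.
  - unfold weierstrass_form. fold h. apply isC_isG; cbn [fst snd].
    + pose proof (smooth_isG U _ p HU Su Hp) as G.
      change (isG (pd du h) p (pd du (pd du h) p, - pd du (pd dv h) p)).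
      rewrite HS. exact G.
    + pose proof (smooth_isG U _ p HU Sv Hp) as G.
      intros eps He. destruct (G eps He) as [d [d0 Hd]]. exists d. split; auto.
      intros q Hq. specialize (Hd q Hq). eapply Rle_trans; [| exact Hd].
      right. rewrite <- Rabs_Ropp. f_equal.
      assert (E : pd du (pd du h) p = - pd dv (pd dv h) p) by lra. rewrite E.
      generalize (pd dv h q), (pd dv h p), (pd dv (pd dv h) p), (pd du (pd dv h) p).
      intros; simpl; ring.
  - apply cont_pair. split; cbn [fst snd].
    + exact (smooth_cont U _ p (smooth_pd U _ du Su) Hp).
    + apply (continuous_opp (V := R_NormedModule)). exact (smooth_cont U _ p (smooth_pd U _ du Sv) Hp).
Qed.
End Immersion.

(** A positively oriented orthonormal basis, recorded by the coordinate formulas for [dot] and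
    [cross], since these are the forms in which it is used for rewriting. *)
Record frame (e1 e2 e3 : R3) : Prop := {
  frame_dot : forall V W, dot V W = dot V e1 * dot W e1 + dot V e2 * dot W e2 + dot V e3 * dot W e3;
  frame_c1 : forall V W, dot (cross V W) e1 = dot V e2 * dot W e3 - dot V e3 * dot W e2;
  frame_c2 : forall V W, dot (cross V W) e2 = dot V e3 * dot W e1 - dot V e1 * dot W e3;
  frame_c3 : forall V W, dot (cross V W) e3 = dot V e1 * dot W e2 - dot V e2 * dot W e1
}.

Lemma dot_opp_r V e : dot V (vscal (-1) e) = - dot V e.
Proof. vunf. ring. Qed.

(** Two signs at once preserve the orientation; the effect is to move the centre of projection to
    the antipode. *)
Lemma frame_flip e1 e2 e3 : frame e1 e2 e3 -> frame e1 (vscal (-1) e2) (vscal (-1) e3).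
Proof.
  intros [H0 H1 H2 H3]. split; intros; rewrite ?dot_opp_r.
  - rewrite H0. ring.
  - rewrite H1. ring.
  - rewrite H2. ring.
  - rewrite H3. ring.
Qed.

Lemma frame_std : frame (1, 0, 0) (0, 1, 0) (0, 0, 1).
Proof. split; intros; vunf; ring. Qed.

Lemma frame_exists (n : R3) : dot n n = 1 -> exists e1 e2, frame e1 e2 n.
Proof.
  destruct n as [[a b] c]. intros H. unfold dot, x1, x2, x3 in H; simpl in H.
  destruct (Req_dec (a * a + b * b) 0) as [H0 | H0].
  - assert (a = 0) by nra. assert (b = 0) by nra. subst a b.
    assert (Hc : (c - 1) * (c + 1) = 0) by nra.
    apply Rmult_integral in Hc. destruct Hc as [Hc | Hc].
    + exists (1, 0, 0), (0, 1, 0). replace c with 1 by lra. apply frame_std.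
    + exists (1, 0, 0), (vscal (-1) (0, 1, 0)).
      replace (0, 0, c) with (vscal (-1) (0, 0, 1)).
      * apply frame_flip, frame_std.
      * apply vext; vunf; lra.
  - set (r := sqrt (a * a + b * b)).
    assert (Hr2 : r * r = a * a + b * b) by (apply sqrt_sqrt; nra).
    assert (Hr0 : r <> 0) by (intros E; rewrite E in Hr2; lra).
    set (k := / r). assert (Hk : k * r = 1) by (unfold k; field; auto).
    (* The frame of spherical coordinates at [n]: the unit tangents of the meridian and of the
       parallel. It degenerates on the axis, which was treated separately. The inverse [k] of [r] is
       kept abstract so that only [k * r = 1] is used. *)
    exists (a * c * k, b * c * k, - r), (- b * k, a * k, 0).
    assert (E1 : a * a * (k * k) + b * b * (k * k) = 1).
    { replace (a * a * (k * k) + b * b * (k * k)) with (k * k * (a * a + b * b)) by ring.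
      rewrite <- Hr2. replace (k * k * (r * r)) with ((k * r) * (k * r)) by ring. rewrite Hk. ring. }
    assert (Caa : (a * c * k) * (a * c * k) + (- b * k) * (- b * k) + a * a = 1).
    {
      replace ((a * c * k) * (a * c * k)) with (a * a * (k * k) * (c * c)) by ring.
      replace (c * c) with (1 - r * r) by lra.
      replace (a * a * (k * k) * (1 - r * r)) with (a * a * (k * k) - a * a * ((k * r) * (k * r))) by ring.
      rewrite Hk. lra. }
    assert (Cbb : (b * c * k) * (b * c * k) + (a * k) * (a * k) + b * b = 1).
    { replace ((b * c * k) * (b * c * k)) with (b * b * (k * k) * (c * c)) by ring.
      replace (c * c) with (1 - r * r) by lra.
      replace (b * b * (k * k) * (1 - r * r)) with (b * b * (k * k) - b * b * ((k * r) * (k * r))) by ring.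
      rewrite Hk. lra. }
    assert (Cab : (a * c * k) * (b * c * k) + (- b * k) * (a * k) + a * b = 0).
    { replace ((a * c * k) * (b * c * k)) with (a * b * (k * k) * (c * c)) by ring.
      replace (c * c) with (1 - r * r) by lra.
      replace (a * b * (k * k) * (1 - r * r)) with (a * b * (k * k) - a * b * ((k * r) * (k * r))) by ring.
      rewrite Hk. ring. }
    assert (Cac : (a * c * k) * - r + a * c = 0).
    { replace ((a * c * k) * - r) with (- (a * c * (k * r))) by ring. rewrite Hk. ring. }
    assert (Cbc : (b * c * k) * - r + b * c = 0).
    { replace ((b * c * k) * - r) with (- (b * c * (k * r))) by ring. rewrite Hk. ring. }
    assert (Ccc : r * r + c * c = 1) by lra.
    assert (D1 : a * k * r = a) by (rewrite Rmult_assoc, Hk; ring).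
    assert (D2 : b * k * r = b) by (rewrite Rmult_assoc, Hk; ring).
    assert (D3 : (a * a + b * b) * k = r).
    { rewrite <- Hr2. replace (r * r * k) with (r * (k * r)) by ring. rewrite Hk. ring. }
    assert (D4 : (a * a + b * b) * (k * k) = 1) by lra.
    split; intros [[v1 v2] v3] [[w1 w2] w3]; vunf.
    + transitivity (v1 * w1 * ((a * c * k) * (a * c * k) + (- b * k) * (- b * k) + a * a)
        + v2 * w2 * ((b * c * k) * (b * c * k) + (a * k) * (a * k) + b * b)
        + (v1 * w2 + v2 * w1) * ((a * c * k) * (b * c * k) + (- b * k) * (a * k) + a * b)
        + (v1 * w3 + v3 * w1) * ((a * c * k) * - r + a * c)
        + (v2 * w3 + v3 * w2) * ((b * c * k) * - r + b * c)
        + v3 * w3 * (r * r + c * c)); [| ring].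
      rewrite Caa, Cbb, Cab, Cac, Cbc, Ccc. ring.
    + transitivity ((v2 * w3 - v3 * w2) * (a * k * c) + (v3 * w1 - v1 * w3) * (b * k * c)
         - (v1 * w2 - v2 * w1) * ((a * a + b * b) * k)); [rewrite D3 |]; ring.
    + transitivity (- (v2 * w3 - v3 * w2) * (b * k * (r * r + c * c)) + (v3 * w1 - v1 * w3) * (a * k * (r * r + c * c)));
       [rewrite Ccc; ring |].
      transitivity (- (v2 * w3 - v3 * w2) * (b * k * r * r + b * k * (c * c)) + (v3 * w1 - v1 * w3) * (a * k * r * r + a * k * (c * c))); [ring |].
      rewrite D1, D2. ring.
    + transitivity ((v2 * w3 - v3 * w2) * (a * k * r) + (v3 * w1 - v1 * w3) * (b * k * r)
        + (v1 * w2 - v2 * w1) * (c * ((a * a + b * b) * (k * k)))); [rewrite D1, D2, D4 |]; ring.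
Qed.

(** * Weierstrass data in an adapted frame *)

Definition Fe (e : R3) (X : C -> R3) (p : C) : C :=
  (dot (pd3 du X p) e, - dot (pd3 dv X p) e).

Lemma Fe_HolD U X e : isopen U -> immersion U X -> conformal U X ->
  (forall p, U p -> mean_curvature X p = 0) -> exists F', HolD U (Fe e X) F'.
Proof.
  intros HU HX HC HM.
  pose proof (weierstrass_HolD U X HU HX HC HM x1 (or_introl eq_refl)) as H1.
  pose proof (weierstrass_HolD U X HU HX HC HM x2 (or_intror (or_introl eq_refl))) as H2.
  pose proof (weierstrass_HolD U X HU HX HC HM x3 (or_intror (or_intror eq_refl))) as H3.
  eexists. eapply HolD_ext.
  2:{ apply (HolD_plus U _ _ _ _ (HolD_mult U _ _ _ _ (HolD_const U (RtoC (x1 e))) H1)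
       (HolD_plus U _ _ _ _ (HolD_mult U _ _ _ _ (HolD_const U (RtoC (x2 e))) H2)
         (HolD_mult U _ _ _ _ (HolD_const U (RtoC (x3 e))) H3))). }
  intros p _. exists 1. split; [lra |]. intros q _.
  unfold weierstrass_form, Fe, pd3, dot.
  generalize (pd du (fun q => x1 (X q)) q), (pd dv (fun q => x1 (X q)) q),
    (pd du (fun q => x2 (X q)) q), (pd dv (fun q => x2 (X q)) q),
    (pd du (fun q => x3 (X q)) q), (pd dv (fun q => x3 (X q)) q).
  intros. unfold RtoC, Cplus, Cmult, x1, x2, x3; simpl. f_equal; ring.
Qed.

Lemma isG_plus h k p w z : isG h p w -> isG k p z -> isG (fun q => h q + k q) p (w + z)%C.
Proof.
  intros Hf Hg eps He.
  destruct (Hf (eps / 2)) as [d1 [d10 Hd1]]; [lra |].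
  destruct (Hg (eps / 2)) as [d2 [d20 Hd2]]; [lra |].
  exists (Rmin d1 d2). split; [apply Rmin_pos; auto |]. intros q Hq.
  specialize (Hd1 q (Rlt_le_trans _ _ _ Hq (Rmin_l _ _))).
  specialize (Hd2 q (Rlt_le_trans _ _ _ Hq (Rmin_r _ _))).
  replace (h q + k q - (h p + k p) - fst ((q - p) * (w + z))%C)
    with ((h q - h p - fst ((q - p) * w)%C) + (k q - k p - fst ((q - p) * z)%C)) by (simpl; ring).
  eapply Rle_trans; [apply Rabs_triang |]. lra.
Qed.

Lemma isG_scal a h p w : isG h p w -> isG (fun q => a * h q) p (RtoC a * w)%C.
Proof.
  intros Hf eps He. assert (Ha : 0 < Rabs a + 1) by (pose proof (Rabs_pos a); lra).
  destruct (Hf (eps / (Rabs a + 1))) as [d [d0 Hd]]; [apply Rdiv_lt_0_compat; lra |].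
  exists d. split; auto. intros q Hq. specialize (Hd q Hq).
  replace (a * h q - a * h p - fst ((q - p) * (RtoC a * w))%C)
    with (a * (h q - h p - fst ((q - p) * w)%C)) by (simpl; ring).
  rewrite Rabs_mult.
  apply Rle_trans with ((Rabs a + 1) * (eps / (Rabs a + 1) * Cmod (q - p))).
  - apply Rmult_le_compat; try apply Rabs_pos; auto. lra.
  - right. field. lra.
Qed.

Lemma Fe_isG U X e p : isopen U -> smooth3 U X -> U p -> isG (fun q => dot (X q) e) p (Fe e X p).
Proof.
  intros HU [H1 [H2 H3]] Hp.
  pose proof (isG_scal (x1 e) _ _ _ (smooth_isG U _ p HU H1 Hp)) as G1.
  pose proof (isG_scal (x2 e) _ _ _ (smooth_isG U _ p HU H2 Hp)) as G2.
  pose proof (isG_scal (x3 e) _ _ _ (smooth_isG U _ p HU H3 Hp)) as G3.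
  pose proof (isG_plus _ _ _ _ _ (isG_plus _ _ _ _ _ G1 G2) G3) as G. cbv beta in G.
  intros eps He. destruct (G eps He) as [d [d0 Hd]]. exists d. split; auto. intros q Hq.
  specialize (Hd q Hq). eapply Rle_trans; [| exact Hd]. right. f_equal.
  unfold Fe, pd3, dot.
  generalize (pd du (fun q => x1 (X q)) p), (pd dv (fun q => x1 (X q)) p),
    (pd du (fun q => x2 (X q)) p), (pd dv (fun q => x2 (X q)) p),
    (pd du (fun q => x3 (X q)) p), (pd dv (fun q => x3 (X q)) p).
  intros. unfold x1, x2, x3; simpl. ring.
Qed.

Section Weierstrass.
Variables (U : C -> Prop) (X : C -> R3) (e1 e2 e3 : R3).
Hypothesis HU : isopen U.
Hypothesis HX : immersion U X.
Hypothesis HC : conformal U X.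
Hypothesis He : frame e1 e2 e3.

(** In the classical representation [om], [Fe e3] and [omb] are [om], [G om] and [- G^2 om].
    Conformality is the equation [om * omb + Fe e3 ^ 2 = 0]. *)
Definition om p := (Fe e1 X p - Ci * Fe e2 X p)%C.
Definition omb p := (Fe e1 X p + Ci * Fe e2 X p)%C.
Definition nu p : C := (dot (gauss X p) e1, dot (gauss X p) e2).

(** The frame components of [gauss_cross] in complex form. They contain no division and hold also
    where the normal equals [e3]; the first one later yields the limit normal of the transformed
    surface. *)
Lemma weier_relations p : U p ->
  (RtoC (1 + dot (gauss X p) e3) * om p = Cconj (nu p) * Fe e3 X p)%C /\
  (nu p * Fe e3 X p = - RtoC (1 - dot (gauss X p) e3) * omb p)%C /\
  (nu p * om p - Cconj (nu p) * omb p = 2 * Fe e3 X p)%C.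
Proof.
  intros Hp. destruct (gauss_cross U X HX HC p Hp) as [H1 H2].
  destruct He as [_ C1 C2 C3].
  pose proof (f_equal (fun V => dot V e1) H1) as A1. cbv beta in A1. rewrite C1 in A1.
  pose proof (f_equal (fun V => dot V e2) H1) as A2. cbv beta in A2. rewrite C2 in A2.
  pose proof (f_equal (fun V => dot V e3) H1) as A3. cbv beta in A3. rewrite C3 in A3.
  pose proof (f_equal (fun V => dot V e1) H2) as B1. cbv beta in B1. rewrite C1 in B1.
  pose proof (f_equal (fun V => dot V e2) H2) as B2. cbv beta in B2. rewrite C2 in B2.
  pose proof (f_equal (fun V => dot V e3) H2) as B3. cbv beta in B3. rewrite C3 in B3.
  assert (S : forall V e, dot (vscal (-1) V) e = - dot V e) by (intros; vunf; ring).
  rewrite S in B1, B2, B3.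
  unfold om, omb, nu, Fe.
  revert A1 A2 A3 B1 B2 B3.
  generalize (dot (gauss X p) e1), (dot (gauss X p) e2), (dot (gauss X p) e3),
    (dot (pd3 du X p) e1), (dot (pd3 du X p) e2), (dot (pd3 du X p) e3),
    (dot (pd3 dv X p) e1), (dot (pd3 dv X p) e2), (dot (pd3 dv X p) e3).
  intros N1 N2 N3 a1 a2 a3 b1 b2 b3 A1 A2 A3 B1 B2 B3.
  split; [| split]; apply injective_projections; simpl; lra.
Qed.

Lemma nu_sq p : U p -> (nu p * Cconj (nu p) = RtoC (1 - dot (gauss X p) e3 * dot (gauss X p) e3))%C.
Proof.
  intros Hp. pose proof (gauss_unit U X HX p Hp) as H.
  rewrite (frame_dot _ _ _ He) in H. apply injective_projections; simpl; lra.
Qed.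

Lemma Fe_nonzero p : U p -> ~ (om p = 0%C /\ omb p = 0%C /\ Fe e3 X p = 0%C).
Proof.
  intros Hp [H1 [H2 H3]].
  assert (F1 : Fe e1 X p = 0%C).
  { replace (Fe e1 X p) with (/ 2 * (om p + omb p))%C by (unfold om, omb; field). rewrite H1, H2. ring. }
  assert (F2 : Fe e2 X p = 0%C).
  { replace (Fe e2 X p) with (/ (2 * Ci) * (omb p - om p))%C by (unfold om, omb; field; apply Ci_nz).
    rewrite H1, H2. ring. }
  apply (f_equal fst) in F1, F2, H3. unfold Fe in *. simpl in *.
  destruct (conformal_E U X HX HC p Hp) as [H _]. unfold ff1 in H.
  rewrite (frame_dot _ _ _ He), F1, F2, H3 in H. lra.
Qed.

(* Stereographic projection of the Gauss map from [e3]. *)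
Definition Gm p := (nu p / RtoC (1 - dot (gauss X p) e3))%C.

(** The relations above divided by [1 - N3]. A zero of [om] would be a zero of all three forms,
    contrary to the immersion property. *)
Lemma weier_G p : U p -> dot (gauss X p) e3 <> 1 ->
  om p <> 0%C /\ Fe e3 X p = (Gm p * om p)%C /\ omb p = (- Gm p * Fe e3 X p)%C.
Proof.
  intros Hp HN. destruct (weier_relations p Hp) as [R1 [R2 R3]].
  pose proof (nu_sq p Hp) as Hnu.
  set (N3 := dot (gauss X p) e3) in *.
  assert (HN' : RtoC (1 - N3) <> 0%C) by (apply RtoC_neq; lra).
  assert (E1 : omb p = (- Gm p * Fe e3 X p)%C).
  { unfold Gm. fold N3.
    replace (- (nu p / RtoC (1 - N3)) * Fe e3 X p)%C with (- / RtoC (1 - N3) * (nu p * Fe e3 X p))%C by (field; auto).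
    rewrite R2. field; auto. }
  assert (E2 : Fe e3 X p = (Gm p * om p)%C).
  { assert (E : (nu p * om p = RtoC (1 - N3) * Fe e3 X p)%C).
    { replace (nu p * om p)%C with ((nu p * om p - Cconj (nu p) * omb p) + Cconj (nu p) * omb p)%C by ring.
      rewrite R3, E1. unfold Gm. fold N3.
      replace (2 * Fe e3 X p + Cconj (nu p) * (- (nu p / RtoC (1 - N3)) * Fe e3 X p))%C
        with (Fe e3 X p * (2 - (nu p * Cconj (nu p)) / RtoC (1 - N3)))%C by (field; auto).
      rewrite Hnu. replace (RtoC (1 - N3 * N3)) with (RtoC (1 - N3) * RtoC (1 + N3))%C
        by (rewrite <- RtoC_mult; f_equal; ring).
      replace (RtoC (1 + N3)) with (2 - RtoC (1 - N3))%C
        by (rewrite <- RtoC_minus; f_equal; ring).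
      field. auto. }
    unfold Gm. fold N3. replace (nu p / RtoC (1 - N3) * om p)%C with (/ RtoC (1 - N3) * (nu p * om p))%C by (field; auto).
    rewrite E. field. auto. }
  split; auto. intros E0. apply (Fe_nonzero p Hp). split; auto.
  assert (F3 : Fe e3 X p = 0%C) by (rewrite E2, E0; ring).
  split; auto. rewrite E1, F3. ring.
Qed.
End Weierstrass.

(** * Ribaucour pairs of minimal immersions *)

Definition cont3 (A : C -> R3) (p : C) : Prop :=
  continuous (T := C_UniformSpace) (fun q => x1 (A q)) p /\
  continuous (T := C_UniformSpace) (fun q => x2 (A q)) p /\
  continuous (T := C_UniformSpace) (fun q => x3 (A q)) p.

Lemma cont_Rplus (f g : C -> R) p :
  continuous (T := C_UniformSpace) f p -> continuous (T := C_UniformSpace) g p ->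
  continuous (T := C_UniformSpace) (fun q => f q + g q) p.
Proof. intros. apply (continuous_plus (V := R_NormedModule)); auto. Qed.

Lemma cont_Rminus (f g : C -> R) p :
  continuous (T := C_UniformSpace) f p -> continuous (T := C_UniformSpace) g p ->
  continuous (T := C_UniformSpace) (fun q => f q - g q) p.
Proof. intros. apply (continuous_minus (V := R_NormedModule)); auto. Qed.

Lemma cont_Rmult (f g : C -> R) p :
  continuous (T := C_UniformSpace) f p -> continuous (T := C_UniformSpace) g p ->
  continuous (T := C_UniformSpace) (fun q => f q * g q) p.
Proof. intros. apply (continuous_mult (K := R_AbsRing)); auto. Qed.

Lemma cont3_dot A B p : cont3 A p -> cont3 B p ->
  continuous (T := C_UniformSpace) (fun q => dot (A q) (B q)) p.
Proof.
  intros [H1 [H2 H3]] [K1 [K2 K3]]. unfold dot.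
  apply cont_Rplus; [apply cont_Rplus |]; apply cont_Rmult; assumption.
Qed.

Lemma cont3_cross A B p : cont3 A p -> cont3 B p -> cont3 (fun q => cross (A q) (B q)) p.
Proof.
  intros [H1 [H2 H3]] [K1 [K2 K3]].
  split; [| split].
  - exact (cont_Rminus _ _ p (cont_Rmult _ _ p H2 K3) (cont_Rmult _ _ p H3 K2)).
  - exact (cont_Rminus _ _ p (cont_Rmult _ _ p H3 K1) (cont_Rmult _ _ p H1 K3)).
  - exact (cont_Rminus _ _ p (cont_Rmult _ _ p H1 K2) (cont_Rmult _ _ p H2 K1)).
Qed.

Lemma cont3_const V p : cont3 (fun _ => V) p.
Proof. repeat split; apply continuous_const. Qed.

Lemma cont3_smooth U A p : smooth3 U A -> U p -> cont3 A p.
Proof. intros [H1 [H2 H3]] Hp. repeat split; eapply smooth_cont; eauto. Qed.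

Lemma cont3_gauss U X p : immersion U X -> U p -> cont3 (gauss X) p.
Proof.
  intros HX Hp.
  assert (HN : cont3 (fun q => cross (pd3 du X q) (pd3 dv X q)) p).
  { apply cont3_cross; apply (cont3_smooth U); auto; apply smooth3_pd3; apply HX. }
  assert (Hk : continuous (T := C_UniformSpace) (fun q => / vnorm (cross (pd3 du X q) (pd3 dv X q))) p).
  { apply (continuous_comp (fun q : C => vnorm (cross (pd3 du X q) (pd3 dv X q))) Rinv).
    - unfold vnorm.
      apply (continuous_comp (fun q : C => dot (cross (pd3 du X q) (pd3 dv X q)) (cross (pd3 du X q) (pd3 dv X q))) sqrt).
      + apply cont3_dot; exact HN.
      + apply continuous_sqrt.
    - apply continuous_Rinv. pose proof (vnorm_pos _ (proj2 HX p Hp)). lra. }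
  destruct HN as [H1 [H2 H3]].
  split; [| split].
  - exact (cont_Rmult _ _ p Hk H1).
  - exact (cont_Rmult _ _ p Hk H2).
  - exact (cont_Rmult _ _ p Hk H3).
Qed.

Lemma cont_eps (h : C -> R) p : continuous (T := C_UniformSpace) h p ->
  forall eps, 0 < eps -> exists d, 0 < d /\ forall q, cball p d q -> Rabs (h q - h p) < eps.
Proof.
  intros H eps He. apply (locally_Cmod p). apply (H (fun z => Rabs (z - h p) < eps)).
  exists (mkposreal eps He). intros z Hz. exact Hz.
Qed.

Definition away (U : C -> Prop) (X : C -> R3) (e3 : R3) (q : C) : Prop :=
  U q /\ dot (gauss X q) e3 <> 1.

Lemma away_open U X e3 : isopen U -> immersion U X -> isopen (away U X e3).
Proof.
  intros HU HX p [Hp HN]. destruct (HU p Hp) as [d [d0 Hd]].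
  assert (Hc : continuous (T := C_UniformSpace) (fun q => dot (gauss X q) e3) p).
  { apply cont3_dot; [eapply cont3_gauss; eauto | apply cont3_const]. }
  destruct (cont_eps _ _ Hc (Rabs (1 - dot (gauss X p) e3))) as [d1 [d10 H1]].
  { apply Rabs_pos_lt. lra. }
  exists (Rmin d d1). split; [apply Rmin_pos; auto |].
  intros q Hq. split.
  - apply Hd. eapply Rlt_le_trans; [exact Hq | apply Rmin_l].
  - intros E. specialize (H1 q). rewrite E in H1.
    assert (Hq1 : cball p d1 q) by (eapply Rlt_le_trans; [exact Hq | apply Rmin_r]).
    specialize (H1 Hq1). lra.
Qed.

(** * The Gauss map of a minimal immersion in a stereographic coordinate *)

Section Gauss.
Variables (U : C -> Prop) (X : C -> R3) (e1 e2 e3 : R3).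
Hypothesis HU : isopen U.
Hypothesis HX : immersion U X.
Hypothesis HC : conformal U X.
Hypothesis HM : forall p, U p -> mean_curvature X p = 0.
Hypothesis He : frame e1 e2 e3.

Let G := Gm X e1 e2 e3.

Lemma om_HolD : exists A', HolD U (om X e1 e2) A'.
Proof.
  destruct (Fe_HolD U X e1 HU HX HC HM) as [F1 H1].
  destruct (Fe_HolD U X e2 HU HX HC HM) as [F2 H2].
  eexists. eapply HolD_ext; [| apply (HolD_plus U _ _ _ _ H1 (HolD_mult U _ _ _ _ (HolD_const U (- Ci)%C) H2))].
  intros p _. exists 1. split; [lra |]. intros q _. unfold om. ring.
Qed.

(** [G] is the quotient of the holomorphic forms [Fe e3] and [om], so the normalised cross product
    need not be differentiated. *)
Lemma Gm_HolD : exists G', HolD (away U X e3) G G'.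
Proof.
  destruct om_HolD as [A' HA]. destruct (Fe_HolD U X e3 HU HX HC HM) as [F3 H3].
  assert (Hs : forall q, away U X e3 q -> U q) by (intros q [H _]; exact H).
  assert (Hw : forall q, away U X e3 q -> om X e1 e2 q <> 0%C).
  { intros q [Hq HN]. apply (weier_G U X e1 e2 e3 HX HC He q Hq HN). }
  eexists. eapply HolD_ext.
  2:{ apply (HolD_mult (away U X e3) _ _ _ _ (HolD_sub _ _ _ _ Hs H3)
       (HolD_inv _ _ _ (HolD_sub _ _ _ _ Hs HA) Hw)). }
  intros p Hp. destruct (away_open U X e3 HU HX p Hp) as [d [d0 Hd]].
  exists d. split; auto. intros q Hq. destruct (Hd q Hq) as [Hq1 Hq2].
  destruct (weier_G U X e1 e2 e3 HX HC He q Hq1 Hq2) as [W1 [W2 _]].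
  unfold G. rewrite W2. field. auto.
Qed.

Lemma gauss_of_G p : away U X e3 p ->
  (1 + G p * Cconj (G p) <> 0)%C /\
  RtoC (dot (gauss X p) e1) = ((G p + Cconj (G p)) / (1 + G p * Cconj (G p)))%C /\
  RtoC (dot (gauss X p) e2) = (- Ci * (G p - Cconj (G p)) / (1 + G p * Cconj (G p)))%C /\
  RtoC (dot (gauss X p) e3) = ((G p * Cconj (G p) - 1) / (1 + G p * Cconj (G p)))%C.
Proof.
  intros [Hp HN]. pose proof (nu_sq U X e1 e2 e3 HX He p Hp) as Hn.
  unfold G, Gm. set (N3 := dot (gauss X p) e3) in *.
  assert (HN' : RtoC (1 - N3) <> 0%C) by (apply RtoC_neq; lra).
  assert (Hcr : forall x : R, Cconj (RtoC x) = RtoC x)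
    by (intros; unfold Cconj, RtoC; simpl; f_equal; ring).
  rewrite Cdiv_conj by auto. rewrite Hcr.
  assert (Es : (1 + nu X e1 e2 p / RtoC (1 - N3) * (Cconj (nu X e1 e2 p) / RtoC (1 - N3)))%C = (2 / RtoC (1 - N3))%C).
  { replace (nu X e1 e2 p / RtoC (1 - N3) * (Cconj (nu X e1 e2 p) / RtoC (1 - N3)))%C
      with (nu X e1 e2 p * Cconj (nu X e1 e2 p) / (RtoC (1 - N3) * RtoC (1 - N3)))%C by (field; auto).
    rewrite Hn. replace (RtoC (1 - N3 * N3)) with (RtoC (1 - N3) * (2 - RtoC (1 - N3)))%C
        by (rewrite <- RtoC_minus, <- RtoC_mult; f_equal; ring).
    field. auto. }
  assert (H2 : RtoC 2 <> 0%C) by (apply RtoC_neq; lra).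
  split; [| split; [| split]].
  - rewrite Es. intros E. apply H2. replace (RtoC 2) with (2 / RtoC (1 - N3) * RtoC (1 - N3))%C by (field; auto).
    rewrite E. ring.
  - rewrite Es. replace (RtoC (dot (gauss X p) e1)) with (/ 2 * (nu X e1 e2 p + Cconj (nu X e1 e2 p)))%C.
    + field. auto.
    + rewrite <- re_half. reflexivity.
  - rewrite Es. transitivity (- Ci / 2 * (nu X e1 e2 p - Cconj (nu X e1 e2 p)))%C.
    + rewrite im_alt'. unfold nu, Im. cbn [snd].
      transitivity (- (Ci * Ci) * RtoC (dot (gauss X p) e2))%C; [| field].
      replace (Ci * Ci)%C with (- (1))%C; [ring |]. apply injective_projections; simpl; ring.
    + field. auto.
  - rewrite Es.
    replace (nu X e1 e2 p / RtoC (1 - N3) * (Cconj (nu X e1 e2 p) / RtoC (1 - N3)))%C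
      with ((1 + nu X e1 e2 p / RtoC (1 - N3) * (Cconj (nu X e1 e2 p) / RtoC (1 - N3))) - 1)%C by ring.
    rewrite Es. replace (RtoC N3) with (1 - RtoC (1 - N3))%C
        by (rewrite <- RtoC_minus; f_equal; ring).
    field. auto.
Qed.

Definition Ne (e : R3) (p : C) : C := (dot (pd3 du (gauss X) p) e, - dot (pd3 dv (gauss X) p) e).

Lemma isW_gauss e p a b : U p -> isW (fun q => RtoC (dot (gauss X q) e)) p a b ->
  Ne e p = (2 * a)%C /\ Cconj (Ne e p) = (2 * b)%C.
Proof.
  intros Hp H.
  assert (S : forall i, isd i (fun q => dot (gauss X q) e) p (dot (pd3 i (gauss X) p) e)).
  { intros i. eapply isd_eq; [apply isd_dot; [apply (gauss_isd3 U X HX i p Hp) | apply isd3_const] |].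
    vunf. ring. }
  destruct (isW_real (fun q => dot (gauss X q) e) p a b _ _ H (S du) (S dv)) as [Ea Eb].
  assert (S2 : forall z : C, z = (2 * (z / 2))%C) by (intros; field).
  unfold Ne. split.
  - rewrite Ea. apply S2.
  - rewrite Eb. replace (Cconj (dot (pd3 du (gauss X) p) e, - dot (pd3 dv (gauss X) p) e))
      with (dot (pd3 du (gauss X) p) e, dot (pd3 dv (gauss X) p) e)
      by (unfold Cconj; simpl; f_equal; ring). apply S2.
Qed.

(** Wirtinger derivatives of the inverse stereographic projection [gauss_of_G], with [G] holomorphic
    and its conjugate antiholomorphic. *)
Lemma Ne_formula G' p : HolD (away U X e3) G G' -> away U X e3 p ->
  let g := G p in let gb := Cconj (G p) in let s := (1 + g * gb)%C in
  (Ne e1 p = 2 * G' p * (1 - gb * gb) / (s * s) /\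
   Cconj (Ne e1 p) = 2 * Cconj (G' p) * (1 - g * g) / (s * s) /\
   Ne e2 p = - 2 * Ci * G' p * (1 + gb * gb) / (s * s) /\
   Cconj (Ne e2 p) = 2 * Ci * Cconj (G' p) * (1 + g * g) / (s * s) /\
   Ne e3 p = 4 * G' p * gb / (s * s) /\
   Cconj (Ne e3 p) = 4 * Cconj (G' p) * g / (s * s))%C.
Proof.
  intros HG Hp g gb s.
  assert (WG : isW G p (G' p) 0%C) by (apply isW_isC; apply HG; auto).
  pose proof (isW_conj _ _ _ _ WG) as WGb.
  replace (Cconj 0) with (RtoC 0) in WGb by (unfold Cconj, RtoC; simpl; f_equal; ring).
  destruct (gauss_of_G p Hp) as [Hs _].
  pose proof (isW_plus _ _ _ _ _ _ _ (isW_const 1%C p) (isW_mult _ _ _ _ _ _ _ WG WGb)) as Ws.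
  pose proof (isW_inv _ _ _ _ Ws Hs) as Wi. cbv beta in Wi.
  pose proof (isW_mult _ _ _ _ _ _ _ (isW_plus _ _ _ _ _ _ _ WG WGb) Wi) as W1.
  pose proof (isW_mult _ _ _ _ _ _ _ (isW_scal (- Ci)%C _ _ _ _ (isW_minus _ _ _ _ _ _ _ WG WGb)) Wi) as W2.
  pose proof (isW_mult _ _ _ _ _ _ _ (isW_minus _ _ _ _ _ _ _ (isW_mult _ _ _ _ _ _ _ WG WGb) (isW_const 1%C p)) Wi) as W3.
  cbv beta in W1, W2, W3.
  destruct (away_open U X e3 HU HX p Hp) as [d [d0 Hd]].
  apply (isW_ext _ (fun q => RtoC (dot (gauss X q) e1)) _ _ _ d d0) in W1.
  2:{ intros q Hq. destruct (gauss_of_G q (Hd q Hq)) as [_ [E _]]. rewrite E. unfold Cdiv. ring. }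
  apply (isW_ext _ (fun q => RtoC (dot (gauss X q) e2)) _ _ _ d d0) in W2.
  2:{ intros q Hq. destruct (gauss_of_G q (Hd q Hq)) as [_ [_ [E _]]]. rewrite E. unfold Cdiv. ring. }
  apply (isW_ext _ (fun q => RtoC (dot (gauss X q) e3)) _ _ _ d d0) in W3.
  2:{ intros q Hq. destruct (gauss_of_G q (Hd q Hq)) as [_ [_ [_ E]]]. rewrite E. unfold Cdiv. ring. }
  destruct Hp as [Hp _].
  apply isW_gauss in W1, W2, W3; auto.
  destruct W1 as [A1 B1], W2 as [A2 B2], W3 as [A3 B3].
  rewrite B1, B2, B3, A1, A2, A3. fold g. fold g in Hs. change (Cconj g) with gb in *. unfold s.
  repeat split; field; auto.
Qed.
End Gauss.

(** * Weierstrass data of the transformed surface *)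

Section Ribaucour.
Variables (U : C -> Prop) (Z Zt : C -> R3) (rho phi : C -> R) (c : R).
Hypothesis HU : isopen U.
Hypothesis HZ : immersion U Z.
Hypothesis HC : conformal U Z.
Hypothesis HM : forall p, U p -> mean_curvature Z p = 0.
Hypothesis HZt : smooth3 U Zt.
Hypothesis Hrho : smooth U rho.
Hypothesis Hphi : smooth U phi.
Hypothesis Hc : c <> 0.
Hypothesis Hn : forall p, U p -> rho p <> 0 /\ phi p <> 0.
Hypothesis HR : ribaucour_system U Z Zt rho phi c.

(* The vector [grad phi + rho N], read off from [Zt = Z - W / (c rho)]. *)
Definition ribaucour_vec (q : C) : R3 := vscal (c * rho q) (vsub (Z q) (Zt q)).

Lemma ribaucour_vec_eq q : U q -> ribaucour_vec q = vadd (grad Z phi q) (vscal (rho q) (gauss Z q)).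
Proof.
  intros Hq. destruct (HR q Hq) as [_ [_ [_ [H _]]]]. destruct (Hn q Hq) as [Hr _].
  unfold ribaucour_vec. rewrite H. set (w := vadd _ _).
  assert (E : c * rho q * (1 / (c * rho q)) = 1) by (field; auto).
  replace (vscal (c * rho q) (vsub (Z q) (vsub (Z q) (vscal (1 / (c * rho q)) w))))
    with (vscal (c * rho q * (1 / (c * rho q))) w) by (apply vext; vunf; ring).
  rewrite E. apply vext; vunf; ring.
Qed.

Lemma grad_gauss q : U q -> dot (grad Z phi q) (gauss Z q) = 0.
Proof.
  intros Hq. pose proof (gauss_dot U Z q du Hq) as H1. pose proof (gauss_dot U Z q dv Hq) as H2.
  unfold grad. set (k := / det1 Z q). set (s := _ - _). set (t := ff1 Z du du q * _ - _).
  replace (dot (vscal k (vadd (vscal s (pd3 du Z q)) (vscal t (pd3 dv Z q)))) (gauss Z q))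
    with (k * (s * dot (gauss Z q) (pd3 du Z q) + t * dot (gauss Z q) (pd3 dv Z q))) by (vunf; ring).
  rewrite H1, H2. ring.
Qed.

Lemma ribaucour_vec_gauss q : U q -> dot (ribaucour_vec q) (gauss Z q) = rho q.
Proof.
  intros Hq. rewrite ribaucour_vec_eq by auto.
  replace (dot (vadd (grad Z phi q) (vscal (rho q) (gauss Z q))) (gauss Z q))
    with (dot (grad Z phi q) (gauss Z q) + rho q * dot (gauss Z q) (gauss Z q)) by (vunf; ring).
  rewrite grad_gauss, (gauss_unit U Z HZ) by auto. ring.
Qed.

(** The quadratic first integral of the system. It is what makes [yv] holomorphic and what
    eliminates [phi] from the forms of [Zt]. *)
Lemma ribaucour_vec_sq q : U q -> dot (ribaucour_vec q) (ribaucour_vec q) = 2 * c * rho q * phi q.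
Proof.
  intros Hq. destruct (HR q Hq) as [_ [_ [H _]]]. rewrite ribaucour_vec_eq by auto.
  set (gr := grad Z phi q) in *. set (N := gauss Z q).
  replace (dot (vadd gr (vscal (rho q) N)) (vadd gr (vscal (rho q) N)))
    with (dot gr gr + 2 * rho q * dot gr N + rho q * rho q * dot N N) by (vunf; ring).
  unfold N, gr in *. rewrite H, grad_gauss, (gauss_unit U Z HZ) by auto. ring.
Qed.

Lemma rho_pd i q : U q -> pd i rho q = dot (ribaucour_vec q) (pd3 i (gauss Z) q).
Proof.
  intros Hq. destruct (HR q Hq) as [H _]. rewrite H, ribaucour_vec_eq by auto.
  pose proof (gauss_dgauss U Z HU HZ i q Hq) as H0.
  replace (dot (vadd (grad Z phi q) (vscal (rho q) (gauss Z q))) (pd3 i (gauss Z) q))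
    with (dot (grad Z phi q) (pd3 i (gauss Z) q) + rho q * dot (gauss Z q) (pd3 i (gauss Z) q)) by (vunf; ring).
  rewrite H0. ring.
Qed.

(** With [W] for the vector, this is [dW = c (rho dZ + phi dN)]. The tangential part is the Hessian
    equation; the normal part comes from differentiating [W . N = rho] and inserting the equation
    for [d rho]. *)
Lemma ribaucour_vec_isd3 i p : U p ->
  isd3 i ribaucour_vec p (vscal c (vadd (vscal (rho p) (pd3 i Z p)) (vscal (phi p) (pd3 i (gauss Z) p)))).
Proof.
  intros Hp.
  assert (Sr := smooth_isd U rho i p Hrho Hp).
  assert (HW : exists D, isd3 i ribaucour_vec p D).
  { eexists. apply isd3_vscal.
    - apply isd_mult; [apply isd_const | exact Sr].
    - apply isd3_vsub; eapply isd3_smooth; eauto. apply HZ. }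
  destruct HW as [D HW].
  assert (SN := gauss_isd3 U Z HZ i p Hp).
  assert (Hg : isd3 i (grad Z phi) p (vsub D (vadd (vscal (pd i rho p) (gauss Z p)) (vscal (rho p) (pd3 i (gauss Z) p))))).
  { destruct (HU p Hp) as [d [d0 Hd]].
    apply (isd3_ext i (fun q => vsub (ribaucour_vec q) (vscal (rho q) (gauss Z q))) _ p _ d d0).
    - intros q Hq. rewrite ribaucour_vec_eq by auto. apply vext; vunf; ring.
    - apply isd3_vsub; auto. apply isd3_vscal; auto. }
  apply isd3_pd3 in Hg.
  destruct (HR p Hp) as [_ [HH _]].
  set (T := vscal c (vadd (vscal (rho p) (pd3 i Z p)) (vscal (phi p) (pd3 i (gauss Z) p)))).
  assert (HDj : forall j, dot (vsub D T) (pd3 j Z p) = 0).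
  { intros j. specialize (HH i j). unfold hess in HH. rewrite Hg in HH.
    pose proof (gauss_dot U Z p j Hp) as H1.
    pose proof (ff2_sym U Z HU HZ i j p Hp) as H2. unfold ff1 in HH.
    replace (dot (vsub D (vadd (vscal (pd i rho p) (gauss Z p)) (vscal (rho p) (pd3 i (gauss Z) p)))) (pd3 j Z p))
      with (dot D (pd3 j Z p) - pd i rho p * dot (gauss Z p) (pd3 j Z p) - rho p * dot (pd3 i (gauss Z) p) (pd3 j Z p))
      in HH by (vunf; ring).
    replace (dot (vsub D T) (pd3 j Z p)) with (dot D (pd3 j Z p) - c * (rho p * dot (pd3 i Z p) (pd3 j Z p)
      + phi p * dot (pd3 i (gauss Z) p) (pd3 j Z p))) by (unfold T; vunf; ring).
    rewrite H1, H2 in HH. rewrite H2. lra. }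
  assert (HDN : dot (vsub D T) (gauss Z p) = 0).
  { assert (E : dot D (gauss Z p) + dot (ribaucour_vec p) (pd3 i (gauss Z) p) = pd i rho p).
    { apply (isd_unique i (fun q => dot (ribaucour_vec q) (gauss Z q)) p).
      - apply isd_dot; auto.
      - destruct (HU p Hp) as [d [d0 Hd]].
        apply (isd_ext i rho _ p _ d d0); auto. intros q Hq. symmetry. apply ribaucour_vec_gauss; auto. }
    rewrite (rho_pd i p Hp) in E.
    pose proof (gauss_dot U Z p i Hp) as H1.
    pose proof (gauss_dgauss U Z HU HZ i p Hp) as H2.
    replace (dot (vsub D T) (gauss Z p)) with (dot D (gauss Z p) - c * (rho p * dot (gauss Z p) (pd3 i Z p)
      + phi p * dot (gauss Z p) (pd3 i (gauss Z) p))) by (unfold T; vunf; ring).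
    rewrite H1, H2. lra. }
  assert (E : vsub D T = v0).
  { apply (vec_zero _ (pd3 du Z p) (pd3 dv Z p)); auto; [| apply (proj2 HZ p Hp)].
    unfold gauss in HDN. set (n := cross _ _) in *.
    replace (dot (vsub D T) (vscal (/ vnorm n) n)) with (/ vnorm n * dot (vsub D T) n) in HDN by (vunf; ring).
    apply Rmult_integral in HDN. destruct HDN as [H | H]; auto.
    exfalso. assert (0 < / vnorm n); [| lra]. apply Rinv_0_lt_compat, vnorm_pos. apply (proj2 HZ p Hp). }
  apply (isd3_eq i ribaucour_vec p D); auto.
  apply vext.
  - apply (f_equal x1) in E. revert E. vunf. lra.
  - apply (f_equal x2) in E. revert E. vunf. lra.
  - apply (f_equal x3) in E. revert E. vunf. lra.
Qed.

(** In the derivative of [Z - W / (c rho)] the two terms in [dZ] cancel. *)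
Lemma Zt_pd3 i p : U p ->
  pd3 i Zt p = vadd (vscal (- phi p / rho p) (pd3 i (gauss Z) p))
    (vscal (dot (ribaucour_vec p) (pd3 i (gauss Z) p) / (c * (rho p * rho p))) (ribaucour_vec p)).
Proof.
  intros Hp. destruct (Hn p Hp) as [Hr _].
  assert (Hcr : c * rho p <> 0) by (apply Rmult_integral_contrapositive; auto).
  assert (Sr := smooth_isd U rho i p Hrho Hp).
  apply isd3_pd3. destruct (HU p Hp) as [d [d0 Hd]].
  apply (isd3_ext i (fun q => vsub (Z q) (vscal (/ (c * rho q)) (ribaucour_vec q))) _ p _ d d0).
  { intros q Hq. unfold ribaucour_vec. destruct (Hn q (Hd q Hq)) as [Hrq _].
    assert (E : / (c * rho q) * (c * rho q) = 1) by (field; auto).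
    replace (vscal (/ (c * rho q)) (vscal (c * rho q) (vsub (Z q) (Zt q))))
      with (vscal (/ (c * rho q) * (c * rho q)) (vsub (Z q) (Zt q))) by (apply vext; vunf; ring).
    rewrite E. apply vext; vunf; ring. }
  eapply isd3_eq.
  - apply isd3_vsub; [apply (isd3_smooth U Z i p (proj1 HZ) Hp) |].
    apply isd3_vscal; [apply isd_inv; [apply isd_mult; [apply isd_const | exact Sr] | exact Hcr] |].
    apply ribaucour_vec_isd3; auto.
  - rewrite (rho_pd i p Hp). set (k := dot (ribaucour_vec p) (pd3 i (gauss Z) p)). cbv beta.
    apply vext; vunf; field; auto.
Qed.

Variables e1 e2 e3 : R3.
Hypothesis He : frame e1 e2 e3.

Let V := away U Z e3.
Let G := Gm Z e1 e2 e3.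
Let A := om Z e1 e2.
Let Wc (e : R3) (q : C) : C := RtoC (dot (ribaucour_vec q) e).

Lemma Wc_isW e p : U p ->
  isW (Wc e) p (RtoC c / 2 * (RtoC (rho p) * Fe e Z p + RtoC (phi p) * Ne Z e p))%C
    (RtoC c / 2 * (RtoC (rho p) * Cconj (Fe e Z p) + RtoC (phi p) * Cconj (Ne Z e p)))%C.
Proof.
  intros Hp.
  (* Differentiability is seen from the product [c rho (Z - Zt)]; the values of the derivatives are
     then those of [ribaucour_vec_isd3]. *)
  assert (H : exists a b, isW (Wc e) p a b).
  { assert (Ir := isG_isW _ _ _ (smooth_isG U rho p HU Hrho Hp)).
    assert (I1 := isG_isW _ _ _ (Fe_isG U Z e p HU (proj1 HZ) Hp)).
    assert (I2 := isG_isW _ _ _ (Fe_isG U Zt e p HU HZt Hp)).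
    pose proof (isW_mult _ _ _ _ _ _ _ (isW_scal (RtoC c) _ _ _ _ Ir) (isW_minus _ _ _ _ _ _ _ I1 I2)) as I.
    cbv beta in I. eexists. eexists. eapply isW_ext; [exact Rlt_0_1 | | exact I].
    intros q _. unfold Wc, ribaucour_vec. rewrite <- RtoC_minus, <- !RtoC_mult. f_equal. vunf. ring. }
  destruct H as [a [b H]].
  assert (S : forall i, isd i (fun q => dot (ribaucour_vec q) e) p
     (c * (rho p * dot (pd3 i Z p) e + phi p * dot (pd3 i (gauss Z) p) e))).
  { intros i. eapply isd_eq; [apply isd_dot; [apply ribaucour_vec_isd3; auto | apply isd3_const] |].
    vunf. ring. }
  destruct (isW_real (fun q => dot (ribaucour_vec q) e) p a b _ _ H (S du) (S dv)) as [Ea Eb].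
  apply (isW_eq _ _ _ _ _ _ H).
  - rewrite Ea. unfold Fe, Ne. unfold Cdiv, Cinv, Cmult, Cplus, RtoC; simpl. f_equal; field.
  - rewrite Eb. unfold Fe, Ne, Cconj. unfold Cdiv, Cinv, Cmult, Cplus, RtoC; simpl. f_equal; field.
Qed.

(* The function [1 / (Gt - G)], in a form that makes sense where [Gt] is infinite;
   the denominator is [rho (1 + |G|^2)]. *)
Definition yv q : C := (- ((Wc e1 q - Ci * Wc e2 q) + Wc e3 q * Cconj (G q)) /
   ((Wc e1 q - Ci * Wc e2 q) * G q + (Wc e1 q + Ci * Wc e2 q) * Cconj (G q)
   + Wc e3 q * (G q * Cconj (G q) - 1)))%C.

(** By inverse stereographic projection the left side is [W . N] times [1 + |G|^2], and
    [W . N = rho]. *)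
Lemma yv_denominator p : V p ->
  ((Wc e1 p - Ci * Wc e2 p) * G p + (Wc e1 p + Ci * Wc e2 p) * Cconj (G p)
   + Wc e3 p * (G p * Cconj (G p) - 1) = RtoC (rho p) * (1 + G p * Cconj (G p)))%C.
Proof.
  intros Hp. destruct (gauss_of_G U Z e1 e2 e3 HZ He p Hp) as [Hs [E1 [E2 E3]]].
  fold G in Hs, E1, E2, E3. destruct Hp as [Hp _].
  pose proof (ribaucour_vec_gauss p Hp) as HW. rewrite (frame_dot _ _ _ He) in HW.
  rewrite <- HW, !RtoC_plus, !RtoC_mult, E1, E2, E3. unfold Wc. field. auto.
Qed.

(** The quotient rule for Wirtinger derivatives. The derivative with respect to the conjugate
    variable is a multiple of [|W|^2 - 2 c rho phi] and hence vanishes; the other one is the Riccati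
    expression. *)
Lemma yv_deriv G' p : HolD V G G' -> V p ->
  isC yv p (- (RtoC c / 2) * A p + G' p * (yv p * yv p))%C.
Proof.
  intros HG Hp. pose proof (yv_denominator p Hp) as Hsg.
  destruct (gauss_of_G U Z e1 e2 e3 HZ He p Hp) as [Hs _]. fold G in Hs.
  assert (WG : isW G p (G' p) 0%C) by (apply isW_isC; apply HG; auto).
  pose proof (isW_conj _ _ _ _ WG) as WGb.
  replace (Cconj 0) with (RtoC 0) in WGb by (unfold Cconj, RtoC; simpl; f_equal; ring).
  destruct (Ne_formula U Z e1 e2 e3 HU HZ He G' p HG Hp) as [N1 [N1b [N2 [N2b [N3 N3b]]]]].
  fold G in N1, N1b, N2, N2b, N3, N3b.
  destruct Hp as [Hp HN]. destruct (weier_G U Z e1 e2 e3 HZ HC He p Hp HN) as [_ [F3 Fb]].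
  fold G A in F3, Fb.
  pose proof (Wc_isW e1 p Hp) as W1. pose proof (Wc_isW e2 p Hp) as W2. pose proof (Wc_isW e3 p Hp) as W3.
  assert (EF1 : Fe e1 Z p = (/ 2 * (A p - G p * (G p * A p)))%C).
  { replace (Fe e1 Z p) with (/ 2 * (om Z e1 e2 p + omb Z e1 e2 p))%C by (unfold om, omb; field).
    rewrite Fb, F3. unfold A. field. }
  assert (EF2 : Fe e2 Z p = (Ci / 2 * (A p + G p * (G p * A p)))%C).
  { replace (Fe e2 Z p) with (Ci / 2 * (om Z e1 e2 p - omb Z e1 e2 p))%C.
    - rewrite Fb, F3. unfold A. field.
    - unfold om, omb. transitivity (- (Ci * Ci) * Fe e2 Z p)%C; [field |].
      replace (Ci * Ci)%C with (- (1))%C; [ring |]. apply injective_projections; simpl; ring. }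
  destruct (Hn p Hp) as [Hr _].
  pose proof (ribaucour_vec_sq p Hp) as HQ. rewrite (frame_dot _ _ _ He) in HQ.
  apply (f_equal RtoC) in HQ. rewrite !RtoC_plus, !RtoC_mult in HQ.
  fold (Wc e1 p) (Wc e2 p) (Wc e3 p) in HQ.
  assert (Hci : (Ci * Ci = - (1))%C) by (apply injective_projections; simpl; ring).
  assert (Hcb : Cconj Ci = (- Ci)%C) by (apply injective_projections; simpl; ring).
  assert (Hc2 : Cconj (/ 2) = (/ 2)%C).
  { rewrite Cinv_conj by (apply RtoC_neq; lra). f_equal. apply injective_projections; simpl; ring. }
  assert (Hw := isW_plus _ _ _ _ _ _ _ W1 (isW_scal Ci _ _ _ _ W2)).
  assert (Hwb := isW_minus _ _ _ _ _ _ _ W1 (isW_scal Ci _ _ _ _ W2)).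
  cbv beta in Hw, Hwb.
  assert (EcF1 : Cconj (Fe e1 Z p) = (/ 2 * (Cconj (A p) - Cconj (G p) * (Cconj (G p) * Cconj (A p))))%C).
  { rewrite EF1, !Cmult_conj, Cminus_conj, !Cmult_conj, Hc2. reflexivity. }
  assert (EcF2 : Cconj (Fe e2 Z p) = (- Ci / 2 * (Cconj (A p) + Cconj (G p) * (Cconj (G p) * Cconj (A p))))%C).
  { rewrite EF2. unfold Cdiv. rewrite !Cmult_conj, Cplus_conj, !Cmult_conj, Hc2, Hcb. reflexivity. }
  assert (EcF3 : Cconj (Fe e3 Z p) = (Cconj (G p) * Cconj (A p))%C) by (rewrite F3, Cmult_conj; reflexivity).
  rewrite EcF1, EcF2, EF1, EF2, N1b, N2b, N1, N2 in Hw, Hwb. rewrite EcF3, F3, N3b, N3 in W3.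
  set (g := G p) in *. set (gb := Cconj g) in *. set (g' := G' p) in *. set (gb' := Cconj g') in *.
  set (a := A p) in *. set (ab := Cconj a) in *.
  set (R_ := RtoC (rho p)) in *. set (P_ := RtoC (phi p)) in *. set (c_ := RtoC c) in *.
  set (s := (1 + g * gb)%C) in *.
  (* [field] takes [Ci] for an atom; each intermediate form below isolates [Ci * Ci] so that it can
     be rewritten to [- 1]. *)
  assert (Hw' : isW (fun q => Wc e1 q + Ci * Wc e2 q)%C p
     (c_ / 2 * (- R_ * g * g * a + 4 * P_ * g' / (s * s)))%C
     (c_ / 2 * (R_ * ab - 4 * P_ * gb' * g * g / (s * s)))%C).
  { apply (isW_eq _ _ _ _ _ _ Hw).
    - transitivity (c_ / 2 * (R_ * (/ 2 * (a - g * (g * a))) + P_ * (2 * g' * (1 - gb * gb) / (s * s)) +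
        (Ci * Ci) * (R_ * (/ 2 * (a + g * (g * a))) + P_ * (- 2 * g' * (1 + gb * gb) / (s * s)))))%C;
        [field; auto | rewrite Hci; field; auto].
    - transitivity (c_ / 2 * (R_ * (/ 2 * (ab - gb * (gb * ab))) + P_ * (2 * gb' * (1 - g * g) / (s * s)) +
        (Ci * Ci) * (R_ * (- / 2 * (ab + gb * (gb * ab))) + P_ * (2 * gb' * (1 + g * g) / (s * s)))))%C;
        [field; auto | rewrite Hci; field; auto]. }
  assert (Hwb' : isW (fun q => Wc e1 q - Ci * Wc e2 q)%C p
     (c_ / 2 * (R_ * a - 4 * P_ * g' * gb * gb / (s * s)))%C
     (c_ / 2 * (- R_ * gb * gb * ab + 4 * P_ * gb' / (s * s)))%C).
  { apply (isW_eq _ _ _ _ _ _ Hwb).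
    - transitivity (c_ / 2 * (R_ * (/ 2 * (a - g * (g * a))) + P_ * (2 * g' * (1 - gb * gb) / (s * s)) -
        (Ci * Ci) * (R_ * (/ 2 * (a + g * (g * a))) + P_ * (- 2 * g' * (1 + gb * gb) / (s * s)))))%C;
        [field; auto | rewrite Hci; field; auto].
    - transitivity (c_ / 2 * (R_ * (/ 2 * (ab - gb * (gb * ab))) + P_ * (2 * gb' * (1 - g * g) / (s * s)) -
        (Ci * Ci) * (R_ * (- / 2 * (ab + gb * (gb * ab))) + P_ * (2 * gb' * (1 + g * g) / (s * s)))))%C;
        [field; auto | rewrite Hci; field; auto]. }
  clear Hw Hwb W1 W2 N1 N1b N2 N2b N3 N3b.
  assert (HRn : R_ <> 0%C) by (apply RtoC_neq; auto).
  assert (Hsn : (R_ * s)%C <> 0%C) by (apply Cmult_neq_0; auto).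
  assert (HP := isW_opp _ _ _ _ (isW_plus _ _ _ _ _ _ _ Hwb' (isW_mult _ _ _ _ _ _ _ W3 WGb))).
  assert (HS := isW_plus _ _ _ _ _ _ _ (isW_plus _ _ _ _ _ _ _ (isW_mult _ _ _ _ _ _ _ Hwb' WG)
    (isW_mult _ _ _ _ _ _ _ Hw' WGb)) (isW_mult _ _ _ _ _ _ _ W3
      (isW_minus _ _ _ _ _ _ _ (isW_mult _ _ _ _ _ _ _ WG WGb) (isW_const 1%C p)))).
  cbv beta in HP, HS. fold g gb g' gb' in HP, HS.
  set (w := (Wc e1 p + Ci * Wc e2 p)%C) in *. set (wb := (Wc e1 p - Ci * Wc e2 p)%C) in *.
  set (w3 := Wc e3 p) in *.
  assert (HQ' : (w * wb + w3 * w3 = 2 * c_ * R_ * P_)%C).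
  { rewrite <- HQ. unfold w, wb. transitivity (Wc e1 p * Wc e1 p - (Ci * Ci) * (Wc e2 p * Wc e2 p) + w3 * w3)%C; [ring |].
    rewrite Hci. ring. }
  assert (HP' : isW (fun q => - (Wc e1 q - Ci * Wc e2 q + Wc e3 q * Cconj (G q)))%C p
    (- (c_ / 2 * (R_ * s * a)))%C (- (gb' * (2 * c_ * P_ / s + w3)))%C).
  { apply (isW_eq _ _ _ _ _ _ HP); unfold s; field; auto. }
  assert (HS' : isW (fun q => (Wc e1 q - Ci * Wc e2 q) * G q + (Wc e1 q + Ci * Wc e2 q) * Cconj (G q)
     + Wc e3 q * (G q * Cconj (G q) - 1))%C p (g' * (wb + w3 * gb))%C (gb' * (w + w3 * g))%C).
  { apply (isW_eq _ _ _ _ _ _ HS); unfold s; field; auto. }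
  clear HP HS W3 Hw' Hwb'.
  assert (HSn : (wb * g + w * gb + w3 * (g * gb - 1))%C <> 0%C) by (rewrite Hsg; exact Hsn).
  pose proof (isW_mult _ _ _ _ _ _ _ HP' (isW_inv _ _ _ _ HS' HSn)) as HY. cbv beta in HY.
  fold g gb in HY. fold w wb w3 in HY. fold gb g' gb' in HY.
  assert (Ey : yv p = (- (wb + w3 * gb) / (R_ * s))%C).
  { unfold yv. fold g gb. fold w wb w3. fold gb. rewrite Hsg. reflexivity. }
  apply isW_isC. apply (isW_eq _ _ _ _ _ _ HY).
  - rewrite Ey, Hsg. field. split; auto.
  - rewrite Hsg.
    transitivity (gb' / (R_ * s * (R_ * s)) * ((wb + w3 * gb) * (w + w3 * g)
       - w3 * (R_ * s) - 2 * c_ * R_ * P_))%C; [field; split; auto |].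
    assert (HB : ((wb + w3 * gb) * (w + w3 * g) - w3 * (R_ * s) - 2 * c_ * R_ * P_)%C = 0%C)
      by (rewrite <- HQ', <- Hsg; ring).
    rewrite HB. unfold Cdiv. ring.
Qed.

Lemma Fe_Zt e p : U p ->
  Fe e Zt p = (- RtoC (phi p) / RtoC (rho p) * Ne Z e p
    + (Wc e1 p * Ne Z e1 p + Wc e2 p * Ne Z e2 p + Wc e3 p * Ne Z e3 p)
      / (RtoC c * (RtoC (rho p) * RtoC (rho p))) * Wc e p)%C.
Proof.
  intros Hp. destruct (Hn p Hp) as [Hr _].
  unfold Fe. rewrite !(Zt_pd3 _ p Hp).
  assert (S : forall k l P Q, dot (vadd (vscal k P) (vscal l Q)) e = k * dot P e + l * dot Q e)
    by (intros; vunf; ring).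
  rewrite !S.
  rewrite (frame_dot _ _ _ He (ribaucour_vec p) (pd3 du (gauss Z) p)), (frame_dot _ _ _ He (ribaucour_vec p) (pd3 dv (gauss Z) p)).
  unfold Ne, Wc.
  generalize (dot (pd3 du (gauss Z) p) e1), (dot (pd3 du (gauss Z) p) e2), (dot (pd3 du (gauss Z) p) e3),
    (dot (pd3 dv (gauss Z) p) e1), (dot (pd3 dv (gauss Z) p) e2), (dot (pd3 dv (gauss Z) p) e3),
    (dot (ribaucour_vec p) e1), (dot (ribaucour_vec p) e2), (dot (ribaucour_vec p) e3), (dot (pd3 du (gauss Z) p) e),
    (dot (pd3 dv (gauss Z) p) e), (dot (ribaucour_vec p) e). intros a1 a2 a3 b1 b2 b3 w1 w2 w3 a b w.
  unfold Cdiv. rewrite <- !RtoC_mult, <- !RtoC_inv, <- RtoC_opp by auto using Rmult_integral_contrapositive.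
  apply injective_projections; simpl; field; auto.
Qed.

(** Once [phi] is eliminated by [|W|^2 = 2 c rho phi], the conjugate of [G] enters through [y]
    alone. With [Gt = G + 1 / y] the three forms are [omt], [Gt omt] and [- Gt^2 omt], written so as
    to make sense where [y = 0]. *)
Lemma Zt_forms G' p : HolD V G G' -> V p ->
  (om Zt e1 e2 p = 2 / RtoC c * G' p * (yv p * yv p) /\
   Fe e3 Zt p = 2 / RtoC c * G' p * (yv p * (G p * yv p + 1)) /\
   omb Zt e1 e2 p = - (2 / RtoC c) * G' p * ((G p * yv p + 1) * (G p * yv p + 1)))%C.
Proof.
  intros HG Hp. pose proof (yv_denominator p Hp) as Hsg.
  destruct (gauss_of_G U Z e1 e2 e3 HZ He p Hp) as [Hs _]. fold G in Hs.
  destruct (Ne_formula U Z e1 e2 e3 HU HZ He G' p HG Hp) as [N1 [_ [N2 [_ [N3 _]]]]].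
  fold G in N1, N2, N3.
  destruct Hp as [Hp HN].
  pose proof (Fe_Zt e1 p Hp) as F1. pose proof (Fe_Zt e2 p Hp) as F2. pose proof (Fe_Zt e3 p Hp) as F3.
  destruct (Hn p Hp) as [Hr _].
  pose proof (ribaucour_vec_sq p Hp) as HQ. rewrite (frame_dot _ _ _ He) in HQ.
  apply (f_equal RtoC) in HQ. rewrite !RtoC_plus, !RtoC_mult in HQ.
  fold (Wc e1 p) (Wc e2 p) (Wc e3 p) in HQ.
  assert (Hci : (Ci * Ci = - (1))%C) by (apply injective_projections; simpl; ring).
  unfold om, omb. rewrite F1, F2, F3. rewrite N1, N2, N3.
  set (g := G p) in *. set (gb := Cconj g) in *. set (g' := G' p) in *.
  set (R_ := RtoC (rho p)) in *. set (P_ := RtoC (phi p)) in *. set (c_ := RtoC c) in *.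
  set (w := (Wc e1 p + Ci * Wc e2 p)%C) in *. set (wb := (Wc e1 p - Ci * Wc e2 p)%C) in *.
  assert (E1 : Wc e1 p = (/ 2 * (w + wb))%C) by (unfold w, wb; field).
  assert (E2 : Wc e2 p = (- Ci / 2 * (w - wb))%C).
  { unfold w, wb. transitivity (- (Ci * Ci) * Wc e2 p)%C; [rewrite Hci; ring | field]. }
  set (w3 := Wc e3 p) in *.
  assert (HRn : R_ <> 0%C) by (apply RtoC_neq; auto).
  assert (Hcn : c_ <> 0%C) by (apply RtoC_neq; auto).
  assert (HQ' : (P_ = (w * wb + w3 * w3) / (2 * c_ * R_))%C).
  { transitivity ((2 * c_ * R_ * P_) / (2 * c_ * R_))%C; [field; auto |].
    rewrite <- HQ. rewrite E1, E2. f_equal.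
    transitivity (/ 4 * (w + wb) * (w + wb) + (Ci * Ci) / 4 * (w - wb) * (w - wb) + w3 * w3)%C; [field |].
    rewrite Hci. field. }
  set (s := (1 + g * gb)%C) in *.
  assert (Ey : yv p = (- (wb + w3 * gb) / (R_ * s))%C).
  { unfold yv. fold g gb. fold w wb w3. fold gb. rewrite Hsg. reflexivity. }

  assert (ES : (Wc e1 p * (2 * g' * (1 - gb * gb) / (s * s)) + Wc e2 p * (- 2 * Ci * g' * (1 + gb * gb) / (s * s))
     + w3 * (4 * g' * gb / (s * s)) = 2 * g' / (s * s) * (wb - gb * gb * w + 2 * gb * w3))%C).
  { rewrite E1, E2.
    transitivity (2 * g' / (s * s) * (/ 2 * (w + wb) * (1 - gb * gb) + (Ci * Ci) / 2 * (w - wb) * (1 + gb * gb) + 2 * gb * w3))%C;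
      [field; auto |]. rewrite Hci. field; auto. }
  rewrite ES. rewrite Ey.
  assert (EB : (g * (- (wb + w3 * gb) / (R_ * s)) + 1 = (w * gb * s - w3 * s) / (R_ * s * s))%C).
  { transitivity ((R_ * s - g * (wb + w3 * gb)) / (R_ * s))%C; [field; auto |].
    rewrite <- Hsg at 1. field. auto. }
  split; [| split].
  - transitivity (2 * g' / (s * s) * (2 * P_ / R_ * gb * gb
       + (wb - gb * gb * w + 2 * gb * w3) / (c_ * (R_ * R_)) * wb))%C.
    + transitivity (- P_ / R_ * (2 * g' * (1 - gb * gb) / (s * s) + (Ci * Ci) * (2 * g' * (1 + gb * gb) / (s * s)))
         + 2 * g' / (s * s) * (wb - gb * gb * w + 2 * gb * w3) / (c_ * (R_ * R_)) * (Wc e1 p - Ci * Wc e2 p))%C;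
        [field; auto |]. fold wb. rewrite Hci. field; auto.
    + rewrite HQ'. field. auto.
  - rewrite EB.
    transitivity (2 * g' / (s * s) * (- P_ / R_ * 2 * gb
       + (wb - gb * gb * w + 2 * gb * w3) / (c_ * (R_ * R_)) * w3))%C; [field; auto |].
    rewrite HQ'. field. auto.
  - rewrite EB.
    transitivity (2 * g' / (s * s) * (- 2 * P_ / R_
       + (wb - gb * gb * w + 2 * gb * w3) / (c_ * (R_ * R_)) * w))%C.
    + transitivity (- P_ / R_ * (2 * g' * (1 - gb * gb) / (s * s) - (Ci * Ci) * (2 * g' * (1 + gb * gb) / (s * s)))
         + 2 * g' / (s * s) * (wb - gb * gb * w + 2 * gb * w3) / (c_ * (R_ * R_)) * (Wc e1 p + Ci * Wc e2 p))%C;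
        [field; auto |]. fold w. rewrite Hci. field; auto.
    + rewrite HQ'. field. auto.
Qed.

Lemma ribaucour_weierstrass : exists G' y y', HolD V G G' /\ HolD V y y' /\ forall p, V p ->
  (y' p = - (RtoC c / 2) * A p + G' p * (y p * y p) /\
   om Zt e1 e2 p = 2 / RtoC c * G' p * (y p * y p) /\
   Fe e3 Zt p = 2 / RtoC c * G' p * (y p * (G p * y p + 1)) /\
   omb Zt e1 e2 p = - (2 / RtoC c) * G' p * ((G p * y p + 1) * (G p * y p + 1)))%C.
Proof.
  destruct (Gm_HolD U Z e1 e2 e3 HU HZ HC HM He) as [G' HG]. fold G V in HG.
  destruct (om_HolD U Z e1 e2 HU HZ HC HM) as [A' HA]. fold A in HA.
  exists G', yv, (fun p => - (RtoC c / 2) * A p + G' p * (yv p * yv p))%C.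
  split; auto. split.
  - intros p Hp. pose proof (yv_deriv G' p HG Hp) as HY. split; auto.
    apply cont_Cplus.
    + apply cont_Cmult; [apply cont_Cconst |]. eapply isC_cont. apply HA. apply Hp.
    + apply cont_Cmult; [apply HG; auto |].
      apply cont_Cmult; eapply isC_cont; exact HY.
  - intros p Hp. split; auto. apply Zt_forms; auto.
Qed.
End Ribaucour.

(** * The Riccati equation at the puncture *)

Definition near (P : C -> Prop) : Prop := exists d, 0 < d /\ forall q, pdisk d q -> P q.

Lemma near_and P Q : near P -> near Q -> near (fun q => P q /\ Q q).
Proof.
  intros [d [d0 Hd]] [e [e0 He]]. exists (Rmin d e). split; [apply Rmin_pos; auto |].
  intros q [Hq Hq0]. split.
  - apply Hd. split; auto. eapply Rlt_le_trans; [exact Hq | apply Rmin_l].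
  - apply He. split; auto. eapply Rlt_le_trans; [exact Hq | apply Rmin_r].
Qed.

Lemma near_imp (P Q : C -> Prop) : (forall q, P q -> Q q) -> near P -> near Q.
Proof. intros H [d [d0 Hd]]. exists d. split; auto. Qed.

Lemma near_pdisk r : 0 < r -> near (pdisk r).
Proof. intros Hr. exists r. split; auto. Qed.

Lemma near_ex (P : C -> Prop) : near P -> exists q, P q.
Proof.
  intros [d [d0 Hd]]. exists (RtoC (d / 2)). apply Hd. split.
  - rewrite Cmod_R, Rabs_right; lra.
  - apply RtoC_neq; lra.
Qed.

Lemma contC_near f eps : contC f 0%C -> 0 < eps -> near (fun z => Cmod (f z - f 0%C) < eps).
Proof.
  intros H He. destruct (proj1 (contC_eps f 0%C) H eps He) as [d [d0 Hd]].
  exists d. split; auto. intros q [Hq _]. apply Hd. replace (q - 0)%C with q by ring. exact Hq.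
Qed.

Lemma near_bounded f : contC f 0%C -> exists K, 0 < K /\ near (fun z => Cmod (f z) <= K).
Proof.
  intros H. exists (Cmod (f 0%C) + 1). split; [pose proof (Cmod_ge_0 (f 0%C)); lra |].
  generalize (contC_near f 1 H Rlt_0_1). apply near_imp. intros q Hq.
  replace (f q) with ((f q - f 0%C) + f 0%C)%C by ring.
  eapply Rle_trans; [apply Cmod_triangle |]. lra.
Qed.

Lemma near_away f : contC f 0%C -> f 0%C <> 0%C -> exists k, 0 < k /\ near (fun z => k <= Cmod (f z)).
Proof.
  intros H H0. assert (Hm : 0 < Cmod (f 0%C)) by exact (proj1 (Cmod_gt_0 _) H0).
  exists (Cmod (f 0%C) / 2). split; [lra |].
  assert (He : 0 < Cmod (f 0%C) / 2) by lra.
  generalize (contC_near f _ H He). apply near_imp. intros q Hq.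
  pose proof (Cmod_minus_ge (f 0%C) (f q)). rewrite Cmod_minus_sym in Hq. lra.
Qed.

Lemma cont_zero f : contC f 0%C -> near (fun z => f z = 0%C) -> f 0%C = 0%C.
Proof.
  intros H Hn. destruct (Ceq_dec (f 0%C) 0%C) as [E | E]; auto. exfalso.
  destruct (near_away f H E) as [k [k0 Hk]].
  destruct (near_ex _ (near_and _ _ Hn Hk)) as [q [H1 H2]].
  rewrite H1, Cmod_0 in H2. lra.
Qed.

Lemma HolD_cont r f f' : 0 < r -> HolD (disk r) f f' -> contC f 0%C /\ contC f' 0%C.
Proof.
  intros Hr Hf. assert (H0 : disk r 0) by (unfold disk; rewrite Cmod_0; lra).
  destruct (Hf _ H0). split; auto. eapply isC_cont; eauto.
Qed.

Lemma isC_pow n (p : C) : isC (fun z => z ^ (S n))%C p (RtoC (INR (S n)) * p ^ n)%C.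
Proof.
  induction n as [|n IH].
  - simpl. apply (isC_ext_loc (fun z => z)).
    + exists 1. split; [lra |]. intros. ring.
    + eapply isC_eq; [apply isC_id | ring].
  - apply (isC_ext_loc (fun z => z * z ^ (S n))%C).
    + exists 1. split; [lra |]. intros. reflexivity.
    + eapply isC_eq; [apply isC_mult; [apply isC_id | exact IH] |].
      rewrite (S_INR (S n)), RtoC_plus. cbn [Cpow]. ring.
Qed.

Lemma pow_deriv_mult n f f' p : isC f p (f' p) ->
  isC (fun z => z ^ (S n) * f z)%C p (p ^ n * (RtoC (INR (S n)) * f p + p * f' p))%C.
Proof.
  intros Hf. eapply isC_eq; [apply isC_mult; [apply isC_pow | exact Hf] |]. cbn [Cpow]. ring.
Qed.

Lemma contC_pow n (p : C) : contC (fun z => z ^ n)%C p.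
Proof.
  destruct n as [|n]; [apply (cont_Cconst 1%C) |]. eapply isC_cont. apply isC_pow.
Qed.

Ltac contC_tac := repeat match goal with
  | H : contC ?f ?p |- contC ?f ?p => exact H
  | H : contC ?f ?p |- contC (fun z => ?f z) ?p => exact H
  | |- contC (fun z => (z ^ ?n)%C) _ => apply (contC_pow n)
  | |- contC (fun z => z) _ => apply contC_id
  | |- contC (fun z => (@?f z * @?g z)%C) _ => apply (cont_Cmult f g)
  | |- contC (fun z => (@?f z + @?g z)%C) _ => apply (cont_Cplus f g)
  | |- contC (fun z => (@?f z - @?g z)%C) _ => apply (cont_Cminus f g)
  | |- contC (fun z => (- @?f z)%C) _ => apply (cont_Copp f)
  | |- contC (fun z => ?c) _ => apply (cont_Cconst c)
  | |- continuous ?f ?p => change (contC f p)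
  end.

Lemma Cpow_0_l n : (0 < n)%nat -> (RtoC 0 ^ n)%C = RtoC 0.
Proof. destruct n; [lia |]. intros _. cbn [Cpow]. ring. Qed.

Lemma pow_le_1 t n : 0 <= t <= 1 -> t ^ n <= 1.
Proof. intros Ht. rewrite <- (pow1 n). apply pow_incr. lra. Qed.

(* The two possible exponents at a regular singular point:
   [Y 0 = 0] or [Y 0 = - k / a 0]. *)
Lemma riccati_limit r (a a' be be' Y Y' : C -> C) k n : 0 < r -> (0 < n)%nat ->
  HolD (disk r) a a' -> HolD (disk r) be be' -> HolD (disk r) Y Y' ->
  (forall z, pdisk r z -> z * Y' z = RtoC (INR k) * Y z + a z * (Y z * Y z) - z ^ n * be z)%C ->
  (RtoC (INR k) * Y 0%C + a 0%C * (Y 0%C * Y 0%C))%C = 0%C.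
Proof.
  intros Hr Hn Ha Hb HY HE.
  destruct (HolD_cont _ _ _ Hr Ha) as [Ca _]. destruct (HolD_cont _ _ _ Hr Hb) as [Cb _].
  destruct (HolD_cont _ _ _ Hr HY) as [CY CY'].
  assert (H := cont_zero (fun z => z * Y' z - RtoC (INR k) * Y z - a z * (Y z * Y z) + z ^ n * be z)%C).
  cbv beta in H.
  assert (H1 : contC (fun z => z * Y' z - RtoC (INR k) * Y z - a z * (Y z * Y z) + z ^ n * be z)%C 0%C) by contC_tac.
  specialize (H H1). rewrite Cpow_0_l in H by auto.
  replace (RtoC (INR k) * Y 0%C + a 0%C * (Y 0%C * Y 0%C))%C with
    (- (0 * Y' 0%C - RtoC (INR k) * Y 0%C - a 0%C * (Y 0%C * Y 0%C) + 0 * be 0%C))%C by ring.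
  rewrite H; [ring |]. exists r. split; auto. intros z Hz. rewrite HE by auto. ring.
Qed.

Lemma Cpow_neq (z : C) n : z <> 0%C -> (z ^ n)%C <> 0%C.
Proof. intros H. apply Cpow_nz. exact H. Qed.

(** Let [q > 0] be the order of [Y], so [Y = z^q y] with [y 0 <> 0]. The linear terms contribute
    [(q - k) y 0] at order [q], the inhomogeneous one [be 0] at order [n], and the quadratic one
    only starts at order [2 q]. Hence [q < n] would give [q = k], against [n <= k]; [q > n] would
    give [be 0 = 0]; and for [q = n] the equation [(n - k) y 0 = - be 0] excludes [n = k]. *)
Lemma riccati_order r (a a' be be' Y Y' : C -> C) k n : 0 < r -> (0 < n <= k)%nat ->
  HolD (disk r) a a' -> HolD (disk r) be be' -> HolD (disk r) Y Y' -> be 0%C <> 0%C -> Y 0%C = 0%C ->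
  (forall z, pdisk r z -> z * Y' z = RtoC (INR k) * Y z + a z * (Y z * Y z) - z ^ n * be z)%C ->
  (n < k)%nat /\ exists y y', HolD (disk r) y y' /\ y 0%C <> 0%C /\
    forall z, disk r z -> Y z = (z ^ n * y z)%C.
Proof.
  intros Hr Hn Ha Hb HY Hbe HY0 HE.
  (* [Y] cannot vanish identically, for then the equation would force [z^n be = 0]. *)
  assert (Hex : exists p0, Cmod p0 < r / 2 /\ Y p0 <> 0%C).
  { apply NNPP. intros Hno.
    assert (HZ : forall z, Cmod z < r / 2 -> Y z = 0%C).
    { intros z Hz. apply NNPP. intros H. apply Hno. exists z. auto. }
    destruct (HolD_cont _ _ _ Hr Hb) as [Cb _].
    destruct (near_away be Cb Hbe) as [kk [kk0 Hk]].
    assert (Hr2 : 0 < r / 2) by lra.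
    destruct (near_ex _ (near_and _ _ Hk (near_pdisk _ Hr2))) as [z [Hz1 [Hz2 Hz3]]].
    assert (Hzr : pdisk r z) by (split; auto; lra).
    assert (HY'z : Y' z = 0%C).
    { apply (isC_unique Y z); [apply HY; apply pdisk_disk; auto |].
      apply (isC_ext_loc (fun _ => 0%C)); [| apply isC_const].
      exists (r / 2 - Cmod z). split; [lra |]. intros q Hq. symmetry. apply HZ.
      replace q with ((q - z) + z)%C by ring. eapply Rle_lt_trans; [apply Cmod_triangle |]. lra. }
    specialize (HE z Hzr). rewrite HY'z, (HZ z Hz2) in HE.
    assert (E : (z ^ n * be z)%C = 0%C).
    { transitivity (RtoC (INR k) * 0 + a z * (0 * 0) - z * 0)%C; [rewrite HE; ring | ring]. }
    revert E. apply Cmult_neq_0; [apply Cpow_neq; auto |].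
    apply (proj2 (Cmod_gt_0 _)). lra. }
  destruct Hex as [p0 [Hp0 HYp0]].
  destruct (HolD_order r Y Y' p0 Hr HY Hp0 HYp0) as [q [y [y' [Hy [Hy0 HYy]]]]].
  assert (H0d : disk r 0) by (unfold disk; rewrite Cmod_0; lra).
  destruct q as [|q].
  { exfalso. apply Hy0. specialize (HYy _ H0d). rewrite HY0 in HYy. cbn [Cpow] in HYy.
    transitivity (1 * y 0%C)%C; [ring | symmetry; exact HYy]. }
  destruct (HolD_cont _ _ _ Hr Ha) as [Ca _]. destruct (HolD_cont _ _ _ Hr Hb) as [Cb _].
  destruct (HolD_cont _ _ _ Hr Hy) as [Cy Cy'].
  set (l := RtoC (INR (S q) - INR k)).
  assert (HE2 : forall z, pdisk r z ->
    (z ^ S q * (l * y z + z * y' z) = z ^ (S q + S q) * (a z * (y z * y z)) - z ^ n * be z)%C).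
  { intros z Hz. pose proof (pdisk_disk _ _ Hz) as Hzd.
    assert (HD : Y' z = (z ^ q * (RtoC (INR (S q)) * y z + z * y' z))%C).
    { apply (isC_unique Y z); [apply HY; auto |].
      apply (isC_ext_loc (fun z => z ^ S q * y z)%C); [| apply pow_deriv_mult; apply Hy; auto].
      exists (r - Cmod z). split; [unfold disk in Hzd; lra |]. intros w Hw. symmetry. apply HYy.
      unfold disk. replace w with ((w - z) + z)%C by ring. eapply Rle_lt_trans; [apply Cmod_triangle |]. lra. }
    specialize (HE z Hz). rewrite HD, (HYy z Hzd) in HE. unfold l. rewrite RtoC_minus.
    rewrite Cpow_add_r.
    transitivity (z * (z ^ q * (RtoC (INR (S q)) * y z + z * y' z)) - RtoC (INR k) * (z ^ S q * y z))%C;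
      [cbn [Cpow]; ring |]. rewrite HE. ring. }
  (* Comparison of coefficients: a common power of [z] is divided out off the origin, and the rest
     is evaluated at the origin by continuity. *)
  assert (Hdiv : forall m f, contC f 0%C -> (forall z, pdisk r z -> (z ^ m * f z = 0)%C) -> f 0%C = 0%C).
  { intros m f Cf Hf. apply cont_zero; auto. exists r. split; auto. intros z Hz.
    destruct (Ceq_dec (f z) 0%C) as [E | E]; auto. exfalso. apply (Cmult_neq_0 (z ^ m)%C (f z)); auto.
    apply Cpow_neq. apply Hz. }
  destruct (Nat.lt_trichotomy (S q) n) as [Hlt | [Heq | Hgt]].
  - exfalso. destruct (Nat.le_exists_sub (S (S q)) n Hlt) as [d [Hd _]].
    pose (f := (fun z => l * y z + z * y' z - z ^ S q * (a z * (y z * y z)) + z ^ (S d) * be z)%C).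
    assert (H : f 0%C = 0%C).
    { apply (Hdiv (S q) f); unfold f; [contC_tac |]. intros z Hz. specialize (HE2 z Hz).
      replace n with (S q + S d)%nat in HE2 by lia. rewrite !Cpow_add_r in HE2.
      transitivity (z ^ S q * (l * y z + z * y' z) - (z ^ S q * z ^ S q * (a z * (y z * y z)) - z ^ S q * z ^ S d * be z))%C;
        [ring |]. rewrite HE2. ring. }
    unfold f in H. rewrite !Cpow_0_l in H by lia.
    assert (E : (l * y 0%C = 0)%C).
    { transitivity (l * y 0%C + 0 * y' 0%C - 0 * (a 0%C * (y 0%C * y 0%C)) + 0 * be 0%C)%C; [ring | exact H]. }
    revert E. apply Cmult_neq_0; auto. unfold l. apply RtoC_neq.
    assert (INR (S q) < INR k) by (apply lt_INR; lia). lra.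
  - pose (f := (fun z => l * y z + z * y' z - z ^ S q * (a z * (y z * y z)) + be z)%C).
    assert (H : f 0%C = 0%C).
    { apply (Hdiv (S q) f); unfold f; [contC_tac |]. intros z Hz. specialize (HE2 z Hz).
      rewrite <- Heq in HE2. rewrite !Cpow_add_r in HE2.
      transitivity (z ^ S q * (l * y z + z * y' z) - (z ^ S q * z ^ S q * (a z * (y z * y z)) - z ^ S q * be z))%C;
        [ring |]. rewrite HE2. ring. }
    unfold f in H. rewrite !Cpow_0_l in H by lia.
    split.
    + destruct (Nat.eq_dec n k) as [E | E]; [| lia]. exfalso. apply Hbe.
      transitivity (l * y 0%C + 0 * y' 0%C - 0 * (a 0%C * (y 0%C * y 0%C)) + be 0%C)%C; [| exact H].
      unfold l. rewrite Heq, E. replace (INR k - INR k) with 0 by ring. ring.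
    + exists y, y'. rewrite <- Heq. auto.
  - exfalso. destruct (Nat.le_exists_sub (S n) (S q) Hgt) as [d [Hd _]].
    pose (f := (fun z => z ^ (S d) * (l * y z + z * y' z) - z ^ (S d) * z ^ S q * (a z * (y z * y z)) + be z)%C).
    assert (H : f 0%C = 0%C).
    { apply (Hdiv n f); unfold f; [contC_tac |]. intros z Hz. specialize (HE2 z Hz).
      replace (S q) with (n + S d)%nat in HE2 at 1 2 by lia. rewrite !Cpow_add_r in HE2.
      transitivity (z ^ n * z ^ S d * (l * y z + z * y' z) - (z ^ n * z ^ S d * z ^ S q * (a z * (y z * y z)) - z ^ n * be z))%C;
        [ring |]. rewrite HE2. ring. }
    unfold f in H. rewrite !Cpow_0_l in H by lia. apply Hbe.
    transitivity (0 * (l * y 0%C + 0 * y' 0%C) - 0 * 0 * (a 0%C * (y 0%C * y 0%C)) + be 0%C)%C; [ring | exact H].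
Qed.

(** * Orders of the transformed data at the puncture *)

Section RiccatiAsymptotics.
Variables (r : R) (c : C) (G G' A F3 F3' y y' : C -> C).
Hypothesis Hr : 0 < r.
Hypothesis Hc : c <> 0%C.
Hypothesis HG : HolD (disk r) G G'.
Hypothesis HG0 : G 0%C = 0%C.
Hypothesis HF3 : HolD (disk r) F3 F3'.
Hypothesis HFA : forall p, pdisk r p -> F3 p = (G p * A p)%C.
Hypothesis HA : forall p, pdisk r p -> A p <> 0%C.
Hypothesis Hy : HolD (pdisk r) y y'.
Hypothesis Hric : forall p, pdisk r p -> (y' p = - c * A p + G' p * (y p * y p))%C.
Hypothesis HGn : exists p, pdisk (r / 2) p /\ G p <> 0%C.
Hypothesis HAu : ~ exists M, near (fun p => Cmod (A p) <= M).

(** Up to the factor [2 / c] the products are the forms of [Zt] in [ribaucour_weierstrass]: the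
    conditions say that [om Zt] has no zero, that [Fe e3 Zt] and [omb Zt] are bounded, and that
    [Gt = G + 1 / y] is [O(z)]. *)
Definition planar_bounds (K : R) : Prop :=
  near (fun p => y p <> 0%C /\ G' p <> 0%C /\
    Cmod (G' p * (y p * (G p * y p + 1))) <= K /\
    Cmod (G' p * ((G p * y p + 1) * (G p * y p + 1))) <= K /\
    Cmod (G p + / y p) <= K * Cmod p).

Lemma HolD_div_near (h h' g g' : C -> C) : HolD (disk r) h h' -> HolD (disk r) g g' -> g 0%C <> 0%C ->
  exists r1, 0 < r1 <= r /\ (forall p, disk r1 p -> g p <> 0%C) /\
    exists q', HolD (disk r1) (fun z => h z * / g z)%C q'.
Proof.
  intros Hh Hg Hg0. destruct (HolD_cont _ _ _ Hr Hg) as [Cg _].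
  destruct (near_away g Cg Hg0) as [k [k0 [d [d0 Hd]]]].
  assert (Hne : forall p, disk (Rmin d r) p -> g p <> 0%C).
  { intros p Hp. destruct (Ceq_dec p 0%C) as [E | E]; [subst p; auto |].
    apply (proj2 (Cmod_gt_0 _)). apply Rlt_le_trans with k; auto. apply Hd. split; auto.
    eapply Rlt_le_trans; [exact Hp | apply Rmin_l]. }
  exists (Rmin d r). split; [split; [apply Rmin_pos; auto | apply Rmin_r] |]. split; auto.
  assert (Hs : forall p, disk (Rmin d r) p -> disk r p).
  { intros p Hp. eapply Rlt_le_trans; [exact Hp | apply Rmin_r]. }
  eexists. apply HolD_mult; [apply (HolD_sub (disk r)); eauto |].
  apply HolD_inv; auto. apply (HolD_sub (disk r)); eauto.
Qed.

Lemma disk_sub (a b : R) p : a <= b -> disk a p -> disk b p.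
Proof. unfold disk. intros. lra. Qed.

Lemma pdisk_sub (a b : R) p : a <= b -> pdisk a p -> pdisk b p.
Proof. intros H [H1 H2]. split; auto. lra. Qed.

(** Write [G = z^(k+1) g], [F3 = z^j h] and [G' = z^k a]. The function [Y = z^(k+1) y] is bounded,
    and its value at the origin is [0] or [- 1 / g 0]. In the first case [y] has a pole of order
    [k - j], and [G' y^2] has order [2 j - k], which may have either sign. In the second case [y]
    has a pole of order [k + 1], and [G' y^2] one of order [k + 2]. *)
Lemma riccati_asymptotics : exists K, 0 < K /\ planar_bounds K /\
  (near (fun p => Cmod (G' p * (y p * y p)) <= K) \/
   near (fun p => 1 <= K * (Cmod p * Cmod (G' p * (y p * y p))))).
Proof.
  destruct HGn as [p0 [[Hp0 Hp0n] HGp0]].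
  assert (H0d : disk r 0) by (unfold disk; rewrite Cmod_0; lra).
  destruct (HolD_order r G G' p0 Hr HG Hp0 HGp0) as [k [g [g' [Hg [Hg0 HGg]]]]].
  destruct k as [|k].
  { exfalso. apply Hg0. specialize (HGg _ H0d). rewrite HG0 in HGg. cbn [Cpow] in HGg.
    transitivity (1 * g 0%C)%C; [ring | symmetry; exact HGg]. }
  assert (Hp0r : pdisk r p0) by (split; auto; lra).
  assert (HFp0 : F3 p0 <> 0%C) by (rewrite HFA by auto; apply Cmult_neq_0; auto).
  destruct (HolD_order r F3 F3' p0 Hr HF3 Hp0 HFp0) as [j [h [h' [Hh [Hh0 HFh]]]]].
  set (be := fun z => (c * (h z * / g z))%C).
  destruct (HolD_div_near h h' g g' Hh Hg Hg0) as [r1 [Hr1 [Hgn [q' Hq]]]].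
  assert (HAe : forall z, pdisk r1 z -> (z ^ S k * A z = z ^ j * (h z * / g z))%C).
  { intros z Hz. pose proof (pdisk_sub r1 r z (proj2 Hr1) Hz) as Hzr.
    specialize (HFA z Hzr). rewrite (HFh z), (HGg z) in HFA by (apply pdisk_disk; auto).
    transitivity (z ^ S k * g z * A z * / g z)%C; [field; apply Hgn; apply pdisk_disk; auto |].
    rewrite <- HFA. ring. }
  (* Otherwise [A] would be bounded. *)
  assert (Hjk : (j <= k)%nat).
  { destruct (Nat.le_gt_cases j k) as [H | H]; auto. exfalso. apply HAu.
    destruct (HolD_cont _ _ _ (proj1 Hr1) Hq) as [Cq _].
    destruct (Nat.le_exists_sub (S k) j H) as [d [Hd _]].
    destruct (near_bounded (fun z => z ^ d * (h z * / g z))%C) as [M [M0 HM]]; [contC_tac |].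
    exists M. generalize (near_and _ _ HM (near_pdisk r1 (proj1 Hr1))). apply near_imp.
    intros z [H1 Hz]. replace (A z) with (z ^ d * (h z * / g z))%C; auto.
    assert (Hzk : (z ^ S k)%C <> 0%C) by (apply Cpow_neq; apply Hz).
    transitivity (/ z ^ S k * (z ^ S k * A z))%C; [| field; auto].
    rewrite HAe by auto. rewrite Hd, Cpow_add_r. field. split; auto. apply Hgn. apply pdisk_disk; auto. }
  set (kk := RtoC (INR (S k))).
  assert (Hkk : kk <> 0%C) by (apply RtoC_neq; apply not_0_INR; lia).
  set (a := fun z => (kk * g z + z * g' z)%C).
  assert (Ha : exists a', HolD (disk r) a a').
  { destruct (HolD_deriv 0%C r g g') as [g'' Hg''].
    { apply (HolD_sub (disk r)); auto. intros p. apply disk_cball. }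
    assert (Hg2 : HolD (disk r) g' g'').
    { apply (HolD_sub (cball 0 r)); auto. intros p. apply disk_cball. }
    eexists. apply (HolD_plus (disk r) _ _ _ _ (HolD_mult _ _ _ _ _ (HolD_const _ kk) Hg)
      (HolD_mult _ _ _ _ _ (HolD_id _) Hg2)). }
  destruct Ha as [a' Ha].
  assert (Ha0 : a 0%C = (kk * g 0%C)%C) by (unfold a; ring).
  assert (Ha0n : a 0%C <> 0%C) by (rewrite Ha0; apply Cmult_neq_0; auto).
  assert (HG' : forall z, disk r z -> (G' z = z ^ k * a z)%C).
  { intros z Hz. apply (isC_unique G z); [apply HG; auto |].
    apply (isC_ext_loc (fun z => z ^ S k * g z)%C); [| apply pow_deriv_mult; apply Hg; auto].
    exists (r - Cmod z). split; [unfold disk in Hz; lra |]. intros w Hw. symmetry. apply HGg.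
    unfold disk. replace w with ((w - z) + z)%C by ring. eapply Rle_lt_trans; [apply Cmod_triangle |]. lra. }
  (* Multiplied by [z^(k+1)] and by the [z] in front of [Y'], the term [c A] becomes
     [c z^(j+1) h / g]. *)
  set (n := S j).
  assert (Hbe : HolD (disk r1) be (fun z => 0 * (h z * / g z) + c * q' z)%C).
  { apply (HolD_mult _ _ _ _ _ (HolD_const _ c) Hq). }
  assert (Hbe0 : be 0%C <> 0%C).
  { unfold be. apply Cmult_neq_0; auto. apply Cmult_neq_0; auto.
    intros E. assert (E1 : (g 0%C * / g 0%C)%C = 0%C) by (rewrite E; ring).
    rewrite Cinv_r in E1 by auto. apply C1_nz. exact E1. }
  set (Y := fun z => (z ^ S k * y z)%C).
  set (Y' := fun z => (z ^ k * (kk * y z + z * y' z))%C).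
  assert (HY : HolD (pdisk r) Y Y').
  { intros z Hz. destruct (Hy z Hz) as [H1 H2]. split; [apply pow_deriv_mult; auto |].
    pose proof (isC_cont _ _ _ H1). unfold Y'. contC_tac. }
  assert (HYE : forall z, pdisk r1 z -> (z * Y' z = kk * Y z + a z * (Y z * Y z) - z ^ n * be z)%C).
  { intros z Hz. pose proof (pdisk_sub r1 r z (proj2 Hr1) Hz) as Hzr.
    assert (E : (z ^ n * be z = c * z * (z ^ S k * A z))%C).
    { rewrite HAe by auto. unfold be, n. cbn [Cpow]. ring. }
    rewrite E. unfold Y', Y. rewrite (Hric z Hzr), HG' by (apply pdisk_disk; auto). cbn [Cpow]. ring. }
  destruct (HolD_cont _ _ _ Hr Ha) as [Ca _]. destruct (HolD_cont _ _ _ (proj1 Hr1) Hbe) as [Cb _].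
  destruct (near_away a Ca Ha0n) as [al [al0 Hal]].
  destruct (near_bounded (fun z => z ^ n * be z)%C) as [B [B0 HB]]; [contC_tac |].
  destruct (near_and _ _ (near_and _ _ Hal HB) (near_pdisk r1 (proj1 Hr1))) as [r2 [Hr2 H2]].
  assert (HYb : forall z, pdisk (Rmin r2 r1 / 2) z -> Cmod (Y z) <= 1 + 4 * (24 + Cmod kk + B) / al).
  { apply (riccati_bound (Rmin r2 r1) Y Y' a (fun z => z ^ n * be z)%C kk al B); auto; try lra.
    - apply (HolD_sub (pdisk r)); auto. intros p. apply pdisk_sub.
      eapply Rle_trans; [apply Rmin_r | lra].
    - intros z Hz. apply (H2 z). revert Hz. apply pdisk_sub. apply Rmin_l.
    - intros z Hz. apply HYE. revert Hz. apply pdisk_sub. apply Rmin_r. }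
  assert (Hrm : 0 < Rmin r2 r1) by (apply Rmin_pos; lra).
  edestruct (fun M => removable r1 (Rmin r2 r1 / 2) M Y Y') as [Ye [Ye' [HYe HYeq]]]; [| | exact HYb |].
  { split; [lra |]. pose proof (Rmin_r r2 r1). lra. }
  { apply (HolD_sub (pdisk r)); auto. intros p. apply pdisk_sub. lra. }
  assert (HYE' : forall z, pdisk r1 z -> (z * Ye' z = kk * Ye z + a z * (Ye z * Ye z) - z ^ n * be z)%C).
  { intros z Hz. rewrite HYeq by auto. rewrite <- HYE by auto. f_equal.
    apply (isC_unique Ye z); [apply HYe; apply pdisk_disk; auto |].
    destruct (pdisk_open r1 z Hz) as [d [d0 Hd]].
    apply (isC_ext_loc Y).
    - exists d. split; auto. intros q Hq0. symmetry. apply HYeq. apply Hd. exact Hq0.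
    - apply HY. revert Hz. apply pdisk_sub. lra. }
  assert (Har1 : HolD (disk r1) a a') by (apply (HolD_sub (disk r)); auto; intros p; apply disk_sub; lra).
  pose proof (riccati_limit r1 a a' be _ Ye Ye' (S k) n (proj1 Hr1) (Nat.lt_0_succ j) Har1 Hbe HYe HYE') as HL.
  fold kk in HL. rewrite Ha0 in HL.
  destruct (HolD_cont _ _ _ (proj1 Hr1) HYe) as [CY _].
  destruct (HolD_cont _ _ _ Hr Hg) as [Cg _].
  destruct (near_bounded a Ca) as [Ka [Ka0 HKa]].
  destruct (near_bounded g Cg) as [Kg [Kg0 HKg]].
  destruct (near_bounded Ye CY) as [KY [KY0 HKY]].
  assert (Hone : near (pdisk (Rmin r1 1))) by (apply near_pdisk; apply Rmin_pos; lra).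
  assert (Hz1 : forall z, pdisk (Rmin r1 1) z -> pdisk r1 z /\ 0 < Cmod z <= 1 /\ z <> 0%C).
  { intros z [Hz Hz0]. split; [split; auto; eapply Rlt_le_trans; [exact Hz | apply Rmin_l] |].
    split; auto. split; [exact (proj1 (Cmod_gt_0 z) Hz0) |].
    left. eapply Rlt_le_trans; [exact Hz | apply Rmin_r]. }
  assert (HGy : forall z, pdisk r1 z -> (G z * y z = g z * Ye z)%C).
  { intros z Hz. pose proof (pdisk_sub r1 r z (proj2 Hr1) Hz) as Hzr.
    rewrite HYeq by auto. rewrite HGg by (apply pdisk_disk; auto). unfold Y. ring. }
  destruct (Ceq_dec (Ye 0%C) 0%C) as [HY0 | HY0].
  - (* [y] has the smaller pole: [Y] vanishes to the order [n = j + 1]. *)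
    assert (Hnk : (0 < n <= S k)%nat) by (unfold n; lia).
    destruct (riccati_order r1 a a' be _ Ye Ye' (S k) n (proj1 Hr1) Hnk Har1 Hbe HYe Hbe0 HY0 HYE')
      as [Hnk2 [v [v' [Hv [Hv0 HYv]]]]].
    destruct (HolD_cont _ _ _ (proj1 Hr1) Hv) as [Cv _].
    destruct (near_bounded v Cv) as [Kv [Kv0 HKv]].
    destruct (near_away v Cv Hv0) as [kv [kv0 Hkv]].
    assert (Hkm : exists m, k = (j + S m)%nat).
    { exists (k - S j)%nat. unfold n in Hnk2. lia. }
    destruct Hkm as [m Hm].
    assert (Hyv : forall z, pdisk r1 z -> (z ^ S m * y z = v z)%C).
    { intros z Hz. assert (Hzn : (z ^ n)%C <> 0%C) by (apply Cpow_neq; apply Hz).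
      pose proof (HYv z (pdisk_disk _ _ Hz)) as E. rewrite HYeq in E by auto. unfold Y in E.
      replace (S k) with (n + S m)%nat in E by (unfold n; lia). rewrite Cpow_add_r in E.
      transitivity (/ z ^ n * (z ^ n * z ^ S m * y z))%C; [field; auto |]. rewrite E. field. auto. }
    (* One positive summand, or two, for each estimate below, so that [K] dominates them all. *)
    set (K := Ka * Kv * (Kg * KY + 1) + Ka * ((Kg * KY + 1) * (Kg * KY + 1)) + Kg + / kv
       + Ka * (Kv * Kv) + / (al * (kv * kv))).
    assert (P1 : 0 < Kg * KY + 1) by nra.
    assert (Q1 : 0 < Ka * Kv * (Kg * KY + 1)) by (repeat apply Rmult_lt_0_compat; auto).
    assert (Q2 : 0 < Ka * ((Kg * KY + 1) * (Kg * KY + 1))) by (repeat apply Rmult_lt_0_compat; auto).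
    assert (Q3 : 0 < / kv) by (apply Rinv_0_lt_compat; auto).
    assert (Q4 : 0 < Ka * (Kv * Kv)) by (repeat apply Rmult_lt_0_compat; auto).
    assert (Q5 : 0 < / (al * (kv * kv))) by (apply Rinv_0_lt_compat; repeat apply Rmult_lt_0_compat; auto).
    assert (HBd : forall z, pdisk r1 z -> Cmod (g z) <= Kg -> Cmod (Ye z) <= KY -> Cmod (G z * y z + 1) <= Kg * KY + 1).
    { intros z Hz H3 H4. rewrite HGy by auto. eapply Rle_trans; [apply Cmod_triangle |].
      rewrite Cmod_1, Cmod_mult. apply Rplus_le_compat_r. apply Rmult_le_compat; auto; apply Cmod_ge_0. }
    exists K. split; [unfold K; lra |]. split; [unfold planar_bounds |].
    + generalize (near_and _ _ (near_and _ _ (near_and _ _ HKa HKg) (near_and _ _ HKY HKv)) (near_and _ _ (near_and _ _ Hal Hkv) Hone)).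
      apply near_imp. intros z [[[H3 H4] [H5 H6]] [[H7 H8] H9]].
      destruct (Hz1 z H9) as [Hzr1 [Hzm Hz0]]. pose proof (pdisk_sub r1 r z (proj2 Hr1) Hzr1) as Hzr.
      specialize (Hyv z Hzr1). specialize (HBd z Hzr1 H4 H5).
      assert (Hvn : v z <> 0%C) by (apply (proj2 (Cmod_gt_0 _)); lra).
      assert (Han : a z <> 0%C) by (apply (proj2 (Cmod_gt_0 _)); lra).
      assert (Hyn : y z <> 0%C).
      { intros E. apply Hvn. rewrite <- Hyv, E. ring. }
      rewrite HG' by (apply pdisk_disk; auto).
      assert (Hpw : forall i, Cmod (z ^ i) <= 1) by (intros i; rewrite Cmod_pow; apply pow_le_1; lra).
      split; auto. split; [apply Cmult_neq_0; auto; apply Cpow_neq; auto |].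
      split; [| split].
      * replace (z ^ k * a z * (y z * (G z * y z + 1)))%C with (z ^ j * (a z * v z * (G z * y z + 1)))%C
          by (rewrite Hm, Cpow_add_r, <- Hyv; ring).
        rewrite Cmod_mult. apply Rle_trans with (1 * (Ka * Kv * (Kg * KY + 1))).
        { apply Rmult_le_compat; auto; try apply Cmod_ge_0. rewrite !Cmod_mult.
          apply Rmult_le_compat; auto; try apply Cmod_ge_0; [apply Rmult_le_pos; apply Cmod_ge_0 |].
          apply Rmult_le_compat; auto; apply Cmod_ge_0. }
        unfold K. lra.
      * rewrite !Cmod_mult. rewrite Rmult_assoc. apply Rle_trans with (1 * (Ka * ((Kg * KY + 1) * (Kg * KY + 1)))).
        { apply Rmult_le_compat; auto; try apply Cmod_ge_0; [prod_le_tac |].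
          apply Rmult_le_compat; auto; try apply Cmod_ge_0; [prod_le_tac |].
          apply Rmult_le_compat; auto; apply Cmod_ge_0. }
        unfold K. lra.
      * replace (/ y z)%C with (z * (z ^ m * / v z))%C
          by (rewrite <- Hyv; cbn [Cpow]; field; repeat split; auto; apply Cpow_neq; auto).
        rewrite HGg by (apply pdisk_disk; auto).
        replace (z ^ S k * g z + z * (z ^ m * / v z))%C with ((z ^ k * g z + z ^ m * / v z) * z)%C by (cbn [Cpow]; ring).
        rewrite Cmod_mult. apply Rmult_le_compat_r; [lra |].
        eapply Rle_trans; [apply Cmod_triangle |]. rewrite !Cmod_mult, Cmod_inv by auto.
        apply Rle_trans with (1 * Kg + 1 * / kv); [| unfold K; lra].
        apply Rplus_le_compat; apply Rmult_le_compat; auto; try apply Cmod_ge_0.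
        { left. apply Rinv_0_lt_compat. lra. }
        { apply Rinv_le_contravar; auto. }
    (* [G' y^2] has order [k - 2 (m + 1) = j - (m + 1)]; if this is negative, it is at most [- 1],
       and one factor [z] does not make the product small. *)
    + destruct (Nat.le_gt_cases (S m) j) as [Hjm | Hjm]; [left | right].
      * generalize (near_and _ _ (near_and _ _ HKa HKv) Hone).
        apply near_imp. intros z [[H3 H6] H9].
        destruct (Hz1 z H9) as [Hzr1 [Hzm Hz0]]. pose proof (pdisk_sub r1 r z (proj2 Hr1) Hzr1) as Hzr.
        specialize (Hyv z Hzr1). rewrite HG' by (apply pdisk_disk; auto).
        destruct (Nat.le_exists_sub (S m) j Hjm) as [d [Hd _]].
        replace (z ^ k * a z * (y z * y z))%C with (z ^ d * (a z * (v z * v z)))%C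
          by (rewrite Hm, Hd, !Cpow_add_r, <- Hyv; ring).
        rewrite !Cmod_mult. apply Rle_trans with (1 * (Ka * (Kv * Kv))); [| unfold K; lra].
        apply Rmult_le_compat; try apply Cmod_ge_0; [prod_le_tac | rewrite Cmod_pow; apply pow_le_1; lra |].
        apply Rmult_le_compat; auto; try apply Cmod_ge_0; [prod_le_tac |].
        apply Rmult_le_compat; auto; apply Cmod_ge_0.
      * generalize (near_and _ _ (near_and _ _ Hal Hkv) Hone).
        apply near_imp. intros z [[H7 H8] H9].
        destruct (Hz1 z H9) as [Hzr1 [Hzm Hz0]]. pose proof (pdisk_sub r1 r z (proj2 Hr1) Hzr1) as Hzr.
        specialize (Hyv z Hzr1). rewrite HG' by (apply pdisk_disk; auto).
        destruct (Nat.le_exists_sub j m (proj1 (Nat.lt_succ_r j m) Hjm)) as [d [Hd _]].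
        assert (E : Cmod z ^ d * (Cmod z * Cmod (z ^ k * a z * (y z * y z))) = Cmod (a z) * (Cmod (v z) * Cmod (v z))).
        { rewrite <- Cmod_pow, <- !Cmod_mult. f_equal. rewrite <- Hyv, Hm, Hd, !Cpow_add_r.
          cbn [Cpow]. rewrite !Cpow_add_r. ring. }
        assert (E2 : al * (kv * kv) <= Cmod z * Cmod (z ^ k * a z * (y z * y z))).
        { apply Rle_trans with (Cmod (a z) * (Cmod (v z) * Cmod (v z))).
          - apply Rmult_le_compat; try lra; [nra |]. apply Rmult_le_compat; lra.
          - rewrite <- E. rewrite <- (Rmult_1_l (Cmod z * _)) at 2.
            apply Rmult_le_compat_r; [prod_le_tac; lra | apply pow_le_1; lra]. }
        apply Rle_trans with (/ (al * (kv * kv)) * (al * (kv * kv))).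
        { right. field. lra. }
        apply Rmult_le_compat; try lra.
        { repeat apply Rmult_le_pos; lra. }
        unfold K. lra.
  - (* [y] has a pole of order [k + 1]. *)
    assert (HgY : (g 0%C * Ye 0%C + 1)%C = 0%C).
    { assert (E : (kk * Ye 0%C * (g 0%C * Ye 0%C + 1))%C = 0%C).
      { transitivity (kk * Ye 0%C + kk * g 0%C * (Ye 0%C * Ye 0%C))%C; [ring | exact HL]. }
      destruct (Ceq_dec (g 0%C * Ye 0%C + 1)%C 0%C) as [E1 | E1]; auto. exfalso.
      revert E. repeat apply Cmult_neq_0; auto. }
    assert (Hgr1 : HolD (disk r1) g g') by (apply (HolD_sub (disk r)); auto; intros p; apply disk_sub; lra).
    (* [G y + 1 = g Y + 1] vanishes at the origin and so yields a factor [z], just enough to cancel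
       the pole of [G' y], which is simple. *)
    destruct (HolD_divide r1 (fun z => g z * Ye z + 1)%C _ (proj1 Hr1)
      (HolD_plus _ _ _ _ _ (HolD_mult _ _ _ _ _ Hgr1 HYe) (HolD_const _ 1%C)) HgY) as [q [qd [Hqd HqE]]].
    cbv beta in HqE.
    destruct (HolD_cont _ _ _ (proj1 Hr1) Hqd) as [Cq _].
    destruct (near_bounded q Cq) as [Kq [Kq0 HKq]].
    destruct (near_away Ye CY HY0) as [kY [kY0 HkY]].
    set (K := Ka * KY * Kq + Ka * (Kq * Kq) + Kg + / kY + / (al * (kY * kY))).
    assert (Q1 : 0 < Ka * KY * Kq) by (repeat apply Rmult_lt_0_compat; auto).
    assert (Q2 : 0 < Ka * (Kq * Kq)) by (repeat apply Rmult_lt_0_compat; auto).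
    assert (Q3 : 0 < / kY) by (apply Rinv_0_lt_compat; auto).
    assert (Q5 : 0 < / (al * (kY * kY))) by (apply Rinv_0_lt_compat; repeat apply Rmult_lt_0_compat; auto).
    assert (Hyz : forall z, pdisk r1 z -> (z ^ S k * y z = Ye z)%C) by (intros z Hz; rewrite HYeq; auto).
    exists K. split; [unfold K; lra |]. split; [unfold planar_bounds | right].
    + generalize (near_and _ _ (near_and _ _ (near_and _ _ HKa HKg) (near_and _ _ HKY HKq)) (near_and _ _ (near_and _ _ Hal HkY) Hone)).
      apply near_imp. intros z [[[H3 H4] [H5 H6]] [[H7 H8] H9]].
      destruct (Hz1 z H9) as [Hzr1 [Hzm Hz0]]. pose proof (pdisk_sub r1 r z (proj2 Hr1) Hzr1) as Hzr.
      specialize (Hyz z Hzr1).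
      assert (Hvn : Ye z <> 0%C) by (apply (proj2 (Cmod_gt_0 _)); lra).
      assert (Han : a z <> 0%C) by (apply (proj2 (Cmod_gt_0 _)); lra).
      assert (Hyn : y z <> 0%C).
      { intros E. apply Hvn. rewrite <- Hyz, E. ring. }
      assert (HB1 : (G z * y z + 1 = z * q z)%C).
      { rewrite HGy by auto. apply HqE. apply pdisk_disk; auto. }
      rewrite HG' by (apply pdisk_disk; auto). rewrite HB1.
      assert (Hpw : forall i, Cmod (z ^ i) <= 1) by (intros i; rewrite Cmod_pow; apply pow_le_1; lra).
      split; auto. split; [apply Cmult_neq_0; auto; apply Cpow_neq; auto |].
      split; [| split].
      * replace (z ^ k * a z * (y z * (z * q z)))%C with (a z * Ye z * q z)%C
          by (rewrite <- Hyz; cbn [Cpow]; ring).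
        rewrite !Cmod_mult. apply Rle_trans with (Ka * KY * Kq); [| unfold K; lra].
        prod_le_tac.
      * replace (z ^ k * a z * (z * q z * (z * q z)))%C with (z ^ S (S k) * (a z * (q z * q z)))%C
          by (cbn [Cpow]; ring).
        rewrite !Cmod_mult. apply Rle_trans with (1 * (Ka * (Kq * Kq))); [| unfold K; lra].
        prod_le_tac.
      * replace (/ y z)%C with (z ^ S k * / Ye z)%C
          by (rewrite <- Hyz; field; split; auto; apply Cpow_neq; auto).
        rewrite HGg by (apply pdisk_disk; auto).
        replace (z ^ S k * g z + z ^ S k * / Ye z)%C with (z ^ k * (g z + / Ye z) * z)%C by (cbn [Cpow]; ring).
        rewrite Cmod_mult. apply Rmult_le_compat_r; [lra |].
        rewrite Cmod_mult. apply Rle_trans with (1 * (Kg + / kY)); [| unfold K; lra].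
        apply Rmult_le_compat; auto; try apply Cmod_ge_0.
        eapply Rle_trans; [apply Cmod_triangle |]. rewrite Cmod_inv by auto.
        apply Rplus_le_compat; auto. apply Rinv_le_contravar; auto.
    + generalize (near_and _ _ (near_and _ _ Hal HkY) Hone).
      apply near_imp. intros z [[H7 H8] H9].
      destruct (Hz1 z H9) as [Hzr1 [Hzm Hz0]]. pose proof (pdisk_sub r1 r z (proj2 Hr1) Hzr1) as Hzr.
      specialize (Hyz z Hzr1). rewrite HG' by (apply pdisk_disk; auto).
      assert (E : Cmod z ^ S k * (Cmod z * Cmod (z ^ k * a z * (y z * y z))) = Cmod (a z) * (Cmod (Ye z) * Cmod (Ye z))).
      { rewrite <- Cmod_pow, <- !Cmod_mult. f_equal. rewrite <- Hyz. cbn [Cpow]. ring. }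
      assert (E2 : al * (kY * kY) <= Cmod z * Cmod (z ^ k * a z * (y z * y z))).
      { apply Rle_trans with (Cmod (a z) * (Cmod (Ye z) * Cmod (Ye z))).
        - apply Rmult_le_compat; try lra; [nra |]. apply Rmult_le_compat; lra.
        - rewrite <- E. rewrite <- (Rmult_1_l (Cmod z * _)) at 2.
          apply Rmult_le_compat_r; [prod_le_tac; lra | apply pow_le_1; lra]. }
      apply Rle_trans with (/ (al * (kY * kY)) * (al * (kY * kY))).
      { right. field. lra. }
      apply Rmult_le_compat; try lra.
      { repeat apply Rmult_le_pos; lra. }
      unfold K. lra.
Qed.
End RiccatiAsymptotics.

(** * Extension across the puncture and lengths of curves *)

Lemma segment_lipschitz (h : C -> R) (F : C -> C) (p q : C) K :
  (forall s, 0 <= s <= 1 -> isG h (p + RtoC s * (q - p))%C (F (p + RtoC s * (q - p))%C) /\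
     Cmod (F (p + RtoC s * (q - p))%C) <= K) ->
  Rabs (h q - h p) <= K * Cmod (q - p).
Proof.
  intros H.
  set (m := fun s : R => (p + RtoC s * (q - p))%C).
  assert (Hm : forall s, isRC m s (q - p)%C).
  { intros s. unfold m. eapply isRC_eq.
    - apply isRC_plus; [apply isRC_const |]. apply isRC_mult; [apply isRC_RtoC | apply isRC_const].
    - simpl. ring. }
  assert (HD : forall s, 0 <= s <= 1 -> is_derive (fun s => h (m s)) s (fst ((q - p) * F (m s))%C)).
  { intros s Hs. apply isG_curve; auto. apply H. auto. }
  destruct (MVT_gen (fun s => h (m s)) 0 1 (fun s => fst ((q - p) * F (m s))%C)) as [s [Hs E]].
  - intros s Hs. rewrite Rmin_left, Rmax_right in Hs by lra. apply HD. lra.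
  - intros s Hs. rewrite Rmin_left, Rmax_right in Hs by lra.
    apply continuity_pt_filterlim. apply (ex_derive_continuous (V := R_NormedModule)).
    eexists. apply HD. lra.
  - rewrite Rmin_left, Rmax_right in Hs by lra. cbv beta in E.
    replace (m 1) with q in E by (unfold m; ring).
    replace (m 0) with p in E by (unfold m; ring).
    rewrite E. rewrite Rminus_0_r, Rmult_1_r.
    eapply Rle_trans; [apply abs_fst_le |]. rewrite Cmod_mult, Rmult_comm.
    apply Rmult_le_compat_r; [apply Cmod_ge_0 |]. apply (H s Hs).
Qed.

Lemma near_proper : ProperFilter (locally' (T := C_UniformSpace) (RtoC 0)).
Proof.
  constructor; [| apply locally'_filter].
  intros P HP. apply locally'_Cmod in HP. apply near_ex. exact HP.
Qed.

Lemma segment_pdisk d (p q : C) s : 0 <= s <= 1 -> Cmod p < d -> Cmod q < d ->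
  (p + RtoC s * (q - p))%C <> 0%C -> pdisk d (p + RtoC s * (q - p))%C.
Proof.
  intros Hs Hp Hq Hn. split; auto.
  replace (p + RtoC s * (q - p))%C with (RtoC (1 - s) * p + RtoC s * q)%C by (rewrite RtoC_minus; ring).
  eapply Rle_lt_trans; [apply Cmod_triangle |].
  rewrite !Cmod_mult, !Cmod_R, !Rabs_right by lra.
  destruct (Req_dec s 0) as [E | E]; [subst s; lra |]. nra.
Qed.

(** Cauchy's criterion. The punctured disk is not convex: if the segment from [p] to [q] meets the
    origin, a detour through [i p] avoids it and at most doubles the bound. *)
Lemma bounded_gradient_limit r (h : C -> R) (F : C -> C) K : 0 < r -> 0 < K ->
  (forall p, pdisk r p -> isG h p (F p)) -> near (fun p => Cmod (F p) <= K) ->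
  exists l, filterlim h (locally' (T := C_UniformSpace) (RtoC 0)) (locally l).
Proof.
  intros Hr HK HG Hn.
  destruct (near_and _ _ Hn (near_pdisk r Hr)) as [d [d0 Hd]].
  assert (Hseg : forall e p q, e <= d -> pdisk e p -> pdisk e q ->
    (forall s, 0 <= s <= 1 -> (p + RtoC s * (q - p))%C <> 0%C) -> Rabs (h q - h p) <= K * (2 * e)).
  { intros e p q He [Hp _] [Hq _] Hs.
    eapply Rle_trans; [apply (segment_lipschitz h F p q K) |].
    - intros s Hs1.
      assert (Hin : pdisk d (p + RtoC s * (q - p))%C).
      { apply (pdisk_sub e d); auto. apply segment_pdisk; auto. }
      destruct (Hd _ Hin). split; auto.
    - apply Rmult_le_compat_l; [lra |]. unfold Cminus. eapply Rle_trans; [apply Cmod_triangle |].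
      rewrite Cmod_opp. lra. }
  assert (Hall : forall e p q, e <= d -> pdisk e p -> pdisk e q -> Rabs (h q - h p) <= K * (4 * e)).
  { intros e p q He Hp Hq.
    assert (He0 : 0 < e) by (destruct Hp; pose proof (Cmod_ge_0 p); lra).
    assert (HK4 : 0 < K * e) by (apply Rmult_lt_0_compat; auto).
    destruct (classic (exists s, 0 <= s <= 1 /\ (p + RtoC s * (q - p))%C = 0%C)) as [[s [Hs E]] | Hno].
    - set (w := (Ci * p)%C).
      assert (Hw : pdisk e w).
      { destruct Hp as [H1 H2]. split; [unfold w; rewrite Cmod_mult, Cmod_Ci; lra |].
        apply Cmult_neq_0; auto. apply Ci_nz. }
      assert (Hre : forall x y : R, (p * (RtoC x + RtoC y * Ci))%C = 0%C -> x = 0 /\ y = 0).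
      { intros x y Hxy. destruct (Ceq_dec (RtoC x + RtoC y * Ci)%C 0%C) as [Ez | Ez].
        - split; [apply (f_equal fst) in Ez | apply (f_equal snd) in Ez]; simpl in Ez; lra.
        - exfalso. revert Hxy. apply Cmult_neq_0; auto. apply Hp. }
      assert (Hs0 : s <> 0).
      { intros E0. apply (proj2 Hp). rewrite <- E, E0. ring. }
      assert (Hq2 : q = (p * RtoC (- (1 - s) / s))%C).
      { assert (Hsn : RtoC s <> 0%C) by (apply RtoC_neq; auto).
        transitivity ((p + RtoC s * (q - p)) / RtoC s - p * RtoC ((1 - s) / s))%C.
        - rewrite RtoC_div, RtoC_minus by auto. field. auto.
        - rewrite E. replace (- (1 - s) / s) with (- ((1 - s) / s)) by (field; auto).
          rewrite RtoC_opp. field. auto. }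
      assert (A1 : Rabs (h w - h p) <= K * (2 * e)).
      { apply Hseg; auto. intros t Ht Et.
        destruct (Hre (1 - t) t) as [B1 B2]; [| lra].
        rewrite <- Et. unfold w. rewrite RtoC_minus. ring. }
      assert (A2 : Rabs (h q - h w) <= K * (2 * e)).
      { apply Hseg; auto. intros t Ht Et.
        destruct (Hre (t * (- (1 - s) / s)) (1 - t)) as [B1 B2].
        - rewrite <- Et. unfold w. rewrite Hq2 at 1. rewrite RtoC_mult, RtoC_minus. ring.
        - assert (t = 1) by lra. subst t. apply (proj2 Hq). rewrite Hq2.
          replace (- (1 - s) / s) with (1 * (- (1 - s) / s)) by ring. rewrite B1. ring. }
      replace (h q - h p) with ((h q - h w) + (h w - h p)) by ring.
      eapply Rle_trans; [apply Rabs_triang |]. lra.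
    - assert (Rabs (h q - h p) <= K * (2 * e)); [| lra].
      apply Hseg; auto. intros s Hs E. apply Hno. exists s. auto. }
  refine (proj1 (@filterlim_locally_cauchy C R_CompleteSpace
    (locally' (T := C_UniformSpace) (RtoC 0)) near_proper h) _).
  intros eps. set (e := Rmin d (eps / (8 * K))).
  assert (He : 0 < e).
  { apply Rmin_pos; auto. apply Rdiv_lt_0_compat; [apply cond_pos | lra]. }
  exists (pdisk e). split.
  - apply locally'_Cmod. exists e. split; auto.
  - intros u v Hu Hv. assert (Hb : Rabs (h v - h u) <= K * (4 * e)).
    { apply Hall; auto. apply Rmin_l. }
    assert (e <= eps / (8 * K)) by apply Rmin_r.
    change (Rabs (h v - h u) < eps).
    eapply Rle_lt_trans; [exact Hb |]. pose proof (cond_pos eps).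
    apply Rle_lt_trans with (K * (4 * (eps / (8 * K)))).
    + apply Rmult_le_compat_l; lra.
    + replace (K * (4 * (eps / (8 * K)))) with (eps / 2) by (field; lra). lra.
Qed.

Lemma isC_fst_isd f p l : isC f p l ->
  isd du (fun q => fst (f q)) p (fst l) /\ isd dv (fun q => fst (f q)) p (fst (Ci * l)%C).
Proof.
  intros H. apply isW_isC in H. destruct (isW_isd _ _ _ _ H) as [A [_ [B _]]]. split.
  - eapply isd_eq; [exact A |]. f_equal. ring.
  - eapply isd_eq; [exact B |]. f_equal. f_equal. ring.
Qed.

Lemma cball_locally_2d (p : C) d (P : C -> Prop) : 0 < d -> (forall q, cball p d q -> P q) ->
  locally_2d (fun u v => P (u, v)) (fst p) (snd p).
Proof.
  intros d0 H. assert (H2 : 0 < d / 2) by lra. exists (mkposreal _ H2). intros u v Hu Hv.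
  simpl in Hu, Hv. apply H. unfold cball. eapply Rle_lt_trans; [apply Cmod_le_abs |].
  simpl. unfold Rminus in *. lra.
Qed.

(** The partial derivatives of the real part of [f] are the real parts of [f'] and [i f'], again
    holomorphic, so induction applies. *)
Lemma HolD_smooth r n : forall f f', HolD (disk r) f f' ->
  forall p, disk r p -> ex_diff_n (fun u v => fst (f (u, v))) n (fst p) (snd p).
Proof.
  assert (Hc0 : forall f f', HolD (disk r) f f' -> forall p, disk r p ->
    continuity_2d_pt (fun u v => fst (f (u, v))) (fst p) (snd p)).
  { intros f f' Hf p Hp. apply continuity_2d_pt_filterlim.
    pose proof (isC_cont _ _ _ (proj1 (Hf p Hp))) as Hc.
    apply (proj1 (cont_pair f p)) in Hc. destruct Hc as [Hc _]. destruct p as [a b]. simpl.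
    change (continuous (T := C_UniformSpace) (U := R_UniformSpace)
      (fun z : R * R => fst (f (fst z, snd z))) (a, b)).
    apply (continuous_ext_loc (T := C_UniformSpace) (U := R_UniformSpace) _ (fun z : C => fst (f z))); [| exact Hc].
    exists (mkposreal 1 Rlt_0_1). intros [u v] _. reflexivity. }
  induction n as [|n IH]; intros f f' Hf p Hp.
  - split; [eapply Hc0; eauto | exact I].
  - split; [eapply Hc0; eauto |].
    assert (Hf' : exists f'', HolD (disk r) f' f'').
    { destruct (HolD_deriv 0%C r f f') as [f'' Hf''].
      { apply (HolD_sub (disk r)); auto. intros q. apply disk_cball. }
      exists f''. apply (HolD_sub (cball 0 r)); auto. intros q. apply disk_cball. }
    destruct Hf' as [f'' Hf'].
    pose proof (HolD_mult _ _ _ _ _ (HolD_const (disk r) Ci) Hf') as Hif.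
    assert (Hd : 0 < r - Cmod p) by (unfold disk in Hp; lra).
    assert (Hin : forall q, cball p (r - Cmod p) q -> disk r q).
    { intros q Hq. unfold cball in Hq. unfold disk. replace q with ((q - p) + p)%C by ring.
      eapply Rle_lt_trans; [apply Cmod_triangle |]. lra. }
    pose proof (isC_fst_isd f p _ (proj1 (Hf p Hp))) as [D1 D2].
    split; [eexists; exact D1 |]. split; [eexists; exact D2 |]. split.
    + apply (ex_diff_n_ext_loc (fun u v => fst (f' (u, v)))); [| apply (IH f' f''); auto].
      apply (cball_locally_2d p _ (fun q => fst (f' q) = Derive (fun z => fst (f (z, snd q))) (fst q)) Hd).
      intros q Hq. symmetry. apply is_derive_unique. apply (isC_fst_isd f q _ (proj1 (Hf q (Hin q Hq)))).
    + apply (ex_diff_n_ext_loc (fun u v => fst (Ci * f' (u, v))%C)); [| eapply (IH (fun z => Ci * f' z)%C); eauto].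
      apply (cball_locally_2d p _ (fun q => fst (Ci * f' q)%C = Derive (fun z => fst (f (fst q, z))) (snd q)) Hd).
      intros q Hq. symmetry. apply is_derive_unique. apply (isC_fst_isd f q _ (proj1 (Hf q (Hin q Hq)))).
Qed.

Lemma isG_isd h p w : isG h p w -> isd du h p (fst w) /\ isd dv h p (- snd w).
Proof.
  intros H. apply isG_isW in H. destruct (isW_isd _ _ _ _ H) as [A [_ [B _]]]. split.
  - eapply isd_eq; [exact A |]. destruct w as [a b]. unfold Cconj, Cdiv, Cinv, RtoC, Cmult, Cplus; simpl. field.
  - eapply isd_eq; [exact B |]. destruct w as [a b]. unfold Cconj, Cdiv, Cinv, RtoC, Cminus, Copp, Cmult, Cplus; simpl. field.
Qed.

Lemma isG_cont h p w : isG h p w -> continuous (T := C_UniformSpace) h p.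
Proof.
  intros H. apply isG_isW in H.
  pose proof (Cmod_ge_0 (w / 2)). pose proof (Cmod_ge_0 (Cconj w / 2)).
  set (K := Cmod (w / 2) + Cmod (Cconj w / 2) + 1).
  intros P [e He]. apply locally_Cmod.
  destruct (H 1 Rlt_0_1) as [d [d0 Hd]].
  assert (HK : 0 < K) by (unfold K; lra).
  exists (Rmin d (e / K)). split; [apply Rmin_pos; auto; apply Rdiv_lt_0_compat; auto; apply cond_pos |].
  intros q Hq. apply He. change (Rabs (h q - h p) < e).
  assert (Hq1 : Cmod (q - p) < d) by (eapply Rlt_le_trans; [exact Hq | apply Rmin_l]).
  assert (Hq2 : Cmod (q - p) < e / K) by (eapply Rlt_le_trans; [exact Hq | apply Rmin_r]).
  specialize (Hd q Hq1). rewrite <- Cmod_R, RtoC_minus.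
  replace (RtoC (h q) - RtoC (h p))%C with ((RtoC (h q) - RtoC (h p) - (q - p) * (w / 2) - Cconj (q - p) * (Cconj w / 2))
    + ((q - p) * (w / 2) + Cconj (q - p) * (Cconj w / 2)))%C by ring.
  eapply Rle_lt_trans; [apply Cmod_triangle |].
  pose proof (Cmod_triangle ((q - p) * (w / 2)) (Cconj (q - p) * (Cconj w / 2))) as HT.
  rewrite !Cmod_mult, Cmod_conj in HT.
  apply Rle_lt_trans with (K * Cmod (q - p)); [unfold K; lra |].
  apply Rlt_le_trans with (K * (e / K)); [apply Rmult_lt_compat_l; auto | right; field; lra].
Qed.

(** The point is differentiability at the origin. After subtraction of the linear map with gradient
    [f 0], the gradient is small near the origin; integrating it along the ray from [t q] to [q],
    which misses the origin, and letting [t] tend to [0] gives the estimate. Smoothness then follows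
    from that of [f]. *)
Lemma smooth_extension r (h : C -> R) (f f' : C -> C) l : 0 < r ->
  HolD (disk r) f f' -> (forall p, pdisk r p -> isG h p (f p)) ->
  filterlim h (locally' (T := C_UniformSpace) (RtoC 0)) (locally l) ->
  let hb := fun p => if Ceq_dec p (RtoC 0) then l else h p in
  smooth (disk r) hb /\ forall p, disk r p -> isG hb p (f p).
Proof.
  intros Hr Hf HG Hl hb.
  assert (Hb : forall p : C, p <> RtoC 0 -> hb p = h p).
  { intros p Hp. unfold hb. destruct (Ceq_dec p (RtoC 0)); [contradiction | reflexivity]. }
  assert (Hb0 : hb (RtoC 0) = l).
  { unfold hb. destruct (Ceq_dec (RtoC 0) (RtoC 0)); [reflexivity | contradiction]. }
  assert (HGb : forall p, disk r p -> isG hb p (f p)).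
  { intros p Hp. destruct (Ceq_dec p (RtoC 0)) as [E | E].
    - subst p. intros eps He.
      destruct (HolD_cont r f f' Hr Hf) as [Cf _].
      destruct (contC_near f eps Cf He) as [d1 [d10 H1]].
      set (d := Rmin d1 r). assert (d0 : 0 < d) by (apply Rmin_pos; auto).
      exists d. split; auto. intros q Hq. replace (q - 0)%C with q in * by ring.
      rewrite Hb0. destruct (Ceq_dec q (RtoC 0)) as [Eq | Eq].
      { subst q. rewrite Hb0, Cmod_0. replace (l - l - fst (0 * f 0%C)%C) with 0 by (simpl; ring).
        rewrite Rabs_R0. lra. }
      rewrite Hb by auto.
      assert (Hm : 0 < Cmod q) by exact (proj1 (Cmod_gt_0 q) Eq).
      set (k := fun z => h z - fst (z * f 0%C)%C).
      assert (Hk : forall z, pdisk d z -> isG k z (f z - f 0%C)%C).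
      { intros z Hz e He0. assert (Hzr : pdisk r z) by (apply (pdisk_sub d r); auto; apply Rmin_r).
        destruct (HG z Hzr e He0) as [dd [dd0 Hdd]]. exists dd. split; auto. intros w Hw.
        specialize (Hdd w Hw). eapply Rle_trans; [| exact Hdd]. right. f_equal. unfold k. simpl. ring. }
      assert (Hrad : forall t, 0 < t < 1 -> Rabs (k q - k (RtoC t * q)%C) <= eps * Cmod q).
      { intros t Ht. eapply Rle_trans; [apply (segment_lipschitz k (fun z => f z - f 0%C)%C (RtoC t * q)%C q eps) |].
        - intros s Hs.
          replace (RtoC t * q + RtoC s * (q - RtoC t * q))%C with (RtoC (t + s * (1 - t)) * q)%C
            by (rewrite RtoC_plus, RtoC_mult, RtoC_minus; ring).
          assert (Hin : pdisk d (RtoC (t + s * (1 - t)) * q)%C).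
          { assert (0 < t + s * (1 - t) <= 1) by nra.
            split; [rewrite Cmod_mult, Cmod_R, Rabs_right by lra; nra |].
            apply Cmult_neq_0; auto. apply RtoC_neq. lra. }
          split; [apply Hk; auto |]. left. apply H1. apply (pdisk_sub d d1); auto. apply Rmin_l.
        - apply Rmult_le_compat_l; [lra |].
          replace (q - RtoC t * q)%C with (RtoC (1 - t) * q)%C by (rewrite RtoC_minus; ring).
          rewrite Cmod_mult, Cmod_R, Rabs_right by lra. nra. }
      replace (h q - l - fst (q * f 0%C)%C) with (k q - l) by (unfold k; ring).
      (* The limit [t -> 0] is replaced by one [t] for which both [h (t q) - l] and the linear term
         at [t q] are at most [e / 2]. *)
      apply le_epsilon. intros e He0.
      destruct (proj1 (locally'_Cmod _) (Hl _ (locally_ball l (mkposreal (e / 2) (Rmult_lt_0_compat _ _ He0 (Rinv_0_lt_compat 2 Rlt_0_2))))))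
        as [d2 [d20 H2]].
      set (B := Cmod q * (Cmod (f 0%C) + 1)).
      pose proof (Cmod_ge_0 (f 0%C)).
      assert (HB : 0 < B) by (apply Rmult_lt_0_compat; lra).
      set (t := Rmin (/ 2) (Rmin (d2 / (2 * Cmod q)) (e / (2 * B)))).
      assert (t0 : 0 < t).
      { unfold t. repeat apply Rmin_pos; try lra; apply Rdiv_lt_0_compat; lra. }
      assert (t1 : t <= / 2) by apply Rmin_l.
      assert (t2 : t <= d2 / (2 * Cmod q)) by (unfold t; eapply Rle_trans; [apply Rmin_r | apply Rmin_l]).
      assert (t3 : t <= e / (2 * B)) by (unfold t; eapply Rle_trans; [apply Rmin_r | apply Rmin_r]).
      assert (Ht : 0 < t < 1) by lra. specialize (Hrad t Ht).
      assert (Htq : Cmod (RtoC t * q) = t * Cmod q) by (rewrite Cmod_mult, Cmod_R, Rabs_right; lra).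
      assert (Hh : Rabs (h (RtoC t * q)%C - l) < e / 2).
      { apply (H2 (RtoC t * q)%C). split.
        - rewrite Htq. apply Rle_lt_trans with (d2 / (2 * Cmod q) * Cmod q).
          + apply Rmult_le_compat_r; lra.
          + replace (d2 / (2 * Cmod q) * Cmod q) with (d2 / 2) by (field; lra). lra.
        - apply Cmult_neq_0; auto. apply RtoC_neq. lra. }
      assert (Hf0 : Rabs (fst (RtoC t * q * f 0%C)%C) <= e / 2).
      { eapply Rle_trans; [apply abs_fst_le |]. rewrite Cmod_mult, Htq.
        apply Rle_trans with (t * B).
        - unfold B. rewrite Rmult_assoc. apply Rmult_le_compat_l; [lra |]. apply Rmult_le_compat_l; lra.
        - apply Rle_trans with (e / (2 * B) * B); [apply Rmult_le_compat_r; lra | right; field; lra]. }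
      replace (k q - l) with ((k q - k (RtoC t * q)%C) + ((h (RtoC t * q)%C - l) - fst (RtoC t * q * f 0%C)%C))
        by (unfold k; ring).
      eapply Rle_trans; [apply Rabs_triang |].
      pose proof (Rabs_triang (h (RtoC t * q)%C - l) (- fst (RtoC t * q * f 0%C)%C)) as HT.
      rewrite Rabs_Ropp in HT. unfold Rminus in *. lra.
    - assert (Hpp : pdisk r p) by (split; auto). destruct (pdisk_open r p Hpp) as [d [d0 Hd]].
      intros eps He. destruct (HG p Hpp eps He) as [d1 [d10 H1]].
      exists (Rmin d d1). split; [apply Rmin_pos; auto |]. intros q Hq.
      rewrite !Hb.
      + apply H1. eapply Rlt_le_trans; [exact Hq | apply Rmin_r].
      + exact E.
      + apply Hd. eapply Rlt_le_trans; [exact Hq | apply Rmin_l]. }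
  split; auto.
  intros n p Hp.
  assert (Hc : forall p, disk r p -> continuity_2d_pt (fun u v => hb (u, v)) (fst p) (snd p)).
  { intros q Hq. apply continuity_2d_pt_filterlim. pose proof (isG_cont _ _ _ (HGb q Hq)) as HC.
    destruct q as [a b]. simpl.
    change (continuous (T := C_UniformSpace) (U := R_UniformSpace)
      (fun z : R * R => hb (fst z, snd z)) (a, b)).
    apply (continuous_ext_loc (T := C_UniformSpace) (U := R_UniformSpace) _ hb); [| exact HC].
    exists (mkposreal 1 Rlt_0_1). intros [u v] _. reflexivity. }
  destruct n as [|n]; [split; [apply Hc; auto | exact I] |].
  split; [apply Hc; auto |].
  pose proof (isG_isd _ _ _ (HGb p Hp)) as [D1 D2].
  assert (Hd : 0 < r - Cmod p) by (unfold disk in Hp; lra).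
  assert (Hin : forall q, cball p (r - Cmod p) q -> disk r q).
  { intros q Hq. unfold cball in Hq. unfold disk. replace q with ((q - p) + p)%C by ring.
    eapply Rle_lt_trans; [apply Cmod_triangle |]. lra. }
  split; [eexists; exact D1 |]. split; [eexists; exact D2 |]. split.
  - apply (ex_diff_n_ext_loc (fun u v => fst (f (u, v)))); [| apply (HolD_smooth r n f f'); auto].
    apply (cball_locally_2d p _ (fun q => fst (f q) = Derive (fun z => hb (z, snd q)) (fst q)) Hd).
    intros q Hq. symmetry. apply is_derive_unique. apply (isG_isd _ _ _ (HGb q (Hin q Hq))).
  - apply (ex_diff_n_ext_loc (fun u v => fst (Ci * f (u, v))%C)).
    + apply (cball_locally_2d p _ (fun q => fst (Ci * f q)%C = Derive (fun z => hb (fst q, z)) (snd q)) Hd).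
      intros q Hq. symmetry. apply is_derive_unique.
      pose proof (proj2 (isG_isd _ _ _ (HGb q (Hin q Hq)))) as D. cbn [isd] in D.
      replace (fst (Ci * f q)%C) with (- snd (f q)) by (simpl; ring). exact D.
    + apply (HolD_smooth r n (fun z => Ci * f z)%C (fun z => 0 * f z + Ci * f' z)%C); auto.
      apply (HolD_mult _ _ _ _ _ (HolD_const _ Ci) Hf).
Qed.

(** Uniform continuity on a compact rectangle. It makes the outer integral of the total curvature
    meaningful, whose integrand is itself an integral. *)
Lemma continuous_RInt_param (f : R -> R -> R) a b l r s0 : l <= r -> a < s0 < b ->
  (forall x y, a < x < b -> l <= y <= r -> continuous (fun z : R * R => f (fst z) (snd z)) (x, y)) ->
  continuous (fun s => RInt (f s) l r) s0.
Proof.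
  intros Hlr Hs Hc.
  set (d := Rmin (s0 - a) (b - s0) / 2).
  assert (Hd : 0 < d) by (unfold d; assert (0 < Rmin (s0 - a) (b - s0)) by (apply Rmin_pos; lra); lra).
  assert (Hda : a < s0 - d) by (pose proof (Rmin_l (s0 - a) (b - s0)); unfold d in *; lra).
  assert (Hdb : s0 + d < b) by (pose proof (Rmin_r (s0 - a) (b - s0)); unfold d in *; lra).
  assert (Hex : forall s, a < s < b -> ex_RInt (f s) l r).
  { intros s Hsab. apply (ex_RInt_continuous (V := R_CompleteNormedModule)). intros y Hy.
    rewrite Rmin_left, Rmax_right in Hy by lra.
    apply (continuous_comp (fun y => (s, y)) (fun z : R * R => f (fst z) (snd z))); [| apply Hc; auto].
    apply (cont_pair (fun y : R => ((s, y) : C)) y). split; simpl; [apply continuous_const | apply continuous_id]. }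
  intros P [e He].
  assert (He2 : 0 < e / (2 * (r - l + 1))) by (apply Rdiv_lt_0_compat; [apply cond_pos | lra]).
  destruct (uniform_continuity_2d f (s0 - d) (s0 + d) l r) with (eps := mkposreal _ He2) as [dl Hdl].
  { intros x y Hx Hy. apply continuity_2d_pt_filterlim. apply Hc; auto. lra. }
  exists (mkposreal _ (Rmin_pos _ _ Hd (cond_pos dl))). intros s Hss.
  assert (Hs1 : Rabs (s - s0) < d) by (eapply Rlt_le_trans; [exact Hss | apply Rmin_l]).
  assert (Hs2 : Rabs (s - s0) < dl) by (eapply Rlt_le_trans; [exact Hss | apply Rmin_r]).
  apply Rabs_def2 in Hs1.
  apply He. change (Rabs (RInt (f s) l r - RInt (f s0) l r) < e).
  assert (E : RInt (f s) l r - RInt (f s0) l r = RInt (fun y => f s y - f s0 y) l r).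
  { symmetry. apply (RInt_minus (V := R_CompleteNormedModule) (f s) (f s0)); apply Hex; lra. }
  rewrite E. eapply Rle_lt_trans.
  - apply (abs_RInt_le_const _ l r (e / (2 * (r - l + 1)))); auto.
    + apply (ex_RInt_minus (V := R_NormedModule) (f s) (f s0)); apply Hex; lra.
    + intros t Ht. left. apply Hdl; try lra.
      replace (t - t) with 0 by ring. rewrite Rabs_R0. apply cond_pos.
  - pose proof (cond_pos e). apply Rmult_lt_reg_r with (2 * (r - l + 1)); [lra |].
    replace ((r - l) * (e / (2 * (r - l + 1))) * (2 * (r - l + 1))) with ((r - l) * e) by (field; lra). nra.
Qed.

Lemma Cmod_continuous (p : C) : continuous (T := C_UniformSpace) Cmod p.
Proof.
  intros P [e He]. apply locally_Cmod. exists e. split; [apply cond_pos |].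
  intros q Hq. apply He. change (Rabs (Cmod q - Cmod p) < e).
  apply Rle_lt_trans with (Cmod (q - p)); auto.
  apply Rabs_le. pose proof (Cmod_minus_ge q p). pose proof (Cmod_minus_ge p q).
  rewrite Cmod_minus_sym in H0. lra.
Qed.

Lemma Cmod_sq (z : C) : Cmod z * Cmod z = fst z * fst z + snd z * snd z.
Proof.
  unfold Cmod. rewrite sqrt_sqrt; [ring |]. simpl. nra.
Qed.

(** * Completeness and the size of the conformal factor *)

Section Curves.
Variables (eps : R) (X : C -> R3).
Hypothesis HX : smooth3 (pdisk eps) X.
Hypothesis HC : conformal (pdisk eps) X.

Let U := pdisk eps.
Let HU : isopen U := pdisk_open eps.

Lemma curve_speed (g : R -> C) t : U (g t) ->
  ex_derive (fun s => fst (g s)) t -> ex_derive (fun s => snd (g s)) t ->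
  vnorm (velocity (fun s => X (g s)) t) = sqrt (ff1 X du du (g t)) * Cmod (Cvelocity g t).
Proof.
  intros Hg D1 D2.
  assert (HR : isRC g t (Cvelocity g t)).
  { split; simpl; apply Derive_correct; auto. }
  set (d := Cvelocity g t) in *.
  assert (HV : velocity (fun s => X (g s)) t
    = vadd (vscal (fst d) (pd3 du X (g t))) (vscal (snd d) (pd3 dv X (g t)))).
  { assert (S : forall x, smooth U (fun p => x (X p)) -> Derive (fun s => x (X (g s))) t
      = fst d * pd du (fun q => x (X q)) (g t) + snd d * pd dv (fun q => x (X q)) (g t)).
    { intros x Sx. apply is_derive_unique.
      pose proof (isG_curve (fun p => x (X p)) g t _ d (smooth_isG U _ (g t) HU Sx Hg) HR) as H.
      evar_last; [exact H |]. simpl. ring. }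
    destruct HX as [S1 [S2 S3]].
    apply vext; [exact (S x1 S1) | exact (S x2 S2) | exact (S x3 S3)]. }
  rewrite HV. destruct (HC (g t) Hg) as [E1 E2].
  unfold vnorm.
  replace (dot (vadd (vscal (fst d) (pd3 du X (g t))) (vscal (snd d) (pd3 dv X (g t))))
     (vadd (vscal (fst d) (pd3 du X (g t))) (vscal (snd d) (pd3 dv X (g t)))))
    with (fst d * fst d * ff1 X du du (g t) + 2 * fst d * snd d * ff1 X du dv (g t)
      + snd d * snd d * ff1 X dv dv (g t)) by (unfold ff1; vunf; ring).
  rewrite <- E1, E2.
  replace (fst d * fst d * ff1 X du du (g t) + 2 * fst d * snd d * 0 + snd d * snd d * ff1 X du du (g t))
    with (ff1 X du du (g t) * (Cmod d * Cmod d)) by (rewrite Cmod_sq; ring).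
  rewrite sqrt_mult.
  - rewrite sqrt_square; [reflexivity | apply Cmod_ge_0].
  - unfold ff1, dot. nra.
  - pose proof (Cmod_ge_0 d). nra.
Qed.

Lemma speed_continuous (g : R -> C) t : U (g t) ->
  ex_derive (fun s => fst (g s)) t -> ex_derive (fun s => snd (g s)) t ->
  continuous (Derive (fun s => fst (g s))) t -> continuous (Derive (fun s => snd (g s))) t ->
  continuous (fun t => sqrt (ff1 X du du (g t)) * Cmod (Cvelocity g t)) t.
Proof.
  intros Hg D1 D2 C1 C2.
  assert (HR : isRC g t (Cvelocity g t)).
  { split; simpl; apply Derive_correct; auto. }
  apply (continuous_mult (K := R_AbsRing)).
  - apply (continuous_comp (fun t => ff1 X du du (g t)) sqrt); [| apply continuous_sqrt].
    apply (continuous_comp g (fun p : C => ff1 X du du p)); [eapply isRC_cont; eauto |].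
    apply (cont3_dot (pd3 du X) (pd3 du X)); apply (cont3_smooth U); auto; apply smooth3_pd3; auto.
  - apply (continuous_comp (fun t => Cvelocity g t) Cmod); [| apply Cmod_continuous].
    apply (cont_pair (fun t => Cvelocity g t)). split; assumption.
Qed.

Lemma curve_length_formula (g : R -> C) a b : 0 <= a <= b ->
  C1_on (fun t => 0 <= t) g -> (forall t, 0 <= t -> U (g t)) ->
  ex_RInt (fun t => sqrt (ff1 X du du (g t)) * Cmod (Cvelocity g t)) a b /\
  curve_length (fun t => X (g t)) a b = RInt (fun t => sqrt (ff1 X du du (g t)) * Cmod (Cvelocity g t)) a b.
Proof.
  intros Hab HC1 Hg. split.
  - apply (ex_RInt_continuous (V := R_CompleteNormedModule)). intros t Ht.
    rewrite Rmin_left, Rmax_right in Ht by lra. assert (Ht0 : 0 <= t) by lra.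
    destruct (HC1 t Ht0) as [D1 [D2 [C1 C2]]]. apply speed_continuous; auto.
  - apply RInt_ext. intros t Ht. rewrite Rmin_left, Rmax_right in Ht by lra.
    assert (Ht0 : 0 <= t) by lra.
    destruct (HC1 t Ht0) as [D1 [D2 _]]. apply curve_speed; auto.
Qed.

(* The curve is compared with [- ln |g|]. *)
Lemma complete_of_lower_bound K : 0 < K ->
  near (fun p => 1 <= K * (Cmod p * sqrt (ff1 X du du p))) -> complete_at_origin eps X.
Proof.
  intros HK [d [d0 Hd]] g HC1 Hg Hlim.
  assert (Hl : forall e, 0 < e -> exists T0, 0 <= T0 /\ forall t, T0 < t -> Cmod (g t) < e).
  { intros e He. assert (HP : locally (T := C_UniformSpace) (RtoC 0) (fun q => Cmod q < e)).
    { apply locally_Cmod. exists e. split; auto. intros q Hq. replace (q - 0)%C with q in Hq by ring. exact Hq. }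
    destruct (Hlim _ HP) as [M HM]. exists (Rmax M 0). split; [apply Rmax_r |].
    intros t Ht. apply HM. eapply Rle_lt_trans; [apply Rmax_l | exact Ht]. }
  destruct (Hl d d0) as [T00 [HT0p HT0']].
  set (T0 := T00 + 1). assert (HT0 : 0 <= T0) by (unfold T0; lra).
  assert (HT1 : forall t, T0 <= t -> Cmod (g t) < d) by (intros t Ht; apply HT0'; unfold T0 in Ht; lra).
  set (ell := fun t => sqrt (ff1 X du du (g t)) * Cmod (Cvelocity g t)).
  set (g1 := fun t => fst (g t)). set (g2 := fun t => snd (g t)).
  set (N := fun t => g1 t * g1 t + g2 t * g2 t).
  assert (HN : forall t, 0 <= t -> 0 < N t).
  { intros t Ht. unfold N, g1, g2. rewrite <- Cmod_sq. destruct (Hg t Ht) as [_ Hn].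
    assert (0 < Cmod (g t)) by exact (proj1 (Cmod_gt_0 _) Hn). nra. }
  (* The derivative of [- ln |g|], written with [N = |g|^2] to avoid differentiating the modulus. By
     the Cauchy-Schwarz inequality it is at most [|g'| / |g|]. *)
  set (dL := fun t => - ((g1 t * Derive g1 t + g2 t * Derive g2 t) / N t)).
  assert (HdL : forall t, 0 <= t -> is_derive (fun t => - / 2 * ln (N t)) t (dL t) /\ continuous dL t).
  { intros t Ht. destruct (HC1 t Ht) as [D1 [D2 [C1 C2]]].
    fold g1 in D1, C1. fold g2 in D2, C2. pose proof (HN t Ht) as HNt.
    assert (HDN : is_derive N t (2 * (g1 t * Derive g1 t + g2 t * Derive g2 t))).
    { unfold N. evar_last.
      - apply (is_derive_plus (K := R_AbsRing) (V := R_NormedModule));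
          apply (is_derive_mult (K := R_AbsRing)); try (apply Derive_correct; eassumption); exact Rmult_comm.
      - unfold plus, mult; simpl. ring. }
    split.
    - evar_last.
      + apply (is_derive_scal (fun t => ln (N t)) t (- / 2)).
        apply (is_derive_comp ln N t); [apply is_derive_ln; exact HNt | exact HDN].
      + unfold dL, scal; simpl. unfold mult; simpl. field. lra.
    - unfold dL. apply (continuous_opp (V := R_NormedModule)).
      assert (K1 : continuous g1 t) by (apply (ex_derive_continuous (V := R_NormedModule)); auto).
      assert (K2 : continuous g2 t) by (apply (ex_derive_continuous (V := R_NormedModule)); auto).
      apply (continuous_mult (K := R_AbsRing)).
      + apply (continuous_plus (V := R_NormedModule)); apply (continuous_mult (K := R_AbsRing)); auto.
      + apply (continuous_comp N Rinv); [| apply continuous_Rinv; lra].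
        apply (ex_derive_continuous (V := R_NormedModule)). eexists. exact HDN. }
  assert (Hcomp : forall t, T0 <= t -> / K * dL t <= ell t).
  { intros t Ht. assert (Ht0 : 0 <= t) by lra. pose proof (HN t Ht0) as HNt.
    destruct (Hg t Ht0) as [Hge Hgn].
    assert (Hm : 0 < Cmod (g t)) by exact (proj1 (Cmod_gt_0 _) Hgn).
    assert (HE : 1 <= K * (Cmod (g t) * sqrt (ff1 X du du (g t)))) by (apply Hd; split; auto).
    unfold ell. set (q := Cvelocity g t). set (sE := sqrt (ff1 X du du (g t))) in *.
    assert (HNm : N t = Cmod (g t) * Cmod (g t)) by (unfold N, g1, g2; rewrite Cmod_sq; reflexivity).
    assert (HCS : - (g1 t * Derive g1 t + g2 t * Derive g2 t) <= Cmod (g t) * Cmod q).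
    { rewrite <- (Cmod_conj q), <- Cmod_mult.
      replace (g1 t * Derive g1 t + g2 t * Derive g2 t) with (fst (g t * Cconj q)%C)
        by (unfold q, g1, g2, Cvelocity, Cconj; simpl; ring).
      pose proof (abs_fst_le (g t * Cconj q)%C). pose proof (Rle_abs (- fst (g t * Cconj q)%C)).
      rewrite Rabs_Ropp in H0. lra. }
    assert (HdL2 : dL t <= Cmod q / Cmod (g t)).
    { unfold dL. rewrite HNm. apply Rmult_le_reg_r with (Cmod (g t) * Cmod (g t)); [nra |].
      replace (- ((g1 t * Derive g1 t + g2 t * Derive g2 t) / (Cmod (g t) * Cmod (g t))) * (Cmod (g t) * Cmod (g t)))
        with (- (g1 t * Derive g1 t + g2 t * Derive g2 t)) by (field; lra).
      replace (Cmod q / Cmod (g t) * (Cmod (g t) * Cmod (g t))) with (Cmod (g t) * Cmod q) by (field; lra).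
      exact HCS. }
    assert (HK2 : 0 < / K) by (apply Rinv_0_lt_compat; auto).
    apply Rle_trans with (/ K * (Cmod q / Cmod (g t))); [apply Rmult_le_compat_l; lra |].
    apply Rmult_le_reg_r with (K * Cmod (g t)); [nra |].
    replace (/ K * (Cmod q / Cmod (g t)) * (K * Cmod (g t))) with (Cmod q * 1) by (field; lra).
    replace (sE * Cmod q * (K * Cmod (g t))) with (Cmod q * (K * (Cmod (g t) * sE))) by ring.
    apply Rmult_le_compat_l; auto. apply Cmod_ge_0. }
  apply is_lim_spec. intros M.
  set (L0 := - / 2 * ln (N T0)).
  (* If [|g|] is below both [1] and [B], then [N = |g|^2 < B], so that [(- ln |g T| - L0) / K]
     exceeds [M]. *)
  set (B := exp (- 2 * (K * M + L0))).
  destruct (Hl (Rmin 1 B)) as [T1 [HT1p HT1']].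
  { apply Rmin_pos; [lra | apply exp_pos]. }
  exists (Rmax T0 T1). intros T HT.
  assert (HTT0 : T0 < T) by (eapply Rle_lt_trans; [apply Rmax_l | exact HT]).
  assert (HTT1 : T1 < T) by (eapply Rle_lt_trans; [apply Rmax_r | exact HT]).
  specialize (HT1' T HTT1).
  assert (H00 : 0 <= 0 <= T0) by lra. assert (H0T : 0 <= T0 <= T) by lra. assert (H00T : 0 <= 0 <= T) by lra.
  destruct (curve_length_formula g 0 T0 H00 HC1 Hg) as [I1 _].
  destruct (curve_length_formula g T0 T H0T HC1 Hg) as [I2 _].
  destruct (curve_length_formula g 0 T H00T HC1 Hg) as [_ EL].
  rewrite EL. fold ell in I1, I2 |- *.
  rewrite <- (RInt_Chasles (V := R_CompleteNormedModule) ell 0 T0 T I1 I2).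
  change (M < RInt ell 0 T0 + RInt ell T0 T).
  assert (P1 : 0 <= RInt ell 0 T0).
  { apply RInt_ge_0; auto. intros t _. apply Rmult_le_pos; [apply sqrt_pos | apply Cmod_ge_0]. }
  assert (ID : is_RInt dL T0 T (- / 2 * ln (N T) - L0)).
  { apply (is_RInt_derive (V := R_CompleteNormedModule) (fun t => - / 2 * ln (N t)));
      intros t Ht; rewrite Rmin_left, Rmax_right in Ht by lra; apply HdL; lra. }
  assert (P2 : / K * (- / 2 * ln (N T) - L0) <= RInt ell T0 T).
  { apply (is_RInt_le (fun t => / K * dL t) ell T0 T).
    - lra.
    - apply (is_RInt_scal (V := R_NormedModule)). exact ID.
    - apply (RInt_correct (V := R_CompleteNormedModule)). exact I2.
    - intros t Ht. apply Hcomp. lra. }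
  assert (HNT : 0 < N T) by (apply HN; lra).
  assert (HlnN : ln (N T) < - 2 * (K * M + L0)).
  { rewrite <- (ln_exp (- 2 * (K * M + L0))). apply ln_increasing; auto. fold B.
    unfold N, g1, g2. rewrite <- Cmod_sq. pose proof (Cmod_ge_0 (g T)).
    pose proof (Rmin_l 1 B). pose proof (Rmin_r 1 B). nra. }
  assert (P3 : M < / K * (- / 2 * ln (N T) - L0)).
  { apply Rmult_lt_reg_l with K; auto. rewrite <- Rmult_assoc, Rinv_r, Rmult_1_l by lra. lra. }
  lra.
Qed.

(** The radial curve [dl / (1 + t)] has Euclidean length at most [dl], so a bounded conformal factor
    bounds its length in space by [M * dl]. *)
Lemma incomplete_of_bounded M : 0 < eps ->
  near (fun p => sqrt (ff1 X du du p) <= M) -> ~ complete_at_origin eps X.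
Proof.
  intros He [d [d0 Hd]] Hcomp.
  set (dl := Rmin d eps / 2).
  assert (Hmin : 0 < Rmin d eps) by (apply Rmin_pos; auto).
  assert (Hdl : 0 < dl) by (unfold dl; lra).

  set (g := fun t : R => (dl / (1 + t), 0) : C).
  assert (HD : forall t, 0 <= t -> is_derive (fun s => fst (g s)) t (- dl / ((1 + t) * (1 + t)))).
  { intros t Ht. simpl. auto_derive; [lra |]. field. lra. }
  assert (HDs : forall t, is_derive (fun s => snd (g s)) t 0).
  { intros t. exact (is_derive_const (K := R_AbsRing) (V := R_NormedModule) 0 t). }
  assert (Hmod : forall t, 0 <= t -> Cmod (g t) = dl / (1 + t)).
  { intros t Ht. change (g t) with (RtoC (dl / (1 + t))). rewrite Cmod_R, Rabs_right; auto.
    apply Rle_ge. left. apply Rdiv_lt_0_compat; lra. }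
  assert (Hle : forall t, 0 <= t -> dl / (1 + t) <= dl).
  { intros t Ht. apply Rmult_le_reg_r with (1 + t); [lra |].
    replace (dl / (1 + t) * (1 + t)) with dl by (field; lra). nra. }
  assert (Hg : forall t, 0 <= t -> pdisk (Rmin d eps) (g t)).
  { intros t Ht. split.
    - rewrite Hmod by auto. specialize (Hle t Ht). unfold dl in *. lra.
    - change (g t) with (RtoC (dl / (1 + t))). apply RtoC_neq.
      assert (0 < dl / (1 + t)) by (apply Rdiv_lt_0_compat; lra). lra. }
  assert (HgU : forall t, 0 <= t -> pdisk eps (g t)).
  { intros t Ht. apply (pdisk_sub (Rmin d eps) eps); auto. apply Rmin_r. }
  assert (HC1 : C1_on (fun t => 0 <= t) g).
  { intros t Ht. split; [eexists; apply HD; auto |]. split; [eexists; apply HDs |]. split.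
    - apply (continuous_ext_loc _ (fun t => - dl / ((1 + t) * (1 + t)))).
      + exists (mkposreal (/ 2) (Rinv_0_lt_compat 2 Rlt_0_2)). intros s Hs.
        assert (Hs2 : Rabs (s - t) < / 2) by exact Hs. apply Rabs_def2 in Hs2.
        symmetry. apply is_derive_unique. simpl. auto_derive; [lra |]. field. lra.
      + apply (ex_derive_continuous (V := R_NormedModule)). auto_derive. nra.
    - apply (continuous_ext (fun _ => 0)); [| apply continuous_const].
      intros s. symmetry. apply is_derive_unique. apply HDs. }
  assert (Hlim : filterlim g (Rbar_locally p_infty) (locally (T := C_UniformSpace) (RtoC 0))).
  { intros P HP. apply locally_Cmod in HP. destruct HP as [e [e0 HP]].
    exists (Rmax 0 (dl / e)). intros t Ht. apply HP.
    assert (Ht0 : 0 < t) by (eapply Rle_lt_trans; [apply Rmax_l | exact Ht]).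
    assert (Ht1 : dl / e < t) by (eapply Rle_lt_trans; [apply Rmax_r | exact Ht]).
    replace (g t - 0)%C with (g t) by ring. rewrite Hmod by lra.
    apply Rmult_lt_reg_r with (1 + t); [lra |].
    replace (dl / (1 + t) * (1 + t)) with dl by (field; lra).
    apply Rlt_le_trans with (e * t); [| nra].
    replace dl with (e * (dl / e)) by (field; lra). apply Rmult_lt_compat_l; auto. }
  specialize (Hcomp g HC1 HgU Hlim). apply is_lim_spec in Hcomp.
  assert (HM0 : 0 <= M).
  { destruct (near_ex (fun p => sqrt (ff1 X du du p) <= M)) as [p Hp]; [exists d; auto |].
    eapply Rle_trans; [apply sqrt_pos | exact Hp]. }
  destruct (Hcomp (M * dl)) as [T0 HT0].
  set (T := Rmax T0 0 + 1). assert (HT : 0 <= T) by (pose proof (Rmax_r T0 0); unfold T; lra).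
  assert (HTT : T0 < T) by (pose proof (Rmax_l T0 0); unfold T; lra).
  specialize (HT0 T HTT).
  assert (H0T : 0 <= 0 <= T) by lra.
  destruct (curve_length_formula g 0 T H0T HC1 HgU) as [I1 EL]. rewrite EL in HT0.
  assert (IB : is_RInt (fun t => M * (dl / ((1 + t) * (1 + t)))) 0 T (M * (dl - dl / (1 + T)))).
  { apply (is_RInt_scal (V := R_NormedModule)).
    evar_last.
    - apply (is_RInt_derive (V := R_CompleteNormedModule) (fun t => - (dl / (1 + t)))).
      + intros t Ht. rewrite Rmin_left, Rmax_right in Ht by lra. auto_derive; [lra |]. field. lra.
      + intros t Ht. rewrite Rmin_left, Rmax_right in Ht by lra.
        apply (ex_derive_continuous (V := R_NormedModule)). auto_derive. nra.
    - unfold minus, plus, opp; simpl. field. lra. }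
  assert (HL : RInt (fun t => sqrt (ff1 X du du (g t)) * Cmod (Cvelocity g t)) 0 T <= M * (dl - dl / (1 + T))).
  { apply (is_RInt_le (fun t => sqrt (ff1 X du du (g t)) * Cmod (Cvelocity g t)) (fun t => M * (dl / ((1 + t) * (1 + t)))) 0 T); auto.
    - apply (RInt_correct (V := R_CompleteNormedModule)). exact I1.
    - intros t Ht. apply Rmult_le_compat; [apply sqrt_pos | apply Cmod_ge_0 | |].
      + apply Hd. apply (pdisk_sub (Rmin d eps) d); [apply Rmin_l |]. apply Hg. lra.
      + right. assert (EV : Cvelocity g t = RtoC (- dl / ((1 + t) * (1 + t)))).
        { unfold Cvelocity, RtoC. f_equal; apply is_derive_unique; [apply HD; lra | apply HDs]. }
        rewrite EV, Cmod_R.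
        replace (- dl / ((1 + t) * (1 + t))) with (- (dl / ((1 + t) * (1 + t)))) by (field; lra).
        rewrite Rabs_Ropp, Rabs_right; auto. apply Rle_ge. left. apply Rdiv_lt_0_compat; [lra | nra]. }
  assert (0 <= dl / (1 + T)) by (left; apply Rdiv_lt_0_compat; lra).
  assert (M * (dl - dl / (1 + T)) <= M * dl) by (apply Rmult_le_compat_l; lra).
  lra.
Qed.
End Curves.

(** * The two kinds of end *)

(** Testing against all vectors makes convergence independent of the basis, so that it passes
    between standard coordinates and an adapted frame. *)
Definition tends (A : C -> R3) (n : R3) : Prop :=
  forall e eps, 0 < eps -> near (fun p => Rabs (dot (A p) e - dot n e) < eps).

Lemma tends_of_filterlim (A : C -> R3) (n : R3) :
  filterlim A (locally' (T := C_UniformSpace) (RtoC 0)) (locally (n : R * R * R)) -> tends A n.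
Proof.
  intros H e eps He.
  set (K := Rabs (x1 e) + Rabs (x2 e) + Rabs (x3 e) + 1).
  assert (HK : 0 < K).
  { pose proof (Rabs_pos (x1 e)). pose proof (Rabs_pos (x2 e)). pose proof (Rabs_pos (x3 e)). unfold K. lra. }
  assert (HeK : 0 < eps / K) by (apply Rdiv_lt_0_compat; auto).
  pose proof (H _ (locally_ball (n : R * R * R) (mkposreal _ HeK))) as Hb.
  apply locally'_Cmod in Hb. revert Hb. apply near_imp.
  intros p [[B1 B2] B3].
  assert (C1 : Rabs (x1 (A p) - x1 n) < eps / K) by exact B1.
  assert (C2 : Rabs (x2 (A p) - x2 n) < eps / K) by exact B2.
  assert (C3 : Rabs (x3 (A p) - x3 n) < eps / K) by exact B3.
  replace (dot (A p) e - dot n e)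
    with ((x1 (A p) - x1 n) * x1 e + (x2 (A p) - x2 n) * x2 e + (x3 (A p) - x3 n) * x3 e) by (unfold dot; ring).
  eapply Rle_lt_trans; [apply Rabs_triang |].
  eapply Rle_lt_trans; [apply Rplus_le_compat_r; apply Rabs_triang |].
  rewrite !Rabs_mult.
  apply Rle_lt_trans with (eps / K * (Rabs (x1 e) + Rabs (x2 e) + Rabs (x3 e))).
  - rewrite !Rmult_plus_distr_l. repeat apply Rplus_le_compat; apply Rmult_le_compat_r; try apply Rabs_pos; lra.
  - replace eps with (eps / K * K) at 2 by (field; lra). apply Rmult_lt_compat_l; auto. unfold K. lra.
Qed.

Lemma filterlim_of_tends (A : C -> R3) (n : R3) : tends A n ->
  filterlim A (locally' (T := C_UniformSpace) (RtoC 0)) (locally (n : R * R * R)).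
Proof.
  intros H P [e He]. apply locally'_Cmod.
  pose proof (H (1, 0, 0) e (cond_pos e)) as H1. pose proof (H (0, 1, 0) e (cond_pos e)) as H2.
  pose proof (H (0, 0, 1) e (cond_pos e)) as H3.
  generalize (near_and _ _ H1 (near_and _ _ H2 H3)). apply near_imp.
  intros p [B1 [B2 B3]]. apply He.
  assert (S1 : forall V, dot V (1, 0, 0) = x1 V) by (intros; vunf; ring).
  assert (S2 : forall V, dot V (0, 1, 0) = x2 V) by (intros; vunf; ring).
  assert (S3 : forall V, dot V (0, 0, 1) = x3 V) by (intros; vunf; ring).
  rewrite !S1 in B1. rewrite !S2 in B2. rewrite !S3 in B3.
  split; [split |]; assumption.
Qed.

Lemma near_scal (h : C -> R) a k : (forall eps, 0 < eps -> near (fun p => Rabs (h p - a) < eps)) ->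
  forall eps, 0 < eps -> near (fun p => Rabs (h p * k - a * k) < eps).
Proof.
  intros H eps He. assert (Hk : 0 < Rabs k + 1) by (pose proof (Rabs_pos k); lra).
  assert (Hek : 0 < eps / (Rabs k + 1)) by (apply Rdiv_lt_0_compat; auto).
  generalize (H _ Hek). apply near_imp. intros p Hp.
  replace (h p * k - a * k) with ((h p - a) * k) by ring. rewrite Rabs_mult.
  replace eps with (eps / (Rabs k + 1) * (Rabs k + 1)) by (field; lra).
  pose proof (Rabs_pos k).
  apply Rle_lt_trans with (eps / (Rabs k + 1) * Rabs k); [apply Rmult_le_compat_r; lra |].
  apply Rmult_lt_compat_l; lra.
Qed.

Lemma tends_of_frame e1 e2 e3 (A : C -> R3) n : frame e1 e2 e3 ->
  (forall eps, 0 < eps -> near (fun p => Rabs (dot (A p) e1 - dot n e1) < eps)) ->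
  (forall eps, 0 < eps -> near (fun p => Rabs (dot (A p) e2 - dot n e2) < eps)) ->
  (forall eps, 0 < eps -> near (fun p => Rabs (dot (A p) e3 - dot n e3) < eps)) -> tends A n.
Proof.
  intros Hf H1 H2 H3 e eps He. assert (He3 : 0 < eps / 3) by lra.
  pose proof (near_scal _ _ (dot e e1) H1 _ He3) as N1.
  pose proof (near_scal _ _ (dot e e2) H2 _ He3) as N2.
  pose proof (near_scal _ _ (dot e e3) H3 _ He3) as N3.
  generalize (near_and _ _ N1 (near_and _ _ N2 N3)). apply near_imp.
  intros p [B1 [B2 B3]]. rewrite (frame_dot _ _ _ Hf (A p) e), (frame_dot _ _ _ Hf n e).
  replace (dot (A p) e1 * dot e e1 + dot (A p) e2 * dot e e2 + dot (A p) e3 * dot e e3 -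
    (dot n e1 * dot e e1 + dot n e2 * dot e e2 + dot n e3 * dot e e3))
    with ((dot (A p) e1 * dot e e1 - dot n e1 * dot e e1) + (dot (A p) e2 * dot e e2 - dot n e2 * dot e e2)
     + (dot (A p) e3 * dot e e3 - dot n e3 * dot e e3)) by ring.
  eapply Rle_lt_trans; [apply Rabs_triang |].
  eapply Rle_lt_trans; [apply Rplus_le_compat_r; apply Rabs_triang |]. lra.
Qed.

Lemma tends_unit eps X n : 0 < eps -> immersion (pdisk eps) X -> tends (gauss X) n -> dot n n = 1.
Proof.
  intros He HX Ht.
  assert (Hs : forall d, 0 < d <= 1 -> Rabs (1 - dot n n) <= 5 * d).
  { intros d Hd.
    pose proof (Ht (1, 0, 0) d (proj1 Hd)) as H1. pose proof (Ht (0, 1, 0) d (proj1 Hd)) as H2.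
    pose proof (Ht (0, 0, 1) d (proj1 Hd)) as H3. pose proof (Ht n d (proj1 Hd)) as H4.
    destruct (near_ex _ (near_and _ _ (near_and _ _ H1 H2) (near_and _ _ (near_and _ _ H3 H4) (near_pdisk eps He))))
      as [p [[B1 B2] [[B3 B4] Hp]]].
    pose proof (gauss_unit (pdisk eps) X HX p Hp) as Hu.
    set (a := dot (gauss X p) (1, 0, 0) - dot n (1, 0, 0)) in *.
    set (b := dot (gauss X p) (0, 1, 0) - dot n (0, 1, 0)) in *.
    set (c := dot (gauss X p) (0, 0, 1) - dot n (0, 0, 1)) in *.
    assert (E : 1 - dot n n = a * a + b * b + c * c + 2 * (dot (gauss X p) n - dot n n)).
    { rewrite <- Hu. unfold a, b, c. vunf. ring. }
    (* Three squares below [d^2 <= d] and a term below [2 d] give the factor [5]. *)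
    rewrite E. apply Rabs_def2 in B1, B2, B3, B4. apply Rabs_le. nra. }
  destruct (Req_dec (dot n n) 1) as [E | E]; auto. exfalso.
  assert (Hp : 0 < Rabs (1 - dot n n)) by (apply Rabs_pos_lt; lra).
  set (d := Rmin 1 (Rabs (1 - dot n n) / 10)).
  assert (Hd : 0 < d <= 1) by (split; [apply Rmin_pos; lra | apply Rmin_l]).
  specialize (Hs d Hd). pose proof (Rmin_r 1 (Rabs (1 - dot n n) / 10)). fold d in H. lra.
Qed.

Lemma Fe_parts e1 e2 X p :
  Fe e1 X p = (/ 2 * (om X e1 e2 p + omb X e1 e2 p))%C /\
  Fe e2 X p = (Ci / 2 * (om X e1 e2 p - omb X e1 e2 p))%C.
Proof.
  assert (Hci : (Ci * Ci = - (1))%C) by (apply injective_projections; simpl; ring).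
  unfold om, omb. split; [field |].
  transitivity (- (Ci * Ci) * Fe e2 X p)%C; [rewrite Hci; ring | field].
Qed.

(** The hypothesis says that the squares of the three forms add up to zero; its real and imaginary
    parts are the two conformality relations. *)
Lemma conf_of_forms e1 e2 e3 X p : frame e1 e2 e3 ->
  (om X e1 e2 p * omb X e1 e2 p + Fe e3 X p * Fe e3 X p = 0)%C ->
  ff1 X du du p = ff1 X dv dv p /\ ff1 X du dv p = 0.
Proof.
  intros Hf H. unfold ff1.
  rewrite (frame_dot _ _ _ Hf (pd3 du X p) (pd3 du X p)), (frame_dot _ _ _ Hf (pd3 dv X p) (pd3 dv X p)),
    (frame_dot _ _ _ Hf (pd3 du X p) (pd3 dv X p)).
  unfold om, omb, Fe in H. revert H.
  generalize (dot (pd3 du X p) e1), (dot (pd3 du X p) e2), (dot (pd3 du X p) e3),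
    (dot (pd3 dv X p) e1), (dot (pd3 dv X p) e2), (dot (pd3 dv X p) e3).
  intros a1 a2 a3 b1 b2 b3 H.
  pose proof (f_equal fst H) as H1. pose proof (f_equal snd H) as H2. simpl in H1, H2. split; lra.
Qed.

Lemma om_le_energy e1 e2 e3 X p : frame e1 e2 e3 -> ff1 X du du p = ff1 X dv dv p ->
  Cmod (om X e1 e2 p) <= 2 * sqrt (ff1 X du du p).
Proof.
  intros Hf HE.
  assert (H0 : 0 <= ff1 X du du p) by (unfold ff1, dot; nra).
  apply Rsqr_incr_0_var; [| pose proof (sqrt_pos (ff1 X du du p)); lra].
  unfold Rsqr. rewrite Cmod_sq.
  replace (2 * sqrt (ff1 X du du p) * (2 * sqrt (ff1 X du du p)))
    with (4 * (sqrt (ff1 X du du p) * sqrt (ff1 X du du p))) by ring.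
  rewrite sqrt_sqrt by auto.
  assert (H2 : 4 * ff1 X du du p = 2 * (ff1 X du du p + ff1 X dv dv p)) by lra. rewrite H2.
  unfold ff1, om, Fe.
  rewrite (frame_dot _ _ _ Hf (pd3 du X p) (pd3 du X p)), (frame_dot _ _ _ Hf (pd3 dv X p) (pd3 dv X p)).
  generalize (dot (pd3 du X p) e1), (dot (pd3 du X p) e2), (dot (pd3 du X p) e3),
    (dot (pd3 dv X p) e1), (dot (pd3 dv X p) e2), (dot (pd3 dv X p) e3).
  intros a1 a2 a3 b1 b2 b3. simpl.
  pose proof (Rle_0_sqr (a1 + b2)). pose proof (Rle_0_sqr (b1 - a2)). pose proof (Rle_0_sqr a3). pose proof (Rle_0_sqr b3).
  unfold Rsqr in *. lra.
Qed.

Lemma energy_le e1 e2 e3 X p K : frame e1 e2 e3 -> 0 <= K ->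
  Cmod (om X e1 e2 p) <= K -> Cmod (omb X e1 e2 p) <= K -> Cmod (Fe e3 X p) <= K ->
  sqrt (ff1 X du du p) <= 2 * K.
Proof.
  intros Hf HK H1 H2 H3. destruct (Fe_parts e1 e2 X p) as [E1 E2].
  assert (B2 : Cmod (/ 2) = / 2) by (rewrite Cmod_inv, Cmod_R, Rabs_right; try lra; apply RtoC_neq; lra).
  assert (B : Cmod (Fe e1 X p) <= K).
  { rewrite E1, Cmod_mult, B2. pose proof (Cmod_triangle (om X e1 e2 p) (omb X e1 e2 p)). lra. }
  assert (D : Cmod (Fe e2 X p) <= K).
  { rewrite E2. unfold Cdiv. rewrite !Cmod_mult, B2, Cmod_Ci.
    unfold Cminus. pose proof (Cmod_triangle (om X e1 e2 p) (- omb X e1 e2 p)) as HT.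
    rewrite Cmod_opp in HT. lra. }
  rewrite <- (sqrt_square (2 * K)) by lra. apply sqrt_le_1_alt.
  unfold ff1. rewrite (frame_dot _ _ _ Hf).
  assert (S : forall e, Cmod (Fe e X p) <= K -> dot (pd3 du X p) e * dot (pd3 du X p) e <= K * K).
  { intros e He. pose proof (abs_fst_le (Fe e X p)) as HA. simpl in HA.
    assert (Rabs (dot (pd3 du X p) e) <= K) by lra. apply Rabs_le_between in H. nra. }
  pose proof (S e1 B). pose proof (S e2 D). pose proof (S e3 H3). nra.
Qed.

(** A pointwise statement, so at each point a frame is taken whose [e3] is not the normal of [Z];
    the products in [ribaucour_weierstrass] then satisfy the quadratic relation identically. *)
Lemma conf_ribaucour U Z Zt rho phi c : isopen U -> immersion U Z -> conformal U Z ->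
  (forall p, U p -> mean_curvature Z p = 0) -> smooth3 U Zt -> smooth U rho -> smooth U phi -> c <> 0 ->
  (forall p, U p -> rho p <> 0 /\ phi p <> 0) -> ribaucour_system U Z Zt rho phi c -> conformal U Zt.
Proof.
  intros HU HZ HC HM HZt Hrho Hphi Hc Hn HR p Hp.
  assert (HS : exists e1 e2 e3, frame e1 e2 e3 /\ dot (gauss Z p) e3 <> 1).
  { destruct (Req_dec (dot (gauss Z p) (0, 0, 1)) 1) as [E | E].
    - exists (1, 0, 0), (vscal (-1) (0, 1, 0)), (vscal (-1) (0, 0, 1)).
      split; [apply frame_flip, frame_std |]. rewrite dot_opp_r. lra.
    - exists (1, 0, 0), (0, 1, 0), (0, 0, 1). split; auto. apply frame_std. }
  destruct HS as [e1 [e2 [e3 [Hf HN]]]].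
  destruct (ribaucour_weierstrass U Z Zt rho phi c HU HZ HC HM HZt Hrho Hc Hn HR e1 e2 e3 Hf)
    as [G' [y [y' [_ [_ HD]]]]].
  destruct (HD p (conj Hp HN)) as [_ [E1 [E2 E3]]].
  apply (conf_of_forms e1 e2 e3); auto. rewrite E1, E2, E3.
  unfold Cdiv. ring.
Qed.

Lemma Gm_small U X e1 e2 e3 p : immersion U X -> frame e1 e2 e3 -> U p -> dot (gauss X p) e3 < 0 ->
  Cmod (Gm X e1 e2 e3 p) <= Rabs (dot (gauss X p) e1) + Rabs (dot (gauss X p) e2).
Proof.
  intros HX Hf Hp HN. unfold Gm.
  rewrite Cmod_div, Cmod_R, Rabs_right by (try apply RtoC_neq; lra).
  pose proof (Cmod_le_abs (nu X e1 e2 p)) as HB. unfold nu in HB at 2 3. cbn [fst snd] in HB.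
  pose proof (Cmod_ge_0 (nu X e1 e2 p)).
  apply Rle_trans with (Cmod (nu X e1 e2 p)); auto.
  apply Rmult_le_reg_r with (1 - dot (gauss X p) e3); [lra |].
  unfold Rdiv. rewrite Rmult_assoc, Rinv_l, Rmult_1_r by lra. nra.
Qed.

(** The normal tends to [- e3], the antipode of the centre of projection, so [G] tends to [0] and
    its singularity is removable. The last clause allows a derivative obtained elsewhere to be
    replaced by that of the extension. *)
Lemma Gm_extends eps X e1 e2 e3 n : 0 < eps -> immersion (pdisk eps) X -> conformal (pdisk eps) X ->
  (forall p, pdisk eps p -> mean_curvature X p = 0) -> frame e1 e2 e3 -> tends (gauss X) n ->
  dot n e1 = 0 -> dot n e2 = 0 -> dot n e3 = -1 ->
  exists r Ge Ge', 0 < r <= eps /\ (forall p, pdisk r p -> dot (gauss X p) e3 < 0) /\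
    HolD (disk r) Ge Ge' /\ Ge 0%C = 0%C /\ (forall p, pdisk r p -> Ge p = Gm X e1 e2 e3 p) /\
    forall G', HolD (away (pdisk eps) X e3) (Gm X e1 e2 e3) G' -> forall p, pdisk r p -> G' p = Ge' p.
Proof.
  intros He HX HC HM Hf Ht Hn1 Hn2 Hn3.
  pose proof (Ht e3 1 Rlt_0_1) as H3.
  assert (H3' : near (fun p => dot (gauss X p) e3 < 0)).
  { revert H3. apply near_imp. intros p Hp. rewrite Hn3 in Hp. apply Rabs_def2 in Hp. lra. }
  destruct (near_and _ _ H3' (near_pdisk eps He)) as [d [d0 Hd]].
  set (r := Rmin d eps). assert (Hr : 0 < r <= eps) by (split; [apply Rmin_pos; auto | apply Rmin_r]).
  assert (Hr3 : forall p, pdisk r p -> dot (gauss X p) e3 < 0 /\ pdisk eps p).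
  { intros p Hp. apply Hd. apply (pdisk_sub r d); auto. apply Rmin_l. }
  destruct (Gm_HolD (pdisk eps) X e1 e2 e3 (pdisk_open eps) HX HC HM Hf) as [G' HG'].
  assert (Haway : forall p, pdisk r p -> away (pdisk eps) X e3 p).
  { intros p Hp. destruct (Hr3 p Hp). split; auto. lra. }
  assert (HGr : HolD (pdisk r) (Gm X e1 e2 e3) G') by (apply (HolD_sub (away (pdisk eps) X e3)); auto).
  assert (Hsm : forall e, 0 < e -> near (fun p => Cmod (Gm X e1 e2 e3 p) < e)).
  { intros e He0. assert (He2 : 0 < e / 2) by lra.
    pose proof (Ht e1 _ He2) as N1. pose proof (Ht e2 _ He2) as N2.
    generalize (near_and _ _ (near_and _ _ N1 N2) (near_pdisk r (proj1 Hr))). apply near_imp.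
    intros p [[B1 B2] Hp]. destruct (Hr3 p Hp) as [H4 H5].
    rewrite Hn1, Rminus_0_r in B1. rewrite Hn2, Rminus_0_r in B2.
    eapply Rle_lt_trans; [apply (Gm_small (pdisk eps) X e1 e2 e3 p); auto |]. lra. }
  destruct (near_and _ _ (Hsm 1 Rlt_0_1) (near_pdisk r (proj1 Hr))) as [r1 [Hr1 HB]].
  assert (Hr1r : 0 < Rmin r1 r <= r) by (split; [apply Rmin_pos; lra | apply Rmin_r]).
  destruct (removable r (Rmin r1 r) 1 (Gm X e1 e2 e3) G' Hr1r HGr) as [Ge [Ge' [HGe HE]]].
  { intros p Hp. left. apply (HB p). apply (pdisk_sub (Rmin r1 r) r1); [apply Rmin_l | exact Hp]. }
  exists r, Ge, Ge'. split; auto. split; [intros p Hp; apply Hr3; auto |]. split; auto. split; [| split; auto].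
  - destruct (Ceq_dec (Ge 0%C) 0%C) as [E | E]; auto. exfalso.
    destruct (HolD_cont _ _ _ (proj1 Hr) HGe) as [CG _].
    destruct (near_away Ge CG E) as [k [k0 Hk]].
    destruct (near_ex _ (near_and _ _ (near_and _ _ Hk (Hsm k k0)) (near_pdisk r (proj1 Hr)))) as [p [[B1 B2] Hp]].
    rewrite HE in B1 by auto. lra.
  - intros G'' HG'' p Hp. apply (isC_unique (Gm X e1 e2 e3) p); [apply HG''; auto |].
    apply (isC_ext_loc Ge); [| apply HGe; apply pdisk_disk; auto].
    destruct (pdisk_open r p Hp) as [dd [dd0 Hdd]]. exists dd. split; auto.
Qed.

(** The interface between the asymptotics and the geometry. The bound on [Fe e3 Zt] by [om Zt] says
    that the stereographic Gauss map is [O(z)]; in the alternative, [om Zt] is either bounded or at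
    least of the size of a simple pole. *)
Definition planar_end_bounds (Zt : C -> R3) (e1 e2 e3 : R3) (K : R) : Prop :=
  near (fun p => om Zt e1 e2 p <> 0%C /\ Cmod (Fe e3 Zt p) <= K /\ Cmod (omb Zt e1 e2 p) <= K /\
    Cmod (Fe e3 Zt p) <= K * (Cmod p * Cmod (om Zt e1 e2 p))) /\
  (near (fun p => Cmod (om Zt e1 e2 p) <= K) \/
   near (fun p => 1 <= K * (Cmod p * Cmod (om Zt e1 e2 p)))).

(** Translates the geometry of [Z] into the hypotheses of [riccati_asymptotics], and the conclusion
    back through [ribaucour_weierstrass]. *)
Lemma ribaucour_end_bounds eps Z Zt rho phi c e1 e2 e3 n l : 0 < eps ->
  immersion (pdisk eps) Z -> conformal (pdisk eps) Z ->
  (forall p, pdisk eps p -> mean_curvature Z p = 0) ->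
  complete_at_origin eps Z -> (forall p, pdisk eps p -> ~ umbilic Z p) ->
  smooth3 (pdisk eps) Zt -> smooth (pdisk eps) rho -> smooth (pdisk eps) phi -> c <> 0 ->
  (forall p, pdisk eps p -> rho p <> 0 /\ phi p <> 0) -> ribaucour_system (pdisk eps) Z Zt rho phi c ->
  frame e1 e2 e3 -> tends (gauss Z) n -> dot n e1 = 0 -> dot n e2 = 0 -> dot n e3 = -1 ->
  filterlim (fun p => dot (Z p) e3) (locally' (T := C_UniformSpace) (RtoC 0)) (locally l) ->
  exists K, 0 < K /\ planar_end_bounds Zt e1 e2 e3 K.
Proof.
  intros He HZ HC HM Hcomp Humb HZt Hrho Hphi Hc Hn HR Hf Ht Hn1 Hn2 Hn3 Hl.
  pose proof (pdisk_open eps) as HU. fold (isopen (pdisk eps)) in HU.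
  destruct (Gm_extends eps Z e1 e2 e3 n He HZ HC HM Hf Ht Hn1 Hn2 Hn3)
    as [r [G [Gd [Hr [Hr3 [HG [HG0 [HGE HGd]]]]]]]].
  destruct (ribaucour_weierstrass (pdisk eps) Z Zt rho phi c HU HZ HC HM HZt Hrho Hc Hn HR e1 e2 e3 Hf)
    as [G' [y [y' [HG' [Hy HD]]]]].
  assert (Hsub : forall p, pdisk r p -> pdisk eps p) by (intros p; apply pdisk_sub; lra).
  assert (Haway : forall p, pdisk r p -> away (pdisk eps) Z e3 p).
  { intros p Hp. split; auto. specialize (Hr3 p Hp). lra. }
  specialize (HGd G' HG').
  destruct (Fe_HolD (pdisk eps) Z e3 HU HZ HC HM) as [F3' HF3].
  assert (HF3r : HolD (pdisk r) (Fe e3 Z) F3') by (apply (HolD_sub (pdisk eps)); auto).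
  destruct (height_removable r (fun p => dot (Z p) e3) (Fe e3 Z) F3' l (proj1 Hr) HF3r) as [F [Fd [HF HFE]]]; auto.
  { intros p Hp. apply (Fe_isG (pdisk eps)); auto. apply HZ. }
  assert (HW : forall p, pdisk r p -> om Z e1 e2 p <> 0%C /\ Fe e3 Z p = (Gm Z e1 e2 e3 p * om Z e1 e2 p)%C /\
    omb Z e1 e2 p = (- Gm Z e1 e2 e3 p * Fe e3 Z p)%C).
  { intros p Hp. apply (weier_G (pdisk eps) Z e1 e2 e3 HZ HC Hf p); auto. specialize (Hr3 p Hp). lra. }
  assert (Hr2 : 0 < r / 2) by lra.
  (* If [G] vanished near the puncture, the normal would be constant, and every point there umbilic
     with factor [0]. *)
  assert (HGn : exists p, pdisk (r / 2) p /\ G p <> 0%C).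
  { apply NNPP. intros Hno.
    assert (HZ0 : forall p, pdisk (r / 2) p -> G p = 0%C).
    { intros p Hp. apply NNPP. intros E. apply Hno. exists p. auto. }
    destruct (near_ex _ (near_pdisk (r / 2) Hr2)) as [p Hp].
    assert (Hpr : pdisk r p) by (apply (pdisk_sub (r / 2) r); auto; lra).
    assert (HGp : G' p = 0%C).
    { rewrite HGd by auto. apply (isC_unique G p); [apply HG; apply pdisk_disk; auto |].
      apply (isC_ext_loc (fun _ => 0%C)); [| apply isC_const].
      destruct (pdisk_open _ p Hp) as [d [d0 Hd]]. exists d. split; auto. intros q Hq. symmetry. apply HZ0. apply Hd. exact Hq. }
    destruct (Ne_formula (pdisk eps) Z e1 e2 e3 HU HZ Hf G' p HG' (Haway p Hpr)) as [N1 [_ [N2 [_ [N3 _]]]]].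
    rewrite HGp in N1, N2, N3.

    assert (A1 : Ne Z e1 p = 0%C) by (rewrite N1; unfold Cdiv; ring).
    assert (A2 : Ne Z e2 p = 0%C) by (rewrite N2; unfold Cdiv; ring).
    assert (A3 : Ne Z e3 p = 0%C) by (rewrite N3; unfold Cdiv; ring).
    assert (HN : forall i e, Ne Z e p = 0%C -> dot (pd3 i (gauss Z) p) e = 0).
    { intros i e E. destruct i; [apply (f_equal fst) in E | apply (f_equal snd) in E]; simpl in E; lra. }
    apply (Humb p (Hsub p Hpr)). exists 0. intros i j. unfold ff2.
    rewrite (frame_dot _ _ _ Hf), (HN j e1 A1), (HN j e2 A2), (HN j e3 A3). ring. }
  destruct (HolD_cont _ _ _ (proj1 Hr) HG) as [CG _]. destruct (HolD_cont _ _ _ (proj1 Hr) HF) as [CF _].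
  (* [Fe e3 Z] and [omb Z = - G Fe e3 Z] are bounded already, so a bounded [om Z] would bound the
     conformal factor, against completeness. *)
  assert (HAu : ~ exists M, near (fun p => Cmod (om Z e1 e2 p) <= M)).
  { intros [M HMb].
    destruct (near_bounded G CG) as [KG [KG0 HKG]]. destruct (near_bounded F CF) as [KF [KF0 HKF]].
    assert (HKM : 0 <= Rabs M) by apply Rabs_pos.
    set (K := Rabs M + KF + KG * KF).
    assert (HK1 : 0 < KG * KF) by (apply Rmult_lt_0_compat; auto).
    apply (incomplete_of_bounded eps Z (proj1 HZ) HC (2 * K) He); auto.
    generalize (near_and _ _ HMb (near_and _ _ (near_and _ _ HKG HKF) (near_pdisk r (proj1 Hr)))).
    apply near_imp. intros p [B1 [[B2 B3] Hp]].
    destruct (HW p Hp) as [_ [_ W3]]. rewrite HFE in B3 by auto. rewrite HGE in B2 by auto.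
    apply (energy_le e1 e2 e3 Z p K Hf).
    - unfold K; lra.
    - pose proof (Rle_abs M). unfold K; lra.
    - rewrite W3, Cmod_mult, Cmod_opp. apply Rle_trans with (KG * KF); [| unfold K; lra].
      apply Rmult_le_compat; auto; apply Cmod_ge_0.
    - unfold K; lra. }
  assert (Hc2 : (RtoC c / 2)%C <> 0%C).
  { apply Cmult_neq_0; [apply RtoC_neq; auto |]. intros E.
    assert (E1 : (2 * / 2)%C = 0%C) by (rewrite E; ring). rewrite Cinv_r in E1 by (apply RtoC_neq; lra).
    apply C1_nz. exact E1. }
  assert (Hyr : HolD (pdisk r) y y') by (apply (HolD_sub (away (pdisk eps) Z e3)); auto).
  destruct (riccati_asymptotics r (RtoC c / 2)%C G Gd (om Z e1 e2) F Fd y y' (proj1 Hr) Hc2 HG HG0 HF) as [K [HK [HA Halt]]]; auto.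
  { intros p Hp. rewrite HFE, HGE by auto. apply HW; auto. }
  { intros p Hp. apply HW; auto. }
  { intros p Hp. rewrite <- HGd by auto. destruct (HD p (Haway p Hp)) as [E _]. exact E. }
  set (kc := Cmod (2 / RtoC c)).
  assert (Hkcn : (2 / RtoC c)%C <> 0%C).
  { intros E. assert (E1 : (2 / RtoC c * RtoC c)%C = 0%C) by (rewrite E; ring).
    replace (2 / RtoC c * RtoC c)%C with (RtoC 2) in E1 by (field; apply RtoC_neq; auto).
    apply RtoC_inj in E1. lra. }
  assert (Hkc : 0 < kc) by exact (proj1 (Cmod_gt_0 _) Hkcn).
  set (K2 := kc * K + K + K / kc).
  assert (Hk1 : 0 < kc * K) by (apply Rmult_lt_0_compat; auto).
  assert (Hk2 : 0 < K / kc) by (apply Rdiv_lt_0_compat; auto).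
  assert (Hom : forall p, pdisk r p -> om Zt e1 e2 p = (2 / RtoC c * (Gd p * (y p * y p)))%C).
  { intros p Hp. destruct (HD p (Haway p Hp)) as [_ [E _]]. rewrite E, HGd by auto. ring. }
  exists K2. split; [unfold K2; lra |]. split.
  - generalize (near_and _ _ HA (near_pdisk r (proj1 Hr))). apply near_imp.
    intros p [[B1 [B2 [B3 [B4 B5]]]] Hp].
    destruct (HD p (Haway p Hp)) as [_ [E1 [E2 E3]]]. rewrite HGd in E1, E2, E3 by auto.
    rewrite <- HGE in E2, E3 by auto.
    split; [rewrite E1; exact (Cmult_neq_0 _ _ (Cmult_neq_0 _ _ Hkcn B2) (Cmult_neq_0 _ _ B1 B1)) |].
    split; [| split].
    + rewrite E2. replace (2 / RtoC c * Gd p * (y p * (G p * y p + 1)))%C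
        with (2 / RtoC c * (Gd p * (y p * (G p * y p + 1))))%C by ring.
      rewrite Cmod_mult. fold kc. apply Rle_trans with (kc * K); [apply Rmult_le_compat_l; lra | unfold K2; lra].
    + rewrite E3. replace (- (2 / RtoC c) * Gd p * ((G p * y p + 1) * (G p * y p + 1)))%C
        with (- (2 / RtoC c * (Gd p * ((G p * y p + 1) * (G p * y p + 1)))))%C by ring.
      rewrite Cmod_opp, Cmod_mult. fold kc. apply Rle_trans with (kc * K); [apply Rmult_le_compat_l; lra | unfold K2; lra].
    (* The quotient of the two forms is [G + 1 / y], the stereographic Gauss map of [Zt]. *)
    + rewrite E2, E1. replace (2 / RtoC c * Gd p * (y p * (G p * y p + 1)))%C
        with ((G p + / y p) * (2 / RtoC c * Gd p * (y p * y p)))%C by (field; split; auto; apply RtoC_neq; auto).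
      rewrite Cmod_mult, <- Rmult_assoc. apply Rmult_le_compat_r; [apply Cmod_ge_0 |].
      eapply Rle_trans; [exact B5 |]. apply Rmult_le_compat_r; [apply Cmod_ge_0 | unfold K2; lra].
  - destruct Halt as [Ha | Ha]; [left | right].
    + generalize (near_and _ _ Ha (near_pdisk r (proj1 Hr))). apply near_imp. intros p [B Hp].
      rewrite Hom, Cmod_mult by auto. fold kc.
      apply Rle_trans with (kc * K); [apply Rmult_le_compat_l; lra | unfold K2; lra].
    + generalize (near_and _ _ Ha (near_pdisk r (proj1 Hr))). apply near_imp. intros p [B Hp].
      rewrite Hom, Cmod_mult by auto. fold kc.
      eapply Rle_trans; [exact B |].
      replace (K * (Cmod p * Cmod (Gd p * (y p * y p))))
        with (K / kc * (Cmod p * (kc * Cmod (Gd p * (y p * y p))))) by (field; lra).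
      apply Rmult_le_compat_r; [| unfold K2; lra].
      repeat apply Rmult_le_pos; try apply Cmod_ge_0; lra.
Qed.

Lemma near_Cmod e : 0 < e -> near (fun p => Cmod p < e).
Proof. intros He. exists e. split; auto. intros q [Hq _]. exact Hq. Qed.

(** * From the bounds on the forms to the geometry of the end *)

Section End.
Variables (eps : R) (X : C -> R3).
Hypothesis Heps : 0 < eps.
Hypothesis HX : immersion (pdisk eps) X.
Hypothesis HC : conformal (pdisk eps) X.
Hypothesis HM : forall p, pdisk eps p -> mean_curvature X p = 0.

Let U := pdisk eps.
Let HU : isopen U := pdisk_open eps.

(** In [(1 + N3) om = conj nu * Fe e3] one has [|nu| <= 1] and [|Fe e3| <= K |z| |om|], hence
    [1 + N3 <= K |z|]. The other two components are controlled by the unit length. *)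
Lemma end_gauss_limit e1 e2 e3 n K : frame e1 e2 e3 -> 0 < K ->
  dot n e1 = 0 -> dot n e2 = 0 -> dot n e3 = -1 -> planar_end_bounds X e1 e2 e3 K -> tends (gauss X) n.
Proof.
  intros Hf HK Hn1 Hn2 Hn3 [Hn _].
  assert (H3 : near (fun p => 0 <= 1 + dot (gauss X p) e3 <= K * Cmod p /\
    dot (gauss X p) e1 * dot (gauss X p) e1 + dot (gauss X p) e2 * dot (gauss X p) e2
      + dot (gauss X p) e3 * dot (gauss X p) e3 = 1)).
  { generalize (near_and _ _ Hn (near_pdisk eps Heps)). apply near_imp.
    intros p [[B1 [B2 [B3 B4]]] Hp].
    pose proof (gauss_unit U X HX p Hp) as Hu. rewrite (frame_dot _ _ _ Hf) in Hu.
    split; auto.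
    destruct (weier_relations U X e1 e2 e3 HX HC Hf p Hp) as [R1 _].
    apply (f_equal Cmod) in R1. rewrite !Cmod_mult, Cmod_R, Cmod_conj in R1.
    assert (Hnu : Cmod (nu X e1 e2 p) <= 1).
    { pose proof (Cmod_sq (nu X e1 e2 p)) as HS. unfold nu in HS at 3 4 5 6. cbn [fst snd] in HS.
      nra. }
    assert (Hom : 0 < Cmod (om X e1 e2 p)) by exact (proj1 (Cmod_gt_0 _) B1).
    set (N3 := dot (gauss X p) e3) in *.
    assert (H0 : 0 <= 1 + N3) by nra. split; auto.
    rewrite Rabs_right in R1 by lra.
    apply Rmult_le_reg_r with (Cmod (om X e1 e2 p)); auto. rewrite R1.
    apply Rle_trans with (1 * Cmod (Fe e3 X p)); [apply Rmult_le_compat_r; auto; apply Cmod_ge_0 |]. lra. }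
  (* The bound [e * e / 2] is what [N1^2 + N2^2 = (1 - N3) (1 + N3) <= 2 (1 + N3)] requires. *)
  assert (HS : forall e, 0 < e -> e <= 1 -> near (fun p => 0 <= 1 + dot (gauss X p) e3 < e * e / 2 /\
    dot (gauss X p) e1 * dot (gauss X p) e1 + dot (gauss X p) e2 * dot (gauss X p) e2
      + dot (gauss X p) e3 * dot (gauss X p) e3 = 1)).
  { intros e He He1. assert (Hd : 0 < e * e / 2 / K) by (apply Rdiv_lt_0_compat; nra).
    generalize (near_and _ _ H3 (near_Cmod _ Hd)). apply near_imp. intros p [[[B1 B2] B3] B4].
    split; auto. split; auto. eapply Rle_lt_trans; [exact B2 |].
    replace (e * e / 2) with (K * (e * e / 2 / K)) by (field; lra). apply Rmult_lt_compat_l; auto. }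
  assert (HA : forall e, 0 < e -> near (fun p => Rabs (dot (gauss X p) e1) < e /\ Rabs (dot (gauss X p) e2) < e
    /\ Rabs (dot (gauss X p) e3 + 1) < e)).
  { intros e He. set (e' := Rmin e 1). assert (He' : 0 < e') by (apply Rmin_pos; lra).
    assert (He1 : e' <= 1) by apply Rmin_r. assert (Hee : e' <= e) by apply Rmin_l.
    generalize (HS e' He' He1). apply near_imp. intros p [[B1 B2] B3].
    assert (A : forall a, a * a < e' * e' -> Rabs a < e).
    { intros a Ha. apply Rlt_le_trans with e'; auto. apply Rabs_def1; nra. }
    split; [apply A; nra |]. split; [apply A; nra |]. apply A. nra. }
  apply (tends_of_frame e1 e2 e3); auto.
  - intros e He. generalize (HA e He). apply near_imp. intros p [B _]. rewrite Hn1, Rminus_0_r. exact B.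
  - intros e He. generalize (HA e He). apply near_imp. intros p [_ [B _]]. rewrite Hn2, Rminus_0_r. exact B.
  - intros e He. generalize (HA e He). apply near_imp. intros p [_ [_ B]]. rewrite Hn3.
    replace (dot (gauss X p) e3 - -1) with (dot (gauss X p) e3 + 1) by ring. exact B.
Qed.

(** Continuity is read off from [Ne_formula]; it serves the integrability of the Gauss curvature. *)
Lemma cont_Ne e1 e2 e3 G' p : frame e1 e2 e3 -> HolD (away U X e3) (Gm X e1 e2 e3) G' -> away U X e3 p ->
  contC (Ne X e1) p /\ contC (Ne X e2) p /\ contC (Ne X e3) p.
Proof.
  intros Hf HG Hp.
  set (G := Gm X e1 e2 e3) in *.
  assert (CG : contC G p) by (eapply isC_cont; apply HG; auto).
  assert (CG' : contC G' p) by (apply HG; auto).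
  assert (CGb : contC (fun q => Cconj (G q)) p).
  { apply (cont_pair (fun q => Cconj (G q))). apply (proj1 (cont_pair G p)) in CG. destruct CG as [C1 C2].
    split; cbn [fst snd Cconj]; [exact C1 | apply (continuous_opp (V := R_NormedModule)); exact C2]. }
  destruct (gauss_of_G U X e1 e2 e3 HX Hf p Hp) as [Hs _]. fold G in Hs.
  assert (Ci' : contC (fun q => / ((1 + G q * Cconj (G q)) * (1 + G q * Cconj (G q))))%C p).
  { apply (cont_Cinv (fun q => (1 + G q * Cconj (G q)) * (1 + G q * Cconj (G q)))%C).
    - contC_tac.
    - apply Cmult_neq_0; auto. }
  destruct (away_open U X e3 HU HX p Hp) as [d [d0 Hd]].
  assert (Ext : forall f g, (forall q, away U X e3 q -> f q = g q) -> contC f p -> contC g p).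
  { intros f g Hfg Hc. apply (continuous_ext_loc _ f); auto.
    apply locally_Cmod. exists d. split; auto. }
  assert (HN := fun q Hq => Ne_formula U X e1 e2 e3 HU HX Hf G' q HG Hq).
  fold G in HN.
  split; [| split].
  - apply (Ext (fun q => 2 * G' q * (1 - Cconj (G q) * Cconj (G q)) * / ((1 + G q * Cconj (G q)) * (1 + G q * Cconj (G q))))%C).
    + intros q Hq. symmetry. apply (HN q Hq).
    + contC_tac.
  - apply (Ext (fun q => - 2 * Ci * G' q * (1 + Cconj (G q) * Cconj (G q)) * / ((1 + G q * Cconj (G q)) * (1 + G q * Cconj (G q))))%C).
    + intros q Hq. symmetry. apply (HN q Hq).
    + contC_tac.
  - apply (Ext (fun q => 4 * G' q * Cconj (G q) * / ((1 + G q * Cconj (G q)) * (1 + G q * Cconj (G q))))%C).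
    + intros q Hq. symmetry. apply (HN q Hq).
    + contC_tac.
Qed.

Lemma Cmod_one_plus_ge (z : C) : 1 <= Cmod (1 + z * Cconj z).
Proof.
  rewrite <- Cmod2_conj, <- RtoC_plus, Cmod_R.
  rewrite Rabs_right; nra.
Qed.

Lemma Cmod_quotient_le (a b s : C) : 1 <= Cmod s -> Cmod (a * b / (s * s)) <= Cmod a * Cmod b.
Proof.
  intros Hs. assert (Hsn : s <> 0%C) by (apply (proj2 (Cmod_gt_0 _)); lra).
  assert (Hss : (s * s)%C <> 0%C) by (apply Cmult_neq_0; auto).
  rewrite Cmod_div, !Cmod_mult by auto.
  pose proof (Cmod_ge_0 a). pose proof (Cmod_ge_0 b).
  apply Rmult_le_reg_r with (Cmod s * Cmod s); [nra |].
  assert (0 < Cmod s * Cmod s) by nra.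
  unfold Rdiv. rewrite Rmult_assoc, Rinv_l, Rmult_1_r by (apply Rgt_not_eq; auto).
  rewrite <- (Rmult_1_r (Cmod a * Cmod b)) at 1.
  apply Rmult_le_compat_l; [apply Rmult_le_pos; auto |]. clear Hsn Hss. nra.
Qed.

(** The curvature density [|K| sqrt (det I)] is the area distortion of the Gauss map. As [G] extends
    holomorphically, the derivatives of the normal are bounded near the puncture, and so is this
    density. *)
Lemma end_finite_curvature e1 e2 e3 n : frame e1 e2 e3 -> tends (gauss X) n ->
  dot n e1 = 0 -> dot n e2 = 0 -> dot n e3 = -1 -> finite_total_curvature eps X.
Proof.
  intros Hf Ht Hn1 Hn2 Hn3.
  destruct (Gm_extends eps X e1 e2 e3 n Heps HX HC HM Hf Ht Hn1 Hn2 Hn3)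
    as [r0 [Ge [Gd [Hr0 [Hr3 [HG [HG0 [HGE HGd]]]]]]]].
  destruct (Gm_HolD U X e1 e2 e3 HU HX HC HM Hf) as [G' HG'].
  specialize (HGd G' HG').
  destruct (HolD_cont _ _ _ (proj1 Hr0) HG) as [CG CGd].
  destruct (near_bounded Gd CGd) as [M [M0 HMb]].
  assert (HG1 := contC_near Ge 1 CG Rlt_0_1).
  destruct (near_and _ _ (near_and _ _ HMb HG1) (near_pdisk r0 (proj1 Hr0))) as [d [d0 Hd]].
  set (r := Rmin d r0). assert (Hr : 0 < r <= r0) by (split; [apply Rmin_pos; lra | apply Rmin_r]).
  assert (Hin : forall p, pdisk r p -> pdisk r0 p /\ U p /\ away U X e3 p /\ Cmod (G' p) <= M /\ Cmod (Gm X e1 e2 e3 p) < 1).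
  { intros p Hp. assert (Hp0 : pdisk r0 p) by (apply (pdisk_sub r r0); auto; lra).
    assert (HpU : U p) by (apply (pdisk_sub r0 eps); auto; lra).
    assert (Hpd : pdisk d p) by (apply (pdisk_sub r d); auto; apply Rmin_l).
    destruct (Hd p Hpd) as [[B1 B2] _]. rewrite HG0 in B2. replace (Ge p - 0)%C with (Ge p) in B2 by ring.
    split; auto. split; auto. split; [split; auto; specialize (Hr3 p Hp0); lra |].
    rewrite HGd, <- HGE by auto. auto. }
  assert (HNb : forall p, pdisk r p -> Cmod (Ne X e1 p) <= 4 * M /\ Cmod (Ne X e2 p) <= 4 * M /\ Cmod (Ne X e3 p) <= 4 * M).
  { intros p Hp. destruct (Hin p Hp) as [_ [_ [Ha [B1 B2]]]].
    destruct (Ne_formula U X e1 e2 e3 HU HX Hf G' p HG' Ha) as [N1 [_ [N2 [_ [N3 _]]]]].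
    set (g := Gm X e1 e2 e3 p) in *.
    pose proof (Cmod_one_plus_ge g) as Hs. pose proof (Cmod_ge_0 g) as Hg0. pose proof (Cmod_ge_0 (G' p)) as HG'0.
    assert (Hgg : Cmod (Cconj g * Cconj g) <= 1) by (rewrite Cmod_mult, Cmod_conj; nra).
    assert (T1' : Cmod (1 - Cconj g * Cconj g) <= 2).
    { unfold Cminus. eapply Rle_trans; [apply Cmod_triangle |]. rewrite Cmod_opp, Cmod_1. lra. }
    assert (T2' : Cmod (1 + Cconj g * Cconj g) <= 2).
    { eapply Rle_trans; [apply Cmod_triangle |]. rewrite Cmod_1. lra. }
    rewrite N1, N2, N3. split; [| split].
    - eapply Rle_trans; [apply Cmod_quotient_le; exact Hs |]. rewrite Cmod_mult, Cmod_R, Rabs_right by lra.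
      nra.
    - eapply Rle_trans; [apply Cmod_quotient_le; exact Hs |].
      rewrite !Cmod_mult, Cmod_Ci, Cmod_R, Rabs_left by lra.
      nra.
    - eapply Rle_trans; [apply Cmod_quotient_le; exact Hs |]. rewrite Cmod_mult, Cmod_R, Rabs_right by lra.
      rewrite Cmod_conj. nra. }
  (* Three components, each at most [4 M] in modulus. *)
  set (B := 48 * (M * M)).
  assert (HB0 : 0 < B) by (unfold B; nra).
  assert (HNi : forall i p, pdisk r p -> dot (pd3 i (gauss X) p) (pd3 i (gauss X) p) <= B).
  { intros i p Hp. destruct (HNb p Hp) as [B1 [B2 B3]]. rewrite (frame_dot _ _ _ Hf).
    assert (S : forall e, Cmod (Ne X e p) <= 4 * M -> dot (pd3 i (gauss X) p) e * dot (pd3 i (gauss X) p) e <= 16 * (M * M)).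
    { intros e He. pose proof (abs_fst_le (Ne X e p)) as H1. pose proof (abs_snd_le (Ne X e p)) as H2.
      simpl in H1, H2. rewrite Rabs_Ropp in H2.
      assert (HA : Rabs (dot (pd3 i (gauss X) p) e) <= 4 * M) by (destruct i; lra).
      apply Rabs_le_between in HA. nra. }
    pose proof (S e1 B1). pose proof (S e2 B2). pose proof (S e3 B3). unfold B. lra. }
  assert (HE : forall p, U p -> 0 < ff1 X du du p /\ det1 X p = ff1 X du du p * ff1 X du du p /\ ff1 X dv dv p = ff1 X du du p).
  { intros p Hp. destruct (conformal_E U X HX HC p Hp) as [H1 [_ H2]]. destruct (HC p Hp) as [H3 _]. auto. }
  assert (HCS : forall V W, dot V W * dot V W <= dot V V * dot W W).
  { intros V W.
    assert (0 <= dot (cross V W) (cross V W)) by (unfold dot; nra).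
    assert (Eq : dot V V * dot W W = dot V W * dot V W + dot (cross V W) (cross V W)) by (vunf; ring).
    lra. }
  assert (Hff : forall i j p, pdisk r p -> ff2 X i j p * ff2 X i j p <= ff1 X du du p * B).
  { intros i j p Hp. destruct (Hin p Hp) as [_ [HpU _]]. destruct (HE p HpU) as [H1 [_ H3]].
    unfold ff2. replace (- dot (pd3 i X p) (pd3 j (gauss X) p) * - dot (pd3 i X p) (pd3 j (gauss X) p))
      with (dot (pd3 i X p) (pd3 j (gauss X) p) * dot (pd3 i X p) (pd3 j (gauss X) p)) by ring.
    eapply Rle_trans; [apply HCS |].
    assert (Hi : dot (pd3 i X p) (pd3 i X p) = ff1 X du du p) by (destruct i; [reflexivity | exact H3]).
    rewrite Hi. apply Rmult_le_compat_l; [lra |]. apply HNi; auto. }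
  set (kf := fun p : C => Rabs (gauss_curvature X p) * sqrt (det1 X p)).
  (* In conformal coordinates [kf] is [|det II| / E], and each entry of the second form has square
     at most [E B]. *)
  assert (Hkf : forall p, pdisk r p -> 0 <= kf p <= 2 * B).
  { intros p Hp. destruct (Hin p Hp) as [_ [HpU _]]. destruct (HE p HpU) as [H1 [H2 _]].
    unfold kf, gauss_curvature. rewrite H2, sqrt_square by lra.
    set (E := ff1 X du du p) in *.
    unfold Rdiv. rewrite Rabs_mult, (Rabs_right (/ (E * E))).
    2:{ apply Rle_ge. left. apply Rinv_0_lt_compat. nra. }
    assert (Hdet : Rabs (det2 X p) <= 2 * B * E).
    { unfold det2. pose proof (Hff du du p Hp) as F1. pose proof (Hff dv dv p Hp) as F2. pose proof (Hff du dv p Hp) as F3.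
      fold E in F1, F2, F3. apply Rabs_le.
      set (a := ff2 X du du p) in *. set (b := ff2 X dv dv p) in *. set (c := ff2 X du dv p) in *.
      unfold Rsqr in *. nra. }
    replace (Rabs (det2 X p) * / (E * E) * E) with (Rabs (det2 X p) * / E) by (field; lra).
    assert (Hi : 0 < / E) by (apply Rinv_0_lt_compat; auto).
    split; [apply Rmult_le_pos; [apply Rabs_pos | lra] |].
    apply Rle_trans with (2 * B * E * / E); [apply Rmult_le_compat_r; lra | right; field; lra]. }
  assert (Hkc : forall p, pdisk r p -> continuous (T := C_UniformSpace) kf p).
  { intros p Hp. destruct (Hin p Hp) as [_ [HpU [Ha _]]].
    destruct (cont_Ne e1 e2 e3 G' p Hf HG' Ha) as [C1 [C2 C3]].
    assert (Cd : forall i j, continuous (T := C_UniformSpace) (fun q => ff1 X i j q) p).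
    { intros i j. unfold ff1. apply cont3_dot; apply (cont3_smooth U); auto; apply smooth3_pd3; apply HX. }
    assert (CNe : forall j e, contC (Ne X e) p -> continuous (T := C_UniformSpace) (fun q => dot (pd3 j (gauss X) q) e) p).
    { intros j e Hc. apply (proj1 (cont_pair _ _)) in Hc. destruct Hc as [D1 D2]. destruct j; [exact D1 |].
      apply (continuous_ext (fun q : C => - snd (Ne X e q))).
      - intros q. simpl. ring.
      - apply (continuous_opp (V := R_NormedModule)). exact D2. }
    assert (CXe : forall i e, continuous (T := C_UniformSpace) (fun q => dot (pd3 i X q) e) p).
    { intros i e. apply cont3_dot; [| apply cont3_const]. apply (cont3_smooth U); auto; apply smooth3_pd3; apply HX. }
    assert (C2f : forall i j, continuous (T := C_UniformSpace) (fun q => ff2 X i j q) p).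
    { intros i j.
      apply (continuous_ext (fun q : C => - (dot (pd3 i X q) e1 * dot (pd3 j (gauss X) q) e1
        + dot (pd3 i X q) e2 * dot (pd3 j (gauss X) q) e2 + dot (pd3 i X q) e3 * dot (pd3 j (gauss X) q) e3))).
      - intros q. unfold ff2. rewrite (frame_dot _ _ _ Hf (pd3 i X q) (pd3 j (gauss X) q)). reflexivity.
      - apply (continuous_opp (V := R_NormedModule)).
        apply cont_Rplus; [apply cont_Rplus |]; apply cont_Rmult; auto. }
    assert (Cdet1 : continuous (T := C_UniformSpace) (fun q => det1 X q) p).
    { apply (continuous_ext (fun q : C => ff1 X du du q * ff1 X dv dv q - ff1 X du dv q * ff1 X du dv q)).
      - intros q. refine (_ : @eq R _ _). unfold det1. ring.
      - apply cont_Rminus; apply cont_Rmult; auto. }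
    assert (Cdet2 : continuous (T := C_UniformSpace) (fun q => det2 X q) p).
    { apply (continuous_ext (fun q : C => ff2 X du du q * ff2 X dv dv q - ff2 X du dv q * ff2 X du dv q)).
      - intros q. refine (_ : @eq R _ _). unfold det2. ring.
      - apply cont_Rminus; apply cont_Rmult; auto. }
    unfold kf. apply cont_Rmult.
    - apply (continuous_comp (fun q : C => gauss_curvature X q) Rabs).
      + unfold gauss_curvature, Rdiv. apply cont_Rmult; auto.
        apply (continuous_comp (fun q : C => det1 X q) Rinv); auto.
        apply continuous_Rinv. destruct (HE p HpU) as [H1 [H2 _]]. rewrite H2. nra.
      + apply continuity_pt_filterlim. apply Rcontinuity_abs.
    - apply (continuous_comp (fun q : C => det1 X q) sqrt); auto. apply continuous_sqrt. }
  set (pol := fun s th : R => (s * cos th, s * sin th) : C).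
  assert (Hpol : forall s th, 0 < s -> Cmod (pol s th) = s).
  { intros s th Hs. replace (pol s th) with (RtoC s * eit th)%C.
    - rewrite Cmod_mult, eit_mod, Cmod_R, Rabs_right; lra.
    - unfold pol, eit, RtoC, Cmult; simpl. f_equal; ring. }
  assert (Hpin : forall s th, 0 < s < r -> pdisk r (pol s th)).
  { intros s th Hs. split; [rewrite Hpol; lra |]. apply (proj2 (Cmod_gt_0 _)). rewrite Hpol; lra. }
  set (f := fun s th : R => kf (pol s th) * s).
  assert (Hfc : forall s th, 0 < s < r -> continuous (fun z : R * R => f (fst z) (snd z)) (s, th)).
  { intros s th Hs. unfold f. apply (continuous_mult (K := R_AbsRing)).
    - apply (continuous_comp (fun z : R * R => pol (fst z) (snd z)) kf); [| apply Hkc; apply Hpin; exact Hs].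
      apply (cont_pair (fun z : R * R => pol (fst z) (snd z))). unfold pol. cbn [fst snd].
      split; apply (continuous_mult (K := R_AbsRing)); try apply continuous_fst.
      + apply (cont_of_snd cos (s, th)). apply continuous_cos.
      + apply (cont_of_snd sin (s, th)). apply continuous_sin.
    - apply continuous_fst. }
  pose proof PI_RGT_0 as HPI.
  assert (Hinner : forall s, 0 < s < r -> Rabs (RInt (f s) 0 (2 * PI)) <= (2 * PI - 0) * (2 * B * r)).
  { intros s Hs. apply abs_RInt_le_const; [lra | |].
    - apply (ex_RInt_continuous (V := R_CompleteNormedModule)). intros th _.
      apply (continuous_comp (fun th => (s, th) : R * R) (fun z : R * R => f (fst z) (snd z))); [| apply Hfc; auto].
      apply (cont_pair (fun th : R => ((s, th) : C)) th). split; simpl; [apply continuous_const | apply continuous_id].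
    - intros th _. destruct (Hkf (pol s th) (Hpin s th Hs)) as [K1 K2].
      unfold f. rewrite Rabs_mult, !Rabs_right by lra. nra. }
  (* Half the radius keeps the outer limit inside the open range where the inner integral is
     continuous. *)
  exists (r / 2), ((r / 2) * ((2 * PI - 0) * (2 * B * r))). split; [lra |].
  intros dd Hdd.
  assert (HR : Rabs (RInt (fun s => RInt (f s) 0 (2 * PI)) dd (r / 2)) <= (r / 2 - dd) * ((2 * PI - 0) * (2 * B * r))).
  { apply abs_RInt_le_const; [lra | |].
    - apply (ex_RInt_continuous (V := R_CompleteNormedModule)). intros s Hs.
      rewrite Rmin_left, Rmax_right in Hs by lra.
      apply (continuous_RInt_param f 0 r 0 (2 * PI)); [lra | lra |].
      intros x y Hx _. apply Hfc; auto.
    - intros s Hs. apply Hinner. lra. }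
  eapply Rle_trans; [apply Rle_abs |]. eapply Rle_trans; [exact HR |].
  apply Rmult_le_compat_r; [| lra]. apply Rmult_le_pos; nra.
Qed.

(** The limit differs from the centre of projection, so [1 - N3] stays away from zero and [G] is
    bounded. *)
Lemma stereo_bounded e1 e2 e3 n : frame e1 e2 e3 -> tends (gauss X) n -> dot n e3 <> 1 ->
  exists r g g', 0 < r <= eps /\ HolD (disk r) g g' /\
    forall p, pdisk r p -> dot (gauss X p) e3 <> 1 /\ g p = Gm X e1 e2 e3 p.
Proof.
  intros Hf Ht Hn.
  set (k := Rabs (1 - dot n e3)). assert (Hk : 0 < k) by (apply Rabs_pos_lt; lra).
  assert (Hk2 : 0 < k / 2) by lra.
  assert (H3 : near (fun p => k / 2 <= Rabs (1 - dot (gauss X p) e3))).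
  { generalize (Ht e3 _ Hk2). apply near_imp. intros p Hp.
    assert (k <= Rabs (1 - dot (gauss X p) e3) + Rabs (dot (gauss X p) e3 - dot n e3)); [| lra].
    unfold k. replace (1 - dot n e3) with ((1 - dot (gauss X p) e3) + (dot (gauss X p) e3 - dot n e3)) by ring.
    apply Rabs_triang. }
  destruct (near_and _ _ H3 (near_pdisk eps Heps)) as [d [d0 Hd]].
  set (r := Rmin d eps). assert (Hr : 0 < r <= eps) by (split; [apply Rmin_pos; auto | apply Rmin_r]).
  assert (Hin : forall p, pdisk r p -> k / 2 <= Rabs (1 - dot (gauss X p) e3) /\ U p).
  { intros p Hp. apply Hd. apply (pdisk_sub r d); auto. apply Rmin_l. }
  assert (Ha : forall p, pdisk r p -> away U X e3 p).
  { intros p Hp. destruct (Hin p Hp) as [B1 B2]. split; auto. intros E. rewrite E in B1.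
    replace (1 - 1) with 0 in B1 by ring. rewrite Rabs_R0 in B1. lra. }
  destruct (Gm_HolD U X e1 e2 e3 HU HX HC HM Hf) as [G' HG'].
  assert (HGr : HolD (pdisk r) (Gm X e1 e2 e3) G') by (apply (HolD_sub (away U X e3)); auto).
  assert (Hrr : 0 < r <= r) by lra.
  destruct (removable r r (2 / (k / 2)) _ _ Hrr HGr) as [g [g' [Hg HE]]].
  { intros p Hp. destruct (Hin p Hp) as [B1 B2]. unfold Gm.
    assert (Hne : 1 - dot (gauss X p) e3 <> 0).
    { intros E. rewrite E, Rabs_R0 in B1. lra. }
    rewrite Cmod_div, Cmod_R by (apply RtoC_neq; auto).
    assert (Hnu : Cmod (nu X e1 e2 p) <= 2).
    { pose proof (gauss_unit U X HX p B2) as Hu. rewrite (frame_dot _ _ _ Hf) in Hu.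
      pose proof (Cmod_sq (nu X e1 e2 p)) as HS. unfold nu in HS at 3 4 5 6. cbn [fst snd] in HS.
      nra. }
    unfold Rdiv. apply Rmult_le_compat; auto; [apply Cmod_ge_0 | |].
    - left. apply Rinv_0_lt_compat. unfold Rdiv in B1. lra.
    - apply Rinv_le_contravar; auto. }
  exists r, g, g'. split; auto. split; auto. intros p Hp. split; [apply (Ha p Hp) | apply HE; auto].
Qed.

(** The chart is chosen by the limit normal: the standard frame gives [stereo], and the flipped one,
    used when [n] is the north pole, gives [stereo_inv]. *)
Lemma end_gauss_extends n : tends (gauss X) n -> gauss_extends eps X.
Proof.
  intros Ht.
  assert (S1 : forall V, dot V (1, 0, 0) = x1 V) by (intros; vunf; ring).
  assert (S2 : forall V, dot V (0, 1, 0) = x2 V) by (intros; vunf; ring).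
  assert (S3 : forall V, dot V (0, 0, 1) = x3 V) by (intros; vunf; ring).
  assert (Sm : forall (a b k : R), k <> 0 -> ((a, b) / RtoC k)%C = (a / k, b / k)).
  { intros a b k Hk. unfold Cdiv, Cmult, Cinv, RtoC; simpl. f_equal; field; auto. }
  destruct (Req_dec (dot n (0, 0, 1)) 1) as [E | E].
  - assert (En : dot n (vscal (-1) (0, 0, 1)) <> 1) by (rewrite dot_opp_r, E; lra).
    destruct (stereo_bounded _ _ _ n (frame_flip _ _ _ frame_std) Ht En) as [r [g [g' [Hr [Hg HE]]]]].
    exists r, g. split; auto. split; [intros p Hp; eexists; apply Hg; auto |]. right.
    intros p Hp. destruct (HE p Hp) as [B1 B2]. rewrite dot_opp_r, S3 in B1. split; [lra |].
    rewrite B2. unfold Gm, nu, stereo_inv. rewrite !dot_opp_r, S1, S2, S3.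
    rewrite Sm by lra. f_equal; f_equal; ring.
  - destruct (stereo_bounded _ _ _ n frame_std Ht E) as [r [g [g' [Hr [Hg HE]]]]].
    exists r, g. split; auto. split; [intros p Hp; eexists; apply Hg; auto |]. left.
    intros p Hp. destruct (HE p Hp) as [B1 B2]. rewrite S3 in B1. split; [lra |].
    rewrite B2. unfold Gm, nu, stereo. rewrite S1, S2, S3. rewrite Sm by lra. reflexivity.
Qed.

Lemma weierstrass_isG x p : xcoord x -> U p -> isG (fun q => x (X q)) p (weierstrass_form x X p).
Proof.
  intros Hx Hp. destruct HX as [[H1 [H2 H3]] _].
  assert (Sh : smooth U (fun q => x (X q))) by (destruct Hx as [-> | [-> | ->]]; assumption).
  apply (smooth_isG U _ p HU Sh Hp).
Qed.

(** A bounded conformal factor bounds all three coordinate gradients. Hence the Weierstrass forms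
    extend, the coordinates have limits, and [smooth_extension] applies to each of them. *)
Lemma end_regular K : near (fun p => sqrt (ff1 X du du p) <= K) ->
  exists Xb : C -> R3, (forall p, pdisk eps p -> Xb p = X p) /\ smooth3 (disk eps) Xb /\
    conformal (disk eps) Xb /\ each_coord (fun x => holomorphic_on (disk eps) (weierstrass_form x Xb)).
Proof.
  intros Hn.
  assert (HK0 : 0 <= K).
  { destruct (near_ex _ Hn) as [p Hp]. eapply Rle_trans; [apply sqrt_pos | exact Hp]. }
  assert (Hco : forall x, xcoord x -> exists f f' l, HolD (disk eps) f f' /\
     (forall p, pdisk eps p -> f p = weierstrass_form x X p) /\
     filterlim (fun p => x (X p)) (locally' (T := C_UniformSpace) (RtoC 0)) (locally l)).
  { intros x Hx.
    assert (Hsm : forall V : R3, x V * x V <= dot V V).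
    { intros V. unfold dot. destruct Hx as [-> | [-> | ->]]; nra. }
    pose proof (weierstrass_HolD U X HU HX HC HM x Hx) as HW.
    assert (HB : near (fun p => Cmod (weierstrass_form x X p) <= 2 * K + 1)).
    { generalize (near_and _ _ Hn (near_pdisk eps Heps)). apply near_imp. intros p [B Hp].
      destruct (HC p Hp) as [E1 _].
      assert (HS : forall i, Rabs (x (pd3 i X p)) <= K).
      { intros i. eapply Rle_trans; [| exact B].
        rewrite <- (sqrt_Rsqr_abs (x (pd3 i X p))). apply sqrt_le_1_alt. unfold Rsqr.
        eapply Rle_trans; [apply Hsm |]. destruct i; [apply Rle_refl |]. apply Req_le. symmetry. exact E1. }
      assert (HP : forall i, x (pd3 i X p) = pd i (fun q => x (X q)) p).
      { intros i. destruct Hx as [-> | [-> | ->]]; reflexivity. }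
      pose proof (HS du) as D1. pose proof (HS dv) as D2. rewrite HP in D1, D2.
      eapply Rle_trans; [apply Cmod_le_abs |]. unfold weierstrass_form. cbn [fst snd]. rewrite Rabs_Ropp. lra. }
    destruct (near_and _ _ HB (near_pdisk eps Heps)) as [d [d0 Hd]].
    assert (Hrange : 0 < Rmin d eps <= eps) by (split; [apply Rmin_pos; auto | apply Rmin_r]).
    destruct (removable eps (Rmin d eps) (2 * K + 1) (weierstrass_form x X) _ Hrange HW) as [f [f' [Hf HE]]].
    { intros p Hp. apply Hd. apply (pdisk_sub (Rmin d eps) d); auto. apply Rmin_l. }
    assert (HK1 : 0 < 2 * K + 1) by lra.
    destruct (bounded_gradient_limit eps (fun p => x (X p)) (weierstrass_form x X) (2 * K + 1) Heps HK1) as [l Hl]; auto.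
    { intros p Hp. apply weierstrass_isG; auto. }
    exists f, f', l. auto. }
  destruct (Hco x1 (or_introl eq_refl)) as [f1 [f1' [l1 [Hf1 [E1 L1]]]]].
  destruct (Hco x2 (or_intror (or_introl eq_refl))) as [f2 [f2' [l2 [Hf2 [E2 L2]]]]].
  destruct (Hco x3 (or_intror (or_intror eq_refl))) as [f3 [f3' [l3 [Hf3 [E3 L3]]]]].
  assert (G1 : forall p, pdisk eps p -> isG (fun q => x1 (X q)) p (f1 p)).
  { intros p Hp. rewrite E1 by auto. apply weierstrass_isG; auto. left; reflexivity. }
  assert (G2 : forall p, pdisk eps p -> isG (fun q => x2 (X q)) p (f2 p)).
  { intros p Hp. rewrite E2 by auto. apply weierstrass_isG; auto. right; left; reflexivity. }
  assert (G3 : forall p, pdisk eps p -> isG (fun q => x3 (X q)) p (f3 p)).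
  { intros p Hp. rewrite E3 by auto. apply weierstrass_isG; auto. right; right; reflexivity. }
  destruct (smooth_extension eps _ f1 f1' l1 Heps Hf1 G1 L1) as [S1 D1].
  destruct (smooth_extension eps _ f2 f2' l2 Heps Hf2 G2 L2) as [S2 D2].
  destruct (smooth_extension eps _ f3 f3' l3 Heps Hf3 G3 L3) as [S3 D3].
  set (h1 := fun p : C => if Ceq_dec p (RtoC 0) then l1 else x1 (X p)) in *.
  set (h2 := fun p : C => if Ceq_dec p (RtoC 0) then l2 else x2 (X p)) in *.
  set (h3 := fun p : C => if Ceq_dec p (RtoC 0) then l3 else x3 (X p)) in *.
  exists (fun p => (h1 p, h2 p, h3 p)).
  assert (HW : forall x h f, (forall p, disk eps p -> isG h p (f p)) -> (forall p, x (h1 p, h2 p, h3 p) = h p) ->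
    forall p, disk eps p -> weierstrass_form x (fun p => (h1 p, h2 p, h3 p)) p = f p).
  { intros x h f HG Hxh p Hp. destruct (isG_isd _ _ _ (HG p Hp)) as [A B]. unfold weierstrass_form.
    assert (A' : isd du (fun q => x (h1 q, h2 q, h3 q)) p (fst (f p))).
    { apply (isd_ext du h _ p _ 1 Rlt_0_1); auto. }
    assert (B' : isd dv (fun q => x (h1 q, h2 q, h3 q)) p (- snd (f p))).
    { apply (isd_ext dv h _ p _ 1 Rlt_0_1); auto. }
    rewrite (isd_pd _ _ _ _ A'), (isd_pd _ _ _ _ B'). destruct (f p). simpl. f_equal. ring. }
  assert (W1 := HW x1 h1 f1 D1 (fun p => eq_refl)).
  assert (W2 := HW x2 h2 f2 D2 (fun p => eq_refl)).
  assert (W3 := HW x3 h3 f3 D3 (fun p => eq_refl)).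
  split; [| split; [| split]].
  - intros p [_ Hp]. unfold h1, h2, h3. destruct (Ceq_dec p (RtoC 0)); [contradiction |].
    destruct (X p) as [[a b] c]. reflexivity.
  - split; [| split]; [exact S1 | exact S2 | exact S3].
  (* Conformality at the origin follows by continuity from the quadratic relation between the
     extended forms. *)
  - assert (HQ : forall p, disk eps p -> (f1 p * f1 p + f2 p * f2 p + f3 p * f3 p)%C = 0%C).
    { assert (HQ1 : forall p, pdisk eps p -> (f1 p * f1 p + f2 p * f2 p + f3 p * f3 p)%C = 0%C).
      { intros p Hp. rewrite E1, E2, E3 by auto. destruct (HC p Hp) as [A B].
        unfold ff1, dot in A, B. unfold pd3, x1, x2, x3 in A, B. cbn [fst snd] in A, B.
        unfold weierstrass_form, x1, x2, x3. apply injective_projections; cbn [fst snd Cplus Cmult RtoC]; lra. }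
      intros p Hp. destruct (Ceq_dec p (RtoC 0)) as [E | E]; [| apply HQ1; split; auto].
      subst p. destruct (HolD_cont _ _ _ Heps Hf1) as [C1 _]. destruct (HolD_cont _ _ _ Heps Hf2) as [C2 _].
      destruct (HolD_cont _ _ _ Heps Hf3) as [C3 _].
      apply (cont_zero (fun p => f1 p * f1 p + f2 p * f2 p + f3 p * f3 p)%C); [contC_tac |].
      exists eps. split; auto. }
    intros p Hp. specialize (HQ p Hp). rewrite <- W1, <- W2, <- W3 in HQ by auto.
    pose proof (f_equal fst HQ) as A. pose proof (f_equal snd HQ) as B.
    unfold weierstrass_form in A, B. cbn [fst snd Cplus Cmult RtoC] in A, B.
    unfold ff1, dot, pd3. cbn [x1 x2 x3 fst snd] in *.
    unfold x1, x2, x3 in *. cbn [fst snd] in *. split; lra.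
  - assert (HH : forall x f f', HolD (disk eps) f f' ->
      (forall p, disk eps p -> weierstrass_form x (fun p => (h1 p, h2 p, h3 p)) p = f p) ->
      holomorphic_on (disk eps) (weierstrass_form x (fun p => (h1 p, h2 p, h3 p)))).
    { intros x f f' Hf HE p Hp. exists (f' p). apply (isC_ext_loc f); [| apply Hf; auto].
      exists (eps - Cmod p). split; [unfold disk in Hp; lra |]. intros q Hq. symmetry. apply HE.
      unfold disk. replace q with ((q - p) + p)%C by ring. eapply Rle_lt_trans; [apply Cmod_triangle |]. lra. }
    split; [exact (HH x1 f1 f1' Hf1 W1) | split; [exact (HH x2 f2 f2' Hf2 W2) | exact (HH x3 f3 f3' Hf3 W3)]].
Qed.
End End.

Theorem theorem3p8 :
  forall (eps : R) (Z Zt : C -> R3),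
    0 < eps ->
    complete_planar_minimal_end eps Z ->
    (forall p : C, pdisk eps p -> ~ umbilic Z p) ->
    minimal_immersion (pdisk eps) Zt ->
    ribaucour_integrable (pdisk eps) Z Zt ->
    complete_planar_minimal_end eps Zt \/ extends_regularly eps Zt.
Proof.
  intros eps Z Zt He [[HZ HM] [HC [Hcomp [_ [n [l [Hn Hl]]]]]]] Humb HZt
    [_ [_ [tau [rho [phi [c [_ [Hrho [Hphi [Hc [Hnz [_ [_ HR]]]]]]]]]]]]].
  pose proof HZt as [HIt HMt].
  pose proof (pdisk_open eps) as HU. fold (isopen (pdisk eps)) in HU.
  pose proof (tends_of_filterlim _ _ Hn) as Ht.
  pose proof (tends_unit eps Z n He HZ Ht) as Hu.
  destruct (frame_exists (vscal (-1) n)) as [e1 [e2 Hf]].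
  { rewrite <- Hu. vunf. ring. }
  set (e3 := vscal (-1) n) in *.
  assert (He3 : forall V, dot V e3 = - dot V n) by (intros V; unfold e3; apply dot_opp_r).
  assert (Hn3 : dot n e3 = -1) by (rewrite He3; lra).
  (* The component along [e3] already exhausts the unit length of [n]. *)
  assert (Hn12 : dot n e1 = 0 /\ dot n e2 = 0).
  { pose proof (frame_dot _ _ _ Hf n n) as E. rewrite Hn3, Hu in E. nra. }
  destruct Hn12 as [Hn1 Hn2].
  assert (Hl3 : filterlim (fun p => dot (Z p) e3) (locally' (T := C_UniformSpace) (RtoC 0)) (locally (- l))).
  { apply (filterlim_ext (fun p => - dot (Z p) n)); [intros p; symmetry; apply He3 |].
    apply (filterlim_comp _ _ _ (fun p => dot (Z p) n) Ropp _ (locally l)); [exact Hl |].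
    apply (filterlim_opp (V := R_NormedModule) l). }
  pose proof (conf_ribaucour _ Z Zt rho phi c HU HZ HC HM (proj1 HIt) Hrho Hphi Hc Hnz HR) as HCt.
  destruct (ribaucour_end_bounds eps Z Zt rho phi c e1 e2 e3 n (- l) He HZ HC HM Hcomp Humb (proj1 HIt) Hrho Hphi Hc Hnz HR
    Hf Ht Hn1 Hn2 Hn3 Hl3) as [K [HK HF]].
  pose proof (end_gauss_limit eps Zt He HIt HCt e1 e2 e3 n K Hf HK Hn1 Hn2 Hn3 HF) as Htt.
  destruct HF as [HFn [Hreg | Hend]].
  (* All three forms are bounded, hence so is the conformal factor. *)
  - right. split; [apply (end_gauss_extends eps Zt He HIt HCt HMt n Htt) |].
    apply (end_regular eps Zt He HIt HCt HMt (2 * K)).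
    generalize (near_and _ _ HFn Hreg). apply near_imp. intros p [[_ [B1 [B2 _]]] B3].
    apply (energy_le e1 e2 e3); auto. lra.
  - left. split; [exact HZt |]. split; [exact HCt |]. split; [| split].
    (* By [om_le_energy] the pole of [om Zt] is a lower bound of order [1 / |z|] for the square root
       of the conformal factor [E]. *)
    + apply (complete_of_lower_bound eps Zt (proj1 HIt) HCt (2 * K)); [lra |].
      generalize (near_and _ _ Hend (near_pdisk eps He)). apply near_imp. intros p [B Hp].
      pose proof (om_le_energy e1 e2 e3 Zt p Hf (proj1 (HCt p Hp))) as HE.
      eapply Rle_trans; [exact B |].
      replace (2 * K * (Cmod p * sqrt (ff1 Zt du du p))) with (K * (Cmod p * (2 * sqrt (ff1 Zt du du p)))) by ring.
      apply Rmult_le_compat_l; [lra |]. apply Rmult_le_compat_l; [apply Cmod_ge_0 | exact HE].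
    + apply (end_finite_curvature eps Zt He HIt HCt HMt e1 e2 e3 n Hf Htt Hn1 Hn2 Hn3).
    (* The height over the common limit plane has the bounded gradient [Fe e3 Zt], so it has a
       limit. *)
    + destruct (bounded_gradient_limit eps (fun p => dot (Zt p) e3) (Fe e3 Zt) K He HK) as [lt Hlt].
      { intros p Hp. apply (Fe_isG (pdisk eps)); auto. apply HIt. }
      { revert HFn. apply near_imp. intros p [_ [B _]]. exact B. }
      exists n, (- lt). split; [apply filterlim_of_tends; exact Htt |].
      apply (filterlim_ext (fun p => - dot (Zt p) e3)); [intros p; rewrite He3; ring |].
      apply (filterlim_comp _ _ _ (fun p => dot (Zt p) e3) Ropp _ (locally lt)); [exact Hlt |].
      apply (filterlim_opp (V := R_NormedModule) lt).
Qed.
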